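(* There exists $N_1>0$ such that for $1>\beta>0$ and $N_1>N>0$ there exist $\kappa_1(N,\beta)>0$ and $\kappa_2(N,\beta)>0$ such that, for all $g\in RPW(\pi)$ with $\|g\|_{L^2}\le1$, the linear statistic $F(\tau)=\sum_{j=-\infty}^\infty(g(\tau_j)-g(j))$ satisfies $$\nu_N^\beta\Bigl\{q\in\Omega_N:F(\tau(q))-\int F\,d\nu_N^\beta>\varepsilon\Bigr\}\le\exp\bigl(-\kappa_1(N,\beta)\,\varepsilon^2\min\{1,\kappa_2(N,\beta)\varepsilon^4\}\bigr)\qquad(\varepsilon>0).$$
   Context: Let $\mathbf T=\mathbf R/2\pi\mathbf Z$ with normalized measure $dx/2\pi$, and for $N>0$ let $\Omega_N=\{\phi\in L^2(\mathbf T;\mathbf R):\int_{\mathbf T}\phi(x)^2\,dx/2\pi\le N\}$. Let $(\gamma_n)_{n\in\mathbf Z}$ be mutually independent standard Gaussian random variables and let $\gamma$ be the Gaussian probability measure on $L^2(\mathbf T;\mathbf R)$ which is the law of $\phi(x)=\gamma_0+\sum_{n=-\infty}^{-1}\gamma_n\frac{\sin nx}{n}+\sum_{n=1}^\infty\gamma_n\frac{\cos nx}{n}$. For $\beta\ge 0$ the KdV Gibbs measure is the Radon probability measure on $\Omega_N$ $$\nu_N^\beta(d\phi)=Z_N(\beta)^{-1}\,\mathbf 1_{\Omega_N}(\phi)\exp\Bigl(\frac{\beta}{6}\int_{\mathbf T}\phi(x)^3\frac{dx}{2\pi}\Bigr)\gamma(d\phi),$$ with $Z_N(\beta)$ the normalizing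 constant. For $q\in\Omega_N$ (extended $2\pi$-periodically), the periodic spectrum of $-f''+qf=\lambda f$ is the sequence, listed with multiplicity, $\lambda_0<\lambda_1\le\lambda_2<\lambda_3\le\lambda_4<\cdots$ of real $\lambda$ for which there is a nontrivial solution that is either $2\pi$-periodic or $2\pi$-antiperiodic. Define $\tau=\tau(q)=(\tau_j)_{j=-\infty}^\infty$ by $\tau_j=\sqrt{2(\lambda_{2j}+\lambda_{2j-1})}$ for $j\ge1$, $\tau_0=0$, and $\tau_{j}=-\tau_{-j}$ for $j\le-1$. (Finitely many $\tau_j$ may be purely imaginary; then $g(\tau_j)+g(\tau_{-j})$ is still real for the $g$ below.) $RPW(\pi)$ is the real Hilbert space of entire functions $g$ of exponential type with $\limsup_{y\to\pm\infty}\log|g(iy)|/|y|\le\pi$, $\int_{-\infty}^\infty|g(x)|^2dx<\infty$ and $\overline{g(z)}=g(\bar z)$, with the $L^2(\mathbf R)$ norm. The integral $\int F\,d\nu_N^\beta$ means $\int_{\Omega_N}F(\tau(q))\,\nu_N^\beta(dq)$. *)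

(* Defs.v *)
(* MathComp-Analysis; the real numbers are an arbitrary [R : realType]. *)
From HB Require Import structures.
From mathcomp Require Import all_boot all_order all_algebra.
From mathcomp Require Import all_classical all_reals all_analysis.
From mathcomp Require Import measurable_realfun.
From mathcomp Require Import complex ring lra.

Set Implicit Arguments.
Unset Strict Implicit.
Unset Printing Implicit Defensive.
Import Order.TTheory GRing.Theory Num.Theory.
Import numFieldNormedType.Exports.
Local Open Scope classical_set_scope.
Local Open Scope ring_scope.

Section circle.
Variable R : realType.

Lemma invr_2pi_ge0 : (0 : R) <= (2 * pi)^-1.
Proof. by rewrite invr_ge0 mulr_ge0// pi_ge0. Qed.

(* T = R/2piZ with dx/2pi, carried by the fundamental domain [0, 2pi[: functions
   on T are functions on R that matter only on [0, 2pi[; see [periodize]. *)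
Definition circle : {measure set (measurableTypeR R) -> \bar R} :=
  mscale (NngNum invr_2pi_ge0)
    (mrestr lebesgue_measure (measurable_itv `[0, 2 * pi[)).

Lemma circle_setT : circle setT = 1%E.
Proof.
have pi2 : (0 : R) < 2 * pi by rewrite mulr_gt0// pi_gt0.
rewrite /circle /= /mscale /= /mrestr setTI lebesgue_measure_itv/= lte_fin pi2.
by rewrite oppr0 adde0 -EFinM mulVf// gt_eqF.
Qed.

Definition L2T : Type := LspaceType2 circle.

(* A representative of the class [f]; nothing below depends on the choice. *)
Definition L2fun (f : L2T) : R -> R := (f : LspaceType2 circle).

End circle.
Coercion L2fun : L2T >-> Funclass.
Arguments circle {R}.

Section L2.
Variable R : realType.
Implicit Types f g h : L2T R.

HB.instance Definition _ := gen_eqMixin (L2T R).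
HB.instance Definition _ := gen_choiceMixin (L2T R).

Lemma measurable_L2fun f : measurable_fun [set: measurableTypeR R] (f : R -> R).
Proof. exact: (@measurable_funPT _ _ _ _ (repr (LebesgueSpace.sort (f : LspaceType2 circle)))). Qed.

Lemma measurable_L2funB f g :
  measurable_fun [set: measurableTypeR R] (f \- g).
Proof. by apply: measurable_funB; exact: measurable_L2fun. Qed.

Lemma Lnorm_L2fun_fin f : ('N[circle]_2[EFin \o f] < +oo)%E.
Proof. by case: f => f [[]]. Qed.

Lemma L2fun_Lfun f : (f : R -> R) \in Lfun circle 2%:E.
Proof.
rewrite inE; apply/andP; split; rewrite inE/=; first exact: measurable_L2fun.
exact: Lnorm_L2fun_fin.
Qed.

Definition L2dist f g : R := fine 'N[circle]_2[EFin \o (f \- g)%R].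

Lemma L2distE f g : ('N[circle]_2[EFin \o (f \- g)%R] = (L2dist f g)%:E)%E.
Proof.
have h : ((f : measurableTypeR R -> R) - (g : _ -> R)) \in Lfun circle 2%:E.
  apply: (Lfun_addr_closed circle (lee1n 2)).2; first exact: L2fun_Lfun.
  by apply: Lfun_oppr_closed; exact: L2fun_Lfun.
rewrite /L2dist fineK// ge0_fin_numE ?Lnorm_ge0//.
by move: h; rewrite inE => /andP[_]; rewrite inE.
Qed.

Lemma L2distxx f : L2dist f f = 0.
Proof.
rewrite /L2dist (_ : EFin \o _ = cst 0%E) ?Lnorm0//.
by apply/funext => x /=; rewrite subrr.
Qed.

Lemma L2dist_sym f g : L2dist f g = L2dist g f.
Proof.
rewrite /L2dist -oppe_Lnorm; congr (fine (Lnorm _ _ _)).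
by apply/funext => x /=; rewrite opprB.
Qed.

Lemma L2dist_triangle g f h : L2dist f h <= L2dist f g + L2dist g h.
Proof.
rewrite -lee_fin EFinD -!L2distE.
rewrite (_ : f \- h = (f \- g) \+ (g \- h)); last first.
  by apply/funext => x/=; rewrite addrA subrK.
exact: (eminkowski circle (measurable_L2funB f g) (measurable_L2funB g h) (lee1n 2)).
Qed.

Lemma L2dist_eq0 f g : L2dist f g = 0 -> f = g.
Proof.
move=> fg0.
have N0 : ('N[circle]_2[EFin \o (f \- g)%R] = 0)%E by rewrite L2distE fg0.
have H : (f : R -> R) = g %[ae circle].
  have p0 : (0 < 2%:E :> \bar R)%E by rewrite lte_fin.
  have := Lnorm_eq0_eq0 ((measurable_EFinP _ _).2 (measurable_L2funB f g)) p0 N0.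
  by apply: filterS => x /(_ Logic.I)/= [] /subr0_eq.
case: f g H {fg0 N0} => [f [[Pf]]] [g [[Pg]]] /= H.
have {H}fg : f = g.
  rewrite -[f]reprK -[g]reprK; apply/eqP.
  by rewrite eqmodE/=; apply/asboolP.
by subst g; rewrite (Prop_irrelevance Pf Pg).
Qed.

HB.instance Definition _ := @isMetric.Build R (L2T R) L2dist L2distxx
  L2dist_eq0 L2dist_sym L2dist_triangle.

End L2.

Section L2_borel.
Variable R : realType.
Implicit Types f g : L2T R.

Let mf := {mfun measurableTypeR R >-> measurableTypeR R}.

Definition class0 : {mfun_ circle, measurableTypeR R >-> measurableTypeR R} :=
  \pi_({mfun_ circle, measurableTypeR R >-> measurableTypeR R})%qT (cst 0 : mf).

Lemma finite_norm_class0 : finite_norm circle 2 (class0 : _ -> R).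
Proof.
have z0 : (class0 : R -> R) = cst 0 %[ae circle].
  apply/asboolP; have /eqP := reprK class0.
  by rewrite eqmodE.
rewrite /finite_norm unlock (ae_eq_integral (cst 0%E))//.
- by rewrite integral0 poweR0r// invr_neq0.
- apply/measurable_EFinP; apply: (measurableT_comp (measurable_powR _)) => //.
  by apply: measurableT_comp => //; exact: measurable_funPT.
- by move: z0; apply: (@filterS _ _ (ae_filter_ringOfSetsType circle)) => x /(_ Logic.I)/= -> _; rewrite normr0 powR0.
Qed.

Definition L2zero : L2T R :=
  LebesgueSpace.Pack (LebesgueSpace.Class
    (isFinLebesgue.Build _ _ R circle _ (lee1n 2) class0 finite_norm_class0)).
HB.instance Definition _ := isPointed.Build (L2T R) L2zero.

(* L2(T) carries the Borel sigma-algebra of its norm topology. *)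
HB.instance Definition _ := Measurable.copy (L2T R) (g_sigma_algebraType (@open (L2T R))).

Lemma open_L2_measurable (A : set (L2T R)) : open A -> measurable A.
Proof. exact: sub_sigma_algebra. Qed.

Lemma lipschitz_L2_measurable (h : L2T R -> R) (C : R) : 0 <= C ->
  (forall f g, h f - h g <= C * L2dist f g) -> measurable_fun setT h.
Proof.
move=> C0 hC; apply: (measurability _ (RGenOInfty.measurableE R)).
move=> _ [_ [x ->] <-]; rewrite setTI.
suff : @open (L2T R) (h @^-1` `]x, +oo[) by exact: open_L2_measurable.
rewrite openE => f /=; rewrite in_itv/= andbT => xf.
rewrite /interior -filter_from_ballE.
exists ((h f - x) / (C + 1)) => /=.
  by apply: divr_gt0; [rewrite subr_gt0|lra].
move=> g; rewrite ballEmdist/= ltr_pdivlMr; [|by lra] => fg.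
rewrite in_itv/= andbT.
have d0 : 0 <= L2dist f g by rewrite /L2dist fine_ge0// Lnorm_ge0.
have {}fg : L2dist f g * (C + 1) < h f - x := fg.
have fg' : L2dist f g * (C + 1) = C * L2dist f g + L2dist f g.
  by rewrite mulrDr mulr1 mulrC.
move: fg; rewrite fg'; have := hC f g; lra.
Qed.

Lemma Lnorm1_L2dist f g : (\int[circle]_x `|f x - g x|%:E <= (L2dist f g)%:E)%E.
Proof.
rewrite -L2distE.
have mfg := measurable_L2funB f g.
have half : (2^-1 + 2^-1 = 1 :> R) by lra.
have m1 : measurable_fun [set: measurableTypeR R] (cst (1 : R)) by exact: measurable_cst.
have := @hoelder _ _ _ circle _ _ 2 2 mfg m1 (ltr0n _ 2) (ltr0n _ 2) half.
have -> : (EFin \o cst (1 : R)) = cst 1%E by [].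
rewrite Lnorm_cst1 circle_setT poweR1r mule1.
rewrite (_ : ((f \- g) \* cst 1) = (f \- g)); last first.
  by apply/funext => x/=; rewrite mulr1.
by rewrite Lnorm1.
Qed.

End L2_borel.

Section L2_int.
Variable R : realType.
Implicit Types f g : L2T R.

Lemma integrable_L2 f : circle.-integrable setT (EFin \o f).
Proof.
apply/Lfun1_integrable/(@Lfun_subset12 _ _ _ circle); last exact: L2fun_Lfun.
by rewrite circle_setT.
Qed.

Section lip.
Variables (T : R -> R) (C : R).
Hypothesis T0 : T 0 = 0.
Hypothesis TC : forall a b, `|T a - T b| <= C * `|a - b|.
Hypothesis mT : measurable_fun setT T.

Let C_ge0 : 0 <= C.
Proof. by have := TC 1 0; rewrite subr0 normr1 mulr1; exact: le_trans. Qed.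

Let mTf f : measurable_fun [set: measurableTypeR R] (T \o f).
Proof. by apply: measurableT_comp => //; exact: measurable_L2fun. Qed.

Lemma integrable_lip_L2 f : circle.-integrable setT (EFin \o (T \o f)).
Proof.
apply: (@le_integrable _ _ _ circle _ measurableT _ (fun x => C%:E * (f x)%:E)%E).
- by apply/measurable_EFinP; exact: mTf.
- move=> x _ /=; rewrite lee_fin -[T _]subr0 -T0 (le_trans (TC _ _))// subr0.
  by rewrite normrM (ger0_norm C_ge0).
- by apply: integrableZl => //; exact: integrable_L2.
Qed.

Lemma measurable_lip_L2 : measurable_fun [set: L2T R]
  (fun f => \int[circle]_x (T (f x))%:E)%E.
Proof.
rewrite (_ : (fun _ => _) = EFin \o (fun f => \int[circle]_x (T (f x)))); last first.
  apply/funext => f /=; rewrite /Rintegral fineK//.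
  by apply: integrable_fin_num => //; exact: integrable_lip_L2.
apply/measurable_EFinP; apply: (lipschitz_L2_measurable C_ge0) => f g.
have mfg : measurable_fun [set: measurableTypeR R] (fun x => `|f x - g x|).
  by apply: measurableT_comp => //; exact: measurable_L2funB.
rewrite -RintegralB//; [|exact: integrable_lip_L2|exact: integrable_lip_L2].
rewrite -lee_fin /Rintegral fineK; last first.
  apply: integrable_fin_num => //.
  have := integrableB measurableT (integrable_lip_L2 f) (integrable_lip_L2 g).
  by [].
have ifg : circle.-integrable setT (fun x => `|f x - g x|%:E).
  exact: (integrable_abse (integrableB measurableT (integrable_L2 f) (integrable_L2 g))).
apply: (@le_trans _ _ (\int[circle]_x (C%:E * `|f x - g x|%:E))%E).
  apply: le_integral => //.
  - exact: (integrableB measurableT (integrable_lip_L2 f) (integrable_lip_L2 g)).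
  - exact: integrableZl.
  - by move=> x _; rewrite -EFinM lee_fin (le_trans _ (TC _ _))// ler_norm.
rewrite integralZl// EFinM; apply: lee_wpmul2l; first by rewrite lee_fin.
exact: Lnorm1_L2dist.
Qed.
End lip.

Lemma measurable_mono_L2 (T : R -> R) (Tn : nat -> R -> R) (C : nat -> R) :
  (forall n, Tn n 0 = 0) ->
  (forall n a b, `|Tn n a - Tn n b| <= C n * `|a - b|) ->
  (forall n, measurable_fun setT (Tn n)) ->
  (forall n a, 0 <= Tn n a) ->
  (forall a, {homo Tn ^~ a : n m / (n <= m)%N >-> n <= m}) ->
  (forall a, Tn ^~ a @ \oo --> T a) ->
  measurable_fun [set: L2T R] (fun f => \int[circle]_x (T (f x))%:E)%E.
Proof.
move=> T0 TC mT Tge0 Tmono Tcvg.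
apply: (@emeasurable_fun_cvg _ _ _ _ (fun n f => \int[circle]_x (Tn n (f x))%:E)%E).
  by move=> n; exact: (measurable_lip_L2 (T0 n) (TC n) (mT n)).
move=> f _.
have := @cvg_monotone_convergence _ _ _ circle _ measurableT
  (fun n x => (Tn n (f x))%:E).
rewrite (_ : (fun x => limn (fun n => (Tn n (f x))%:E)) = (fun x => (T (f x))%:E)); last first.
  apply/funext => x; apply/cvg_lim => //.
  by apply: cvg_EFin; [exact: nearW|exact: Tcvg].
apply.
- move=> n; apply/measurable_EFinP; apply: (measurableT_comp (mT n)).
  exact: (measurable_L2fun f).
- by move=> n x _; rewrite lee_fin.
- by move=> x _ n m nm; rewrite lee_fin; exact: Tmono.
Qed.


Lemma measurable_max0X_L2 (s : R) (k : nat) : `|s| = 1 ->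
  measurable_fun [set: L2T R]
    (fun f => \int[circle]_x ((Num.max (s * f x) 0) ^+ k.+1)%:E)%E.
Proof.
move=> s1.
pose Tn (n : nat) (a : R) := (Num.min (Num.max (s * a) 0) n%:R) ^+ k.+1.
have u0 n a : 0 <= Num.min (Num.max (s * a) 0) n%:R.
  by rewrite le_min ler0n le_max lexx orbT.
have un n a : Num.min (Num.max (s * a) 0) n%:R <= n%:R by rewrite ge_min lexx orbT.
have lipX n (x y : R) : 0 <= x -> x <= n%:R -> 0 <= y -> y <= n%:R ->
    `|x ^+ k.+1 - y ^+ k.+1| <= (n%:R ^+ k *+ k.+1) * `|x - y|.
  move=> x0 xn y0 yn; rewrite subrXX normrM mulrC ler_wpM2r//.
  rewrite (le_trans (ler_norm_sum _ _ _))//.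
  rewrite -[leRHS](_ : \sum_(i < k.+1) n%:R ^+ k = _); last first.
    by rewrite sumr_const card_ord.
  apply: ler_sum => i _; rewrite normrM !normrX !ger0_norm//.
  have ik : ((k.+1.-1 - i) + i = k)%N by rewrite subnK// -ltnS.
  rewrite -[leRHS](_ : n%:R ^+ (k.+1.-1 - i) * n%:R ^+ i = _); last first.
    by rewrite -exprD ik.
  apply: ler_pM; rewrite ?exprn_ge0//; apply: lerXn2r; rewrite ?nnegrE//.
have clip (n : nat) (c d : R) : `|Num.min (Num.max c 0) n%:R -
    Num.min (Num.max d 0) n%:R| <= `|c - d|.
  have n0 : 0 <= n%:R :> R by [].
  have := ler_norm (c - d); have := ler_norm (d - c); rewrite (distrC d c).
  move=> h1 h2; rewrite ler_norml; apply/andP.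
  by case: (leP c 0) => ?; case: (leP d 0) => ?;
    repeat (case: (leP _ n%:R) => ?); split; lra.
apply: (@measurable_mono_L2 (fun a => (Num.max (s * a) 0) ^+ k.+1) Tn (fun n => n%:R ^+ k *+ k.+1)).
- by move=> n; rewrite /Tn mulr0 maxxx min_l// expr0n.
- move=> n a b; rewrite /Tn (le_trans (@lipX n _ _ _ _ _ _))//.
  rewrite ler_wpM2l ?mulrn_wge0 ?exprn_ge0//.
  by rewrite (le_trans (clip _ _ _))// -mulrBr normrM s1 mul1r.
- move=> n; rewrite /Tn; apply: measurable_funX; apply: measurable_minr => //.
  by apply: measurable_maxr => //; exact: mulrl_measurable.
- by move=> n a; rewrite exprn_ge0.
- move=> a n m nm; rewrite /Tn lerXn2r ?nnegrE//.
  by rewrite le_min ge_min lexx/= ge_min ler_nat nm orbT.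
- move=> a; apply: cvg_near_cst.
  near=> n; rewrite /Tn min_l//.
  near: n; exact: nbhs_infty_ger.
Unshelve. all: by end_near. Qed.

Lemma measurable_sqr_L2 : measurable_fun [set: L2T R]
  (fun f => \int[circle]_x ((f x) ^+ 2)%:E)%E.
Proof.
rewrite (_ : (fun _ => _) = (fun f : L2T R =>
    \int[circle]_x ((Num.max (1 * f x) 0) ^+ 2)%:E +
    \int[circle]_x ((Num.max (- 1 * f x) 0) ^+ 2)%:E)%E).
  by apply: emeasurable_funD; apply: measurable_max0X_L2; rewrite ?normrN normr1.
apply/funext => f.
have m (s : R) : measurable_fun [set: measurableTypeR R]
    (fun x => ((Num.max (s * f x) 0) ^+ 2)%:E).
  apply/measurable_EFinP; apply: measurable_funX; apply: measurable_maxr => //.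
  by apply: measurable_funM => //; exact: measurable_L2fun.
rewrite -ge0_integralD//; first last.
- by move=> x _; rewrite lee_fin sqr_ge0.
- by move=> x _; rewrite lee_fin sqr_ge0.
apply: eq_integral => x _; rewrite -EFinD; congr EFin.
rewrite mul1r mulN1r; have [fx|/ltW fx] := leP (f x) 0.
  by rewrite max_l ?oppr_ge0// expr0n add0r sqrrN.
by rewrite max_r ?oppr_le0// expr0n addr0.
Qed.

Lemma measurable_cube_L2 : measurable_fun [set: L2T R]
  (fun f => \int[circle]_x (f x) ^+ 3).
Proof.
rewrite /Rintegral; apply: (measurableT_comp (fine_measurable measurableT)).
rewrite (_ : (fun _ => _) = (fun f : L2T R =>
    \int[circle]_x ((Num.max (1 * f x) 0) ^+ 3)%:E -
    \int[circle]_x ((Num.max (- 1 * f x) 0) ^+ 3)%:E)%E).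
  by apply: emeasurable_funB; apply: measurable_max0X_L2; rewrite ?normrN normr1.
apply/funext => f; rewrite integralE; congr (_ - _)%E;
  apply: eq_integral => x _; rewrite ?funeposE ?funenegE ?mul1r ?mulN1r -?EFinN;
  rewrite -EFin_max; congr EFin; have [fx|/ltW fx] := leP (f x) 0.
- by rewrite [in LHS]max_r ?exprn_odd_le0// expr0n.
- by rewrite [in LHS]max_l// exprn_ge0.
- rewrite [in RHS]max_l ?oppr_ge0// max_l; last by rewrite oppr_ge0 exprn_odd_le0.
  by rewrite exprNn -signr_odd/= expr1 mulN1r.
- by rewrite [in RHS]max_r ?oppr_le0// expr0n max_r// oppr_le0 exprn_ge0.
Qed.
End L2_int.

Section gaussian.
Variable R : realType.

Definition mutually_independent d (T : measurableType d) (P : probability T R)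
    (I : choiceType) (X : I -> {RV P >-> R}) : Prop :=
  forall (s : seq I) (B : I -> set R), uniq s -> (forall i, measurable (B i)) ->
    P (\bigcap_(i in [set` s]) (X i @^-1` B i)) =
      (\prod_(i <- s) P (X i @^-1` B i))%E.

(* Partial sums of
   c_0 + sum_(n < 0) c_n sin (n x) / n + sum_(n > 0) c_n cos (n x) / n,
   the two series being truncated simultaneously. *)
Definition gaussian_series (c : int -> R) (K : nat) (x : R) : R :=
  c 0 + \sum_(1 <= n < K.+1)
    (c (- n%:Z) * (sin (- n%:R * x) / - n%:R) + c n%:Z * (cos (n%:R * x) / n%:R)).

(* [gamma] is the law of the L2(T)-valued random variable [phi] to which the
   series with independent N(0, 1) coefficients converges in L2(T), a.s.;
   this determines [gamma]. *)
Definition is_series_law (gamma : probability (L2T R) R) : Prop :=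
  exists (d : measure_display) (T : measurableType d) (P : probability T R)
    (xi : int -> {RV P >-> R}) (phi : {RV P >-> L2T R}),
  [/\ @mutually_independent d T P int xi,
      forall n B, measurable B -> distribution P (xi n) B = normal_prob 0 1 B,
      {ae P, forall w,
        'N[circle]_2[EFin \o (gaussian_series (xi ^~ w) K \- phi w)%R]%E
          @[K --> \oo] --> 0%E} &
      forall A, measurable A -> gamma A = distribution P phi A].

End gaussian.

Section gibbs.
Variable R : realType.
Implicit Types (N beta : R) (q : L2T R).
Local Open Scope ereal_scope.

Definition L2ball N : set (L2T R) := [set q | \int[circle]_x (q x ^+ 2)%:E <= N%:E].

Lemma measurable_L2ball N : measurable (L2ball N).
Proof.
rewrite -[L2ball N]setTI.
rewrite (_ : L2ball N = (fun q => \int[circle]_x ((q x) ^+ 2)%:E) @^-1` `]-oo, N%:E]).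
  by apply: measurable_sqr_L2 => //; exact: emeasurable_itv.
by apply/seteqP; split => q /=; rewrite in_itv.
Qed.

(* [\int[circle]_x q x ^+ 3] is a real number, with value 0 by convention
   where the integral is infinite or undefined; since gamma is carried by L3
   this only concerns a gamma-null set of [q]. *)
Definition gibbs_density N beta q : \bar R :=
  (\1_(L2ball N) q * expR (beta / 6 * \int[circle]_x q x ^+ 3))%:E.

Lemma measurable_gibbs_density N beta :
  measurable_fun [set: L2T R] (gibbs_density N beta).
Proof.
apply/measurable_EFinP; apply: measurable_funM.
  exact: measurable_indic (measurable_L2ball N).
apply: measurableT_comp => //; apply: measurable_funM => //.
exact: measurable_cube_L2.
Qed.

Lemma gibbs_density_ge0 N beta q : 0 <= gibbs_density N beta q.
Proof. by rewrite lee_fin mulr_ge0// expR_ge0. Qed.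

Definition gibbs_unnormalized (gamma : probability (L2T R) R) N beta
    (A : set (L2T R)) : \bar R := \int[gamma]_(q in A) gibbs_density N beta q.

Section measure.
Variables (gamma : probability (L2T R) R) (N beta : R).
Let mu := gibbs_unnormalized gamma N beta.
Let mu0 : mu set0 = 0. Proof. by rewrite /mu /gibbs_unnormalized integral_set0. Qed.
Let mu_ge0 A : 0 <= mu A.
Proof. by apply: integral_ge0 => q _; exact: gibbs_density_ge0. Qed.
Let mu_sigma : semi_sigma_additive mu.
Proof.
apply: semi_sigma_additive_nng_induced => [|q]; last exact: gibbs_density_ge0.
exact: measurable_gibbs_density.
Qed.
HB.instance Definition _ := isMeasure.Build _ _ _
  (gibbs_unnormalized gamma N beta) mu0 mu_ge0 mu_sigma.
End measure.

(* [mnormalize m P] is [m] divided by its total mass Z_N(beta); the default [P]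
   is only used when that mass is 0 or infinite, which does not happen when
   [is_series_law gamma] and 0 < N. *)
Definition kdv_gibbs (gamma : probability (L2T R) R) N beta : probability (L2T R) R :=
  mnormalize (gibbs_unnormalized gamma N beta) (dirac point).

End gibbs.

Section spectrum.
Variable R : realType.
Implicit Types (q f : R -> R) (mu : R).

Definition periodize q (x : R) : R :=
  q (x - 2 * pi * (Num.floor (x / (2 * pi)))%:~R).

(* - f'' + q f = mu f for q in L2: f' is an indefinite integral of (q - mu) f,
   i.e. f' is locally absolutely continuous and the equation holds a.e. *)
Definition hill_solution q mu f : Prop :=
  (forall x, derivable f x 1) /\
  forall a b, a <= b -> derive1 f b - derive1 f a =
    \int[lebesgue_measure]_(x in `[a, b]) ((periodize q x - mu) * f x).

Definition periodic_solutions q mu : set (R -> R) :=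
  [set f | hill_solution q mu f /\ forall x, f (x + 2 * pi) = f x].

Definition antiperiodic_solutions q mu : set (R -> R) :=
  [set f | hill_solution q mu f /\ forall x, f (x + 2 * pi) = - f x].

(* The subspace [E] of functions has dimension [k]: it has a [k]-element basis. *)
Definition has_dim (E : set (R -> R)) (k : nat) : Prop :=
  exists e : 'I_k -> R -> R, (forall i, E (e i)) /\
    forall f, E f -> exists! c : 'I_k -> R, f = (fun x => \sum_i c i * e i x).

(* lam_0 < lam_1 <= lam_2 < lam_3 <= lam_4 < ... lists every [mu] as many times
   as its multiplicity, the dimension of the space of the 2pi-periodic and
   2pi-antiperiodic solutions.  These two kinds of solutions never coexist
   nontrivially, so one of [k] and [l] is 0. *)
Definition is_periodic_spectrum q (lam : nat -> R) : Prop :=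
  (forall j, lam j.*2 < lam j.*2.+1 /\ lam j.*2.+1 <= lam j.*2.+2) /\
  forall mu, exists k l,
    [/\ has_dim (periodic_solutions q mu) k,
        has_dim (antiperiodic_solutions q mu) l &
        ([set n | lam n = mu] #= `I_(k + l))%card].

Definition periodic_spectrum q : nat -> R :=
  xget (fun=> 0) [set lam | is_periodic_spectrum q lam].

(* [sqrtC] of a negative real is purely imaginary. *)
Definition tau_pos (lam : nat -> R) (j : nat) : R[i] :=
  sqrtC (real_complex R (2 * (lam j.*2 + lam j.*2.-1))).

Definition tau q (j : int) : R[i] :=
  match j with
  | Posz 0 => 0
  | Posz n.+1 => tau_pos (periodic_spectrum q) n.+1
  | Negz n => - tau_pos (periodic_spectrum q) n.+1
  end.

End spectrum.

Section RPW.
Variable R : realType.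
Implicit Types g : R[i] -> R[i].

Definition entire g : Prop :=
  forall z : R[i], derivable (g : R[i]^o -> R[i]^o) z 1.

Definition cabs (z : R[i]) : R := complex.Re `|z|.

Definition exponential_type g : Prop :=
  exists A B : R, forall z, cabs (g z) <= A * expR (B * cabs z).

(* log |g(iy)| / |y|, with log 0 = -oo. *)
Definition log_growth g (y : R) : \bar R :=
  (lne (cabs (g (Complex 0 y)))%:E * (`|y|^-1)%:E)%E.

(* The L2(R) norm of the restriction of [g] to the real axis. *)
Definition L2norm g : \bar R :=
  Lnorm lebesgue_measure 2%:E
    (fun x : measurableTypeR R => (cabs (g (real_complex R x)))%:E).

Definition RPW g : Prop :=
  [/\ entire g, exponential_type g,
      (limf_esup (log_growth g) (pinfty_nbhs R) <= pi%:E)%E /\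
      (limf_esup (log_growth g) (ninfty_nbhs R) <= pi%:E)%E,
      (L2norm g < +oo)%E &
      forall z, conjc (g z) = g (conjc z)].

Definition statistic_term g (t : int -> R[i]) (j : int) : R[i]^o :=
  g (t j) - g j%:~R.

Definition summableZ (a : int -> R[i]^o) : Prop :=
  cvgn (series (fun n => a n%:Z)) /\ cvgn (series (fun n => a (Negz n))).

(* [Negz n] is the integer - n.+1. *)
Definition sumZ (a : int -> R[i]^o) : R[i]^o :=
  limn (series (fun n => a n%:Z)) + limn (series (fun n => a (Negz n))).

(* The terms of index j and - j add up to a real number when [g] is in RPW. *)
Definition linear_statistic g (t : int -> R[i]) : R :=
  complex.Re (sumZ (statistic_term g t)).

End RPW.

(* Main.v *)
(** For N small the potentials of the ball are small in L^1, and on the ball the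
statistic is bounded by a constant M independent of g; the deviation bound is
then elementary and holds with kappa1 = 1 / (8 M^2), kappa2 = 1, since it is
enough that P(F - EF > eps) be at most exp (- eps^2 / (8 M^2)).

Bounding F. If t_j is real with |t_j - j| <= 1/2, then
sum_j |g(t_j) - g(j)| <= C (1 + sum_j (t_j - j)^2) for all g in the unit ball of
RPW(pi). A Phragmen-Lindelof argument gives |g(x + i y)| <= K e^((pi + 1)|y|), up
to a polynomial factor; the residue theorem then reproduces g(w) by integrating
g(x) against a band-limited kernel in x - w that is Lipschitz and decays
quadratically, and Cauchy-Schwarz concludes.

The spectrum. Write mu = k^2. For k >= 1/32 the solutions of -f'' + q f = mu f on
[0, 2 pi] are a cos + b sin plus a small Volterra-Fredholm term, and the
(anti)periodicity conditions reduce to a linear system for a symmetric 2 x 2 matrix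
S(k) = O(1/k): with eta = atan (eigenvalue of S) / pi they read 2 (k - eta(k)) = j,
with the parity of j telling periodic from antiperiodic. As eta is small and
Lipschitz, each of the two eigenvalues of S yields for each j >= 1 exactly one k, at
distance O(1/j) from j/2 and Lipschitz in q; these are the square roots of
lambda_(2j-1) and lambda_(2j). Near mu = 0 the periodicity condition is the
vanishing of a decreasing function of mu, which gives lambda_0, and energy estimates
exclude everything else. Hence tau_j = j + O(1/j) is a measurable function of q. *)
Require Import Defs.
From HB Require Import structures.
From mathcomp Require Import all_boot all_order all_algebra.
From mathcomp Require Import all_classical all_reals all_analysis.
From mathcomp Require Import measurable_realfun.
From mathcomp Require Import complex ring lra.
From mathcomp Require finmap.

Set Implicit Arguments.
Unset Strict Implicit.
Unset Printing Implicit Defensive.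
Import Order.TTheory GRing.Theory Num.Theory.
Import numFieldNormedType.Exports.
Local Open Scope classical_set_scope.
Local Open Scope ring_scope.

(** * Integration on intervals *)

(** Membership in RPW(pi) bounds g pointwise along the imaginary axis but only in mean square along
    the real axis. The Phragmen-Lindelof principle is therefore applied to a primitive of g, and
    Cauchy's estimate leads back to g. The passage from the limsup to an actual bound costs one unit
    in the exponent, the primitive another one, and there remains a growth constant depending on g.
    That constant enters only the truncation error of the reproducing formula, which tends to 0;
    this is why the sampling constant 12 (pi + 4)^2 is the same for all g. The estimates for Hill's
    equation see q only through its L^1 norm over a period. The bound 1/9600 on this norm makes eta
    1/2-Lipschitz in k, so that k - eta(k) increases with slope at least 1/2. The two energy regimes
    meet at k = 1/32, that is, mu = 1/1024. The spectrum is written down as an explicit sequence. It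
    is the one of the definition because dimensions are well defined and a sorted listing with
    prescribed multiplicities is unique. *)

Section integral_on_intervals.
Variable R : realType.
Implicit Types (f g p F : R -> R) (a b c C r x l : R).
Notation mu := (@lebesgue_measure R).

Definition itg a b f := mu.-integrable `[a, b] (EFin \o f).
Definition I a b f : R := \int[mu]_(x in `[a, b]) f x.

Lemma itgS a b c d f : a <= c -> d <= b -> itg a b f -> itg c d f.
Proof.
move=> ac db; apply: integrableS => //.
by apply: subset_itv; rewrite bnd_simp.
Qed.

Lemma itgD a b f g : itg a b f -> itg a b g -> itg a b (fun x => f x + g x).
Proof. by move=> hf hg; exact: (integrableD _ hf hg). Qed.

Lemma itgZ a b r f : itg a b f -> itg a b (fun x => r * f x).
Proof. by move=> hf; exact: (integrableZl _ r hf). Qed.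

Lemma itgN a b f : itg a b f -> itg a b (fun x => - f x).
Proof.
move=> /(itgZ (-1)); congr (_.-integrable _ _); apply/funext => x /=.
by rewrite mulN1r.
Qed.

Lemma itgB a b f g : itg a b f -> itg a b g -> itg a b (fun x => f x - g x).
Proof. by move=> hf /itgN hg; exact: itgD. Qed.

Lemma itg_abs a b f : itg a b f -> itg a b (fun x => `|f x|).
Proof. by move=> /integrable_abse; congr (_.-integrable _ _). Qed.

Lemma itg_cst a b r : itg a b (fun=> r).
Proof.
apply: measurable_bounded_integrable => //; last first.
  by exists `|r|; split => // M rM x _ /=; exact: ltW.
by rewrite /= lebesgue_measure_itv/=; case: ifP; rewrite ?ltry// -EFinD ltry.
Qed.

Lemma itg_cont a b f : (forall x, a <= x <= b -> {for x, continuous f}) ->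
  itg a b f.
Proof.
move=> cf; apply: continuous_compact_integrable; first exact: segment_compact.
apply: continuous_in_subspaceT => x; rewrite inE/= in_itv/=; exact: cf.
Qed.

Lemma itg_mul a b p f C : itg a b p -> measurable_fun `[a, b] f ->
  (forall x, a <= x <= b -> `|f x| <= C) -> itg a b (fun x => p x * f x).
Proof.
move=> ip mf fC.
have := @integrableMr _ _ _ mu `[a, b] _ f (EFin \o p) mf _ ip.
have -> : ((EFin \o f) \* (EFin \o p))%E = EFin \o (fun x => p x * f x).
  by apply/funext => x /=; rewrite -EFinM mulrC.
apply=> //; exists C; split; first exact: num_real.
by move=> M CM x /=; rewrite in_itv/= => /fC /le_trans; apply; exact: ltW.
Qed.

Lemma cont_meas a b f : (forall x, a <= x <= b -> {for x, continuous f}) ->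
  measurable_fun `[a, b] f.
Proof. by move=> /itg_cont/integrableP[/measurable_EFinP]. Qed.

Lemma eqI a b f g : (forall x, a <= x <= b -> f x = g x) -> I a b f = I a b g.
Proof. by move=> fg; apply: eq_Rintegral => x; rewrite inE/= in_itv/=; exact: fg. Qed.

Lemma eq_itg a b f g : (forall x, a <= x <= b -> f x = g x) ->
  itg a b f -> itg a b g.
Proof.
move=> fg; apply: eq_integrable => // x.
by rewrite inE/= in_itv/= => /fg ->.
Qed.

Lemma ID a b f g : itg a b f -> itg a b g ->
  I a b (fun x => f x + g x) = I a b f + I a b g.
Proof. exact: RintegralD. Qed.

Lemma IB a b f g : itg a b f -> itg a b g ->
  I a b (fun x => f x - g x) = I a b f - I a b g.
Proof. exact: RintegralB. Qed.

Lemma IZ a b r f : itg a b f -> I a b (fun x => r * f x) = r * I a b f.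
Proof. exact: RintegralZl. Qed.

Lemma IN a b f : itg a b f -> I a b (fun x => - f x) = - I a b f.
Proof.
by move=> hf; rewrite -mulN1r -IZ//; apply: eqI => x _; rewrite mulN1r.
Qed.

Lemma Icst a b r : a <= b -> I a b (fun=> r) = r * (b - a).
Proof.
move=> ab; rewrite /I Rintegral_cst//= lebesgue_measure_itv/= lte_fin.
by case: ltP => [|ba] //=; rewrite (le_anti (introT andP (conj ab ba))) subrr.
Qed.

Lemma leI a b f g : itg a b f -> itg a b g ->
  (forall x, a <= x <= b -> f x <= g x) -> I a b f <= I a b g.
Proof.
by move=> hf hg fg; apply: le_Rintegral => // x /=; rewrite in_itv/=; exact: fg.
Qed.

Lemma I_ge0 a b f : (forall x, a <= x <= b -> 0 <= f x) -> 0 <= I a b f.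
Proof. by move=> h; apply: Rintegral_ge0 => x /=; rewrite in_itv/=; exact: h. Qed.

Lemma Iabs a b f : itg a b f -> `|I a b f| <= I a b (fun x => `|f x|).
Proof. by move=> hf; exact: le_normr_Rintegral. Qed.

Lemma I0 a f : I a a f = 0.
Proof. by rewrite /I set_itv1 Rintegral_set1. Qed.

Lemma chasles a b c f : a <= b -> b <= c -> itg a c f ->
  I a c f = I a b f + I b c f.
Proof.
move=> ab bc hf.
have := @Rintegral_itvB R f (BLeft a) (BRight c) b hf.
rewrite !bnd_simp => /(_ ab bc); rewrite Rintegral_itv_obnd_cbnd; last first.
  apply: (@integrableS _ _ _ mu `[a, c]) => //.
  by apply: subset_itv; rewrite bnd_simp.
by rewrite /I => <-; rewrite addrC subrK.
Qed.

Lemma I_bound a b f C : a <= b -> itg a b f ->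
  (forall x, a <= x <= b -> `|f x| <= C) -> `|I a b f| <= C * (b - a).
Proof.
move=> ab hf fC; rewrite (le_trans (Iabs hf))// -Icst//.
by apply: leI => //; [exact: itg_abs|exact: itg_cst].
Qed.

Lemma is_derive_cont f x (df : R) : is_derive x 1 f df -> {for x, continuous f}.
Proof. by move=> h; apply/differentiable_continuous/derivable1_diffP. Qed.

Lemma FTC2 a b F f : a <= b ->
  (forall x, a <= x <= b -> is_derive x 1 F (f x)) ->
  (forall x, a <= x <= b -> {for x, continuous f}) -> I a b f = F b - F a.
Proof.
rewrite le_eqVlt => /predU1P[-> _ _|ab dF cf]; first by rewrite I0 subrr.
have cF x : a <= x <= b -> {for x, continuous F} by move=> /dF/is_derive_cont.
rewrite /I /Rintegral (@continuous_FTC2 _ _ F)//.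
- by apply: continuous_in_subspaceT => x; rewrite inE/= in_itv/=; exact: cf.
- split.
  + by move=> x; rewrite in_itv/= => /andP[ax xb]; have := dF x; rewrite !ltW// => /(_ isT)[].
  + by apply: cvg_at_right_filter; apply: cF; rewrite lexx ltW.
  + by apply: cvg_at_left_filter; apply: cF; rewrite lexx ltW.
- move=> x; rewrite in_itv/= => /andP[ax xb].
  by rewrite derive1E; have := dF x; rewrite !ltW// => /(_ isT)[].
Qed.

(** Obtained from Caratheodory's factorization of the increment. Without a quotient, y = x needs no
    separate case, and the closed inequalities suit chains of estimates. *)
Lemma derive_epsP F x l : is_derive x 1 F l <->
  (forall e, 0 < e -> exists2 d, 0 < d &
    forall y, `|y - x| <= d -> `|F y - F x - l * (y - x)| <= e * `|y - x|).
Proof.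
split.
  move=> /is_derive1_caratheodory[G [FG cG Gx]] e e0.
  move/cvgrPdist_le : cG => /(_ e e0)[d /= d0 hd].
  exists (d / 2); first by rewrite divr_gt0.
  move=> y yx; rewrite FG -mulrBl normrM ler_wpM2r// -Gx distrC.
  apply: hd; rewrite /ball_/= distrC (le_lt_trans yx)// ltr_pdivrMr//.
  by rewrite ltr_pMr// ltr1n.
move=> h; apply/is_derive1_caratheodory.
exists (fun z => if z == x then l else (F z - F x) / (z - x)); split.
- move=> z; case: eqP => [->|/eqP zx]; first by rewrite !subrr mulr0.
  by rewrite divfK// subr_eq0.
- apply/cvgrPdist_le => /= e e0; have [d d0 hd] := h e e0.
  exists d => //= y; rewrite /ball_/= => yx; rewrite eqxx.
  case: eqP => [_|/eqP yx0]; first by rewrite subrr normr0 ltW.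
  have yx1 : y - x != 0 by rewrite subr_eq0.
  rewrite distrC -(ler_pM2r (x := `|y - x|)) ?normr_gt0// -normrM mulrBl divfK//.
  by apply: hd; rewrite distrC ltW.
- by rewrite eqxx.
Qed.

Lemma cont_epsP F x : {for x, continuous F} <->
  (forall e, 0 < e -> exists2 d, 0 < d &
    forall y, `|y - x| <= d -> `|F y - F x| <= e).
Proof.
split=> [/cvgrPdist_le h e e0|h].
  have [d /= d0 hd] := h e e0; exists (d / 2); first by rewrite divr_gt0.
  move=> y yx; rewrite distrC; apply: hd; rewrite /ball_/= distrC (le_lt_trans yx)//.
  by rewrite ltr_pdivrMr// ltr_pMr// ltr1n.
apply/cvgrPdist_le => e e0; have [d d0 hd] := h e e0.
exists d => //= y; rewrite /ball_/= => yx; rewrite distrC.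
by apply: hd; rewrite distrC ltW.
Qed.

(** The increment differs from f x * (y - x) by the integral of f - f x, so continuity of f at the
    single point x is enough. It is applied with f itself an indefinite integral. *)
Lemma derive_of_increments a b F f x : a < x < b ->
  itg a b f -> (forall y z, a <= y -> y <= z -> z <= b -> F z - F y = I y z f) ->
  {for x, continuous f} -> is_derive x 1 F (f x).
Proof.
move=> /andP[ax xb] hf hF /cont_epsP cf; apply/derive_epsP => e e0.
have [d d0 hd] := cf e e0.
have m0 : 0 < Num.min d (Num.min (x - a) (b - x)) by rewrite !lt_min d0 !subr_gt0 ax.
exists (Num.min d (Num.min (x - a) (b - x))) => // y.
rewrite !le_min => /and3P[yd ya yb].
have [ay yb'] : a <= y /\ y <= b by move: ya yb; rewrite !ler_norml; lra.
have [xy|yx] := leP x y.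
  rewrite hF//; last exact: ltW.
  have -> : f x * (y - x) = I x y (fun=> f x) by rewrite Icst.
  have hxy : itg x y f by apply: itgS hf => //; exact: ltW.
  rewrite -IB//; last exact: itg_cst.
  rewrite (ger0_norm (_ : 0 <= y - x)) ?subr_ge0//.
  apply: I_bound => //; first by apply: itgB => //; exact: itg_cst.
  move=> t /andP[xt ty]; apply: hd; move: yd; rewrite !ger0_norm ?subr_ge0//; lra.
have yx' := ltW yx.
have -> : F y - F x - f x * (y - x) = - (F x - F y - f x * (x - y)) by ring.
rewrite normrN [`|y - x|]distrC hF//; last exact: ltW.
have -> : f x * (x - y) = I y x (fun=> f x) by rewrite Icst.
have hxy : itg y x f by apply: itgS hf => //; exact: ltW.
rewrite -IB//; last exact: itg_cst.
rewrite (ger0_norm (_ : 0 <= x - y)) ?subr_ge0//.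
apply: I_bound => //; first by apply: itgB => //; exact: itg_cst.
move=> t /andP[yt tx]; apply: hd; move: yd.
by rewrite distrC ger0_norm ?subr_ge0// distrC ger0_norm ?subr_ge0//; lra.
Qed.

Lemma mvt_bound a b F f C : a <= b ->
  (forall x, a <= x <= b -> is_derive x 1 F (f x)) ->
  (forall x, a <= x <= b -> `|f x| <= C) -> `|F b - F a| <= C * (b - a).
Proof.
rewrite le_eqVlt => /predU1P[->|ab dF fC]; first by rewrite !subrr normr0 mulr0.
have dF' x : x \in `]a, b[ -> is_derive x 1 F (f x).
  by rewrite in_itv/= => /andP[? ?]; apply: dF; rewrite !ltW.
have cF' : {within `[a, b], continuous F}.
  apply: continuous_in_subspaceT => x; rewrite inE/= in_itv/= => /dF.
  exact: is_derive_cont.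
have [c] := MVT ab dF' cF'.
rewrite in_itv/= => /andP[? ?] ->; rewrite normrM (gtr0_norm (_ : 0 < b - a)) ?subr_gt0//.
by rewrite ler_wpM2r ?subr_ge0 ?fC ?ltW.
Qed.

Lemma dcst (r x : R) : is_derive x 1 (fun=> r) 0.
Proof. exact: is_derive_cst. Qed.

Lemma did (x : R) : is_derive x 1 (fun y : R => y) 1.
Proof. exact: is_derive_id. Qed.

Lemma dD f g (x u v : R) : is_derive x 1 f u -> is_derive x 1 g v ->
  is_derive x 1 (fun y => f y + g y) (u + v).
Proof. by move=> hf hg; exact: is_deriveD. Qed.

Lemma dB f g (x u v : R) : is_derive x 1 f u -> is_derive x 1 g v ->
  is_derive x 1 (fun y => f y - g y) (u - v).
Proof. by move=> hf hg; exact: is_deriveB. Qed.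

Lemma dM f g (x u v : R) : is_derive x 1 f u -> is_derive x 1 g v ->
  is_derive x 1 (fun y => f y * g y) (u * g x + f x * v).
Proof.
move=> hf hg; have h := is_deriveM hf hg.
have h' : is_derive x 1 (fun y => f y * g y) (f x *: v + g x *: u) by exact: h.
by apply: (is_derive_eq h'); rewrite /GRing.scale/=; ring.
Qed.

Lemma dcomp f g (x u v : R) : is_derive (g x) 1 f u -> is_derive x 1 g v ->
  is_derive x 1 (fun y => f (g y)) (u * v).
Proof. by move=> hf hg; exact: is_derive1_comp. Qed.

Lemma dZ (k : R) f (x u : R) : is_derive x 1 f u ->
  is_derive x 1 (fun y => k * f y) (k * u).
Proof.
move=> hf; apply: (is_derive_eq (dM (dcst k x) hf)).
by rewrite mul0r add0r.
Qed.

Lemma dlin (k x : R) : is_derive x 1 (fun y => k * y) k.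
Proof. by apply: (is_derive_eq (dZ k (did x))); rewrite mulr1. Qed.

Lemma dsinZ (k x : R) : is_derive x 1 (fun y => sin (k * y)) (k * cos (k * x)).
Proof.
apply: (is_derive_eq (dcomp (is_derive_sin (k * x)) (dlin k x))).
by rewrite mulrC.
Qed.

Lemma dcosZ (k x : R) : is_derive x 1 (fun y => cos (k * y)) (- k * sin (k * x)).
Proof.
apply: (is_derive_eq (dcomp (is_derive_cos (k * x)) (dlin k x))).
by rewrite mulrC mulrN mulNr.
Qed.

End integral_on_intervals.

(** * Complex calculus *)

Section complex_modulus.
Variable R : realType.
Implicit Types (z w : R[i]) (f g : R[i] -> R[i]).

Lemma cabsE z : cabs z = Num.sqrt (complex.Re z ^+ 2 + complex.Im z ^+ 2).
Proof. by rewrite /cabs normc_def. Qed.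

Lemma norm_cabs z : `|z| = (cabs z)%:C%C.
Proof. by rewrite normc_def cabsE. Qed.

Lemma cabs_ge0 z : 0 <= cabs z. Proof. by rewrite cabsE sqrtr_ge0. Qed.
Hint Resolve cabs_ge0 : core.

Lemma cabsM z w : cabs (z * w) = cabs z * cabs w.
Proof. by apply: complexI; rewrite rmorphM/= -!norm_cabs normrM. Qed.

Lemma cabsD z w : cabs (z + w) <= cabs z + cabs w.
Proof. by rewrite -lecR rmorphD/= -!norm_cabs ler_normD. Qed.

Lemma cabsN z : cabs (- z) = cabs z.
Proof. by apply: complexI; rewrite -!norm_cabs normrN. Qed.

Lemma cabsB z w : cabs (z - w) <= cabs z + cabs w.
Proof. by rewrite -(cabsN w) cabsD. Qed.

Lemma cabs_sub z w : cabs (z - w) = cabs (w - z).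
Proof. by rewrite -cabsN opprB. Qed.

Lemma cabs_lip z w : cabs z - cabs w <= cabs (z - w).
Proof. by rewrite lerBlDr -{1}(subrK w z) cabsD. Qed.

Lemma cabs0 : cabs (0 : R[i]) = 0.
Proof. by rewrite cabsE/= expr0n addr0 sqrtr0. Qed.

Lemma cabs_real (x : R) : cabs (x%:C)%C = `|x|.
Proof. by rewrite cabsE/= expr0n addr0 sqrtr_sqr. Qed.

Lemma cabs_im (y : R) : cabs (Complex 0 y) = `|y|.
Proof. by rewrite cabsE/= expr0n add0r sqrtr_sqr. Qed.

Lemma cabs1 : cabs (1 : R[i]) = 1.
Proof. by rewrite (cabs_real 1) normr1. Qed.

Lemma cabs_eq0 z : (cabs z == 0) = (z == 0).
Proof. by rewrite -(inj_eq (@complexI R)) -norm_cabs normr_eq0. Qed.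

Lemma cabs_gt0 z : (0 < cabs z) = (z != 0).
Proof. by rewrite lt_neqAle cabs_ge0 andbT eq_sym cabs_eq0. Qed.

Lemma cabsV z : cabs z^-1 = (cabs z)^-1.
Proof.
have [->|z0] := eqVneq z 0; first by rewrite invr0 cabs0 invr0.
apply: (mulfI (_ : cabs z != 0)); first by rewrite cabs_eq0.
by rewrite -cabsM divff// mulfV ?cabs1// cabs_eq0.
Qed.

Lemma cabsX z n : cabs (z ^+ n) = cabs z ^+ n.
Proof. by elim: n => [|n ih]; rewrite ?expr0 ?cabs1// !exprS cabsM ih. Qed.

Lemma cabs_conj z : cabs (conjc z) = cabs z.
Proof. by apply: complexI; rewrite -!norm_cabs normcJ. Qed.

Lemma cabs_sqr z : cabs z ^+ 2 = complex.Re z ^+ 2 + complex.Im z ^+ 2.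
Proof. by rewrite cabsE sqr_sqrtr// addr_ge0// sqr_ge0. Qed.

Lemma Re_cabs z : `|complex.Re z| <= cabs z.
Proof.
by rewrite -(ler_pXn2r (n := 2))// ?nnegrE// cabs_sqr real_normK ?num_real// lerDl sqr_ge0.
Qed.

Lemma Im_cabs z : `|complex.Im z| <= cabs z.
Proof.
by rewrite -(ler_pXn2r (n := 2))// ?nnegrE// cabs_sqr real_normK ?num_real// lerDr sqr_ge0.
Qed.

Lemma cabs_ReIm z : cabs z <= `|complex.Re z| + `|complex.Im z|.
Proof.
case: z => x y /=; have -> : Complex x y = (x%:C + Complex 0 y)%C.
  by apply/eqP; rewrite eq_complex/= addr0 add0r !eqxx.
by rewrite (le_trans (cabsD _ _))// cabs_real cabs_im.
Qed.

(** Radii, tolerances and moduli are real numbers in both notions, so that estimates can be closed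
    by real arithmetic. *)
Definition ccont f z := forall e : R, 0 < e -> exists2 d : R, 0 < d &
  forall w, cabs (w - z) <= d -> cabs (f w - f z) <= e.

Definition cder f z l := forall e : R, 0 < e -> exists2 d : R, 0 < d &
  forall w, cabs (w - z) <= d -> cabs (f w - f z - l * (w - z)) <= e * cabs (w - z).

Lemma cder_cont f z l : cder f z l -> ccont f z.
Proof.
move=> /(_ 1 ltr01)[d d0 hd] e e0.
have K0 : 0 < 1 + cabs l by rewrite ltr_wpDr.
exists (Num.min d (e / (1 + cabs l))).
  by rewrite lt_min d0/= divr_gt0.
move=> w; rewrite le_min => /andP[wd we].
rewrite -(subrK (l * (w - z)) (f w - f z)) (le_trans (cabsD _ _))//.
rewrite (le_trans (lerD (hd w wd) (lexx _)))// cabsM -mulrDl mulrC.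
by rewrite -ler_pdivlMr.
Qed.

Lemma cder_cst (a : R[i]) z : cder (fun=> a) z 0.
Proof.
move=> e e0; exists 1 => // w _.
by rewrite subrr mul0r subrr cabs0 mulr_ge0// ltW.
Qed.

Lemma cder_id z : cder id z 1.
Proof.
move=> e e0; exists 1 => // w _.
by rewrite mul1r subrr cabs0 mulr_ge0// ltW.
Qed.

Lemma cderD f g z l m : cder f z l -> cder g z m ->
  cder (fun w => f w + g w) z (l + m).
Proof.
move=> hf hg e e0; have e2 : 0 < e / 2 by rewrite divr_gt0.
have [d d0 hd] := hf _ e2; have [d' d0' hd'] := hg _ e2.
exists (Num.min d d'); first by rewrite lt_min d0.
move=> w; rewrite le_min => /andP[wd wd'].
have -> : f w + g w - (f z + g z) - (l + m) * (w - z) =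
  (f w - f z - l * (w - z)) + (g w - g z - m * (w - z)) by ring.
rewrite (le_trans (cabsD _ _))// (le_trans (lerD (hd _ wd) (hd' _ wd')))//.
by rewrite -mulrDl -splitr.
Qed.

Lemma cderM f g z l m : cder f z l -> cder g z m ->
  cder (fun w => f w * g w) z (l * g z + f z * m).
Proof.
move=> hf hg e e0.
pose K := cabs (f z) + cabs (g z) + cabs l + 1.
have K0 : 0 < K by rewrite ltr_wpDl// !addr_ge0.
have e3 : 0 < Num.min 1 (e / 3 / K) by rewrite lt_min ltr01 !divr_gt0.
have [d d0 hd] := hf _ e3; have [d' d0' hd'] := hg _ e3.
have [d2 d20 hd2] := cder_cont hg e3.
exists (Num.min d (Num.min d' d2)); first by rewrite !lt_min d0 d0' d20.
move=> w; rewrite !le_min => /and3P[/hd h1 /hd' h2 /hd2 h3].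
have -> : f w * g w - f z * g z - (l * g z + f z * m) * (w - z) =
  (f w - f z - l * (w - z)) * g w + l * (w - z) * (g w - g z)
  + f z * (g w - g z - m * (w - z)) by ring.
move: e3 h1 h2 h3; set q := Num.min _ _ => q0 h1 h2 h3.
have q1 : q <= 1 by rewrite /q ge_min lexx.
have qK : q * K <= e / 3 by rewrite -ler_pdivlMr// /q ge_min lexx orbT.
have gw : cabs (g w) <= K.
  rewrite -(subrK (g z) (g w)) (le_trans (cabsD _ _))// /K.
  have := cabs_ge0 (f z); have := cabs_ge0 l; lra.
have c0 := cabs_ge0 (w - z).
have b1 : cabs ((f w - f z - l * (w - z)) * g w) <= e / 3 * cabs (w - z).
  rewrite cabsM (le_trans (ler_pM _ _ h1 gw))// mulrAC ler_wpM2r//.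
have b2 : cabs (l * (w - z) * (g w - g z)) <= e / 3 * cabs (w - z).
  rewrite !cabsM mulrAC ler_wpM2r// (le_trans _ qK)// mulrC ler_pM//.
  by rewrite /K; have := cabs_ge0 (f z); have := cabs_ge0 (g z); lra.
have b3 : cabs (f z * (g w - g z - m * (w - z))) <= e / 3 * cabs (w - z).
  rewrite cabsM (le_trans (ler_wpM2l _ h2))// mulrA ler_wpM2r//.
  rewrite (le_trans _ qK)// mulrC ler_wpM2l ?(ltW q0)//.
  by rewrite /K; have := cabs_ge0 l; have := cabs_ge0 (g z); lra.
rewrite (le_trans (cabsD _ _))//.
have := cabsD ((f w - f z - l * (w - z)) * g w) (l * (w - z) * (g w - g z)).
lra.
Qed.

Lemma cder_comp f g z l m : cder g z m -> cder f (g z) l ->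
  cder (f \o g) z (l * m).
Proof.
move=> hg hf e e0.
pose K := cabs l + cabs m + 2.
have K0 : 0 < K by rewrite ltr_wpDl// addr_ge0.
have e3 : 0 < Num.min 1 (e / 2 / K) by rewrite lt_min ltr01 !divr_gt0.
have [d d0 hd] := hf _ e3; have [d' d0' hd'] := hg _ e3.
have [d2 d20 hd2] := cder_cont hg d0.
exists (Num.min d' d2); first by rewrite lt_min d0' d20.
move=> w; rewrite !le_min => /andP[/hd' h2 /hd2/hd h1] /=.
move: e3 h1 h2; set q := Num.min _ _ => q0 h1 h2.
have q1 : q <= 1 by rewrite /q ge_min lexx.
have qK : q * K <= e / 2 by rewrite -ler_pdivlMr// /q ge_min lexx orbT.
have -> : f (g w) - f (g z) - l * m * (w - z) =
  (f (g w) - f (g z) - l * (g w - g z)) + l * (g w - g z - m * (w - z)) by ring.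
have c0 := cabs_ge0 (w - z).
have gw : cabs (g w - g z) <= K * cabs (w - z).
  rewrite -(subrK (m * (w - z)) (g w - g z)) (le_trans (cabsD _ _))// cabsM.
  have : q * cabs (w - z) <= 1 * cabs (w - z) by rewrite ler_wpM2r.
  have := mulr_ge0 (cabs_ge0 l) c0; rewrite /K; move: h2.
  set a := cabs (_ - _ - _); lra.
rewrite (le_trans (cabsD _ _))// (splitr e) mulrDl lerD//.
  rewrite (le_trans h1)// (le_trans (ler_wpM2l (ltW q0) gw))// mulrA.
  by rewrite ler_wpM2r.
rewrite cabsM (le_trans (ler_wpM2l _ h2))// mulrA ler_wpM2r//.
rewrite (le_trans _ qK)// mulrC ler_wpM2l ?(ltW q0)//.
by rewrite /K; have := cabs_ge0 m; lra.
Qed.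

Lemma cder_inv z : z != 0 -> cder (fun w => w^-1) z (- (z ^- 2)).
Proof.
move=> z0 e e0; have cz : 0 < cabs z by rewrite cabs_gt0.
exists (Num.min (cabs z / 2) (e * cabs z ^+ 3 / 2)).
  by rewrite lt_min divr_gt0//= divr_gt0// mulr_gt0// exprn_gt0.
move=> w; rewrite le_min => /andP[w1 w2].
have cw : cabs z / 2 <= cabs w.
  have := cabs_lip z w; rewrite cabs_sub; lra.
have w0 : w != 0 by rewrite -cabs_gt0; lra.
have -> : w^-1 - z^-1 - (- z ^- 2) * (w - z) = (w - z) * (w - z) * (w^-1 * z ^- 2).
  by field; rewrite z0 w0.
rewrite cabsM cabsM [X in _ <= X]mulrC -mulrA ler_wpM2l// cabsM !cabsV cabsX.
rewrite -invfM ler_pdivrMr; last by rewrite mulr_gt0 ?exprn_gt0//; lra.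
rewrite (le_trans w2)// -mulrA ler_wpM2l ?(ltW e0)// exprS mulrAC.
by rewrite ler_wpM2r ?sqr_ge0.
Qed.

Lemma cder_eq f z l m : cder f z l -> l = m -> cder f z m.
Proof. by move=> h <-. Qed.

Lemma cderZ (k : R[i]) f z l : cder f z l -> cder (fun w => k * f w) z (k * l).
Proof.
by move=> h; apply: cder_eq; [exact: (cderM (cder_cst k z) h)|rewrite mul0r add0r].
Qed.

Lemma cderB f g z l m : cder f z l -> cder g z m ->
  cder (fun w => f w - g w) z (l - m).
Proof.
move=> hf /(cderZ (-1)); rewrite mulN1r => hg.
have := cderD hf hg; congr (cder _ _ _).
by apply/funext => w; rewrite mulN1r.
Qed.

Lemma cder_affine (al be : R[i]) z : cder (fun w => al + be * w) z be.
Proof.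
apply: cder_eq; first exact: (cderD (cder_cst al z) (cderZ be (cder_id z))).
by rewrite add0r mulr1.
Qed.

(** The scalars are [R[i]], so the limit along the direction 1 already runs over all complex
    increments. *)
Lemma derivable_cder (f : R[i]^o -> R[i]^o) (z : R[i]) : derivable f z 1 -> exists l, cder f z l.
Proof.
move=> df; exists ('D_1 f z) => e e0.
have e0' : 0 < e%:C%C by rewrite ltcR.
move/cvgrPdist_le : (df) => /(_ _ e0')[[d y]/=].
rewrite ltcE/= => /andP[/eqP-> d0] hd.
exists (d / 2); first by rewrite divr_gt0.
move=> w wz; have [->|wz0] := eqVneq w z.
  by rewrite !subrr mulr0 subrr cabs0 mulr0.
have wz1 : w - z != 0 by rewrite subr_eq0.
have := hd (w - z); rewrite /ball_ /= sub0r normrN wz1 => /(_ _ isT).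
rewrite norm_cabs ltcR (le_lt_trans wz) ?ltr_pdivrMr ?ltr_pMr ?ltr1n// => /(_ isT).
rewrite norm_cabs lecR -(ler_pM2r (x := cabs (w - z))) ?cabs_gt0// -cabsM.
set Q := cabs _ => hQ; suff -> : cabs (f w - f z - 'D_1 f z * (w - z)) = Q by [].
rewrite /Q -cabsN; congr cabs; rewrite mulrBl opprB; congr (_ - _).
by rewrite /GRing.scale/= mulrAC mulVf// mul1r mulr1 subrK.
Qed.

End complex_modulus.
#[global] Hint Extern 0 (is_true (0 <= cabs _)) => solve [exact: cabs_ge0] : core.

(** * Translation invariance of integrals *)

Section translation.
Variable R : realType.
Notation mu := (@lebesgue_measure R).

Definition sh (c : R) : measurableTypeR R -> measurableTypeR R := fun x => x + c.

Let msh (c : R) : measurable_fun [set: measurableTypeR R] (sh c).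
Proof. by apply: measurable_funD => //; exact: measurable_id. Qed.

HB.instance Definition _ (c : R) := isMeasurableFun.Build _ _ _ _ (sh c) (msh c).

(** Lebesgue measure is determined by its values on half-open intervals, whose length a translation
    preserves. *)
Lemma lebesgue_translation (c : R) (A : set R) : measurable A ->
  pushforward mu (sh c) A = mu A.
Proof.
move=> mA; apply/esym/lebesgue_measure_unique => //= _ [[a b]] _ <-.
rewrite /pushforward (_ : sh c @^-1` `]a, b] = `](a - c), (b - c)])%classic; last first.
  by apply/seteqP; split => x /=; rewrite /sh !in_itv/= ltrBlDr lerBrDr.
rewrite !lebesgue_measure_itv/= !lte_fin ltrD2r.
by case: ifP => // _; rewrite -!EFinB; congr EFin; ring.
Qed.

Lemma sh_preimage (a b c : R) : sh c @^-1` `[a + c, b + c] = `[a, b]%classic.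
Proof. by apply/seteqP; split => x /=; rewrite /sh !in_itv/= !lerD2r. Qed.

Lemma itg_shift (a b c : R) (f : R -> R) : measurable_fun [set: R] f ->
  itg (a + c) (b + c) f -> itg a b (fun x => f (x + c)).
Proof.
move=> mf /integrableP[_ fi]; apply/integrableP; split.
  apply/measurable_EFinP; apply: measurable_funTS.
  exact: (measurableT_comp mf (msh c)).
move: fi; rewrite (eq_measure_integral (pushforward mu (sh c))); last first.
  by move=> A mA _; exact/esym/lebesgue_translation.
rewrite ge0_integral_pushforward//; last first.
  by apply: measurable_funTS; apply: measurableT_comp => //; exact/measurable_EFinP.
by rewrite sh_preimage.
Qed.

Lemma I_shift (a b c : R) (f : R -> R) : measurable_fun [set: R] f ->
  itg (a + c) (b + c) f -> I a b (fun x => f (x + c)) = I (a + c) (b + c) f.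
Proof.
move=> mf fi; rewrite /I /Rintegral; congr fine.
rewrite [RHS](eq_measure_integral (pushforward mu (sh c))); last first.
  by move=> A mA _; exact/esym/lebesgue_translation.
rewrite integral_pushforward//; first by rewrite sh_preimage.
- exact/measurable_EFinP.
- by rewrite sh_preimage; exact: itg_shift.
Qed.

End translation.

(** * Goursat's theorem on rectangles *)

Section rectangle_integral.
Variable R : realType.
Implicit Types (z w : R[i]) (f g : R[i] -> R[i]) (a b c d x y : R).

(* The real part of the integral of f along the counterclockwise boundary of
   [a, b] x [c, d]; the imaginary part is the one of -i f. *)
Definition rr f a b c d : R :=
  I a b (fun x => complex.Re (f (Complex x c)))
  - I a b (fun x => complex.Re (f (Complex x d)))
  - I c d (fun y => complex.Im (f (Complex b y)))
  + I c d (fun y => complex.Im (f (Complex a y))).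

Definition rect a b c d : set R[i] :=
  [set z | a <= complex.Re z <= b /\ c <= complex.Im z <= d].

(** These are the four lines carrying the sides; [rect] cuts out the segments. Asking for continuity
    on the boundary only, as in [bcont], admits integrands with a pole inside. *)
Definition side a b c d z :=
  [\/ complex.Re z = a, complex.Re z = b, complex.Im z = c | complex.Im z = d].

Definition bcont f a b c d :=
  forall z, rect a b c d z -> side a b c d z -> ccont f z.

Definition rcont f a b c d := forall z, rect a b c d z -> ccont f z.

Lemma ccontH_Re f x y : ccont f (Complex x y) ->
  {for x, continuous (fun x => complex.Re (f (Complex x y)))}.
Proof.
move=> h; apply/cont_epsP => e e0; have [d d0 hd] := h e e0; exists d => // t td.
have := hd (Complex t y); rewrite cabsE/= subrr expr0n addr0 sqrtr_sqr => /(_ td).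
by apply: le_trans; rewrite (le_trans _ (Re_cabs _))// raddfB.
Qed.

Lemma ccontH_Im f x y : ccont f (Complex x y) ->
  {for x, continuous (fun x => complex.Im (f (Complex x y)))}.
Proof.
move=> h; apply/cont_epsP => e e0; have [d d0 hd] := h e e0; exists d => // t td.
have := hd (Complex t y); rewrite cabsE/= subrr expr0n addr0 sqrtr_sqr => /(_ td).
by apply: le_trans; rewrite (le_trans _ (Im_cabs _))// raddfB.
Qed.

Lemma ccontV_Re f x y : ccont f (Complex x y) ->
  {for y, continuous (fun y => complex.Re (f (Complex x y)))}.
Proof.
move=> h; apply/cont_epsP => e e0; have [d d0 hd] := h e e0; exists d => // t td.
have := hd (Complex x t); rewrite cabsE/= subrr expr0n add0r sqrtr_sqr => /(_ td).
by apply: le_trans; rewrite (le_trans _ (Re_cabs _))// raddfB.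
Qed.

Lemma ccontV_Im f x y : ccont f (Complex x y) ->
  {for y, continuous (fun y => complex.Im (f (Complex x y)))}.
Proof.
move=> h; apply/cont_epsP => e e0; have [d d0 hd] := h e e0; exists d => // t td.
have := hd (Complex x t); rewrite cabsE/= subrr expr0n add0r sqrtr_sqr => /(_ td).
by apply: le_trans; rewrite (le_trans _ (Im_cabs _))// raddfB.
Qed.

Lemma rcont_bcont f a b c d : rcont f a b c d -> bcont f a b c d.
Proof. by move=> h z hz _; exact: h. Qed.

Section sides.
Variables (f : R[i] -> R[i]) (a b c d : R).

Lemma itg_h y : rcont f a b c d -> c <= y <= d ->
  itg a b (fun x => complex.Re (f (Complex x y))).
Proof. by move=> hf cy; apply: itg_cont => x ax; apply: ccontH_Re; exact: hf. Qed.

Lemma itg_v x : rcont f a b c d -> a <= x <= b ->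
  itg c d (fun y => complex.Im (f (Complex x y))).
Proof. by move=> hf ax; apply: itg_cont => y cy; apply: ccontV_Im; exact: hf. Qed.

Lemma bcont_itg : a <= b -> c <= d -> bcont f a b c d ->
  [/\ itg a b (fun x => complex.Re (f (Complex x c))),
      itg a b (fun x => complex.Re (f (Complex x d))),
      itg c d (fun y => complex.Im (f (Complex a y))) &
      itg c d (fun y => complex.Im (f (Complex b y)))].
Proof.
move=> ab cd hf; split.
- apply: itg_cont => x ax; apply: ccontH_Re; apply: hf; first by rewrite /rect/= ax lexx.
  by apply: Or43.
- apply: itg_cont => x ax; apply: ccontH_Re; apply: hf; first by rewrite /rect/= ax lexx cd.
  by apply: Or44.
- apply: itg_cont => x ax; apply: ccontV_Im; apply: hf; first by rewrite /rect/= ax lexx.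
  by apply: Or41.
- apply: itg_cont => x ax; apply: ccontV_Im; apply: hf; first by rewrite /rect/= ax lexx ab.
  by apply: Or42.
Qed.
End sides.

Lemma rcontS f a b c d a' b' c' d' : a <= a' -> b' <= b -> c <= c' -> d' <= d ->
  rcont f a b c d -> rcont f a' b' c' d'.
Proof.
move=> aa bb cc dd h [x y] /= [/andP[? ?] /andP[? ?]]; apply: h; split => /=.
  by rewrite (le_trans aa)// (le_trans _ bb).
by rewrite (le_trans cc)// (le_trans _ dd).
Qed.

Lemma rr_splitx f a m b c d : a <= m -> m <= b -> c <= d -> rcont f a b c d ->
  rr f a b c d = rr f a m c d + rr f m b c d.
Proof.
move=> am mb cd hf; rewrite /rr !(chasles am mb)//.
- by ring.
- by apply: (itg_h hf); rewrite ?cd lexx.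
- by apply: (itg_h hf); rewrite ?cd lexx.
Qed.

Lemma rr_splity f a b c m d : c <= m -> m <= d -> a <= b -> rcont f a b c d ->
  rr f a b c d = rr f a b c m + rr f a b m d.
Proof.
move=> cm md ab hf; rewrite /rr !(chasles cm md)//.
- by ring.
- by apply: (itg_v hf); rewrite ab lexx.
- by apply: (itg_v hf); rewrite ab lexx.
Qed.

Lemma rrB f g a b c d : a <= b -> c <= d -> bcont f a b c d -> bcont g a b c d ->
  rr (fun z => f z - g z) a b c d = rr f a b c d - rr g a b c d.
Proof.
move=> ab cd hf hg; rewrite /rr.
have hRe p q (u v : R -> R[i]) : itg p q (fun x => complex.Re (u x)) ->
    itg p q (fun x => complex.Re (v x)) ->
    I p q (fun x => complex.Re (u x - v x)) =
    I p q (fun x => complex.Re (u x)) - I p q (fun x => complex.Re (v x)).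
  by move=> hu hv; rewrite -IB//; apply: eqI => x _; rewrite raddfB.
have hIm p q (u v : R -> R[i]) : itg p q (fun x => complex.Im (u x)) ->
    itg p q (fun x => complex.Im (v x)) ->
    I p q (fun x => complex.Im (u x - v x)) =
    I p q (fun x => complex.Im (u x)) - I p q (fun x => complex.Im (v x)).
  by move=> hu hv; rewrite -IB//; apply: eqI => x _; rewrite raddfB.
have [f1 f2 f3 f4] := bcont_itg ab cd hf; have [g1 g2 g3 g4] := bcont_itg ab cd hg.
by rewrite !(hRe, hIm)//; ring.
Qed.

Lemma rr_bound f a b c d K : a <= b -> c <= d -> bcont f a b c d ->
  (forall z, rect a b c d z -> side a b c d z -> cabs (f z) <= K) ->
  `|rr f a b c d| <= K * (2 * ((b - a) + (d - c))).
Proof.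
move=> ab cd /(bcont_itg ab cd)[f1 f2 f3 f4] fK; rewrite /rr.
have h1 : `|I a b (fun x => complex.Re (f (Complex x c)))| <= K * (b - a).
  apply: I_bound => // x ax; rewrite (le_trans (Re_cabs _))// fK//=; last exact: Or43.
  by rewrite /rect/= ax lexx.
have h2 : `|I a b (fun x => complex.Re (f (Complex x d)))| <= K * (b - a).
  apply: I_bound => // x ax; rewrite (le_trans (Re_cabs _))// fK//=; last exact: Or44.
  by rewrite /rect/= ax lexx cd.
have h3 : `|I c d (fun x => complex.Im (f (Complex a x)))| <= K * (d - c).
  apply: I_bound => // x ax; rewrite (le_trans (Im_cabs _))// fK//=; last exact: Or41.
  by rewrite /rect/= ax lexx ab.
have h4 : `|I c d (fun x => complex.Im (f (Complex b x)))| <= K * (d - c).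
  apply: I_bound => // x ax; rewrite (le_trans (Im_cabs _))// fK//=; last exact: Or42.
  by rewrite /rect/= ax lexx ab.
move: h1 h2 h3 h4; rewrite !ler_norml => /andP[? ?] /andP[? ?] /andP[? ?] /andP[? ?].
by apply/andP; split; lra.
Qed.

Lemma I_affine a b p q : a <= b ->
  I a b (fun x => p + q * x) = p * (b - a) + q * (b ^+ 2 - a ^+ 2) / 2.
Proof.
move=> ab; have dF x : is_derive x 1 (fun y => p * y + q / 2 * (y * y)) (p + q * x).
  apply: (is_derive_eq (dD (dlin p x) (dZ (q / 2) (dM (did x) (did x))))).
  by field.
rewrite (FTC2 ab (fun x _ => dF x)); first by field.
move=> x _; have := dD (dcst p x) (dlin q x); exact: is_derive_cont.
Qed.

Lemma rr_affine (al be : R[i]) a b c d : a <= b -> c <= d ->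
  rr (fun z => al + be * z) a b c d = 0.
Proof.
move=> ab cd; rewrite /rr; case: al => a1 a2; case: be => b1 b2 /=.
have Hh y : I a b (fun x => a1 + (b1 * x - b2 * y)) =
    (a1 - b2 * y) * (b - a) + b1 * (b ^+ 2 - a ^+ 2) / 2.
  by rewrite -I_affine//; apply: eqI => x _; ring.
have Hv x : I c d (fun y => a2 + (b1 * y + b2 * x)) =
    (a2 + b2 * x) * (d - c) + b1 * (d ^+ 2 - c ^+ 2) / 2.
  by rewrite -I_affine//; apply: eqI => y _; ring.
by rewrite !Hh !Hv; field.
Qed.

Section bisection.
Variable P : R -> R -> R -> R -> Prop.
Hypothesis Pbis : forall a b c d, a <= b -> c <= d -> P a b c d ->
  let m := (a + b) / 2 in let k := (c + d) / 2 in
  [\/ P a m c k, P m b c k, P a m k d | P m b k d].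

Let quad : Type := ((R * R) * (R * R))%type.
Let Pq (q : quad) := P q.1.1 q.1.2 q.2.1 q.2.2.
Let step (q : quad) : quad :=
  let: ((a, b), (c, d)) := q in
  let m := (a + b) / 2 in let k := (c + d) / 2 in
  if `[< P a m c k >] then ((a, m), (c, k)) else
  if `[< P m b c k >] then ((m, b), (c, k)) else
  if `[< P a m k d >] then ((a, m), (k, d)) else ((m, b), (k, d)).

Let valid (q : quad) := [/\ q.1.1 <= q.1.2, q.2.1 <= q.2.2 & Pq q].

Let stepP q : valid q -> [/\ valid (step q), q.1.1 <= (step q).1.1,
  (step q).1.2 <= q.1.2, q.2.1 <= (step q).2.1 & (step q).2.2 <= q.2.2] /\
  ((step q).1.2 - (step q).1.1 = (q.1.2 - q.1.1) / 2 /\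
   (step q).2.2 - (step q).2.1 = (q.2.2 - q.2.1) / 2).
Proof.
case: q => [[a b] [c d]] [/= ab cd Pabcd].
have := Pbis ab cd Pabcd => /=; rewrite /step /valid /Pq.
case: asboolP => [? _|n1]/=; first by split; [split => //=; [split => //; lra|lra..]|lra].
case: asboolP => [? _|n2]/=; first by split; [split => //=; [split => //; lra|lra..]|lra].
case: asboolP => [? _|n3]/=; first by split; [split => //=; [split => //; lra|lra..]|lra].
case=> // P4; split; [split => //=; [split => //; lra|lra..]|lra].
Qed.

(** The left and lower ends of the nested quarters are nondecreasing and bounded by all right and
    upper ends; their suprema give the common point. *)
Lemma bisection a b c d : a <= b -> c <= d -> P a b c d ->
  exists x y, forall e, 0 < e -> exists a' b' c' d',
    [/\ a <= a', b' <= b, c <= c' & d' <= d] /\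
    [/\ a' <= x <= b', c' <= y <= d', b' - a' <= e, d' - c' <= e & P a' b' c' d'].
Proof.
move=> ab cd P0; pose q0 : quad := ((a, b), (c, d)).
pose q n := iter n step q0.
have v n : valid (q n) by elim: n => [//|n /stepP[[]]].
have mono m n : (m <= n)%N -> [/\ (q m).1.1 <= (q n).1.1, (q n).1.2 <= (q m).1.2,
    (q m).2.1 <= (q n).2.1 & (q n).2.2 <= (q m).2.2].
  move=> /subnK <-; elim: (n - m)%N => [|k [h1 h2 h3 h4]]; first by rewrite add0n.
  have [[_ g1 g2 g3 g4] _] := stepP (v (k + m)%N).
  by rewrite addSn; split; [exact: le_trans h1 g1|exact: le_trans g2 h2
    |exact: le_trans h3 g3|exact: le_trans g4 h4].
have width n : (q n).1.2 - (q n).1.1 = (b - a) / 2 ^+ n /\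
    (q n).2.2 - (q n).2.1 = (d - c) / 2 ^+ n.
  elim: n => [|n [h1 h2]]; first by rewrite expr0 !divr1.
  have [_ [g1 g2]] := stepP (v n).
  by rewrite /= g1 g2 h1 h2 exprS invfM; split; ring.
have cross m n : (q m).1.1 <= (q n).1.2 /\ (q m).2.1 <= (q n).2.2.
  have [h1 _ h3 _] := mono _ _ (leq_maxl m n).
  have [_ g2 _ g4] := mono _ _ (leq_maxr m n).
  have [u1 u2 _] := v (maxn m n).
  by split; [rewrite (le_trans h1)// (le_trans u1)|rewrite (le_trans h3)// (le_trans u2)].
pose x := sup (range (fun n => (q n).1.1)).
pose y := sup (range (fun n => (q n).2.1)).
have hx n : (q n).1.1 <= x <= (q n).1.2.
  apply/andP; split.
    by apply: ub_le_sup; [exists (q 0%N).1.2 => _ [m _ <-]; exact: (cross m 0%N).1|exists n].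
  by apply: ge_sup; [exists (q 0%N).1.1; exists 0%N|move=> _ [m _ <-]; exact: (cross m n).1].
have hy n : (q n).2.1 <= y <= (q n).2.2.
  apply/andP; split.
    by apply: ub_le_sup; [exists (q 0%N).2.2 => _ [m _ <-]; exact: (cross m 0%N).2|exists n].
  by apply: ge_sup; [exists (q 0%N).2.1; exists 0%N|move=> _ [m _ <-]; exact: (cross m n).2].
exists x, y => e e0.
pose n := Num.bound ((b - a + (d - c)) / e).
have hn : (b - a + (d - c)) / 2 ^+ n <= e.
  rewrite ler_pdivrMr ?exprn_gt0// mulrC -ler_pdivrMr//.
  rewrite (le_trans (ltW (archi_boundP _)))//; first by rewrite divr_ge0 ?(ltW e0)//; lra.
  by rewrite -/n -natrX ler_nat ltnW// ltn_expl.
have [w1 w2] := width n; have [m1 m2 m3 m4] := mono 0%N n (leq0n _).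
have e1 : 0 <= (b - a) / 2 ^+ n by rewrite divr_ge0 ?subr_ge0.
have e2 : 0 <= (d - c) / 2 ^+ n by rewrite divr_ge0 ?subr_ge0.
exists (q n).1.1, (q n).1.2, (q n).2.1, (q n).2.2; split; first by split.
have [_ _ Pn] := v n.
by move: hn; rewrite mulrDl => hn; split; rewrite ?hx ?hy// ?w1 ?w2; lra.
Qed.

End bisection.

(** Let s be the half perimeter. The failure |integral| > e s^2 passes to one of the four quarters,
    because s^2 is divided by 4. Near the limit point f differs by at most (e / 4) s from an affine
    function, whose integral is 0, so the integral is at most (e / 4) s * 2 s, half of what failure
    demands. *)
Lemma goursat f a b c d : a <= b -> c <= d ->
  (forall z, rect a b c d z -> exists l, cder f z l) -> rr f a b c d = 0.
Proof.
move=> ab cd hf.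
have cf : rcont f a b c d by move=> z /hf[l]; exact: cder_cont.
suff key e : 0 < e -> `|rr f a b c d| <= e * ((b - a) + (d - c)) ^+ 2.
  apply/eqP; rewrite -normr_le0; apply/ler_addgt0Pl => e e0; rewrite addr0.
  have s0 : 0 < ((b - a) + (d - c)) ^+ 2 + 1 by rewrite ltr_wpDl// sqr_ge0.
  rewrite (le_trans (key (e / (((b - a) + (d - c)) ^+ 2 + 1)) _)) ?divr_gt0//.
  by rewrite mulrAC ler_pdivrMr// ler_wpM2l ?(ltW e0)// lerDl.
move=> e0; rewrite leNgt; apply/negP => habs.
pose P a' b' c' d' := [/\ a <= a', b' <= b, c <= c' & d' <= d] /\
  e * ((b' - a') + (d' - c')) ^+ 2 < `|rr f a' b' c' d'|.
have Pbis a' b' c' d' : a' <= b' -> c' <= d' -> P a' b' c' d' ->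
  let m := (a' + b') / 2 in let k := (c' + d') / 2 in
  [\/ P a' m c' k, P m b' c' k, P a' m k d' | P m b' k d'].
  move=> ab' cd' [[h1 h2 h3 h4] hP] m k.
  have am : a' <= m by rewrite /m; lra.
  have mb : m <= b' by rewrite /m; lra.
  have ck : c' <= k by rewrite /k; lra.
  have kd : k <= d' by rewrite /k; lra.
  have cf' : rcont f a' b' c' d' by exact: rcontS cf.
  have E : rr f a' b' c' d' = rr f a' m c' k + rr f m b' c' k + (rr f a' m k d' + rr f m b' k d').
    rewrite (rr_splity ck kd ab' cf'); congr (_ + _); apply: rr_splitx => //.
      by apply: rcontS cf'.
    by apply: rcontS cf'.
  have [n|p1] := leP `|rr f a' m c' k| (e * ((m - a') + (k - c')) ^+ 2); last first.
    by apply: Or41; split => //; split => //; [exact: le_trans mb h2|exact: le_trans kd h4].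
  have [n1|p1] := leP `|rr f m b' c' k| (e * ((b' - m) + (k - c')) ^+ 2); last first.
    by apply: Or42; split => //; split => //; [exact: le_trans am|exact: le_trans kd h4].
  have [n2|p1] := leP `|rr f a' m k d'| (e * ((m - a') + (d' - k)) ^+ 2); last first.
    by apply: Or43; split => //; split => //; [exact: le_trans mb h2|exact: le_trans ck].
  have [n3|p1] := leP `|rr f m b' k d'| (e * ((b' - m) + (d' - k)) ^+ 2); last first.
    by apply: Or44; split => //; split => //; [exact: le_trans am|exact: le_trans ck].
  exfalso; move: hP; rewrite ltNge => /negP; apply; rewrite E.
  rewrite (le_trans (ler_normD _ _))//.
  have g1 := ler_normD (rr f a' m c' k) (rr f m b' c' k).
  have g2 := ler_normD (rr f a' m k d') (rr f m b' k d').
  have e1 : m - a' = (b' - a') / 2 by rewrite /m; field.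
  have e2 : b' - m = (b' - a') / 2 by rewrite /m; field.
  have e3 : k - c' = (d' - c') / 2 by rewrite /k; field.
  have e4 : d' - k = (d' - c') / 2 by rewrite /k; field.
  move: n n1 n2 n3; rewrite e1 e2 e3 e4 -mulrDl exprMn.
  have -> : (2^-1 : R) ^+ 2 = 1 / 4 by field.
  lra.
have P0 : P a b c d by [].
have [x [y hxy]] := bisection Pbis ab cd P0.
have : exists l, cder f (Complex x y) l.
  have [a' [b' [c' [d' [[? ? ? ?] [/andP[? ?] /andP[? ?] _ _ _]]]]]] := hxy 1 ltr01.
  by apply: hf; split; apply/andP; split => /=; lra.
move=> [l /(_ (e / 4))]; rewrite divr_gt0// => /(_ isT)[del del0 hdel].
have del2 : 0 < del / 2 by rewrite divr_gt0.
have [a' [b' [c' [d' [[h1 h2 h3 h4] [/andP[ax xb] /andP[cy yd] wa wc [_ hP]]]]]]] := hxy _ del2.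
have ab' : a' <= b' by exact: le_trans xb.
have cd' : c' <= d' by exact: le_trans yd.
have cf' : rcont f a' b' c' d' by exact: rcontS cf.
pose L z := (f (Complex x y) - l * Complex x y) + l * z.
have cL : rcont L a' b' c' d'.
  by move=> z _; apply: cder_cont (cder_affine _ _ _).
move: hP; rewrite ltNge => /negP; apply.
have -> : rr f a' b' c' d' = rr (fun z => f z - L z) a' b' c' d'.
  by rewrite rrB//; [rewrite /L rr_affine// subr0|exact: rcont_bcont..].
set s := b' - a' + (d' - c').
have cB : rcont (fun z => f z - L z) a' b' c' d'.
  move=> z hz; have [|m hm] := hf z.
    case: z hz => zx zy [/= /andP[z1 z2] /andP[z3 z4]]; split; apply/andP; split => /=;
      clear - z1 z2 z3 z4 ax xb cy yd h1 h2 h3 h4; lra.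
  exact: cder_cont (cderB hm (cder_affine _ _ _)).
apply: (@le_trans _ _ ((e / 4 * s) * (2 * s))); last first.
  have h0 : 0 <= e * s ^+ 2 by rewrite mulr_ge0 ?(ltW e0)// sqr_ge0.
  have -> : e / 4 * s * (2 * s) = e * s ^+ 2 / 2 by field.
  by lra.
apply: rr_bound => //; first exact: rcont_bcont.
move=> -[zx zy] [/= /andP[z1 z2] /andP[z3 z4]] _.
have -> : f (Complex zx zy) - L (Complex zx zy) = f (Complex zx zy) - f (Complex x y) - l * (Complex zx zy - Complex x y).
  by rewrite /L; ring.
have hs : cabs (Complex zx zy - Complex x y) <= s.
  rewrite (le_trans (cabs_ReIm _))//= /s lerD// ler_norml; apply/andP; split;
    clear - z1 z2 z3 z4 ax xb cy yd h1 h2 h3 h4; lra.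
rewrite (le_trans (hdel _ _))//; first by rewrite (le_trans hs)// /s; lra.
by rewrite ler_wpM2l// divr_ge0// ltW.
Qed.

End rectangle_integral.

(** * Cauchy estimates and the maximum principle *)

Section cauchy.
Variable R : realType.
Implicit Types (z w : R[i]) (f g P : R[i] -> R[i]) (a b c d x y : R).

Lemma rr_degx f a c d : rr f a a c d = 0.
Proof. by rewrite /rr !I0; ring. Qed.

Lemma rr_degy f a b c : rr f a b c c = 0.
Proof. by rewrite /rr !I0; ring. Qed.

(** Four strips that avoid w are cut off and contribute 0. On the remaining small rectangle f is
    bounded by K, its value at w plus 1, and the side lengths are at most 2 s, so the integral is at
    most 8 K s <= e. When w is close to the boundary some strips degenerate. *)
Lemma goursat_except f w a b c d : a <= b -> c <= d -> rcont f a b c d ->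
  (forall z, rect a b c d z -> z != w -> exists l, cder f z l) ->
  rr f a b c d = 0.
Proof.
move=> ab cd cf hf.
have [wr|wr] := pselect (rect a b c d w); last first.
  apply: goursat => // z hz; apply: hf => //.
  by apply/eqP => zw; apply: wr; rewrite -zw.
case: w wr hf => u v [/= /andP[au ub] /andP[cv vd]] hf.
have [del del0 hdel] := cf (Complex u v) (conj (introT andP (conj au ub)) (introT andP (conj cv vd))) 1 ltr01.
pose K := cabs (f (Complex u v)) + 1.
have K0 : 0 < K by rewrite /K ltr_wpDl.
apply/eqP; rewrite -normr_le0; apply/ler_addgt0Pl => e e0; rewrite addr0.
pose s := Num.min (del / 2) (e / 8 / K).
have s0 : 0 < s by rewrite lt_min !divr_gt0.
have sdel : s <= del / 2 by rewrite ge_min lexx.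
have sK : K * s <= e / 8 by rewrite mulrC -ler_pdivlMr// ge_min lexx orbT.
pose x1 := Num.max a (u - s); pose x2 := Num.min b (u + s).
pose y1 := Num.max c (v - s); pose y2 := Num.min d (v + s).
have hx1 : a <= x1 /\ x1 <= u by rewrite /x1 le_max ge_max lexx au/=; split => //; lra.
have hx2 : x2 <= b /\ u <= x2 by rewrite /x2 le_min ge_min lexx ub/=; split => //; lra.
have hy1 : c <= y1 /\ y1 <= v by rewrite /y1 le_max ge_max lexx cv/=; split => //; lra.
have hy2 : y2 <= d /\ v <= y2 by rewrite /y2 le_min ge_min lexx vd/=; split => //; lra.
have [[? ?] [? ?] [? ?] [? ?]] := And4 hx1 hx2 hy1 hy2.
have x12 : x1 <= x2 by lra.
have y12 : y1 <= y2 by lra.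
have sub a' b' c' d' : a <= a' -> b' <= b -> c <= c' -> d' <= d ->
    a' <= b' -> c' <= d' -> ~ rect a' b' c' d' (Complex u v) -> rr f a' b' c' d' = 0.
  move=> ha hb hc hd ab' cd' nw; apply: goursat => // -[zx zy] hz; apply: hf.
    case: hz => /= /andP[z1 z2] /andP[z3 z4].
    by split; apply/andP; split => /=; clear - z1 z2 z3 z4 ha hb hc hd; lra.
  by apply/eqP => zw; apply: nw; rewrite -zw.
have p1 : rr f a x1 c d = 0.
  have [ax|xa] := ltP a (u - s); last by rewrite /x1 max_l// rr_degx.
  by apply: sub => //=; [lra|rewrite /x1 max_r ?ltW// => -[/= /andP[_]]; lra].
have p2 : rr f x2 b c d = 0.
  have [ax|xa] := ltP (u + s) b; last by rewrite /x2 min_l// rr_degx.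
  by apply: sub => //=; [lra|rewrite /x2 min_r ?ltW// => -[/= /andP[]]; lra].
have p3 : rr f x1 x2 c y1 = 0.
  have [ax|xa] := ltP c (v - s); last by rewrite /y1 max_l// rr_degy.
  by apply: sub => //=; [lra|rewrite /y1 max_r ?ltW// => -[/= _ /andP[_]]; lra].
have p4 : rr f x1 x2 y2 d = 0.
  have [ax|xa] := ltP (v + s) d; last by rewrite /y2 min_l// rr_degy.
  by apply: sub => //=; [lra|rewrite /y2 min_r ?ltW// => -[/= _ /andP[]]; lra].
have -> : rr f a b c d = rr f x1 x2 y1 y2.
  have e1 : rr f a b c d = rr f a x1 c d + rr f x1 b c d by apply: rr_splitx => //; lra.
  have e2 : rr f x1 b c d = rr f x1 x2 c d + rr f x2 b c d.
    by apply: rr_splitx => //; apply: rcontS cf.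
  have e3 : rr f x1 x2 c d = rr f x1 x2 c y1 + rr f x1 x2 y1 d.
    by apply: rr_splity => //; [lra|apply: rcontS cf].
  have e4 : rr f x1 x2 y1 d = rr f x1 x2 y1 y2 + rr f x1 x2 y2 d.
    by apply: rr_splity => //; apply: rcontS cf.
  by rewrite e1 e2 e3 e4 p1 p2 p3 p4; ring.
have xs : x2 - x1 <= 2 * s.
  have : u - s <= x1 by rewrite /x1 le_max lexx orbT.
  have : x2 <= u + s by rewrite /x2 ge_min lexx orbT.
  lra.
have ys : y2 - y1 <= 2 * s.
  have : v - s <= y1 by rewrite /y1 le_max lexx orbT.
  have : y2 <= v + s by rewrite /y2 ge_min lexx orbT.
  lra.
have h : `|rr f x1 x2 y1 y2| <= K * (2 * ((x2 - x1) + (y2 - y1))).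
  apply: rr_bound => //; first by apply: rcont_bcont; apply: rcontS cf.
  move=> [zx zy] [/= /andP[z1 z2] /andP[z3 z4]] _.
  rewrite /K -lerBlDl (le_trans (cabs_lip _ _))//; apply: hdel.
  rewrite (le_trans (cabs_ReIm _))//=.
  have sx1 : u - s <= x1 by rewrite /x1 le_max lexx orbT.
  have sx2 : x2 <= u + s by rewrite /x2 ge_min lexx orbT.
  have sy1 : v - s <= y1 by rewrite /y1 le_max lexx orbT.
  have sy2 : y2 <= v + s by rewrite /y2 ge_min lexx orbT.
  have : `|zx - u| <= s.
    by rewrite ler_norml; apply/andP; split; clear - z1 z2 sx1 sx2; lra.
  have : `|zy - v| <= s.
    by rewrite ler_norml; apply/andP; split; clear - z3 z4 sy1 sy2; lra.
  lra.
rewrite (le_trans h)//.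
have : K * (2 * (x2 - x1 + (y2 - y1))) <= K * (8 * s) by rewrite ler_wpM2l ?(ltW K0)//; lra.
move/le_trans; apply; move: sK; rewrite mulrCA; lra.
Qed.

Lemma cder_invB w z : z != w -> cder (fun z => (z - w)^-1) z (- ((z - w) ^- 2)).
Proof.
move=> zw; have h0 : z - w != 0 by rewrite subr_eq0.
have h1 : cder (fun z => z - w) z 1.
  by apply: cder_eq; [exact: (cderB (cder_id z) (cder_cst w z))|rewrite subr0].
have := @cder_comp R (fun z => z^-1) (fun z => z - w) z _ _ h1 (cder_inv h0).
by rewrite mulr1.
Qed.

Lemma side_neq a b c d w z : a < complex.Re w < b -> c < complex.Im w < d ->
  side a b c d z -> z != w.
Proof.
move=> /andP[? ?] /andP[? ?] h; apply/eqP => zw; move: h; rewrite /side zw.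
by case; lra.
Qed.

(** A positive lower bound is enough, the value 2 pi is not computed. All four sides contribute
    nonnegatively; the bottom one is kept, with |z - w|^2 bounded by the squared diagonal. *)
Lemma winding a b c d w : a < complex.Re w < b -> c < complex.Im w < d ->
  (b - a) * ((complex.Im w - c) / ((b - a) ^+ 2 + (d - c) ^+ 2))
  <= rr (fun z => - Complex 0 1 / (z - w)) a b c d.
Proof.
case: w => u v /= /andP[au ub] /andP[cv vd].
have ab : a <= b by lra.
have cd : c <= d by lra.
have cB : bcont (fun z => - Complex 0 1 / (z - Complex u v)) a b c d.
  move=> z _ sz; apply: cder_cont.
  apply: (cderZ (- Complex 0 1) (cder_invB _)).
  by apply: side_neq sz; rewrite /= ?au ?cv.
have [f1 f2 f3 f4] := bcont_itg ab cd cB.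
rewrite /rr.
have E x y : - Complex 0 1 / (Complex x y - Complex u v) =
   Complex (- ((y - v) / ((x - u) ^+ 2 + (y - v) ^+ 2)))
           (- ((x - u) / ((x - u) ^+ 2 + (y - v) ^+ 2))).
  by apply/eqP; rewrite eq_complex/=; apply/andP; split; apply/eqP; ring.
have g2 : I a b (fun x => complex.Re (- Complex 0 1 / (Complex x d - Complex u v))) <= 0.
  rewrite -oppr_ge0 -IN//; apply: I_ge0 => x _.
  rewrite E/= opprK divr_ge0 ?(addr_ge0 (sqr_ge0 _) (sqr_ge0 _))//; lra.
have g3 : 0 <= I c d (fun y => complex.Im (- Complex 0 1 / (Complex a y - Complex u v))).
  apply: I_ge0 => x _; rewrite E/= -mulNr divr_ge0 ?(addr_ge0 (sqr_ge0 _) (sqr_ge0 _))//; lra.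
have g4 : I c d (fun y => complex.Im (- Complex 0 1 / (Complex b y - Complex u v))) <= 0.
  rewrite -oppr_ge0 -IN//; apply: I_ge0 => x _.
  rewrite E/= opprK divr_ge0 ?(addr_ge0 (sqr_ge0 _) (sqr_ge0 _))//; lra.
have g1 : (b - a) * ((v - c) / ((b - a) ^+ 2 + (d - c) ^+ 2)) <=
   I a b (fun x => complex.Re (- Complex 0 1 / (Complex x c - Complex u v))).
  rewrite mulrC -Icst//; apply: leI => //; first exact: itg_cst.
  move=> x /andP[ax xb]; rewrite E/= -mulNr opprB; apply: ler_wpM2l; first lra.
  rewrite lef_pV2 ?posrE.
  - by apply: lerD; rewrite -subr_ge0 subr_sqr mulr_ge0//; lra.
  - by rewrite ltr_pwDl ?sqr_ge0// exprn_gt0; lra.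
  - by rewrite ltr_wpDl ?sqr_ge0// exprn_even_gt0//=; lra.
lra.
Qed.

Lemma cabs_ge_side a b c d w z s : a + s <= complex.Re w -> complex.Re w + s <= b ->
  c + s <= complex.Im w -> complex.Im w + s <= d -> side a b c d z -> s <= cabs (z - w).
Proof.
case: w z => u v [x y] /= h1 h2 h3 h4 H3.
have := Re_cabs (Complex x y - Complex u v); have := Im_cabs (Complex x y - Complex u v).
move=> /=; rewrite !ler_norml => /andP[? ?] /andP[? ?].
by move: H3; case => /= ?; lra.
Qed.

(* Cauchy's formula for f(w), with the contour integral replaced by a bound. *)
Lemma cauchy_bound f a b c d w (s K : R) : 0 < s ->
  a + s <= complex.Re w -> complex.Re w + s <= b ->
  c + s <= complex.Im w -> complex.Im w + s <= d ->
  (forall z, rect a b c d z -> exists l, cder f z l) ->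
  (forall z, rect a b c d z -> side a b c d z -> cabs (f z) <= K) ->
  cabs (f w) * ((b - a) * ((complex.Im w - c) / ((b - a) ^+ 2 + (d - c) ^+ 2)))
    <= K / s * (2 * ((b - a) + (d - c))).
Proof.
move=> s0 h1 h2 h3 h4 hf fK.
have ab : a <= b by lra. have cd : c <= d by lra.
have aw : a < complex.Re w < b by apply/andP; split; lra.
have cw : c < complex.Im w < d by apply/andP; split; lra.
have rw : rect a b c d w by split; apply/andP; split; lra.
have K0 : 0 <= K.
  have /fK : rect a b c d (Complex a c) by rewrite /rect/= !lexx ab cd.
  by move=> /(_ (Or41 _ _ _ erefl)); exact: le_trans.
have [fw0|fw0] := eqVneq (f w) 0.
  rewrite fw0 cabs0 mul0r mulr_ge0//; last by lra.
  by rewrite divr_ge0// ltW.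
(* [rr] sees real parts only. This factor turns f(w) into - i |f(w)|^2, so that the polar part of k
   f(z) / (z - w) is |f(w)|^2 times the kernel of [winding]. *)
pose k := - Complex 0 1 * conjc (f w).
have [l hl] := hf w rw.
pose F z := if z == w then k * l else k * (f z - f w) / (z - w).
have hF z : rect a b c d z -> z != w -> exists l, cder F z l.
  move=> rz zw; have [m hm] := hf z rz.
  have D := cderM (cderZ k (cderB hm (cder_cst (f w) z))) (cder_invB zw).
  exists (k * (m - 0) * (z - w)^-1 + k * (f z - f w) * - (z - w) ^- 2).
  move=> e e0; have [d1 d10 hd1] := D e e0.
  exists (Num.min d1 (cabs (z - w) / 2)).
    by rewrite lt_min d10 divr_gt0// cabs_gt0 subr_eq0.
  move=> t; rewrite le_min => /andP[td1 td2].
  have tw : t != w.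
    apply/eqP => tw; move: td2; rewrite tw cabs_sub.
    have : 0 < cabs (z - w) by rewrite cabs_gt0 subr_eq0.
    lra.
  by rewrite /F (negbTE tw) (negbTE zw); exact: hd1.
have cF : rcont F a b c d.
  move=> z rz; have [->|zw] := eqVneq z w; last by have [m] := hF z rz zw; exact: cder_cont.
  move=> e e0; have k0 : 0 < cabs k + 1 by rewrite ltr_wpDl.
  have [d1 d10 hd1] := hl (e / (cabs k + 1)) (divr_gt0 e0 k0).
  exists d1 => // t td; rewrite /F eqxx; case: eqP => [_|/eqP tw].
    by rewrite subrr cabs0 ltW.
  have tw0 : t - w != 0 by rewrite subr_eq0.
  have -> : k * (f t - f w) / (t - w) - k * l = k * ((f t - f w - l * (t - w)) / (t - w)).
    by field.
  rewrite (cabsM k) (cabsM (f t - f w - l * (t - w))) cabsV.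
  have hq : cabs (f t - f w - l * (t - w)) / cabs (t - w) <= e / (cabs k + 1).
    by rewrite ler_pdivrMr ?cabs_gt0//; exact: hd1.
  apply: (le_trans (ler_wpM2l (cabs_ge0 k) hq)).
  rewrite mulrA ler_pdivrMr// mulrC; apply: ler_wpM2l; [exact: ltW|lra].
have F0 : rr F a b c d = 0 by apply: (goursat_except (w := w)) => //; lra.
pose G z := k * f z / (z - w).
pose H z := (cabs (f w) ^+ 2)%:C%C * (- Complex 0 1 / (z - w)).
have cG : bcont G a b c d.
  move=> z rz sz; have [m hm] := hf z rz; apply: cder_cont.
  by apply: cderM; [exact: (cderZ k hm)|apply: cder_invB; exact: side_neq sz].
have cH : bcont H a b c d.
  move=> z rz sz; apply: cder_cont; apply: cderZ; apply: cderZ.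
  by apply: cder_invB; exact: side_neq sz.
have FE : rr F a b c d = rr (fun z => G z - H z) a b c d.
  have FGH z : side a b c d z -> F z = G z - H z.
    move=> sz; rewrite /F (negbTE (side_neq aw cw sz)) /G /H mulrBr mulrBl; congr (_ - _).
    rewrite /k mulrA; congr (_ / _); rewrite [in RHS]mulrC -mulrA; congr (_ * _).
    rewrite rmorphXn/= -norm_cabs sqr_normc mulrC//.
  rewrite /rr; congr (_ - _ - _ + _); apply: eqI => t _; rewrite FGH//.
  - exact: Or43. - exact: Or44. - exact: Or42. - exact: Or41.
have := F0; rewrite FE rrB// => /eqP; rewrite subr_eq0 => /eqP GH.
have HE : rr H a b c d = cabs (f w) ^+ 2 * rr (fun z => - Complex 0 1 / (z - w)) a b c d.
  have cB : bcont (fun z => - Complex 0 1 / (z - w)) a b c d.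
    move=> z _ sz; apply: cder_cont; apply: (cderZ (- Complex 0 1) (cder_invB _)).
    exact: side_neq sz.
  have [f1 f2 f3 f4] := bcont_itg ab cd cB.
  have ReE (r : R) z : complex.Re (r%:C%C * z) = r * complex.Re z.
    by case: z => ? ?; rewrite /= mul0r subr0.
  have ImE (r : R) z : complex.Im (r%:C%C * z) = r * complex.Im z.
    by case: z => ? ?; rewrite /= mul0r addr0.
  rewrite /rr /H; set q := cabs (f w) ^+ 2.
  have e1 := IZ q f1; have e2 := IZ q f2; have e3 := IZ q f3; have e4 := IZ q f4.
  rewrite mulrDr !mulrBr -e1 -e2 -e3 -e4.
  by congr (_ - _ - _ + _); apply: eqI => t _; rewrite ?ReE ?ImE.
have Gb : `|rr G a b c d| <= cabs (f w) * (K / s) * (2 * ((b - a) + (d - c))).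
  apply: rr_bound => // z rz sz; rewrite /G (cabsM (k * f z)) (cabsM k) cabsV.
  have -> : cabs k = cabs (f w) by rewrite /k cabsM cabsN cabs_im normr1 mul1r cabs_conj.
  have zs := cabs_ge_side h1 h2 h3 h4 sz.
  rewrite -mulrA ler_wpM2l// ler_pM ?invr_ge0 ?fK// lef_pV2 ?posrE//; lra.
have fw1 : 0 < cabs (f w) by rewrite cabs_gt0.
have W := winding aw cw.
move: W; set A := (b - a) * _ => W.
rewrite -(ler_pM2l fw1).
have -> : cabs (f w) * (cabs (f w) * A) = cabs (f w) ^+ 2 * A by ring.
apply: (@le_trans _ _ (rr G a b c d)); first by rewrite GH HE ler_wpM2l ?sqr_ge0.
by apply: (le_trans (ler_norm _)); move: Gb; rewrite -!mulrA.
Qed.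

Lemma cderX f z l n : cder f z l -> exists m, cder (fun z => f z ^+ n) z m.
Proof.
move=> h; elim: n => [|n [m hm]]; first by exists 0; exact: cder_cst.
have D := cderM h hm; exists (l * f z ^+ n + f z * m).
by move: D; congr (cder _ _ _); apply/funext => t; rewrite exprS.
Qed.

(** If x > K > 0, Bernoulli's inequality makes (x / K)^n exceed C for some n. The case K = 0 is
    settled by n = 1. *)
Lemma power_le (x K C : R) : 0 <= x -> 0 <= K ->
  (forall n : nat, x ^+ n <= C * K ^+ n) -> x <= K.
Proof.
move=> x0 K0 h; rewrite leNgt; apply/negP => Kx.
have [KE|KE] := eqVneq K 0.
  by have := h 1%N; rewrite !expr1 KE mulr0; lra.
have K1 : 0 < K by rewrite lt_neqAle eq_sym KE.
pose r := x / K; have r1 : 1 < r by rewrite /r ltr_pdivlMr// mul1r.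
have hr n : r ^+ n <= C by rewrite /r expr_div_n ler_pdivrMr ?exprn_gt0.
have bern n : 1 + n%:R * (r - 1) <= r ^+ n.
  elim: n => [|n ih]; first by rewrite mul0r addr0 expr0.
  rewrite exprS (le_trans _ (ler_wpM2l _ ih))//; last lra.
  rewrite -natr1; have : 0 <= n%:R * (r - 1) ^+ 2 by rewrite mulr_ge0 ?sqr_ge0.
  rewrite expr2; lra.
have C0 : 0 <= C by have := hr 0%N; rewrite expr0; lra.
have := archi_boundP (divr_ge0 C0 (ltW (_ : 0 < r - 1))).
rewrite subr_gt0 => /(_ r1); rewrite ltr_pdivrMr ?subr_gt0//.
set n := Num.bound _; have := bern n; have := hr n; lra.
Qed.

(** Landau's trick: [cauchy_bound] for f^n has a constant independent of n, which disappears on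
    taking n-th roots. This is why the crude bound of [winding] suffices. *)
Lemma max_modulus f a b c d w K :
  a < complex.Re w < b -> c < complex.Im w < d ->
  (forall z, rect a b c d z -> exists l, cder f z l) ->
  (forall z, rect a b c d z -> side a b c d z -> cabs (f z) <= K) ->
  cabs (f w) <= K.
Proof.
move=> /andP[aw wb] /andP[cw wd] hf fK.
have ab : a <= b by lra. have cd : c <= d by lra.
have K0 : 0 <= K.
  have /fK : rect a b c d (Complex a c) by rewrite /rect/= !lexx ab cd.
  by move=> /(_ (Or41 _ _ _ erefl)); exact: le_trans.
pose s := Num.min (Num.min (complex.Re w - a) (b - complex.Re w))
  (Num.min (complex.Im w - c) (d - complex.Im w)).
have s0 : 0 < s by rewrite !lt_min !subr_gt0 aw wb cw wd.
have [[s1 s2] [s3 s4]] : (s <= complex.Re w - a /\ s <= b - complex.Re w) /\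
   (s <= complex.Im w - c /\ s <= d - complex.Im w).
  by rewrite /s !ge_min !lexx ?orbT.
pose A := (b - a) * ((complex.Im w - c) / ((b - a) ^+ 2 + (d - c) ^+ 2)).
have A0 : 0 < A.
  rewrite mulr_gt0//; first by lra.
  rewrite divr_gt0//; first by lra.
  by rewrite ltr_pwDl ?sqr_ge0// exprn_gt0; lra.
apply: (@power_le _ _ (s^-1 * (2 * ((b - a) + (d - c))) / A)) => // n.
have := @cauchy_bound (fun z => f z ^+ n) a b c d w s (K ^+ n) s0.
rewrite -/A => h; rewrite mulrAC ler_pdivlMr// -cabsX [X in _ <= X](_ : _ = K ^+ n / s * (2 * (b - a + (d - c)))).
  apply: h; try lra.
  - by move=> z /hf[l]; exact: cderX.
  - by move=> z rz sz; rewrite cabsX lerXn2r ?nnegrE ?fK.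
by ring.
Qed.

End cauchy.

(** * The Phragmen-Lindelof principle *)

Section taylor.
Variable R : realType.
Implicit Types (z w : R[i]) (f g P : R[i] -> R[i]).

Lemma is_derive_line f (k w h m : R[i]) (t : R) :
  cder f (w + t%:C%C * h) m ->
  is_derive t 1 (fun t : R => complex.Re (k * f (w + t%:C%C * h)))
    (complex.Re (k * m * h)).
Proof.
move=> hf; apply/derive_epsP => e e0.
pose K := cabs k * cabs h + 1.
have K0 : 0 < K by rewrite /K ltr_wpDl// mulr_ge0.
have [d d0 hd] := hf (e / K) (divr_gt0 e0 K0).
have h0 : 0 < cabs h + 1 by rewrite ltr_wpDl.
exists (d / (cabs h + 1)); first by rewrite divr_gt0.
move=> s st.
have E : w + s%:C%C * h - (w + t%:C%C * h) = (s - t)%:C%C * h by rewrite rmorphB/=; ring.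
have := hd (w + s%:C%C * h); rewrite E cabsM cabs_real.
have hs : `|s - t| * cabs h <= d.
  rewrite (@le_trans _ _ (`|s - t| * (cabs h + 1)))//; last by rewrite -ler_pdivlMr.
  by rewrite ler_wpM2l// lerDl.
move=> /(_ hs) hfs.
have -> : complex.Re (k * f (w + s%:C%C * h)) - complex.Re (k * f (w + t%:C%C * h))
    - complex.Re (k * m * h) * (s - t) =
  complex.Re (k * (f (w + s%:C%C * h) - f (w + t%:C%C * h) - m * ((s - t)%:C%C * h))).
  have -> : complex.Re (k * m * h) * (s - t) = complex.Re (k * m * h * (s - t)%:C%C).
    by case: (k * m * h) => ? ? /=; rewrite mulr0 subr0.
  by rewrite -!raddfB; congr (complex.Re _); ring.
rewrite (le_trans (Re_cabs _))// cabsM (le_trans (ler_wpM2l (cabs_ge0 k) hfs))//.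
have -> : cabs k * (e / K * (`|s - t| * cabs h)) = e * `|s - t| * (cabs k * cabs h / K).
  by ring.
rewrite ler_piMr ?mulr_ge0 ?(ltW e0)// ler_pdivrMr// mul1r /K; lra.
Qed.

(** Let T be P minus its quadratic expansion and u = T(z). The real mean value inequality is applied
    along the segment from w to z to Re (conj(u) T), which equals |u|^2 at z and 0 at w; the
    derivative is at most |u| e |z - w|^2 because g is differentiable at w. *)
Lemma taylor2 P g w l : (forall z, cder P z (g z)) -> cder g w l ->
  forall e, 0 < e -> exists2 d, 0 < d & forall z, cabs (z - w) <= d ->
    cabs (P z - P w - g w * (z - w) - l / 2 * (z - w) ^+ 2) <= e * cabs (z - w) ^+ 2.
Proof.
move=> hP hg e e0; have [d d0 hd] := hg e e0.
exists d => // z zd; set h := z - w; move: zd; rewrite -/h => hh.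
pose T t := P t - (P w - g w * w + l / 2 * w ^+ 2 + (g w - l * w) * t + l / 2 * (t * t)).
have TE t : T t = P t - P w - g w * (t - w) - l / 2 * (t - w) ^+ 2.
  by rewrite /T; field.
have dT t : cder T t (g t - g w - l * (t - w)).
  have dq : cder (fun t => P w - g w * w + l / 2 * w ^+ 2 + (g w - l * w) * t) t (g w - l * w).
    exact: cder_affine.
  have ds : cder (fun t => l / 2 * (t * t)) t (l / 2 * (1 * t + t * 1)).
    by apply: cderZ; apply: cderM; exact: cder_id.
  apply: cder_eq; first exact: (cderB (hP t) (cderD dq ds)).
  by field.
set u := P z - _ - _ - _; have uE : u = T z by rewrite TE.
have zE : w + 1%:C%C * h = z by rewrite mul1r /h addrC subrK.
have wE : w + 0%:C%C * h = w by rewrite mul0r addr0.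
have D (t : R) : is_derive t 1 (fun t : R => complex.Re (conjc u * T (w + t%:C%C * h)))
    (complex.Re (conjc u * (g (w + t%:C%C * h) - g w - l * (w + t%:C%C * h - w)) * h)).
  by apply: is_derive_line; exact: dT.
have := @mvt_bound R 0 1 _ _ (cabs u * e * cabs h ^+ 2) ler01 (fun t _ => D t).
rewrite zE wE.
have -> : T w = 0 by rewrite TE !subrr expr0n !mulr0 !subr0.
have R0 : complex.Re (0 : R[i]) = 0 by [].
rewrite mulr0 R0 !subr0 -uE.
have -> : complex.Re (conjc u * u) = cabs u ^+ 2.
  by rewrite cabs_sqr; case: (u) => a b /=; ring.
rewrite mulr1 (ger0_norm (sqr_ge0 _)) => H.
have [u0|u0] := eqVneq (cabs u) 0; first by rewrite u0 mulr_ge0 ?(ltW e0)// sqr_ge0.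
have u1 : 0 < cabs u by rewrite lt_neqAle eq_sym u0/=.
rewrite -(ler_pM2l u1) -expr2 mulrA; apply: H => t /andP[t0 t1].
have wt : w + t%:C%C * h - w = t%:C%C * h by rewrite addrC addKr.
have ch : cabs (t%:C%C * h) <= cabs h by rewrite cabsM cabs_real ger0_norm// ler_piMl.
have := hd (w + t%:C%C * h); rewrite wt => /(_ (le_trans ch hh)) hT.
have -> : cabs u * e * cabs h ^+ 2 = cabs u * (e * cabs h) * cabs h by ring.
apply: (le_trans (Re_cabs _)); rewrite [leLHS]cabsM ler_wpM2r// cabsM cabs_conj.
by rewrite ler_wpM2l// (le_trans hT)// ler_wpM2l// ltW.
Qed.

(** Difference quotients of order 1 and 2 with the singularity filled in: l is meant to be f'(w) in
    [quot] and P''(w) in [quot2], whence the value l / 2 there. *)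
Definition quot f w l z := if z == w then l else (f z - f w) / (z - w).
Definition quot2 P w (gw l : R[i]) z :=
  if z == w then l / 2 else (P z - P w - gw * (z - w)) / (z - w) ^+ 2.

Lemma cder_near f g z l : (exists2 d : R, 0 < d & forall w, cabs (w - z) <= d -> f w = g w) ->
  f z = g z -> cder f z l -> cder g z l.
Proof.
move=> [d d0 fg] fgz hf e e0; have [d1 d10 hd] := hf e e0.
exists (Num.min d d1); first by rewrite lt_min d0.
by move=> w; rewrite le_min => /andP[h1 h2]; rewrite -fg// -fgz; exact: hd.
Qed.

Lemma neq_near z w : z != w -> exists2 d : R, 0 < d & forall t, cabs (t - z) <= d -> t != w.
Proof.
move=> zw; have c0 : 0 < cabs (z - w) by rewrite cabs_gt0 subr_eq0.
exists (cabs (z - w) / 2); first by rewrite divr_gt0.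
move=> t td; apply/eqP => tw; move: td c0; rewrite tw (cabs_sub w z).
by clear tw; set q := cabs _ => h1 h2; lra.
Qed.

Lemma quot_cont f w l : cder f w l -> ccont (quot f w l) w.
Proof.
move=> hf e e0; have [d d0 hd] := hf e e0; exists d => // t td.
rewrite /quot eqxx; case: eqP => [_|/eqP tw]; first by rewrite subrr cabs0 ltW.
have tw0 : t - w != 0 by rewrite subr_eq0.
have -> : (f t - f w) / (t - w) - l = (f t - f w - l * (t - w)) / (t - w) by field.
by rewrite cabsM cabsV ler_pdivrMr ?cabs_gt0//; exact: hd.
Qed.

Lemma quot_der f w l z m : z != w -> cder f z m -> exists l', cder (quot f w l) z l'.
Proof.
move=> zw hf; have [d d0 hd] := neq_near zw.
have D := cderM (cderB hf (cder_cst (f w) z)) (cder_invB zw).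
eexists; apply: cder_near D; last by rewrite /quot (negbTE zw).
by exists d => // t /hd tw; rewrite /quot (negbTE tw).
Qed.

Lemma quot2_cont P g w l : (forall z, cder P z (g z)) -> cder g w l ->
  ccont (quot2 P w (g w) l) w.
Proof.
move=> hP hg e e0; have [d d0 hd] := taylor2 hP hg e0; exists d => // t td.
rewrite /quot2 eqxx; case: eqP => [_|/eqP tw]; first by rewrite subrr cabs0 ltW.
have tw0 : t - w != 0 by rewrite subr_eq0.
have -> : (P t - P w - g w * (t - w)) / (t - w) ^+ 2 - l / 2 =
  (P t - P w - g w * (t - w) - l / 2 * (t - w) ^+ 2) / (t - w) ^+ 2 by field.
by rewrite cabsM cabsV cabsX ler_pdivrMr ?exprn_gt0 ?cabs_gt0//; exact: hd.
Qed.

Lemma quot2_der P w (gw l : R[i]) z m : z != w -> cder P z m ->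
  exists l', cder (quot2 P w gw l) z l'.
Proof.
move=> zw hf; have [d d0 hd] := neq_near zw.
have D1 : cder (fun t => P t - (P w - gw * w + gw * t)) z (m - gw).
  exact: cderB hf (cder_affine _ _ _).
have D := cderM (cderM D1 (cder_invB zw)) (cder_invB zw).
have E t : (P t - (P w - gw * w + gw * t)) / (t - w) / (t - w) =
    (P t - P w - gw * (t - w)) / (t - w) ^+ 2.
  by rewrite -mulrA -invfM expr2; congr (_ / _); ring.
eexists; apply: cder_near D; last by rewrite /quot2 (negbTE zw).
by exists d => // t /hd tw; rewrite /quot2 (negbTE tw).
Qed.

Lemma ccontD f g z : ccont f z -> ccont g z -> ccont (fun t => f t + g t) z.
Proof.
move=> hf hg e e0; have e2 : 0 < e / 2 by rewrite divr_gt0.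
have [d d0 hd] := hf _ e2; have [d' d0' hd'] := hg _ e2.
exists (Num.min d d'); first by rewrite lt_min d0.
move=> w; rewrite le_min => /andP[/hd h1 /hd' h2].
have -> : f w + g w - (f z + g z) = (f w - f z) + (g w - g z) by ring.
by rewrite (le_trans (cabsD _ _))//; lra.
Qed.

Lemma ccontM f g z : ccont f z -> ccont g z -> ccont (fun t => f t * g t) z.
Proof.
move=> hf hg e e0; pose K := cabs (f z) + cabs (g z) + 2.
have K0 : 0 < K by rewrite /K ltr_wpDl// addr_ge0.
have e2 : 0 < Num.min 1 (e / K) by rewrite lt_min ltr01 divr_gt0.
have [d d0 hd] := hf _ e2; have [d' d0' hd'] := hg _ e2.
exists (Num.min d d'); first by rewrite lt_min d0.
move=> w; rewrite le_min => /andP[/hd + /hd' +]; move: e2.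
set q := Num.min _ _ => q0 h1 h2.
have q1 : q <= 1 by rewrite /q ge_min lexx.
have qK : q * K <= e by rewrite -ler_pdivlMr// /q ge_min lexx orbT.
have -> : f w * g w - f z * g z = (f w - f z) * g w + f z * (g w - g z) by ring.
have gw : cabs (g w) <= cabs (g z) + 1.
  rewrite -lerBlDl (le_trans (cabs_lip _ _))//; lra.
rewrite (le_trans (cabsD _ _))// !cabsM.
have a1 : cabs (f w - f z) * cabs (g w) <= q * (cabs (g z) + 1).
  by apply: ler_pM.
have a2 : cabs (f z) * cabs (g w - g z) <= cabs (f z) * q by rewrite ler_wpM2l.
by move: qK; rewrite /K; lra.
Qed.

End taylor.

Section complex_exponential.
Variable R : realType.
Implicit Types (z w : R[i]).

Definition cexp z : R[i] := let: Complex x y := z in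
  Complex (expR x * cos y) (expR x * sin y).

Lemma cexpD z w : cexp (z + w) = cexp z * cexp w.
Proof.
case: z w => a b [c d] /=; apply/eqP; rewrite eq_complex/= expRD cosD sinD.
by apply/andP; split; apply/eqP; ring.
Qed.

Lemma cabs_cexp z : cabs (cexp z) = expR (complex.Re z).
Proof.
case: z => x y; rewrite cabsE/= !exprMn -mulrDr cos2Dsin2 mulr1 sqrtr_sqr.
by rewrite ger0_norm// expR_ge0.
Qed.

Lemma cexp0 : cexp 0 = 1.
Proof. by apply/eqP; rewrite eq_complex/= expR0 cos0 sin0 mulr1 mulr0 !eqxx. Qed.

(** Real differentiability of [expR], [cos] and [sin] at 0 is enough: the addition formula carries
    the result to every other point. *)
Lemma cder_cexp0 : cder cexp 0 1.
Proof.
move=> e e0; pose E := expR 1 : R.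
have E1 : 1 <= E by rewrite -expR0 ler_expR.
have E0 : 0 < E by lra.
pose q := Num.min 1 (e / (4 * E)).
have q0 : 0 < q by rewrite lt_min ltr01 divr_gt0// mulr_gt0.
have [d1 d10 h1] := (derive_epsP _ _ _).1 (is_derive_expR (0 : R)) q q0.
have [d2 d20 h2] := (derive_epsP _ _ _).1 (is_derive_cos (0 : R)) q q0.
have [d3 d30 h3] := (derive_epsP _ _ _).1 (is_derive_sin (0 : R)) q q0.
pose d := Num.min (Num.min d1 d2) (Num.min d3 (Num.min 1 (e / 8))).
have d0 : 0 < d by rewrite !lt_min d10 d20 d30 ltr01 divr_gt0.
exists d => //; case=> x y.
rewrite subr0 mul1r cexp0 => hxy.
have [hx hy] : `|x| <= d /\ `|y| <= d.
  by split; apply: le_trans hxy; [exact: (Re_cabs (Complex x y))|exact: (Im_cabs (Complex x y))].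
move: (hx) (hy); rewrite !le_min => /andP[/andP[x1 x2] /and3P[x3 x4 x8]].
move=> /andP[/andP[y1 y2] /and3P[y3 y4 y8]].
have := h1 x; rewrite subr0 expR0 mul1r => /(_ x1) g1.
have := h2 y; rewrite subr0 cos0 sin0 oppr0 mul0r subr0 => /(_ y2) g2.
have := h3 y; rewrite subr0 sin0 cos0 mul1r subr0 => /(_ y3) g3.
have EX : expR x <= E by rewrite ler_expR; move: x4; rewrite ler_norml => /andP[].
have EX0 := expR_ge0 x.
set c := cabs (Complex x y) in hxy *.
have cx : `|x| <= c by exact: (Re_cabs (Complex x y)).
have cy : `|y| <= c by exact: (Im_cabs (Complex x y)).
have c0 : 0 <= c by exact: cabs_ge0.
rewrite (le_trans (cabs_ReIm _))//= subr0.
have q1 : q <= 1 by rewrite /q ge_min lexx.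
have qE : q * E <= e / 4.
  rewrite -ler_pdivlMr// -mulrA -invfM /q ge_min lexx orbT//.
have qe : q <= e / 4 by apply: le_trans qE; rewrite ler_peMr// ltW.
have qEc : q * E * c <= e / 4 * c by rewrite ler_wpM2r.
have r1 : `|expR x * cos y - 1 - x| <= e / 2 * c.
  have -> : expR x * cos y - 1 - x = (expR x - 1 - x) + expR x * (cos y - 1) by ring.
  rewrite (le_trans (ler_normD _ _))// normrM (ger0_norm EX0).
  have b1 : q * `|x| <= e / 4 * c by rewrite ler_pM// ltW.
  have b2 : expR x * `|cos y - 1| <= E * (q * c).
    by apply: ler_pM => //; rewrite (le_trans g2)// ler_wpM2l// ltW.
  by move: b2; rewrite mulrA [E * q]mulrC; clear - g1 b1 qEc; lra.
have r2 : `|expR x * sin y - y| <= e / 2 * c.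
  have -> : expR x * sin y - y = expR x * (sin y - y) + (expR x - 1) * y by ring.
  rewrite (le_trans (ler_normD _ _))// !normrM (ger0_norm EX0).
  have b2 : expR x * `|sin y - y| <= E * (q * c).
    by apply: ler_pM => //; rewrite (le_trans g3)// ler_wpM2l// ltW.
  have b3 : `|expR x - 1| * `|y| <= e / 4 * c.
    apply: ler_pM => //.
    rewrite -(subrK x (expR x - 1)) (le_trans (ler_normD _ _))//.
    have : q * `|x| <= 1 * `|x| by rewrite ler_wpM2r.
    by clear - g1 q1 x8; lra.
  by move: b2; rewrite mulrA [E * q]mulrC; clear - b3 qEc; lra.
by clear - r1 r2; lra.
Qed.

Lemma cder_cexp z : cder cexp z (cexp z).
Proof.
move=> e e0; have E0 : 0 < cabs (cexp z) by rewrite cabs_cexp expR_gt0.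
have [d d0 hd] := cder_cexp0 (divr_gt0 e0 E0).
exists d => // w wz; have := hd (w - z); rewrite subr0 cexp0 mul1r => /(_ wz) h.
have -> : cexp w - cexp z - cexp z * (w - z) = cexp z * (cexp (w - z) - 1 - (w - z)).
  by rewrite !mulrBr mulr1 -cexpD [z + _]addrC subrK.
by rewrite cabsM mulrC -ler_pdivlMr// mulrAC.
Qed.

Lemma cder_cexpZ (k : R[i]) z : cder (fun t => cexp (k * t)) z (k * cexp (k * z)).
Proof.
have h : cder (fun t => k * t) z k.
  by apply: cder_eq; [exact: (cderZ k (cder_id z))|rewrite mulr1].
by have := @cder_comp R cexp (fun t => k * t) z _ _ h (cder_cexp _); rewrite mulrC.
Qed.

End complex_exponential.

Section phragmen_lindelof.
Variable R : realType.
Implicit Types (z w : R[i]).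

Lemma polar (x y : R) : 0 < x -> 0 < y ->
  exists xi eta, [/\ 0 < eta, eta < pi / 2 & cexp (Complex xi eta) = Complex x y].
Proof.
move=> x0 y0; pose r := Num.sqrt (x ^+ 2 + y ^+ 2).
have s0 : 0 < x ^+ 2 + y ^+ 2 by rewrite addr_gt0// exprn_gt0.
have r0 : 0 < r by rewrite sqrtr_gt0.
have r2 : r ^+ 2 = x ^+ 2 + y ^+ 2 by rewrite sqr_sqrtr// ltW.
have xr : x <= r.
  by rewrite -(ler_pXn2r (n := 2)) ?nnegrE ?(ltW x0) ?(ltW r0)// r2 lerDl sqr_ge0.
have c1 : -1 <= x / r <= 1.
  by rewrite ler_pdivrMr// mul1r xr andbT (le_trans _ (divr_ge0 (ltW x0) (ltW r0))).
have c1' : x / r \in `[-1, 1] by rewrite in_itv/=.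
have cosE := acosK c1'.
have sinE : sin (acos (x / r)) = y / r.
  rewrite sin_acos// (_ : 1 - _ = (y / r) ^+ 2).
    by rewrite sqrtr_sqr ger0_norm// divr_ge0// ltW.
  by rewrite !expr_div_n r2; field; rewrite gt_eqF.
have a0 := acos_ge0 c1; have api := acos_lepi c1.
have p0 := pi_gt0 R.
exists (ln r), (acos (x / r)); split.
- rewrite lt_neqAle a0 andbT; apply/eqP => h.
  by move: sinE; rewrite -h sin0 => /esym/eqP; rewrite mulf_eq0 invr_eq0 !gt_eqF.
- rewrite -(@ltr_cos R) ?cosE ?cos_pihalf ?divr_gt0//; rewrite in_itv/= ?a0 ?api//.
  by apply/andP; split; lra.
- by rewrite /= cosE sinE lnK ?posrE//; congr Complex; field; rewrite gt_eqF.
Qed.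

(** By reflection about pi / 4 one may take eta >= pi / 4; then 3/2 (eta - pi / 4) lies in
    [0, 3 pi / 8], where cosine decreases. The bound is positive because the exponent 3/2 is below
    2. *)
Lemma cos_sector (eta : R) : 0 <= eta -> eta <= pi / 2 ->
  cos (3 / 8 * pi) <= cos (3 / 2 * (eta - pi / 4)).
Proof.
move=> e0 e1; have p0 := pi_gt0 R.
wlog h : eta e0 e1 / pi / 4 <= eta.
  move=> H; have [h|h] := leP (pi / 4) eta; first exact: H.
  have := H (pi / 2 - eta); rewrite -(cosN (3 / 2 * (eta - _))).
  have -> : 3 / 2 * (pi / 2 - eta - pi / 4) = - (3 / 2 * (eta - pi / 4)) by field.
  by apply; lra.
have [->//|ne] := eqVneq (3 / 2 * (eta - pi / 4)) (3 / 8 * pi).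
rewrite ltW// ltr_cos ?in_itv/=; [rewrite lt_neqAle ne/=|apply/andP; split|apply/andP; split]; lra.
Qed.

(** Writing z = exp(zeta) turns the quadrant into the strip 0 <= Im zeta <= pi / 2 and the power
    z^(3/2), rotated so as to be real on the diagonal, into an exponential, so no branch has to be
    chosen. The maximum principle is used on [- L, L] x [0, pi / 2]. The horizontal sides are the
    axes, the left side lies near the origin, where continuity gives a bound M' > M, and on the
    right side the factor exp(- e z^(3/2)) beats the growth of F. *)
Lemma phragmen_lindelof (F : R[i] -> R[i]) (A B M : R) : 0 < A -> 0 < B -> 0 < M ->
  (forall z, 0 <= complex.Re z -> 0 <= complex.Im z -> exists l, cder F z l) ->
  (forall z, 0 <= complex.Re z -> 0 <= complex.Im z ->
     cabs (F z) <= A * expR (B * cabs z)) ->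
  (forall x : R, 0 <= x -> cabs (F (Complex x 0)) <= M) ->
  (forall y : R, 0 <= y -> cabs (F (Complex 0 y)) <= M) ->
  forall z, 0 <= complex.Re z -> 0 <= complex.Im z -> cabs (F z) <= M.
Proof.
move=> A0 B0 M0 dF FAB FM1 FM2 [x0 y0] /= hx0 hy0.
have p0 := pi_gt0 R.
have [->|x0n] := eqVneq x0 0; first exact: FM2.
have [->|y0n] := eqVneq y0 0; first exact: FM1.
have x0' : 0 < x0 by rewrite lt_neqAle eq_sym x0n.
have y0' : 0 < y0 by rewrite lt_neqAle eq_sym y0n.
have [xi0 [eta0 [eta00 eta01 cE]]] := polar x0' y0'.
pose c0 := cos (3 / 8 * pi) : R.
have c00 : 0 < c0 by apply: cos_gt0_pihalf; apply/andP; split; lra.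
pose T := expR (3 / 2 * xi0) * cos (3 / 2 * (eta0 - pi / 4)).
(* the exponent 3/2 lies strictly between the order 1 of F and the critical
   order 2 of a quadrant *)
have key (e M' : R) : 0 < e -> M < M' ->
    cabs (F (Complex x0 y0)) * expR (- (e * T)) <= M'.
  move=> e0 MM'; have M'0 : 0 < M' by lra.
  pose G z := F (cexp z) *
    cexp ((- e)%:C%C * cexp (Complex 0 (- (3 / 8 * pi)) + (3 / 2)%:C%C * z)).
  have GE xi eta : cabs (G (Complex xi eta)) = cabs (F (cexp (Complex xi eta))) *
      expR (- (e * (expR (3 / 2 * xi) * cos (3 / 2 * (eta - pi / 4))))).
    rewrite /G cabsM cabs_cexp; congr (_ * expR _).
    rewrite /= add0r !mul0r !subr0 addr0 mulNr; congr (- (_ * (_ * cos _))).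
    by field.
  have [d d0 hd] : exists2 d : R, 0 < d & forall w, cabs w <= d ->
      0 <= complex.Re w -> 0 <= complex.Im w -> cabs (F w) <= M'.
    have [l hl] := dF 0 (lexx _) (lexx _).
    have MM : 0 < M' - M by lra.
    have [d d0 hd] := cder_cont hl MM; exists d => // w wd _ _.
    have := hd w; rewrite subr0 => /(_ wd).
    have := cabs_lip (F w) (F 0); have := FM1 0 (lexx _).
    have -> : Complex (0 : R) 0 = 0 by []. lra.
  (* X exceeds every threshold needed: 2 makes ln X positive, (B + 1) / (e c0) and A / M' serve the
     right side, 1 / d the left side, and exp |xi0| puts the given point inside the rectangle. *)
  pose X := 2 + (B + 1) / (e * c0) + A / M' + d^-1 + expR `|xi0|.
  have ec : 0 < e * c0 by rewrite mulr_gt0.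
  have t1 : 0 <= (B + 1) / (e * c0) by rewrite divr_ge0 ?(ltW ec)//; lra.
  have t2 : 0 <= A / M' by rewrite divr_ge0 ?ltW.
  have t3 : 0 <= d^-1 by rewrite invr_ge0 ltW.
  have t4 := expR_ge0 `|xi0|.
  have X2 : 2 <= X by rewrite /X; clear - t1 t2 t3 t4; lra.
  have X0 : 0 < X by clear - X2; lra.
  have XB : (B + 1) / (e * c0) <= X by rewrite /X; clear - t1 t2 t3 t4; lra.
  have XA : A / M' <= X by rewrite /X; clear - t1 t2 t3 t4; lra.
  have Xd : d^-1 <= X by rewrite /X; clear - t1 t2 t3 t4; lra.
  have Xx : expR `|xi0| <= X by rewrite /X; clear - t1 t2 t3 t4; lra.
  clearbody X.
  (* The factor 2 makes exp(L) and exp(3 L / 2) the integer powers X^2 and X^3. *)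
  pose L := 2 * ln X.
  have XE n : expR (ln X * n%:R) = X ^+ n by rewrite expRM_natr lnK.
  have E1 : expR L = X ^+ 2 by rewrite -XE /L mulrC.
  have E2 : expR (3 / 2 * L) = X ^+ 3 by rewrite -XE /L; congr expR; field.
  have lnX : `|xi0| <= ln X.
    by rewrite -(expRK `|xi0|) ler_ln ?posrE ?expR_gt0.
  have lnX0 : 0 < ln X by rewrite ln_gt0//; clear - X2; lra.
  have hxi : - L < xi0 < L.
    by move: lnX; rewrite ler_norml /L => /andP[b1 b2]; apply/andP; split; clear - b1 b2 lnX0; lra.
  have cc (xi eta : R) : 0 <= eta <= pi / 2 -> 0 <= complex.Re (cexp (Complex xi eta)) /\
      0 <= complex.Im (cexp (Complex xi eta)).
    move=> /andP[b1 b2] /=; split; apply: mulr_ge0; rewrite ?expR_ge0//.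
      by apply: cos_ge0_pihalf; apply/andP; split; clear - b1 b2; lra.
    by apply: sin_ge0_pi; apply/andP; split; clear - b1 b2; lra.
  have ex1 (xi eta : R) : 0 <= eta <= pi / 2 ->
      expR (- (e * (expR (3 / 2 * xi) * cos (3 / 2 * (eta - pi / 4))))) <= 1.
    move=> /andP[h1 h2]; rewrite -[leRHS]expR0 ler_expR oppr_le0 mulr_ge0 ?(ltW e0)//.
    by rewrite mulr_ge0 ?expR_ge0//; exact: (le_trans (ltW c00) (cos_sector h1 h2)).
  have -> : cabs (F (Complex x0 y0)) * expR (- (e * T)) = cabs (G (Complex xi0 eta0)).
    by rewrite GE cE.
  apply: (@max_modulus R G (- L) L 0 (pi / 2)) => //=; first by rewrite eta00.
    move=> z [/= hz1 hz2].
    have [g1 g2] : 0 <= complex.Re (cexp z) /\ 0 <= complex.Im (cexp z).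
      by case: z hz1 hz2 => xi eta _ h; exact: cc.
    have [l hl] := dF _ g1 g2.
    have D1 := cder_comp (cder_cexp z) hl.
    have D2 := cder_comp (cder_affine (Complex 0 (- (3 / 8 * pi))) (3 / 2)%:C%C z) (cder_cexp _).
    have D3 := cder_comp (cderZ (- e)%:C%C D2) (cder_cexp _).
    by eexists; exact: cderM D1 D3.
  case=> xi eta [/= hxi' heta]; rewrite GE.
  have h1 := ex1 xi eta heta; have [g1 g2] := cc xi eta heta.
  have gen : cabs (F (cexp (Complex xi eta))) <= M' ->
      cabs (F (cexp (Complex xi eta))) * expR (- (e * (expR (3 / 2 * xi) * cos (3 / 2 * (eta - pi / 4))))) <= M'.
    by move=> h; apply: le_trans h; rewrite ler_piMr.
  case=> /= hs.
  - apply: gen; apply: hd => //; rewrite cabs_cexp/= hs expRN E1.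
    rewrite -[d]invrK lef_pV2 ?posrE ?invr_gt0 ?exprn_gt0//.
    by rewrite (le_trans Xd)// expr2 ler_peMr//; clear - X2; lra.
  - have hF := FAB _ g1 g2; move: hF; rewrite cabs_cexp/= hs E1 => hF.
    have hc : c0 <= cos (3 / 2 * (eta - pi / 4)).
      by move: heta => /andP[? ?]; apply: cos_sector.
    have h2 : expR (- (e * (expR (3 / 2 * L) * cos (3 / 2 * (eta - pi / 4))))) <=
        expR (- (e * c0 * X ^+ 3)).
      rewrite ler_expR lerN2 E2 -mulrA ler_wpM2l ?(ltW e0)// mulrC ler_wpM2l//.
      by rewrite exprn_ge0// ltW.
    apply: (le_trans (ler_pM _ _ hF h2)); rewrite ?expR_ge0//.
    rewrite -(mulrA A) -expRD.
    have h3 : expR (B * X ^+ 2 - e * c0 * X ^+ 3) <= expR (- X ^+ 2).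
      rewrite ler_expR.
      have : (B + 1) <= e * c0 * X by rewrite mulrC -ler_pdivrMr.
      move=> /(ler_wpM2r (sqr_ge0 X)).
      have -> : e * c0 * X * X ^+ 2 = e * c0 * X ^+ 3 by ring.
      by clear; lra.
    rewrite (le_trans (ler_wpM2l (ltW A0) h3))// expRN ler_pdivrMr ?expR_gt0//.
    rewrite mulrC -ler_pdivrMr//.
    rewrite (le_trans XA)// (le_trans _ (expR_ge1Dx _))//.
    by rewrite expr2; have := ler_peMr (ltW X0) (le_trans (ler1n R 2) X2); clear; lra.
  - apply: gen; have -> : cexp (Complex xi eta) = Complex (expR xi) 0.
      by rewrite /= hs cos0 sin0 mulr1 mulr0.
    by rewrite (le_trans (FM1 _ (expR_ge0 _)))// ltW.
  - apply: gen; have -> : cexp (Complex xi eta) = Complex 0 (expR xi).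
      by rewrite /= hs cos_pihalf sin_pihalf mulr1 mulr0.
    by rewrite (le_trans (FM2 _ (expR_ge0 _)))// ltW.
(* Removal of the damping: if the modulus r exceeded M', the choice e = ln (r / M') / (2 T') would
   keep r exp(- e T) above M'. *)
have key2 (M' : R) : M < M' -> cabs (F (Complex x0 y0)) <= M'.
  move=> MM'; have M'0 : 0 < M' by lra.
  rewrite leNgt; apply/negP => h; set r := cabs _ in h key.
  pose T' := `|T| + 1; have T'0 : 0 < T' by rewrite /T' ltr_wpDl.
  have l0 : 0 < ln (r / M') by rewrite ln_gt0// ltr_pdivlMr// mul1r.
  have := key (ln (r / M') / (2 * T')) M'.
  rewrite divr_gt0 ?mulr_gt0// => /(_ isT MM').
  apply/negP; rewrite -ltNge.
  have rM : r * expR (- (ln (r / M') / 2)) > M'.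
    rewrite expRN -ltr_pdivrMr ?invr_gt0 ?expR_gt0// invrK mulrC -ltr_pdivlMr//.
    have {2}<- : expR (ln (r / M')) = r / M' by rewrite lnK// posrE divr_gt0//; lra.
    rewrite ltr_expR; lra.
  apply: (lt_le_trans rM); apply: ler_wpM2l; first exact: cabs_ge0.
  rewrite ler_expR lerN2.
  have -> : ln (r / M') / (2 * T') * T = ln (r / M') / 2 * (T / T') by field; rewrite gt_eqF.
  rewrite ger_pMr ?divr_gt0// ler_pdivrMr// mul1r /T'.
  have := ler_norm T; lra.
apply/ler_addgt0Pr => e e0; apply: key2; lra.
Qed.

End phragmen_lindelof.

Section derivative_bound.
Variable R : realType.
Implicit Types (z w : R[i]) (f g P : R[i] -> R[i]).

Lemma rrZ (q : R) f a b c d : a <= b -> c <= d -> bcont f a b c d ->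
  rr (fun z => q%:C%C * f z) a b c d = q * rr f a b c d.
Proof.
move=> ab cd /(bcont_itg ab cd)[f1 f2 f3 f4].
have ReE z : complex.Re (q%:C%C * z) = q * complex.Re z.
  by case: z => ? ?; rewrite /= mul0r subr0.
have ImE z : complex.Im (q%:C%C * z) = q * complex.Im z.
  by case: z => ? ?; rewrite /= mul0r addr0.
rewrite /rr.
have e1 := IZ q f1; have e2 := IZ q f2; have e3 := IZ q f3; have e4 := IZ q f4.
rewrite mulrDr !mulrBr -e1 -e2 -e3 -e4.
by congr (_ - _ - _ + _); apply: eqI => t _; rewrite ?ReE ?ImE.
Qed.

Lemma eq_rr f g a b c d : (forall z, side a b c d z -> f z = g z) ->
  rr f a b c d = rr g a b c d.
Proof.
move=> fg; rewrite /rr; congr (_ - _ - _ + _); apply: eqI => t _; rewrite fg//.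
- exact: Or43. - exact: Or44. - exact: Or42. - exact: Or41.
Qed.

(** The contour integral of (P(z) - P(w)) / (z - w)^2 isolates g(w). On the square of half side 1
    about w the bound of [winding] is 1/4, the perimeter is 8 and the numerator is at most 2 K,
    which gives 4 * 8 * 2 K. *)
Lemma derivative_bound P g w (K : R) : (forall z, cder P z (g z)) ->
  (forall z, exists l, cder g z l) ->
  (forall z, cabs (z - w) <= 2 -> cabs (P z) <= K) -> cabs (g w) <= 64 * K.
Proof.
move=> hP hg PK; have [l hl] := hg w.
have K0 : 0 <= K by rewrite (le_trans _ (PK w _))// subrr cabs0.
have [gw0|gw0] := eqVneq (g w) 0; first by rewrite gw0 cabs0 mulr_ge0.
pose u := complex.Re w; pose v := complex.Im w.
have aw : u - 1 < complex.Re w < u + 1 by rewrite /u; apply/andP; split; lra.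
have cw : v - 1 < complex.Im w < v + 1 by rewrite /v; apply/andP; split; lra.
have ab : u - 1 <= u + 1 by lra.
have cd : v - 1 <= v + 1 by lra.
pose k := - Complex 0 1 * conjc (g w).
have hF z : z != w -> exists m, cder (fun z => k * quot2 P w (g w) l z) z m.
  by move=> zw; have [m hm] := quot2_der (g w) l zw (hP z); exists (k * m); exact: cderZ.
have F0 : rr (fun z => k * quot2 P w (g w) l z) (u - 1) (u + 1) (v - 1) (v + 1) = 0.
  apply: (goursat_except (w := w)) => // [z _|z _ zw]; last exact: hF.
  have [->|zw] := eqVneq z w; last by have [m] := hF z zw; exact: cder_cont.
  apply: ccontM; first exact: cder_cont (cder_cst k w).
  exact: quot2_cont.
pose G z := k * ((P z - P w) * (z - w)^-1 * (z - w)^-1).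
pose H z := (cabs (g w) ^+ 2)%:C%C * (- Complex 0 1 / (z - w)).
have cB : bcont (fun z => - Complex 0 1 / (z - w)) (u - 1) (u + 1) (v - 1) (v + 1).
  move=> z _ sz; apply: cder_cont; apply: (cderZ (- Complex 0 1) (cder_invB _)).
  exact: side_neq sz.
have cG : bcont G (u - 1) (u + 1) (v - 1) (v + 1).
  move=> z rz sz; have zw := side_neq aw cw sz.
  apply: cder_cont; apply: cderZ; apply: cderM; last exact: cder_invB.
  by apply: cderM; [exact: (cderB (hP z) (cder_cst (P w) z))|exact: cder_invB].
have cH : bcont H (u - 1) (u + 1) (v - 1) (v + 1).
  by move=> z rz sz; apply: ccontM; [exact: cder_cont (cder_cst _ _)|exact: cB].
have FE : rr (fun z => k * quot2 P w (g w) l z) (u - 1) (u + 1) (v - 1) (v + 1)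
    = rr (fun z => G z - H z) (u - 1) (u + 1) (v - 1) (v + 1).
  apply: eq_rr => z sz; have zw := side_neq aw cw sz.
  rewrite /quot2 (negbTE zw) /G /H.
  have zw0 : z - w != 0 by rewrite subr_eq0.
  have kE : k * g w = (cabs (g w) ^+ 2)%:C%C * - Complex 0 1.
    rewrite /k rmorphXn/= -norm_cabs sqr_normc; ring.
  have -> : (cabs (g w) ^+ 2)%:C%C * (- Complex 0 1 / (z - w)) = k * g w / (z - w).
    by rewrite kE [in LHS]mulrA.
  by field; exact: zw0.
have := F0; rewrite FE rrB// => /eqP; rewrite subr_eq0 => /eqP GH.
have W := winding aw cw.
have cg : 0 < cabs (g w) by rewrite cabs_gt0.
have Gb : `|rr G (u - 1) (u + 1) (v - 1) (v + 1)| <= cabs (g w) * (2 * K) * (2 * ((u + 1 - (u - 1)) + (v + 1 - (v - 1)))).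
  apply: rr_bound => // z [/andP[z1 z2] /andP[z3 z4]] sz.
  have zs : 1 <= cabs (z - w).
    by apply: (@cabs_ge_side R (u - 1) (u + 1) (v - 1) (v + 1)) => //; rewrite /u /v; clear; lra.
  rewrite /G (cabsM k) cabsM cabsM cabsV.
  have -> : cabs k = cabs (g w) by rewrite /k cabsM cabsN cabs_im normr1 mul1r cabs_conj.
  rewrite ler_wpM2l// -mulrA.
  have i0 : 0 <= (cabs (z - w))^-1 by rewrite invr_ge0.
  have i1 : (cabs (z - w))^-1 <= 1 by rewrite invf_le1//; lra.
  have i2 : (cabs (z - w))^-1 / cabs (z - w) <= 1 by rewrite mulr_ile1.
  have p1 : cabs (P z - P w) <= 2 * K.
    rewrite (le_trans (cabsB _ _))//.
    have := PK w; rewrite subrr cabs0 => /(_ (ler0n _ 2)) h1.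
    have := PK z; have zw2 : cabs (z - w) <= 2.
      rewrite (le_trans (cabs_ReIm _))// !raddfB/= -/u -/v.
      have : `|complex.Re z - u| <= 1 by rewrite ler_norml; apply/andP; split; clear - z1 z2; lra.
      have : `|complex.Im z - v| <= 1 by rewrite ler_norml; apply/andP; split; clear - z3 z4; lra.
      clear; lra.
    by move=> /(_ zw2); lra.
  rewrite (le_trans (ler_wpM2l (cabs_ge0 _) i2))// mulr1//.
move: W GH Gb; rewrite rrZ//.
have -> : (u + 1 - (u - 1)) * ((complex.Im w - (v - 1)) / ((u + 1 - (u - 1)) ^+ 2 + (v + 1 - (v - 1)) ^+ 2)) = 1 / 4.
  by rewrite /v; field; apply/eqP => h; move: h; lra.
set W := rr (fun z => _ / _) _ _ _ _ => W1 GH Gb.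
have h1 : cabs (g w) ^+ 2 * (1 / 4) <= cabs (g w) * (2 * K) * (2 * ((u + 1 - (u - 1)) + (v + 1 - (v - 1)))).
  apply: le_trans Gb; apply: (le_trans _ (ler_norm _)); rewrite GH.
  by rewrite ler_wpM2l ?sqr_ge0.
rewrite -(ler_pM2l cg) -expr2; move: h1.
have -> : 2 * (u + 1 - (u - 1) + (v + 1 - (v - 1))) = 8 by ring.
lra.
Qed.

End derivative_bound.

(** * Primitives of entire functions *)

Section primitive.
Variable R : realType.
Implicit Types (z w : R[i]) (f g : R[i] -> R[i]) (u : R -> R).

(** The primitive vanishing at 0. With the oriented integral [SI], paths and rectangles need no
    convention on the order of their endpoints. *)
Definition PI (u : R -> R) (x : R) : R := if 0 <= x then I 0 x u else - I x 0 u.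
Definition SI (a b : R) (u : R -> R) : R := PI u b - PI u a.

Lemma SI_I a b u : (forall x : R, {for x, continuous u}) -> a <= b -> SI a b u = I a b u.
Proof.
move=> cu ab; have iu x y : itg x y u by apply: itg_cont => ? _; exact: cu.
rewrite /SI /PI; case: (leP 0 a) => ha; case: (leP 0 b) => hb.
- by rewrite (chasles ha ab)//; ring.
- lra.
- by rewrite (chasles (ltW ha) hb)//; ring.
- by rewrite (chasles ab (ltW hb))//; ring.
Qed.

Lemma SI_sym a b u : SI b a u = - SI a b u.
Proof. by rewrite /SI; ring. Qed.

Lemma SI_bound a b u k e : (forall x : R, {for x, continuous u}) ->
  (forall t, `|t - a| <= `|b - a| -> `|u t - k| <= e) ->
  `|SI a b u - k * (b - a)| <= e * `|b - a|.
Proof.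
move=> cu hu; have iu x y : itg x y u by apply: itg_cont => ? _; exact: cu.
have [ab|ba] := leP a b.
  rewrite (SI_I cu ab) -Icst// -IB//; last exact: itg_cst.
  rewrite (ger0_norm (_ : 0 <= b - a)) ?subr_ge0//; apply: I_bound => //.
    by apply: itgB => //; exact: itg_cst.
  by move=> t /andP[? ?]; apply: hu; rewrite !ger0_norm; lra.
rewrite SI_sym (SI_I cu (ltW ba)).
have -> : - I b a u - k * (b - a) = - (I b a u - k * (a - b)) by ring.
rewrite normrN -(Icst k (ltW ba)) -IB//; last exact: itg_cst.
rewrite [`|b - a|]distrC (ger0_norm (_ : 0 <= a - b)); last lra.
apply: I_bound; first exact: ltW.
  by apply: itgB => //; exact: itg_cst.
move=> t /andP[? ?]; apply: hu; rewrite distrC [`|b - a|]distrC !ger0_norm; lra.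
Qed.

Definition prim g z : R[i] := let: Complex x y := z in
  Complex (SI 0 x (fun t => complex.Re (g (Complex t 0)))
           - SI 0 y (fun s => complex.Im (g (Complex x s))))
          (SI 0 x (fun t => complex.Im (g (Complex t 0)))
           + SI 0 y (fun s => complex.Re (g (Complex x s)))).

Variables (g : R[i] -> R[i]).
Hypothesis hg : forall z, exists l, cder g z l.

Let cg z : ccont g z. Proof. by have [l] := hg z; exact: cder_cont. Qed.
Let cReh y (x : R) : {for x, continuous (fun t => complex.Re (g (Complex t y)))}.
Proof. exact: ccontH_Re. Qed.
Let cImh y (x : R) : {for x, continuous (fun t => complex.Im (g (Complex t y)))}.
Proof. exact: ccontH_Im. Qed.
Let cRev x (y : R) : {for y, continuous (fun s => complex.Re (g (Complex x s)))}.
Proof. exact: ccontV_Re. Qed.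
Let cImv x (y : R) : {for y, continuous (fun s => complex.Im (g (Complex x s)))}.
Proof. exact: ccontV_Im. Qed.

Let goursatS_Re a b c d :
  SI a b (fun x => complex.Re (g (Complex x c)))
  - SI a b (fun x => complex.Re (g (Complex x d)))
  - SI c d (fun y => complex.Im (g (Complex b y)))
  + SI c d (fun y => complex.Im (g (Complex a y))) = 0.
Proof.
wlog ab : a b / a <= b.
  move=> H; have [ab|ba] := leP a b; first exact: H.
  have := H b a (ltW ba); rewrite ![SI b a _]SI_sym; lra.
wlog cd : c d / c <= d.
  move=> H; have [cd|dc] := leP c d; first exact: H.
  have := H d c (ltW dc); rewrite ![SI d c _]SI_sym; lra.
rewrite !SI_I//; exact: (goursat ab cd (fun z _ => hg z)).
Qed.

Let goursatS_Im a b c d :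
  SI a b (fun x => complex.Im (g (Complex x c)))
  - SI a b (fun x => complex.Im (g (Complex x d)))
  + SI c d (fun y => complex.Re (g (Complex b y)))
  - SI c d (fun y => complex.Re (g (Complex a y))) = 0.
Proof.
wlog ab : a b / a <= b.
  move=> H; have [ab|ba] := leP a b; first exact: H.
  have := H b a (ltW ba); rewrite ![SI b a _]SI_sym; lra.
wlog cd : c d / c <= d.
  move=> H; have [cd|dc] := leP c d; first exact: H.
  have := H d c (ltW dc); rewrite ![SI d c _]SI_sym; lra.
rewrite !SI_I//.
have hig z : exists l, cder (fun z => - Complex 0 1 * g z) z l.
  by have [l hl] := hg z; exists (- Complex 0 1 * l); exact: cderZ.
have := goursat ab cd (fun z _ => hig z); rewrite /rr.
have ReE z : complex.Re (- Complex 0 1 * z) = complex.Im z.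
  by case: z => p q /=; ring.
have ImE z : complex.Im (- Complex 0 1 * z) = - complex.Re z.
  by case: z => p q /=; ring.
have E1 y : I a b (fun x => complex.Re (- Complex 0 1 * g (Complex x y))) =
   I a b (fun x => complex.Im (g (Complex x y))) by apply: eqI => x _; exact: ReE.
have E2 x : I c d (fun y => complex.Im (- Complex 0 1 * g (Complex x y))) =
   - I c d (fun y => complex.Re (g (Complex x y))).
  rewrite -IN; first by apply: eqI => y _; exact: ImE.
  by apply: itg_cont => y _; exact: cRev.
by rewrite !E1 !E2; lra.
Qed.

(** Goursat's theorem on [x, x'] x [0, y] moves the horizontal step from the real axis up to height
    y. The increment of [prim] is then an integral along a short path with one corner, on which g is
    close to g(z). *)
Lemma cder_prim z : cder (prim g) z (g z).
Proof.
case: z => x y e e0; have e4 : 0 < e / 4 by rewrite divr_gt0.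
have [d d0 hd] := cg (Complex x y) e4.
exists (d / 2); first by rewrite divr_gt0.
case=> x' y' hw; set c := cabs _ in hw *.
have hx : `|x' - x| <= c by exact: (Re_cabs (Complex x' y' - Complex x y)).
have hy : `|y' - y| <= c by exact: (Im_cabs (Complex x' y' - Complex x y)).
have E1 : complex.Re (prim g (Complex x' y') - prim g (Complex x y) - g (Complex x y) * (Complex x' y' - Complex x y))
  = (SI x x' (fun t => complex.Re (g (Complex t y))) - complex.Re (g (Complex x y)) * (x' - x))
   - (SI y y' (fun s => complex.Im (g (Complex x' s))) - complex.Im (g (Complex x y)) * (y' - y)).
  have := goursatS_Re x x' 0 y; case: (g (Complex x y)) => p q.
  by rewrite /= /SI; do ! [move: (PI _ _) => ?]; lra.
have E2 : complex.Im (prim g (Complex x' y') - prim g (Complex x y) - g (Complex x y) * (Complex x' y' - Complex x y))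
  = (SI x x' (fun t => complex.Im (g (Complex t y))) - complex.Im (g (Complex x y)) * (x' - x))
   + (SI y y' (fun s => complex.Re (g (Complex x' s))) - complex.Re (g (Complex x y)) * (y' - y)).
  have := goursatS_Im x x' 0 y; case: (g (Complex x y)) => p q.
  by rewrite /= /SI; do ! [move: (PI _ _) => ?]; lra.
have nH t : `|t - x| <= `|x' - x| -> cabs (g (Complex t y) - g (Complex x y)) <= e / 4.
  move=> ht; apply: hd; rewrite (le_trans (cabs_ReIm _))//= subrr normr0; lra.
have nV s : `|s - y| <= `|y' - y| -> cabs (g (Complex x' s) - g (Complex x y)) <= e / 4.
  move=> ht; apply: hd; rewrite (le_trans (cabs_ReIm _))//=; lra.
have ReB a b : `|complex.Re a - complex.Re b| <= cabs (a - b :> R[i]).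
  by rewrite -raddfB; exact: Re_cabs.
have ImB a b : `|complex.Im a - complex.Im b| <= cabs (a - b :> R[i]).
  by rewrite -raddfB; exact: Im_cabs.
have b1 := @SI_bound x x' _ (complex.Re (g (Complex x y))) (e / 4) (@cReh y) (fun t ht => le_trans (ReB _ _) (nH t ht)).
have b2 := @SI_bound x x' _ (complex.Im (g (Complex x y))) (e / 4) (@cImh y) (fun t ht => le_trans (ImB _ _) (nH t ht)).
have b3 := @SI_bound y y' _ (complex.Re (g (Complex x y))) (e / 4) (@cRev x') (fun t ht => le_trans (ReB _ _) (nV t ht)).
have b4 := @SI_bound y y' _ (complex.Im (g (Complex x y))) (e / 4) (@cImv x') (fun t ht => le_trans (ImB _ _) (nV t ht)).
rewrite (le_trans (cabs_ReIm _))// E1 E2.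
have := ler_wpM2l (ltW e4) hx; have := ler_wpM2l (ltW e4) hy.
move: b1 b2 b3 b4; rewrite !ler_norml.
set s1 := SI _ _ _ - _; set s2 := SI _ _ _ - _; set s3 := SI _ _ _ - _; set s4 := SI _ _ _ - _.
move=> /andP[a1 a2] /andP[a3 a4] /andP[a5 a6] /andP[a7 a8] hxx hyy.
clearbody s1 s2 s3 s4 c; clear - a1 a2 a3 a4 a5 a6 a7 a8 hxx hyy.
have h1 : `|s1 - s2| <= e / 2 * c by rewrite ler_norml; apply/andP; split; lra.
have h2 : `|s3 + s4| <= e / 2 * c by rewrite ler_norml; apply/andP; split; lra.
lra.
Qed.

Lemma prim_bound (x y K : R) :
  (forall t : R, `|t| <= `|x| -> cabs (g (Complex t 0)) <= K) ->
  (forall s : R, `|s| <= `|y| -> cabs (g (Complex x s)) <= K) ->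
  cabs (prim g (Complex x y)) <= 2 * (`|x| + `|y|) * K.
Proof.
move=> h1 h2.
have SIb (p : R) u : (forall x : R, {for x, continuous u}) -> (forall t, `|t| <= `|p| -> `|u t| <= K) ->
    `|SI 0 p u| <= K * `|p|.
  move=> cu hu; have := @SI_bound 0 p u 0 K cu.
  by rewrite mul0r !subr0; apply => t; rewrite !subr0; exact: hu.
rewrite (le_trans (cabs_ReIm _))//=.
have b1 := SIb x _ (@cReh 0) (fun t ht => le_trans (Re_cabs _) (h1 t ht)).
have b2 := SIb x _ (@cImh 0) (fun t ht => le_trans (Im_cabs _) (h1 t ht)).
have b3 := SIb y _ (@cRev x) (fun t ht => le_trans (Re_cabs _) (h2 t ht)).
have b4 := SIb y _ (@cImv x) (fun t ht => le_trans (Im_cabs _) (h2 t ht)).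
have := ler_normB (SI 0 x (fun t => complex.Re (g (Complex t 0)))) (SI 0 y (fun s => complex.Im (g (Complex x s)))).
have := ler_normD (SI 0 x (fun t => complex.Im (g (Complex t 0)))) (SI 0 y (fun s => complex.Re (g (Complex x s)))).
lra.
Qed.

End primitive.

(** * Growth of entire functions that are square integrable on the real axis *)

Section growth.
Variable R : realType.
Implicit Types (z w : R[i]).

(** Division by z + 1 + i, of modulus at least 1 + x and 1 + y on the quadrant, absorbs the linear
    growth allowed on the axes; |z + 1 + i| <= |z| + 2 gives it back at the end. The rotation u
    brings any quadrant to the first one, and exp(k z) carries the exponential weight. *)
Lemma quadrant_growth (P : R[i] -> R[i]) (u k : R[i]) (A B M : R) :
  0 < A -> 0 < B -> 0 < M -> cabs u = 1 ->
  (forall z, exists l, cder P z l) ->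
  (forall z, cabs (P z) <= A * expR (B * cabs z)) ->
  (forall x : R, 0 <= x -> cabs (P (u * Complex x 0)) * expR (complex.Re (k * Complex x 0)) <= M * (x + 1)) ->
  (forall y : R, 0 <= y -> cabs (P (u * Complex 0 y)) * expR (complex.Re (k * Complex 0 y)) <= M * (y + 1)) ->
  forall z, 0 <= complex.Re z -> 0 <= complex.Im z ->
    cabs (P (u * z)) * expR (complex.Re (k * z)) <= M * (cabs z + 2).
Proof.
move=> A0 B0 M0 u1 dP PAB h1 h2 z z1 z2.
pose F z := P (u * z) * cexp (k * z) * (z - Complex (-1) (-1))^-1.
have den (x y : R) : 0 <= x -> 0 <= y -> [/\ x + 1 <= cabs (Complex x y - Complex (-1) (-1)),
    y + 1 <= cabs (Complex x y - Complex (-1) (-1)) &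
    1 <= cabs (Complex x y - Complex (-1) (-1))].
  move=> x0 y0; have := Re_cabs (Complex x y - Complex (-1) (-1)).
  have := Im_cabs (Complex x y - Complex (-1) (-1)); rewrite /= !opprK.
  rewrite !ger0_norm ?addr_ge0// => ? ?; split => //; lra.
have FE t : cabs (F t) = cabs (P (u * t)) * expR (complex.Re (k * t)) / cabs (t - Complex (-1) (-1)).
  by rewrite /F !cabsM cabsV cabs_cexp.
have K0 : 0 < B + cabs k by rewrite ltr_wpDr.
have := @phragmen_lindelof R F A (B + cabs k) M A0 K0 M0.
have key : cabs (F z) <= M -> cabs (P (u * z)) * expR (complex.Re (k * z)) <= M * (cabs z + 2).
  rewrite FE; case: z z1 z2 => x y /= x0 y0; have [_ _ d1] := den x y x0 y0.
  rewrite ler_pdivrMr; last lra.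
  move/le_trans; apply; rewrite ler_wpM2l ?(ltW M0)//.
  rewrite (le_trans (cabsB _ _))// lerD2l (le_trans (cabs_ReIm _))//= !normrN normr1; lra.
move=> H; apply: key; apply: H => //.
- move=> t t1 t2.
  have tn : t != Complex (-1) (-1).
    by apply: contraPneq t1 => -> /=; rewrite oppr_ge0 ler10.
  have [l hl] := dP (u * t).
  have hu : cder (fun z => u * z) t u by apply: cder_eq; [exact: (cderZ u (cder_id t))|rewrite mulr1].
  eexists; apply: cderM; last exact: cder_invB tn.
  by apply: cderM; [exact: (cder_comp hu hl)|exact: cder_cexpZ].
- case=> x y /= x0 y0; rewrite FE; have [_ _ d1] := den x y x0 y0.
  rewrite ler_pdivrMr; last lra.
  rewrite -[X in X <= _]mulr1; apply: ler_pM => //; first by rewrite mulr_ge0 ?expR_ge0.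
  rewrite mulrDl expRD mulrA; apply: ler_pM; rewrite ?expR_ge0//.
    by rewrite (le_trans (PAB _))// cabsM u1 mul1r.
  by rewrite ler_expR -cabsM (le_trans (ler_norm _))// Re_cabs.
- move=> x x0; rewrite FE; have [d1 _ _] := den x 0 x0 (lexx _).
  rewrite ler_pdivrMr; last lra.
  by rewrite (le_trans (h1 x x0))// ler_wpM2l// ltW.
- move=> y y0; rewrite FE; have [_ d1 _] := den 0 y (lexx _) y0.
  rewrite ler_pdivrMr; last lra.
  by rewrite (le_trans (h2 y y0))// ler_wpM2l// ltW.
Qed.

Variables (g : R[i] -> R[i]) (A B C b : R).
Hypotheses (A0 : 0 < A) (B0 : 0 < B) (C0 : 0 < C) (b0 : 0 < b).
Hypothesis hg : forall z, exists l, cder g z l.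
Hypothesis gexp : forall z, cabs (g z) <= A * expR (B * cabs z).
Hypothesis gimag : forall y : R, cabs (g (Complex 0 y)) <= C * expR (b * `|y|).
Hypothesis greal : forall x : R, complex.Im (g (Complex x 0)) = 0.
Hypothesis gL2 : forall X : R, 0 <= X -> I (- X) X (fun x => complex.Re (g (Complex x 0)) ^+ 2) <= 1.

Let cu (x : R) : {for x, continuous (fun t => complex.Re (g (Complex t 0)))}.
Proof. by apply: ccontH_Re; have [l] := hg (Complex x 0); exact: cder_cont. Qed.

(** Pointwise |u| <= 1 + u^2, and the integral of u^2 over an interval inside [- |x|, |x|] is at
    most 1. *)
Let SI_real x : `|SI 0 x (fun t => complex.Re (g (Complex t 0)))| <= `|x| + 1.
Proof.
set u := fun t => _.
have cu2 y : {for y, continuous (fun t => u t ^+ 2)}.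
  by apply: continuousM; exact: cu.
have iu p q : itg p q u by apply: itg_cont => ? _; exact: cu.
have iu2 p q : itg p q (fun t => u t ^+ 2) by apply: itg_cont => ? _; exact: cu2.
have key p q : p <= q -> - `|x| <= p -> q <= `|x| -> q - p = `|x| -> `|I p q u| <= `|x| + 1.
  move=> pq px qx qp; rewrite (le_trans (Iabs (iu p q)))//.
  apply: (@le_trans _ _ (I p q (fun t => 1 + u t ^+ 2))).
    apply: leI; first exact: itg_abs.
      by apply: itgD => //; exact: itg_cst.
    move=> t _; rewrite -normr_id -(real_normK (num_real (u t))) normr_id.
    have := sqr_ge0 (`|u t| - 1); have := normr_ge0 (u t); rewrite sqrrB1; lra.
  rewrite ID//; last exact: itg_cst.
  rewrite Icst// mul1r qp lerD2l (le_trans _ (gL2 (normr_ge0 x)))//.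
  have xp : - `|x| <= q by lra.
  rewrite (chasles xp qx (iu2 _ _)) (chasles px pq (iu2 _ _)).
  rewrite -[X in X <= _]add0r -[X in _ <= X]addrA; apply: lerD; first by apply: I_ge0 => t _; exact: sqr_ge0.
  by rewrite lerDl; apply: I_ge0 => t _; exact: sqr_ge0.
have [x0|x0] := leP 0 x.
  by rewrite (SI_I cu x0); apply: key; rewrite // ger0_norm//; lra.
rewrite SI_sym normrN (SI_I cu (ltW x0)); apply: key; rewrite ?(ltr0_norm x0)//; lra.
Qed.

Let prim_real x : cabs (prim g (Complex x 0)) <= `|x| + 1.
Proof.
have -> : prim g (Complex x 0) = (SI 0 x (fun t => complex.Re (g (Complex t 0))))%:C%C.
  rewrite /prim; congr Complex; first by rewrite {2}/SI subrr subr0.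
  rewrite {2}/SI subrr addr0 /SI /PI.
  have -> : (fun t : R => complex.Im (g (Complex t 0))) = (fun=> 0).
    by apply/funext => t; exact: greal.
  have I00 (p q : R) : I p q (fun=> 0) = 0 by rewrite /I Rintegral_cst// mul0r.
  by rewrite !I00 !oppr0 !if_same subrr.
by rewrite cabs_real SI_real.
Qed.

Let prim_imag y : cabs (prim g (Complex 0 y)) <= 2 * C * expR ((b + 1) * `|y|).
Proof.
have h : cabs (prim g (Complex 0 y)) <= 2 * (`|0 : R| + `|y|) * (C * expR (b * `|y|)).
  apply: (prim_bound hg) => //.
    move=> t; rewrite normr0 normr_le0 => /eqP ->.
    rewrite (le_trans (gimag 0))// normr0 mulr0 ler_wpM2l ?(ltW C0)// ler_expR.
    by rewrite mulr_ge0// ltW.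
  move=> s hs; rewrite (le_trans (gimag s))// ler_wpM2l ?(ltW C0)// ler_expR.
  by rewrite ler_wpM2l// ltW.
rewrite (le_trans h)// normr0 add0r [(b + 1) * _]mulrDl mul1r expRD.
have hy : `|y| <= expR `|y| by rewrite (le_trans _ (expR_ge1Dx _))// lerDr.
have -> : 2 * `|y| * (C * expR (b * `|y|)) = 2 * C * expR (b * `|y|) * `|y| by ring.
rewrite mulrA ler_wpM2l// mulr_ge0 ?expR_ge0// mulr_ge0// ltW//.
Qed.

Let prim_exp z : cabs (prim g z) <= 4 * A * expR ((B + 1) * cabs z).
Proof.
case: z => x y; pose c := cabs (Complex x y); rewrite -/c.
have cx : `|x| <= c by exact: (Re_cabs (Complex x y)).
have cy : `|y| <= c by exact: (Im_cabs (Complex x y)).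
have c0 : 0 <= c by exact: cabs_ge0.
have h : cabs (prim g (Complex x y)) <= 2 * (`|x| + `|y|) * (A * expR (B * c)).
  have mono w : cabs w <= c -> cabs (g w) <= A * expR (B * c).
    by move=> wc; rewrite (le_trans (gexp w))// ler_wpM2l ?(ltW A0)// ler_expR ler_wpM2l// ltW.
  apply: (prim_bound hg) => // t ht; apply: mono.
    by rewrite cabs_real (le_trans ht).
  rewrite /c -(ler_pXn2r (n := 2)) ?nnegrE ?cabs_ge0// !cabs_sqr/= lerD2l.
  by rewrite -(real_normK (num_real t)) -(real_normK (num_real y)) lerXn2r ?nnegrE.
rewrite (le_trans h)// [(B + 1) * _]mulrDl mul1r expRD.
have hc : c <= expR c by rewrite (le_trans _ (expR_ge1Dx _))// lerDr.
apply: (@le_trans _ _ (4 * c * (A * expR (B * c)))).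
  by rewrite ler_wpM2r ?(mulr_ge0 (ltW A0) (expR_ge0 _))//; lra.
have -> : 4 * c * (A * expR (B * c)) = 4 * A * expR (B * c) * c by ring.
by rewrite mulrA ler_wpM2l// mulr_ge0 ?expR_ge0// mulr_ge0// ltW.
Qed.

Let M := 2 * C + 2.
Let M0 : 0 < M. Proof. by rewrite /M; have := C0; lra. Qed.

(** In each quadrant k is chosen with Re (k z') = - (b + 1) |Im z|, where z = u z'. The exponent is
    b + 1 because integration along the imaginary axis produces a factor |y| <= exp |y|. *)
Lemma prim_growth z : cabs (prim g z) <=
  M * (cabs z + 2) * expR ((b + 1) * `|complex.Im z|).
Proof.
have dP w : exists l, cder (prim g) w l by exists (g w); exact: cder_prim.
have a0 := A0; have bb0 := B0; have c0 := C0; have bbb0 := b0.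
have A40 : 0 < 4 * A by lra.
have B10 : 0 < B + 1 by lra.
have b1 : 0 < b + 1 by lra.
have axr (x : R) : 0 <= x -> forall q : R, `|q| = x -> forall r : R, r <= 0 ->
    cabs (prim g (Complex q 0)) * expR r <= M * (x + 1).
  move=> x0 q qx r r0; apply: (@le_trans _ _ ((x + 1) * 1)).
    apply: ler_pM; rewrite ?expR_ge0//; first by rewrite -qx.
    by rewrite -[leRHS]expR0 ler_expR.
  by rewrite mulr1 ler_peMl// /M; lra.
have axi (x : R) : 0 <= x -> forall q : R, `|q| = x -> forall r : R, r = - ((b + 1) * x) ->
    cabs (prim g (Complex 0 q)) * expR r <= M * (x + 1).
  move=> x0 q qx r ->.
  apply: (@le_trans _ _ (2 * C)).
    by rewrite expRN ler_pdivrMr ?expR_gt0// -qx.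
  rewrite /M; have : 0 <= (2 * C + 2) * x by rewrite mulr_ge0//; lra.
  lra.
have fin (u k z' : R[i]) : cabs u = 1 -> u * z' = z -> complex.Re (k * z') = - ((b + 1) * `|complex.Im z|) ->
    cabs (prim g (u * z')) * expR (complex.Re (k * z')) <= M * (cabs z' + 2) ->
    cabs (prim g z) <= M * (cabs z + 2) * expR ((b + 1) * `|complex.Im z|).
  move=> u1 uz kz; rewrite uz kz expRN ler_pdivrMr ?expR_gt0//.
  by rewrite -uz cabsM u1 mul1r.
have im1 : cabs (Complex 0 1 : R[i]) = 1 by rewrite cabs_im normr1.
case: z fin => p q fin.
have [p0|p0] := leP 0 p; have [q0|q0] := leP 0 q.
- apply: (fin 1 (Complex 0 (b + 1)) (Complex p q)); rewrite ?cabs1 ?mul1r//.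
    by rewrite /= (ger0_norm q0); ring.
  have := @quadrant_growth (prim g) 1 (Complex 0 (b + 1)) _ _ _ A40 B10 M0 (cabs1 R) dP prim_exp.
  move=> /(_ _ _ (Complex p q)); rewrite mul1r; apply => // x x0; rewrite mul1r.
    by apply: axr; rewrite ?ger0_norm//=; lra.
  by apply: axi; rewrite ?ger0_norm//=; ring.
- apply: (fin (- Complex 0 1) (- (b + 1))%:C%C (Complex (- q) p)).
  + by rewrite cabsN.
  + by apply/eqP; rewrite eq_complex/=; apply/andP; split; apply/eqP; ring.
  + by rewrite /= (ltr0_norm q0); ring.
  apply: (@quadrant_growth (prim g) (- Complex 0 1) (- (b + 1))%:C%C _ _ _ A40 B10 M0) => //.
  + by rewrite cabsN.
  + move=> x x0.
    have -> : - Complex 0 1 * Complex x 0 = Complex 0 (- x) :> R[i].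
      by apply/eqP; rewrite eq_complex/=; apply/andP; split; apply/eqP; ring.
    by apply: axi; rewrite ?normrN ?ger0_norm//=; ring.
  + move=> x x0.
    have -> : - Complex 0 1 * Complex 0 x = Complex x 0 :> R[i].
      by apply/eqP; rewrite eq_complex/=; apply/andP; split; apply/eqP; ring.
    by apply: axr; rewrite ?ger0_norm//=; lra.
  + by rewrite /=; lra.
- apply: (fin (Complex 0 1) (- (b + 1))%:C%C (Complex q (- p))).
  + exact: im1.
  + by apply/eqP; rewrite eq_complex/=; apply/andP; split; apply/eqP; ring.
  + by rewrite /= (ger0_norm q0); ring.
  apply: (@quadrant_growth (prim g) (Complex 0 1) (- (b + 1))%:C%C _ _ _ A40 B10 M0) => //.
  + move=> x x0.
    have -> : Complex 0 1 * Complex x 0 = Complex 0 x :> R[i].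
      by apply/eqP; rewrite eq_complex/=; apply/andP; split; apply/eqP; ring.
    by apply: axi; rewrite ?ger0_norm//=; ring.
  + move=> x x0.
    have -> : Complex 0 1 * Complex 0 x = Complex (- x) 0 :> R[i].
      by apply/eqP; rewrite eq_complex/=; apply/andP; split; apply/eqP; ring.
    by apply: axr; rewrite ?normrN ?ger0_norm//=; lra.
  + by rewrite /=; lra.
- apply: (fin (-1) (Complex 0 (b + 1)) (Complex (- p) (- q))).
  + by rewrite cabsN cabs1.
  + by rewrite mulN1r /=; apply/eqP; rewrite eq_complex/= !opprK !eqxx.
  + by rewrite /= (ltr0_norm q0); ring.
  apply: (@quadrant_growth (prim g) (-1) (Complex 0 (b + 1)) _ _ _ A40 B10 M0) => //.
  + by rewrite cabsN cabs1.
  + move=> x x0.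
    have -> : -1 * Complex x 0 = Complex (- x) 0 :> R[i].
      by apply/eqP; rewrite eq_complex/=; apply/andP; split; apply/eqP; ring.
    by apply: axr; rewrite ?normrN ?ger0_norm//=; lra.
  + move=> x x0.
    have -> : -1 * Complex 0 x = Complex 0 (- x) :> R[i].
      by apply/eqP; rewrite eq_complex/=; apply/andP; split; apply/eqP; ring.
    by apply: axi; rewrite ?normrN ?ger0_norm//=; ring.
  + by rewrite /=; lra.
  + by rewrite /=; lra.
Qed.

(** [derivative_bound] is used on the disc of radius 2 about w, where |z| + 2 <= |w| + 4 and |Im z|
    <= |Im w| + 2; this accounts for the 4 and for the factor exp(2 (b + 1)) in the constant. *)
Lemma entire_growth : exists2 K : R, 0 < K & forall z,
  cabs (g z) <= K * (cabs z + 4) * expR ((b + 1) * `|complex.Im z|).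
Proof.
have bb0 := b0.
exists (64 * M * expR ((b + 1) * 2)); first by rewrite !mulr_gt0 ?expR_gt0.
move=> w.
have := @derivative_bound R (prim g) g w
  (M * (cabs w + 4) * expR ((b + 1) * (`|complex.Im w| + 2))) (cder_prim hg) hg.
rewrite [(b + 1) * _]mulrDr expRD => H.
have -> : 64 * M * expR ((b + 1) * 2) * (cabs w + 4) * expR ((b + 1) * `|complex.Im w|) =
  64 * (M * (cabs w + 4) * (expR ((b + 1) * `|complex.Im w|) * expR ((b + 1) * 2))) by ring.
apply: H => z zw; rewrite (le_trans (prim_growth z))//.
have b1 : 0 < b + 1 by lra.
apply: ler_pM; rewrite ?expR_ge0//; first by rewrite mulr_ge0 ?(ltW M0)// addr_ge0.
  rewrite ler_wpM2l ?(ltW M0)//; have := cabs_lip z w; lra.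
rewrite -expRD ler_expR -mulrDr ler_wpM2l ?(ltW b1)//.
have := Im_cabs (z - w); rewrite raddfB/= => h.
have := ler_normD (complex.Im z - complex.Im w) (complex.Im w); rewrite subrK; lra.
Qed.

End growth.

(** * Sampling in RPW(pi) *)

Section kernel.
Variable R : realType.
Implicit Types (z w : R[i]) (s t x y : R).

Definition sincd (a s : R) : R := if s == 0 then a else sin (a * s) / s.

Lemma sin_abs x : `|sin x| <= `|x|.
Proof.
have h t : 0 <= t -> `|sin t - sin 0| <= 1 * (t - 0).
  move=> t0; apply: (@mvt_bound R 0 t sin cos 1 t0 (fun u _ => is_derive_sin u)) => u _.
  by rewrite ler_norml cos_geN1 cos_le1.
have [x0|x0] := leP 0 x.
  by have := h x x0; rewrite sin0 !subr0 mul1r (ger0_norm x0).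
by have := h (- x); rewrite sin0 !subr0 mul1r sinN normrN (ltr0_norm x0); apply; lra.
Qed.

Lemma sin_lip x y : `|sin x - sin y| <= `|x - y|.
Proof.
wlog xy : x y / y <= x.
  by move=> H; have [h|/ltW h] := leP y x; [exact: H|rewrite distrC [leRHS]distrC; exact: H].
rewrite [leRHS]ger0_norm ?subr_ge0// -[leRHS]mul1r.
apply: (@mvt_bound R y x sin cos 1 xy (fun u _ => is_derive_sin u)) => u _.
by rewrite ler_norml cos_geN1 cos_le1.
Qed.

Lemma cos_lip x y : `|cos x - cos y| <= `|x - y|.
Proof.
wlog xy : x y / y <= x.
  by move=> H; have [h|/ltW h] := leP y x; [exact: H|rewrite distrC [leRHS]distrC; exact: H].
rewrite [leRHS]ger0_norm ?subr_ge0// -[leRHS]mul1r.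
apply: (@mvt_bound R y x cos (fun u => - sin u) 1 xy (fun u _ => is_derive_cos u)) => u _.
by rewrite normrN ler_norml sin_geN1 sin_le1.
Qed.

Lemma sincd_le a s : 0 <= a -> `|sincd a s| <= a.
Proof.
move=> a0; rewrite /sincd; case: eqP => [_|/eqP s0]; first by rewrite ger0_norm.
by rewrite normrM normfV ler_pdivrMr ?normr_gt0// (le_trans (sin_abs _))// normrM ger0_norm.
Qed.

Lemma sincd_decay a s : s != 0 -> `|sincd a s| <= `|s|^-1.
Proof.
move=> s0; rewrite /sincd (negbTE s0) normrM normfV ler_piMl ?invr_ge0//.
by rewrite ler_norml sin_geN1 sin_le1.
Qed.

(* d/du (sin (u s) / s) = cos (u s), so the Lipschitz bound in s comes from
   the one of cos *)
Lemma sincd_lip a s t : 0 <= a -> `|sincd a s - sincd a t| <= a ^+ 2 * `|s - t|.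
Proof.
move=> a0.
have D (r u : R) : is_derive u 1 (fun u => sincd u r) (cos (u * r)).
  rewrite /sincd; case: eqP => [->|/eqP r0].
    by rewrite mulr0 cos0; exact: did.
  have -> : (fun u : R => sin (u * r) / r) = (fun u => r^-1 * sin (r * u)).
    by apply/funext => v; rewrite mulrC [v * _]mulrC.
  by apply: (is_derive_eq (dZ r^-1 (dsinZ r u))); rewrite mulrA mulVf// mul1r mulrC.
have S0 r : sincd 0 r = 0 by rewrite /sincd mul0r sin0 mul0r if_same.
have := @mvt_bound R 0 a _ _ (a * `|s - t|) a0 (fun u _ => dB (D s u) (D t u)).
rewrite !S0 !subr0 mulrAC -expr2; apply => u /andP[u0 ua].
by rewrite (le_trans (cos_lip _ _))// -mulrBr normrM (ger0_norm u0) ler_wpM2r.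
Qed.

(** The de la Vallee Poussin kernel (cos ((a - 1) s) - cos ((a + 1) s)) / s^2. Its Fourier transform
    is a trapezoid, constant on [- (a - 1), a - 1], which is why it reproduces functions of smaller
    type. It decays quadratically, unlike the sinc kernel. *)
Definition ker (a s : R) : R := 2 * sincd a s * sincd 1 s.

Lemma sincd_cont a s : 0 <= a -> {for s, continuous (sincd a)}.
Proof.
move=> a0; apply/cont_epsP => e e0.
have h : 0 < a ^+ 2 + 1 by rewrite ltr_wpDl ?sqr_ge0.
exists (e / (a ^+ 2 + 1)); first by rewrite divr_gt0.
move=> t ht; rewrite (le_trans (sincd_lip _ _ a0))//.
rewrite (@le_trans _ _ ((a ^+ 2 + 1) * `|t - s|))//; last by rewrite mulrC -ler_pdivlMr.
by rewrite ler_wpM2r// lerDl.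
Qed.

Lemma ker_cont a s : 0 <= a -> {for s, continuous (ker a)}.
Proof.
move=> a0; apply: continuousM; last exact: sincd_cont.
by apply: continuousM; [exact: cst_continuous|exact: sincd_cont].
Qed.

(** For |t| <= 1 the Lipschitz bounds suffice, as 1 + t^2 <= 2. For |t| > 1 one has |s| >= |t| / 2,
    and the values as well as the increments of both factors decay like 1 / |t|. *)
Lemma ker_lip a s t : 1 <= a -> `|s - t| <= 1 / 2 ->
  `|ker a s - ker a t| <= (48 * a ^+ 2) * `|s - t| / (1 + t ^+ 2).
Proof.
move=> a1 st; have a0 : 0 <= a by lra.
have E : ker a s - ker a t = 2 * ((sincd a s - sincd a t) * sincd 1 s + sincd a t * (sincd 1 s - sincd 1 t)).
  by rewrite /ker; ring.
have t2 : 0 < 1 + t ^+ 2 by rewrite ltr_pwDl ?sqr_ge0.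
have d0 := normr_ge0 (s - t).
have a2 : 1 <= a ^+ 2 by rewrite expr_ge1.
have aa : a <= a ^+ 2 by rewrite expr2 ler_peMl.
have [t1|t1] := leP `|t| 1.
  apply: (@le_trans _ _ (4 * a ^+ 2 * `|s - t|)).
    rewrite E normrM (ger0_norm (_ : 0 <= 2 :> R))//.
    have h1 : `|(sincd a s - sincd a t) * sincd 1 s| <= a ^+ 2 * `|s - t| * 1.
      by rewrite normrM ler_pM ?sincd_lip ?sincd_le.
    have h2 : `|sincd a t * (sincd 1 s - sincd 1 t)| <= a * (1 ^+ 2 * `|s - t|).
      by rewrite normrM ler_pM ?sincd_lip ?sincd_le.
    have h3 : a * `|s - t| <= a ^+ 2 * `|s - t| by rewrite ler_wpM2r.
    move: h1 h2; rewrite expr1n mulr1 mul1r => h1 h2.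
    have := ler_normD ((sincd a s - sincd a t) * sincd 1 s) (sincd a t * (sincd 1 s - sincd 1 t)).
    lra.
  rewrite ler_pdivlMr//.
  have t21 : t ^+ 2 <= 1.
    by rewrite -(real_normK (num_real t)) exprn_ile1.
  have h : 4 * a ^+ 2 * `|s - t| * (1 + t ^+ 2) <= 4 * a ^+ 2 * `|s - t| * 2.
    by rewrite ler_wpM2l ?mulr_ge0 ?sqr_ge0//; lra.
  have : 0 <= a ^+ 2 * `|s - t| by rewrite mulr_ge0 ?sqr_ge0.
  lra.
have tn : t != 0 by rewrite -normr_gt0; lra.
have s1 : `|t| / 2 <= `|s|.
  have := ler_normB s (s - t); rewrite opprB addrC subrK; lra.
have sn : s != 0 by rewrite -normr_gt0; lra.
have t0 : 0 < `|t| by rewrite normr_gt0.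
have it : 0 < `|t|^-1 by rewrite invr_gt0.
have is2 : `|s|^-1 <= 2 * `|t|^-1.
  rewrite -[leRHS]invrK invfM invrK lef_pV2 ?posrE ?normr_gt0//; first by rewrite mulrC.
  by rewrite mulr_gt0// invr_gt0.
have slip b : 1 <= b -> `|sincd b s - sincd b t| <= 2 * (b + 1) * `|s - t| * `|t|^-1.
  move=> b1; rewrite /sincd (negbTE sn) (negbTE tn).
  have -> : sin (b * s) / s - sin (b * t) / t = (sin (b * s) - sin (b * t)) / t
      - sin (b * s) * ((s - t) / s / t).
    by field; rewrite sn tn.
  rewrite (le_trans (ler_normB _ _))// !normrM !normfV.
  have h1 : `|sin (b * s) - sin (b * t)| <= b * `|s - t|.
    by rewrite (le_trans (sin_lip _ _))// -mulrBr normrM ger0_norm//; lra.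
  have h2 : `|sin (b * s)| <= 1 by rewrite ler_norml sin_geN1 sin_le1.
  have is1 : `|s|^-1 <= 2 by rewrite (le_trans is2)// ler_pdivrMr//; lra.
  have h3 : `|sin (b * s)| * (`|s - t| / `|s| / `|t|) <= 2 * `|s - t| * `|t|^-1.
    rewrite -[leRHS]mul1r; apply: ler_pM => //.
    by rewrite ler_wpM2r ?(ltW it)// mulrC ler_wpM2r.
  have h4 : `|sin (b * s) - sin (b * t)| / `|t| <= b * `|s - t| * `|t|^-1.
    by rewrite ler_wpM2r// ltW.
  have : 0 <= b * (`|s - t| * `|t|^-1) by rewrite !mulr_ge0//; lra.
  lra.
apply: (@le_trans _ _ ((24 * a ^+ 2) * `|s - t| * (`|t|^-1 ^+ 2))).
  rewrite E normrM (ger0_norm (_ : 0 <= 2 :> R))//.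
  have h1 : `|(sincd a s - sincd a t) * sincd 1 s| <= (2 * (a + 1) * `|s - t| * `|t|^-1) * (2 * `|t|^-1).
    by rewrite normrM ler_pM ?slip// (le_trans (sincd_decay 1 sn)).
  have h2 : `|sincd a t * (sincd 1 s - sincd 1 t)| <= `|t|^-1 * (2 * (1 + 1) * `|s - t| * `|t|^-1).
    by rewrite normrM ler_pM ?slip// sincd_decay.
  have p : 0 <= `|s - t| * (`|t|^-1 ^+ 2) by rewrite mulr_ge0 ?sqr_ge0.
  have pa : a * (`|s - t| * (`|t|^-1 ^+ 2)) <= a ^+ 2 * (`|s - t| * (`|t|^-1 ^+ 2)) by rewrite ler_wpM2r.
  have p1 : 1 * (`|s - t| * (`|t|^-1 ^+ 2)) <= a ^+ 2 * (`|s - t| * (`|t|^-1 ^+ 2)) by rewrite ler_wpM2r.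
  have := ler_normD ((sincd a s - sincd a t) * sincd 1 s) (sincd a t * (sincd 1 s - sincd 1 t)).
  move: h1 h2.
  have -> : 2 * (a + 1) * `|s - t| / `|t| * (2 / `|t|) = 4 * (a + 1) * (`|s - t| * `|t|^-1 ^+ 2) by ring.
  have -> : `|t|^-1 * (2 * (1 + 1) * `|s - t| / `|t|) = 4 * (`|s - t| * `|t|^-1 ^+ 2) by ring.
  lra.
have tt : 1 + t ^+ 2 <= 2 * `|t| ^+ 2.
  have : 1 <= `|t| ^+ 2 by rewrite expr_ge1// ltW.
  rewrite real_normK ?num_real//; lra.
have -> : 48 * a ^+ 2 * `|s - t| / (1 + t ^+ 2) = 24 * a ^+ 2 * `|s - t| * (2 / (1 + t ^+ 2)) by ring.
rewrite ler_wpM2l ?mulr_ge0 ?sqr_ge0//.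
by rewrite exprVn ler_pdivlMr// mulrC ler_pdivrMr// exprn_gt0.
Qed.

Lemma atan_inv x : 0 < x -> atan x + atan x^-1 = pi / 2.
Proof.
move=> x0; have [h0 [c0 s0]] : 0 < atan x < pi / 2 /\ cos (atan x) != 0 /\ sin (atan x) != 0.
  have a0 : 0 < atan x by rewrite -atan0; exact: lt_atan.
  have a1 := atan_ltpi2 x.
  split; first by rewrite a0 a1.
  split; rewrite gt_eqF//; first by have p0 := pi_gt0 R; apply: cos_gt0_pihalf; apply/andP; split; lra.
  by apply: sin_gt0_pihalf; rewrite a0 a1.
have /andP[h1 h2] := h0.
have -> : atan x^-1 = pi / 2 - atan x.
  apply: tan_inj; rewrite ?in_itv/=.
  - by rewrite atan_gtNpi2 atan_ltpi2.
  - by apply/andP; split; lra.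
  rewrite atanK /tan.
  have -> : sin (pi / 2 - atan x) = cos (atan x).
    by rewrite -cosBpihalf -cosN; congr cos; ring.
  have -> : cos (pi / 2 - atan x) = sin (atan x).
    by rewrite -cosBpihalf -cosN; congr cos; ring.
  by rewrite -{1}(atanK x) /tan invfM invrK mulrC.
by rewrite addrC subrK.
Qed.

Lemma I_poisson (a b y : R) : 0 < y -> a <= b ->
  I a b (fun x => y / (x ^+ 2 + y ^+ 2)) = atan (b / y) - atan (a / y).
Proof.
move=> y0 ab; have den x : x ^+ 2 + y ^+ 2 != 0.
  by rewrite gt_eqF// ltr_wpDl ?sqr_ge0// exprn_gt0.
have D x : is_derive x 1 (fun x => atan (y^-1 * x)) (y / (x ^+ 2 + y ^+ 2)).
  apply: (is_derive_eq (dcomp (is_derive1_atan (y^-1 * x)) (dlin y^-1 x))).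
  have y00 : y != 0 by rewrite gt_eqF.
  have -> : 1 + (y^-1 * x) ^+ 2 = (x ^+ 2 + y ^+ 2) / y ^+ 2 by field.
  by field; rewrite y00 den.
rewrite (FTC2 ab (fun x _ => D x)); first by rewrite ![y^-1 * _]mulrC.
move=> x _.
have dx : is_derive x 1 (fun x => x ^+ 2 + y ^+ 2) (2 * x).
  have h := dD (dM (did x) (did x)) (dcst (y ^+ 2) x).
  by apply: (is_derive_eq h); ring.
have := dZ y (@is_deriveV R _ x _ 1 (den x) dx); exact: is_derive_cont.
Qed.

Lemma I_expN (Y : R) : 0 <= Y -> I 0 Y (fun y => expR (- y)) <= 1.
Proof.
move=> Y0.
have dN (y : R) : is_derive y 1 (fun y : R => - y) (-1) by exact: is_deriveNid.
have dE (y : R) : is_derive y 1 (fun y => expR (- y)) (expR (- y) * -1).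
  exact: (dcomp (is_derive_expR (- y)) (dN y)).
have D (y : R) : is_derive y 1 (fun y => - expR (- y)) (expR (- y)).
  have h : is_derive y 1 (fun y => -1 * expR (- y)) (expR (- y)).
    by apply: (is_derive_eq (dZ (-1) (dE y))); ring.
  by move: h; congr is_derive; apply/funext => t; rewrite mulN1r.
rewrite (FTC2 Y0 (fun y _ => D y)); last by move=> y _; exact: is_derive_cont (dE y).
by rewrite oppr0 expR0 opprK gerDr oppr_le0 expR_ge0.
Qed.

End kernel.

(** * The reproducing formula *)

Section reproducing.
Variable R : realType.
Implicit Types (z w : R[i]).

Lemma I_bound_fun (a b : R) (f h : R -> R) : itg a b f -> itg a b h ->
  (forall x, a <= x <= b -> `|f x| <= h x) -> `|I a b f| <= I a b h.
Proof. by move=> hf hh fh; rewrite (le_trans (Iabs hf))//; apply: leI => //; exact: itg_abs. Qed.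

Section centered.
Variables (G : R[i] -> R[i]) (K0 b c4 : R).
Hypotheses (K00 : 0 < K0) (b0 : 0 < b) (c40 : 4 <= c4).
Hypothesis hG : forall z, exists l, cder G z l.
Hypothesis Ggrowth : forall z,
  cabs (G z) <= K0 * (cabs z + c4) * expR (b * `|complex.Im z|).
Hypothesis Greal : forall x : R, complex.Im (G (Complex x 0)) = 0.

Let al := b + 1.
Let be := b + 3.
(** The real part of E(x) / x^2 on the real axis is [ker (b + 2)], as al and be are b + 2 minus and
    plus 1. In the upper half-plane the decay exp(- (b + 1) y) of E beats the growth exp(b y) of
    G. *)
Let E z := cexp (Complex 0 al * z) - cexp (Complex 0 be * z).
Let E1 z := Complex 0 al * cexp (Complex 0 al * z) - Complex 0 be * cexp (Complex 0 be * z).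

Let dE z : cder E z (E1 z).
Proof. by apply: cderB; exact: cder_cexpZ. Qed.

Let l2 := Complex 0 al * Complex 0 al - Complex 0 be * Complex 0 be : R[i].

Let dE1 : cder E1 0 l2.
Proof.
apply: cder_eq; first by apply: cderB; apply: cderZ; exact: cder_cexpZ.
by rewrite !mulr0 cexp0 !mulr1.
Qed.

Let E0 : E 0 = 0. Proof. by rewrite /E !mulr0 subrr. Qed.

Let E10 : E1 0 = - Complex 0 2.
Proof.
rewrite /E1 !mulr0 cexp0 !mulr1; apply/eqP; rewrite eq_complex/= subrr oppr0 eqxx/=.
by apply/eqP; rewrite /al /be; ring.
Qed.

Let Ebound z : 0 <= complex.Im z -> cabs (E z) <= 2 * expR (- (al * complex.Im z)).
Proof.
case: z => x y /= y0; rewrite (le_trans (cabsB _ _))// !cabs_cexp/= !mul0r !sub0r.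
have h : expR (- (be * y)) <= expR (- (al * y)).
  by rewrite ler_expR lerN2 ler_wpM2r// /al /be; lra.
lra.
Qed.

Let g0 := complex.Re (G 0).
Let G0E : G 0 = g0%:C%C.
Proof. by have := Greal 0; rewrite /g0; case: (G 0) => p q /= ->. Qed.

(** The three sides off the real axis contribute 2 g0 times the angles under which they are seen
    from 0, in total 2 pi g0; the top and the two vertical sides have errors 32, 8 and 8 times K0 /
    X. The ends X1 and X2 may differ because the window is not centered at the point of
    evaluation. *)
Lemma reproducing_centered (X X1 X2 : R) : c4 <= X ->
  X <= X1 <= 2 * X -> X <= X2 <= 2 * X ->
  `|I (- X1) X2 (fun x => complex.Re (G (Complex x 0)) * ker (b + 2) x) - 2 * pi * g0| <= 48 * K0 / X.
Proof.
move=> cX /andP[X11 X12] /andP[X21 X22].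
have bb := b0; have kk := K00; have cc := c40.
have [l hl] := hG 0.
have X0 : 0 < X by lra.
(* G E / z^2 has the polar part - 2 i G(0) / z at 0. Adding 2 i G(0) / z removes it, and since G(0)
   is real this changes nothing in the real part on the real axis. *)
pose Th z := quot G 0 l z * quot E 0 (E1 0) z + G 0 * quot2 E 0 (E1 0) l2 z.
have ThE z : z != 0 -> Th z = G z * E z / z ^+ 2 + Complex 0 2 * G 0 / z.
  move=> z0; rewrite /Th /quot /quot2 (negbTE z0) E10 E0 !subr0.
  by field.
have lreal : complex.Im l = 0.
  apply/eqP; rewrite -normr_le0; apply/ler_addgt0Pr => e e0; rewrite add0r.
  have [d d0 hd] := hl e e0; have := hd (Complex d 0).
  rewrite subr0 cabs_real (gtr0_norm d0) => /(_ (lexx _)).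
  move=> /(le_trans (Im_cabs _)); rewrite !raddfB/= Greal (Greal 0).
  have -> : complex.Im (l * Complex d 0) = complex.Im l * d.
    by case: (l) => p q /=; ring.
  by rewrite subrr sub0r normrN normrM (gtr0_norm d0) ler_pM2r.
have bottomE x : complex.Re (Th (Complex x 0)) = complex.Re (G (Complex x 0)) * ker (b + 2) x.
  have [->|x0] := eqVneq x 0.
    rewrite /Th /quot /quot2 eqxx E10 G0E /ker /sincd !eqxx.
    have -> : complex.Re (G (Complex 0 0)) = g0 by [].
    have -> : l2 / 2 = (2 * b + 4)%:C%C.
      apply: (mulIf (_ : (2 : R[i]) != 0)); first by rewrite pnatr_eq0.
      rewrite divfK ?pnatr_eq0//; apply/eqP; rewrite eq_complex /l2 /al /be /=.
      by apply/andP; split; apply/eqP; ring.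
    by case: l lreal {hl Th ThE} => p q /= ->; ring.
  have z0 : Complex x 0 != 0 by rewrite eq_complex/= (negbTE x0).
  rewrite ThE// G0E; have := Greal x; case: (G (Complex x 0)) => p q /= ->.
  rewrite /ker /sincd (negbTE x0) !mul0r !addr0 !mulr0 !subr0 expR0 !mul1r !add0r.
  have -> : cos (al * x) = cos ((b + 2) * x - x) by congr cos; rewrite /al; ring.
  have -> : cos (be * x) = cos ((b + 2) * x + x) by congr cos; rewrite /be; ring.
  rewrite cosB cosD !(mul0r, mulr0, subr0, addr0, expr0n)/=.
  by field.
have tb : rcont Th (- X1) X2 0 X.
  move=> z _; have [->|z0] := eqVneq z 0.
    apply: ccontD; first by apply: ccontM; [exact: quot_cont|exact: quot_cont (dE 0)].
    by apply: ccontM; [exact: cder_cont (cder_cst _ _)|exact: quot2_cont].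
  have [m hm] := hG z.
  have [m1 hm1] := quot_der l z0 hm; have [m2 hm2] := quot_der (E1 0) z0 (dE z).
  have [m3 hm3] := quot2_der (E1 0) l2 z0 (dE z).
  apply: ccontD; first by apply: ccontM; [exact: cder_cont hm1|exact: cder_cont hm2].
  by apply: ccontM; [exact: cder_cont (cder_cst _ _)|exact: cder_cont hm3].
have ab : - X1 <= X2 by lra.
have F0 : rr Th (- X1) X2 0 X = 0.
  apply: (goursat_except (w := 0)) => //; first exact: ltW.
  move=> z _ z0; have [m hm] := hG z.
  have [m1 hm1] := quot_der l z0 hm; have [m2 hm2] := quot_der (E1 0) z0 (dE z).
  have [m3 hm3] := quot2_der (E1 0) l2 z0 (dE z).
  by eexists; exact: cderD (cderM hm1 hm2) (cderZ (G 0) hm3).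
have [f1 f2 f3 f4] := bcont_itg ab (ltW X0) (rcont_bcont tb).
have Qb x y : 0 <= y <= X -> `|x| <= 2 * X -> X <= cabs (Complex x y) ->
    cabs (G (Complex x y) * E (Complex x y) / Complex x y ^+ 2) <= 8 * K0 / X * expR (- y).
  move=> /andP[y0 yX] x2 zX; have := Ebound (z := Complex x y) y0 => /= hE.
  have := Ggrowth (Complex x y); rewrite /= (ger0_norm y0) => hGr.
  have zc : cabs (Complex x y) <= 3 * X.
    by rewrite (le_trans (cabs_ReIm _))//= (ger0_norm y0); lra.
  rewrite 2!cabsM cabsV cabsX.
  apply: (@le_trans _ _ ((K0 * (4 * X) * expR (b * y)) * (2 * expR (- (al * y))) / X ^+ 2)).
    apply: ler_pM; rewrite ?mulr_ge0 ?invr_ge0 ?exprn_ge0//.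
      apply: ler_pM => //; rewrite (le_trans hGr)// ler_wpM2r ?expR_ge0//.
      by rewrite ler_wpM2l ?(ltW kk)//; lra.
    rewrite lef_pV2 ?posrE ?exprn_gt0//; last lra.
    by rewrite lerXn2r ?nnegrE// ltW.
  rewrite mulrACA -expRD.
  have -> : b * y + - (al * y) = - y by rewrite /al; ring.
  by rewrite le_eqVlt; apply/orP; left; apply/eqP; field; rewrite gt_eqF.
have polE x y : complex.Re (Complex 0 2 * G 0 / Complex x y) = 2 * g0 * (y / (x ^+ 2 + y ^+ 2)) /\
    complex.Im (Complex 0 2 * G 0 / Complex x y) = 2 * g0 * (x / (x ^+ 2 + y ^+ 2)).
  by rewrite G0E/=; split; ring.
have cp (c : R) : 0 < c -> forall p q, itg p q (fun x => c / (x ^+ 2 + c ^+ 2)).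
  move=> c0 p q; apply: itg_cont => x _.
  have dx : is_derive x 1 (fun x => x ^+ 2 + c ^+ 2) (2 * x).
    have h := dD (dM (did x) (did x)) (dcst (c ^+ 2) x).
    by apply: (is_derive_eq h); ring.
  have den : x ^+ 2 + c ^+ 2 != 0 by rewrite gt_eqF// ltr_wpDl ?sqr_ge0// exprn_gt0.
  have := dZ c (@is_deriveV R _ x _ 1 den dx); exact: is_derive_cont.
have ie p q (c : R) : itg p q (fun y => c * expR (- y)).
  apply: itgZ; apply: itg_cont => y _.
  have dN : is_derive y 1 (fun y : R => - y) (-1) by exact: is_deriveNid.
  exact: is_derive_cont (dcomp (is_derive_expR (- y)) dN).
have top : `|I (- X1) X2 (fun x => complex.Re (Th (Complex x X))) - 2 * g0 * (atan (X2 / X) - atan (- X1 / X))| <= 32 * K0 / X.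
  rewrite -(I_poisson X0 ab) -IZ ?cp// -IB//; last by apply: itgZ; exact: cp.
  apply: (@le_trans _ _ (8 * K0 / X * expR (- X) * (X2 - - X1))).
    apply: I_bound => //; first by apply: itgB => //; apply: itgZ; exact: cp.
    move=> x /andP[x1 x2].
    have z0 : Complex x X != 0 by rewrite eq_complex/= (gt_eqF X0) andbF.
    rewrite ThE// raddfD/= (polE x X).1 addrK (le_trans (Re_cabs _))//.
    apply: Qb; first by rewrite lexx ltW.
      by rewrite ler_norml; apply/andP; split; lra.
    by have := Im_cabs (Complex x X); rewrite /= gtr0_norm.
  apply: (@le_trans _ _ (8 * K0 / X * X^-1 * (4 * X))); last first.
    by rewrite le_eqVlt; apply/orP; left; apply/eqP; field; rewrite gt_eqF.
  apply: ler_pM => //; [|lra| |lra].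
    by rewrite mulr_ge0 ?expR_ge0// divr_ge0 ?(ltW X0)//; lra.
  rewrite ler_wpM2l ?divr_ge0 ?(ltW X0)//; first lra.
  rewrite expRN lef_pV2 ?posrE ?expR_gt0// (le_trans _ (expR_ge1Dx _))//; lra.
have right : `|I 0 X (fun y => complex.Im (Th (Complex X2 y))) - 2 * g0 * atan (X / X2)| <= 8 * K0 / X.
  have X20 : 0 < X2 by lra.
  have <- : atan (X / X2) - atan (0 / X2) = atan (X / X2) by rewrite mul0r atan0 subr0.
  rewrite -(I_poisson X20 (ltW X0)) -IZ ?cp// -IB//; last by apply: itgZ; exact: cp.
  apply: (@le_trans _ _ (I 0 X (fun y => 8 * K0 / X * expR (- y)))).
    apply: I_bound_fun => //; first by apply: itgB => //; apply: itgZ; exact: cp.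
    move=> y y0.
    have z0 : Complex X2 y != 0 by rewrite eq_complex/= (gt_eqF X20).
    rewrite ThE// raddfD/= (polE X2 y).2 [y ^+ 2 + _]addrC addrK (le_trans (Im_cabs _))//.
    apply: Qb => //; first by rewrite gtr0_norm.
    by have := Re_cabs (Complex X2 y); rewrite /= gtr0_norm//; lra.
  rewrite IZ; last by have := ie 0 X 1; apply: eq_itg => y _; rewrite mul1r.
  rewrite ler_piMr ?I_expN ?(ltW X0)// divr_ge0 ?(ltW X0)//; lra.
have left : `|I 0 X (fun y => complex.Im (Th (Complex (- X1) y))) + 2 * g0 * atan (X / X1)| <= 8 * K0 / X.
  have X10 : 0 < X1 by lra.
  have <- : atan (X / X1) - atan (0 / X1) = atan (X / X1) by rewrite mul0r atan0 subr0.
  rewrite -(I_poisson X10 (ltW X0)) -IZ ?cp// -ID//; last by apply: itgZ; exact: cp.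
  apply: (@le_trans _ _ (I 0 X (fun y => 8 * K0 / X * expR (- y)))).
    apply: I_bound_fun => //; first by apply: itgD => //; apply: itgZ; exact: cp.
    move=> y y0.
    have z0 : Complex (- X1) y != 0 by rewrite eq_complex/= oppr_eq0 (gt_eqF X10).
    rewrite ThE// raddfD/= (polE (- X1) y).2 sqrrN [y ^+ 2 + _]addrC mulNr mulrN subrK.
    rewrite (le_trans (Im_cabs _))//.
    apply: Qb => //; first by rewrite normrN gtr0_norm.
    by have := Re_cabs (Complex (- X1) y); rewrite /= normrN gtr0_norm//; lra.
  rewrite IZ; last by have := ie 0 X 1; apply: eq_itg => y _; rewrite mul1r.
  rewrite ler_piMr ?I_expN ?(ltW X0)// divr_ge0 ?(ltW X0)//; lra.
have a1 : atan (X2 / X) + atan (X / X2) = pi / 2.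
  by rewrite -(invf_div X2 X); apply: atan_inv; rewrite divr_gt0//; lra.
have a2 : atan (X1 / X) + atan (X / X1) = pi / 2.
  by rewrite -(invf_div X1 X); apply: atan_inv; rewrite divr_gt0//; lra.
have BE : I (- X1) X2 (fun x => complex.Re (G (Complex x 0)) * ker (b + 2) x) =
    I (- X1) X2 (fun x => complex.Re (Th (Complex x 0))).
  by apply: eqI => x _; rewrite bottomE.
rewrite BE; move: F0 top right left; rewrite /rr mulNr atanN opprK.
set i1 := I _ _ _; set i2 := I _ _ _; set i3 := I _ _ _; set i4 := I _ _ _.
have -> : atan (X / X2) = pi / 2 - atan (X2 / X) by lra.
have -> : atan (X / X1) = pi / 2 - atan (X1 / X) by lra.
set t1 := atan _; set t2 := atan _.
move=> F0; rewrite !ler_norml => /andP[? ?] /andP[? ?] /andP[? ?].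
by apply/andP; split; lra.
Qed.

End centered.

End reproducing.

(** * Sampling near the integers *)

Section sampling.
Variable R : realType.
Implicit Types (z w : R[i]).
Variables (g : R[i] -> R[i]) (K0 b : R).
Hypotheses (K00 : 0 < K0) (b0 : 0 < b).
Hypothesis hg : forall z, exists l, cder g z l.
Hypothesis ggrowth : forall z,
  cabs (g z) <= K0 * (cabs z + 4) * expR (b * `|complex.Im z|).
Hypothesis greal : forall x : R, complex.Im (g (Complex x 0)) = 0.
Let u (x : R) := complex.Re (g (Complex x 0)).
Hypothesis gL2 : forall X : R, 0 <= X -> I (- X) X (fun x => u x ^+ 2) <= 1.

Let cu (x : R) : {for x, continuous u}.
Proof. by apply: ccontH_Re; have [l] := hg (Complex x 0); exact: cder_cont. Qed.

Let ck (w x : R) : {for x, continuous (fun x => ker (b + 2) (x - w))}.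
Proof.
have bb := b0.
have h : is_derive x 1 (fun x => x - w) 1.
  by apply: (is_derive_eq (dB (did x) (dcst w x))); rewrite subr0.
by apply: continuous_comp; [exact: is_derive_cont h|apply: ker_cont; lra].
Qed.

Let iuk (w p q : R) : itg p q (fun x => u x * ker (b + 2) (x - w)).
Proof. by apply: itg_cont => x _; apply: continuousM; [exact: cu|exact: ck]. Qed.

(** Translation by w. The window [- Z, Z] has to be common to all w; seen from w its ends lie at
    distances Z + w and Z - w, both between Z - |w| and twice that number because 3 |w| <= Z. *)
Lemma reproducing (w Z : R) : 3 * `|w| + 4 <= Z ->
  `|I (- Z) Z (fun x => u x * ker (b + 2) (x - w)) - 2 * pi * u w| <= 48 * K0 / (Z - `|w|).
Proof.
move=> hZ; pose G z := g (z + w%:C%C).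
have hG z : exists l, cder G z l.
  have [l hl] := hg (z + w%:C%C); exists (l * 1).
  have hs : cder (fun z => z + w%:C%C) z 1.
    by apply: cder_eq; [exact: (cderD (cder_id z) (cder_cst _ z))|rewrite addr0].
  exact: (cder_comp hs hl).
have GE x : G (Complex x 0) = g (Complex (x + w) 0).
  by rewrite /G; congr g; apply/eqP; rewrite eq_complex/= addr0 !eqxx.
have Greal x : complex.Im (G (Complex x 0)) = 0 by rewrite GE.
have c40 : 4 <= `|w| + 4 by rewrite lerDr.
have Ggrowth z : cabs (G z) <= K0 * (cabs z + (`|w| + 4)) * expR (b * `|complex.Im z|).
  rewrite (le_trans (ggrowth _))// raddfD/= addr0 ler_wpM2r ?expR_ge0//.
  rewrite ler_wpM2l ?(ltW K00)//.
  rewrite [cabs z + _]addrA lerD2r (le_trans (cabsD _ _))//.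
  by rewrite cabs_real.
have [w1 w2] : - w <= `|w| /\ w <= `|w| by rewrite ler_norm -normrN ler_norm.
have := @reproducing_centered R G K0 b (`|w| + 4) K00 b0 c40 hG Ggrowth Greal
  (Z - `|w|) (Z + w) (Z - w).
have -> : I (- (Z + w)) (Z - w) (fun x => complex.Re (G (Complex x 0)) * ker (b + 2) x) =
   I (- Z) Z (fun x => u x * ker (b + 2) (x - w)).
  have := @I_shift R (- (Z + w)) (Z - w) w (fun x => u x * ker (b + 2) (x - w)).
  have -> : - (Z + w) + w = - Z by ring.
  rewrite subrK => <-; last first.
  - exact: iuk.
  - apply: measurable_realfun.continuous_measurable_fun => x.
    by apply: continuousM; [exact: cu|exact: ck].
  by apply: eqI => x _; rewrite GE addrK.
have -> : complex.Re (G 0) = u w by rewrite /G add0r.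
apply; [lra|apply/andP; split; lra|apply/andP; split; lra].
Qed.

Let k (t x : R) := 1 / (1 + (x - t) ^+ 2).

Let kden (t x : R) : 0 < 1 + (x - t) ^+ 2.
Proof. by rewrite ltr_pwDl ?sqr_ge0. Qed.

Let ckk (t x : R) : {for x, continuous (k t)}.
Proof.
have h : is_derive x 1 (fun x => x - t) 1.
  by apply: (is_derive_eq (dB (did x) (dcst t x))); rewrite subr0.
have h2 : is_derive x 1 (fun x => 1 + (x - t) ^+ 2) (2 * (x - t)).
  by have h3 := dD (dcst 1 x) (dM h h); apply: (is_derive_eq h3); ring.
have := dZ 1 (@is_deriveV R _ x _ 1 (lt0r_neq0 (kden t x)) h2); exact: is_derive_cont.
Qed.

(** On an interval of length 1 starting at t - x, the quantity 1 + c^2 is at most 3 (1 + (x - t)^2),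
    so the derivative of [atan] is at least a third of [k t x]. Over consecutive integers t the
    right side telescopes. *)
Let k_le (t x : R) : k t x <= 3 * (atan (t + 1 - x) - atan (t - x)).
Proof.
have lt : t - x < t + 1 - x by lra.
have cF : {within `[t - x, t + 1 - x], continuous (@atan R)}.
  by apply: continuous_in_subspaceT => y _; exact: continuous_atan.
have [c + ->] := MVT lt (fun y _ => is_derive1_atan y) cF.
rewrite in_itv/= => /andP[c1 c2].
have -> : t + 1 - x - (t - x) = 1 by ring.
rewrite mulr1 /k ler_pdivrMr// mulrAC ler_pdivlMr; last by rewrite ltr_pwDl ?sqr_ge0.
rewrite mul1r.
have -> : c = (t - x) + (c - (t - x)) by ring.
set s := c - (t - x); have s0 : 0 <= s <= 1 by rewrite /s; apply/andP; split; lra.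
have : 0 <= (x - t + s) ^+ 2 by exact: sqr_ge0.
have : s ^+ 2 <= 1 by move/andP: s0 => [? ?]; rewrite exprn_ile1.
have -> : (t - x + s) ^+ 2 = (x - t) ^+ 2 - 2 * (x - t) * s + s ^+ 2 by ring.
have -> : (x - t + s) ^+ 2 = (x - t) ^+ 2 + 2 * (x - t) * s + s ^+ 2 by ring.
have := sqr_ge0 (x - t); lra.
Qed.

Let sum_k (n : nat) (x : R) : \sum_(i < n) k i%:R x <= 3 * pi.
Proof.
have h m : \sum_(i < m) k i%:R x <= 3 * (atan (m%:R - x) - atan (- x)).
  elim: m => [|m ih]; first by rewrite big_ord0 add0r subrr mulr0.
  by rewrite big_ord_recr/= -[m.+1%:R]natr1; have := k_le m%:R x; lra.
have := atan_ltpi2 (n%:R - x); have := atan_gtNpi2 (- x); have := h n; lra.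
Qed.

Let sum_ks (s : R) (n : nat) (x : R) : s = 1 \/ s = -1 ->
  \sum_(i < n) k (s * i%:R) x <= 3 * pi.
Proof.
case=> ->.
  rewrite (_ : \sum_(i < n) _ = \sum_(i < n) k i%:R x); first exact: sum_k.
  by apply: eq_bigr => i _; rewrite mul1r.
rewrite (_ : \sum_(i < n) _ = \sum_(i < n) k i%:R (- x)); first exact: sum_k.
by apply: eq_bigr => i _; rewrite /k; congr (_ / (_ + _)); ring.
Qed.

Let Ik (t Z : R) : 0 <= Z -> I (- Z) Z (k t) <= pi.
Proof.
move=> Z0; have D (x : R) : is_derive x 1 (fun x => atan (x - t)) (k t x).
  have h : is_derive x 1 (fun x => x - t) 1.
    by apply: (is_derive_eq (dB (did x) (dcst t x))); rewrite subr0.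
  have h2 : is_derive x 1 (fun x => atan (x - t)) ((1 + (x - t) ^+ 2)^-1 * 1).
    exact: (@dcomp R atan (fun x => x - t) x _ _ (is_derive1_atan (x - t)) h).
  by apply: (is_derive_eq h2); rewrite /k mulr1 div1r.
rewrite (@FTC2 R (- Z) Z _ _ _ (fun x _ => D x) (fun x _ => @ckk t x)); last lra.
have := atan_ltpi2 (Z - t); have := atan_gtNpi2 (- Z - t); lra.
Qed.

Lemma I_sum (n : nat) (p q : R) (f : nat -> R -> R) : (forall i, itg p q (f i)) ->
  itg p q (fun x => \sum_(i < n) f i x) /\
  I p q (fun x => \sum_(i < n) f i x) = \sum_(i < n) I p q (f i).
Proof.
move=> hf; elim: n => [|n [ih1 ih2]].
  rewrite big_ord0 (_ : (fun x => _) = (fun=> 0)); last by apply/funext => x; rewrite big_ord0.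
  by split; [exact: itg_cst|rewrite /I Rintegral_cst// mul0r].
rewrite big_ord_recr/= -ih2 (_ : (fun x => _) = (fun x => \sum_(i < n) f i x + f n x)).
  by split; [exact: itgD|rewrite ID].
by apply/funext => x; rewrite big_ord_recr.
Qed.

(** The reproducing formulas at t_i and at s i are subtracted. By [ker_lip] the integrand is at most
    48 (b + 2)^2 |u| |t_i - s i| k, and 2 |u| |t_i - s i| <= u^2 + (t_i - s i)^2 separates two
    terms: the integral of k is at most pi, and the sum of k over i is at most 3 pi. The sign s
    selects one half of the integers. *)
Lemma sampling (s : R) (n : nat) (t : nat -> R) : s = 1 \/ s = -1 -> (forall i, `|t i - (s * i%:R)| <= 1 / 2) ->
  \sum_(i < n) `|u (t i) - u (s * i%:R)| <= 12 * (b + 2) ^+ 2 * (\sum_(i < n) (t i - (s * i%:R)) ^+ 2 + 3).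
Proof.
move=> hs ht; have bb := b0; have p0 := pi_gt0 R; have p2 := pi_ge2 R.
pose a2 := (b + 2) ^+ 2.
have a20 : 0 <= a2 by exact: sqr_ge0.
pose S := \sum_(i < n) (t i - (s * i%:R)) ^+ 2.
suff H e : 0 < e -> 2 * pi * (\sum_(i < n) `|u (t i) - u (s * i%:R)|) <= 24 * a2 * (pi * S + 3 * pi) + e.
  rewrite -(ler_pM2l (_ : 0 < 2 * pi)); last by rewrite mulr_gt0.
  apply/ler_addgt0Pr => e e0; rewrite (le_trans (H e e0))// lerD2r.
  by rewrite le_eqVlt; apply/orP; left; apply/eqP; rewrite -/a2 -/S; ring.
move=> e0; have n0 : 0 <= n%:R :> R by [].
(* The last term of Z makes each of the two reproducing errors at most e / (2 n). The constant [K0]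
   thereby disappears from the final bound. *)
pose Z := 3 * (n%:R + 1) + 4 + n%:R * (96 * K0) / e.
have nK : 0 <= n%:R * (96 * K0) / e by rewrite divr_ge0 ?(ltW e0)// mulr_ge0//; have := K00; lra.
have Z0 : 0 <= Z by rewrite /Z; lra.
have iu2 p q : itg p q (fun x => u x ^+ 2).
  by apply: itg_cont => x _; apply: continuousM; exact: cu.
have ik r p q : itg p q (k r) by apply: itg_cont => x _; exact: ckk.
have iku r p q : itg p q (fun x => u x ^+ 2 * k r x).
  apply: itg_cont => x _; apply: continuousM; last exact: ckk.
  by apply: continuousM; exact: cu.
have step (i : nat) : (i < n)%N -> 2 * pi * `|u (t i) - u (s * i%:R)| <=
    24 * a2 * ((t i - (s * i%:R)) ^+ 2 * pi + I (- Z) Z (fun x => u x ^+ 2 * k (s * i%:R) x)) + e / n%:R.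
  move=> ilt; have il : i%:R <= n%:R :> R by rewrite ler_nat ltnW.
  have i0 : 0 <= i%:R :> R by [].
  have si : `|s * i%:R| = i%:R.
    by case: hs => ->; rewrite ?mul1r ?mulN1r ?normrN ger0_norm.
  have n1 : 0 < n%:R :> R by rewrite ltr0n (leq_trans _ ilt).
  have hti : `|t i| <= n%:R + 1.
    rewrite -(subrK (s * i%:R) (t i)) (le_trans (ler_normD _ _))// si.
    have := ht i; lra.
  have r1 : `|I (- Z) Z (fun x => u x * ker (b + 2) (x - t i)) - 2 * pi * u (t i)| <= e / (2 * n%:R).
    apply: (le_trans (@reproducing (t i) Z _)); first by rewrite /Z; lra.
    have zp : 0 < Z - `|t i| by rewrite /Z; lra.
    rewrite ler_pdivrMr//.
    have : n%:R * (96 * K0) / e <= Z - `|t i| by rewrite /Z; lra.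
    move=> h; have := ler_wpM2l (_ : 0 <= e / (2 * n%:R)) h.
    rewrite divr_ge0 ?(ltW e0) ?mulr_ge0// => /(_ isT).
    have -> : e / (2 * n%:R) * (n%:R * (96 * K0) / e) = 48 * K0 by field; rewrite !gt_eqF.
    by [].
  have r2 : `|I (- Z) Z (fun x => u x * ker (b + 2) (x - (s * i%:R))) - 2 * pi * u (s * i%:R)| <= e / (2 * n%:R).
    apply: (le_trans (@reproducing (s * i%:R) Z _)); first by rewrite si /Z; lra.
    rewrite si; have zp : 0 < Z - i%:R by rewrite /Z; lra.
    rewrite ler_pdivrMr//.
    have : n%:R * (96 * K0) / e <= Z - i%:R by rewrite /Z; lra.
    move=> h; have := ler_wpM2l (_ : 0 <= e / (2 * n%:R)) h.
    rewrite divr_ge0 ?(ltW e0) ?mulr_ge0// => /(_ isT).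
    have -> : e / (2 * n%:R) * (n%:R * (96 * K0) / e) = 48 * K0 by field; rewrite !gt_eqF.
    by [].
  have D : `|I (- Z) Z (fun x => u x * ker (b + 2) (x - t i)) - I (- Z) Z (fun x => u x * ker (b + 2) (x - (s * i%:R)))| <=
      24 * a2 * ((t i - (s * i%:R)) ^+ 2 * pi + I (- Z) Z (fun x => u x ^+ 2 * k (s * i%:R) x)).
    rewrite -IB ?iuk//.
    apply: (@le_trans _ _ (I (- Z) Z (fun x => 24 * a2 * ((t i - (s * i%:R)) ^+ 2 * k (s * i%:R) x + u x ^+ 2 * k (s * i%:R) x)))).
      apply: I_bound_fun; first by apply: itgB; exact: iuk.
        by apply: itgZ; apply: itgD; [exact: itgZ|exact: iku].
      move=> x _; rewrite -mulrBr normrM.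
      have hk : `|ker (b + 2) (x - t i) - ker (b + 2) (x - (s * i%:R))| <= 48 * a2 * `|t i - (s * i%:R)| * k (s * i%:R) x.
        have e1 : x - t i - (x - (s * i%:R)) = - (t i - (s * i%:R)) by ring.
        have := @ker_lip R (b + 2) (x - t i) (x - (s * i%:R)).
        have kE : k (s * i%:R) x = (1 + (x - (s * i%:R)) ^+ 2)^-1 by rewrite /k div1r.
        rewrite e1 normrN kE -/a2; apply; first lra.
        exact: ht.
      apply: (le_trans (ler_wpM2l (normr_ge0 _) hk)).
      have kk0 : 0 <= k (s * i%:R) x by rewrite /k divr_ge0// ltW.
      have -> : `|u x| * (48 * a2 * `|t i - (s * i%:R)| * k (s * i%:R) x) = 24 * a2 * k (s * i%:R) x * (2 * (`|u x| * `|t i - (s * i%:R)|)) by ring.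
      have -> : 24 * a2 * ((t i - (s * i%:R)) ^+ 2 * k (s * i%:R) x + u x ^+ 2 * k (s * i%:R) x) = 24 * a2 * k (s * i%:R) x * ((t i - (s * i%:R)) ^+ 2 + u x ^+ 2) by ring.
      apply: ler_wpM2l; first by apply: mulr_ge0 => //; apply: mulr_ge0.
      rewrite -(real_normK (num_real (u x))) -(real_normK (num_real (t i - (s * i%:R)))).
      have := sqr_ge0 (`|u x| - `|t i - (s * i%:R)|); rewrite sqrrB; lra.
    rewrite IZ; last by apply: itgD; [exact: itgZ|exact: iku].
    rewrite ID; [|exact: itgZ|exact: iku].
    rewrite (IZ _ (ik _ _ _)); apply: ler_wpM2l; first exact: mulr_ge0.
    by apply: lerD => //; apply: ler_wpM2l; [exact: sqr_ge0|exact: Ik].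
  have -> : 2 * pi * `|u (t i) - u (s * i%:R)| = `|2 * pi * u (t i) - 2 * pi * u (s * i%:R)|.
    by rewrite -mulrBr normrM ger0_norm// mulr_ge0// ltW.
  have en : e / (2 * n%:R) = e / n%:R / 2 by field; rewrite gt_eqF.
  move: r1 r2 D; rewrite en.
  set i1 := I _ _ _; set i2 := I _ _ _; set i3 := I _ _ _.
  set q1 := 2 * pi * u (t i); set q2 := 2 * pi * u (s * i%:R) => r1 r2 D.
  have -> : q1 - q2 = (i1 - i2) + ((i2 - q2) - (i1 - q1)) by ring.
  have := ler_normD (i1 - i2) ((i2 - q2) - (i1 - q1)).
  have := ler_normB (i2 - q2) (i1 - q1); lra.
rewrite mulr_sumr (le_trans (ler_sum _ (fun (i : 'I_n) _ => step i (ltn_ord i))))//.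
rewrite big_split/= -mulr_sumr big_split/= -mulr_suml -/S.
have [hi1 hi2] := @I_sum n (- Z) Z (fun i x => u x ^+ 2 * k (s * i%:R) x) (fun i => iku _ _ _).
rewrite -hi2; apply: lerD; last first.
  rewrite sumr_const card_ord -[_ *+ n]mulr_natr.
  have [->|nn] := eqVneq (n%:R : R) 0; first by rewrite mulr0; exact: ltW.
  by rewrite divfK.
apply: ler_wpM2l; first by apply: mulr_ge0.
rewrite [S * pi]mulrC lerD2l.
apply: (@le_trans _ _ (I (- Z) Z (fun x => 3 * pi * u x ^+ 2))).
  apply: leI => //; first exact: itgZ.
  by move=> x _; rewrite -mulr_sumr mulrC ler_wpM2r ?sqr_ge0// sum_ks.
by rewrite IZ// ler_piMr ?gL2// mulr_ge0// ltW.
Qed.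

End sampling.

(** * Functions in the unit ball of RPW(pi) *)

Section RPW_sampling.
Variable R : realType.
Implicit Types (z w : R[i]).

Lemma log_growth_bound (f : R[i] -> R[i]) (F : set_system R) (a : R) :
  (limf_esup (log_growth f) F <= pi%:E)%E -> (pi : R) < a ->
  exists2 V, F V & forall y, V y -> y != 0 -> cabs (f (Complex 0 y)) <= expR (a * `|y|).
Proof.
move=> hl pa; have : (limf_esup (log_growth f) F < a%:E)%E.
  by apply: le_lt_trans hl _; rewrite lte_fin.
move=> /ereal_inf_lt[_ [V FV <-] hV]; exists V => // y Vy y0.
have y1 : 0 < `|y| by rewrite normr_gt0.
have : (log_growth f y < a%:E)%E by apply: le_lt_trans hV; apply: ereal_sup_ubound; exists y.
rewrite /log_growth /lne; case: ifPn => [c0 _|].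
  by rewrite (le_trans c0)// expR_ge0.
rewrite -ltNge -EFinM lte_fin => c0.
rewrite ltr_pdivrMr// => h.
by rewrite -[leLHS](lnK (c0 : _ \in Num.pos)) ler_expR ltW.
Qed.

Lemma RPW_real (g : R[i] -> R[i]) : RPW g -> forall x : R, complex.Im (g (Complex x 0)) = 0.
Proof.
move=> [_ _ _ _ gconj] x; have := gconj (Complex x 0).
rewrite /conjc/= oppr0; case: (g _) => p q /= [] /eqP.
by rewrite -subr_eq0 -opprD oppr_eq0 -mulr2n mulrn_eq0/= => /eqP.
Qed.

Lemma RPW_cder (g : R[i] -> R[i]) : RPW g -> forall z, exists l, cder g z l.
Proof. by move=> [gent _ _ _ _] z; apply: derivable_cder; exact: gent. Qed.

(** The limsup allows any exponent above pi, here pi + 1, outside a bounded interval; on that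
    interval the exponential type bounds g. *)
Lemma RPW_imag (g : R[i] -> R[i]) : RPW g -> exists2 C : R, 0 < C &
  forall y : R, cabs (g (Complex 0 y)) <= C * expR ((pi + 1) * `|y|).
Proof.
move=> [_ [A [B gAB]] [gp gn] _ _].
have pa : (pi : R) < pi + 1 by lra.
have [V1 [M1 [_ hM1]] h1] := log_growth_bound gp pa.
have [V2 [M2 [_ hM2]] h2] := log_growth_bound gn pa.
pose Y := `|M1| + `|M2| + 1.
exists (1 + `|A| * expR (`|B| * Y)); first by rewrite ltr_pwDl// mulr_ge0// expR_ge0.
move=> y; have p0 := pi_gt0 R.
have E1 : 1 <= expR ((pi + 1) * `|y|).
  by rewrite -[leLHS]expR0 ler_expR mulr_ge0//; lra.
have K0 : 0 <= `|A| * expR (`|B| * Y) by rewrite mulr_ge0// expR_ge0.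
have big : cabs (g (Complex 0 y)) <= expR ((pi + 1) * `|y|) ->
    cabs (g (Complex 0 y)) <= (1 + `|A| * expR (`|B| * Y)) * expR ((pi + 1) * `|y|).
  by move/le_trans; apply; rewrite ler_peMl ?expR_ge0// lerDl.
have := ler_norm M1; have := ler_norm (- M2); rewrite normrN => n2 n1.
have m1 := normr_ge0 M1; have m2 := normr_ge0 M2.
have [yY|yY] := ltP Y y.
  apply: big; apply: h1; first by apply: hM1; rewrite /Y in yY; lra.
  by rewrite gt_eqF//; rewrite /Y in yY; lra.
have [yN|yN] := ltP y (- Y).
  apply: big; apply: h2; first by apply: hM2; rewrite /Y in yN; lra.
  by rewrite lt_eqF//; rewrite /Y in yN; lra.
have yc : `|y| <= Y by rewrite ler_norml yN yY.
apply: (@le_trans _ _ (`|A| * expR (`|B| * Y))).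
  rewrite (le_trans (gAB _))// cabs_im; apply: (@le_trans _ _ (`|A| * expR (B * `|y|))).
    by rewrite ler_wpM2r ?expR_ge0// ler_norm.
  rewrite ler_wpM2l// ler_expR; apply: (@le_trans _ _ (`|B| * `|y|)).
    by rewrite ler_wpM2r// ler_norm.
  by rewrite ler_wpM2l.
apply: (@le_trans _ _ (1 + `|A| * expR (`|B| * Y))); first by rewrite lerDr.
by rewrite ler_peMr//; lra.
Qed.

Lemma RPW_L2 (g : R[i] -> R[i]) : RPW g -> (L2norm g <= 1)%E -> forall X : R,
  I (- X) X (fun x => complex.Re (g (Complex x 0)) ^+ 2) <= 1.
Proof.
move=> hg; rewrite /L2norm unlock/= => h X.
set J := (\int[_]_x _)%E in h.
have J0 : (0 <= J)%E by apply: integral_ge0 => x _; rewrite lee_fin powR_ge0.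
have {h} J1 : (J <= 1)%E.
  have two : (2^-1 * 2 = 1 :> R) by rewrite mulVf.
  have := @gt0_ler_poweR R 2 (ler0n _ 2) (J `^ 2^-1)%E 1%E.
  rewrite !in_itv/= !leey poweR_ge0 lee_fin ler01 => /(_ isT isT h).
  by rewrite -poweRrM two poweRe1// powR1.
have cu (x : R) : {for x, continuous (fun x => complex.Re (g (Complex x 0)))}.
  by apply: ccontH_Re; have [l] := RPW_cder hg (Complex x 0); exact: cder_cont.
have cu2 (x : R) : {for x, continuous (fun x => complex.Re (g (Complex x 0)) ^+ 2)}.
  by apply: continuousM; exact: cu.
have iu : itg (- X) X (fun x => complex.Re (g (Complex x 0)) ^+ 2) by apply: itg_cont.
rewrite -lee_fin /I /Rintegral fineK; last exact: integrable_fin_num.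
apply: le_trans J1.
pose D : set (measurableTypeR R) := `[- X, X]%classic.
have mD : measurable D by exact: measurable_itv.
rewrite (_ : (\int[_]_(x in _) _)%E = (\int[lebesgue_measure]_(x in D)
    (`|cabs (g (real_complex R x))| `^ 2)%:E)%E); last first.
  apply: eq_integral => x _ /=; rewrite ger0_norm ?cabs_ge0//.
  rewrite powR_mulrn ?cabs_ge0// cabs_sqr.
  have -> : real_complex R x = Complex x 0 by [].
  by rewrite (RPW_real hg) expr0n addr0.
apply: ge0_subset_integral => //.
- apply/measurable_EFinP; apply: (measurableT_comp (measurable_powR _)) => //.
  apply: measurableT_comp => //.
  apply: measurable_realfun.continuous_measurable_fun => x.
  apply/cont_epsP => e e0; have [l hl] := RPW_cder hg (Complex x 0).
  have [d d0 hd] := cder_cont hl e0; exists d => // y yd.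
  have := hd (Complex y 0); rewrite cabsE/= subrr expr0n addr0 sqrtr_sqr => /(_ yd).
  have := cabs_lip (g (Complex y 0)) (g (Complex x 0)).
  have := cabs_lip (g (Complex x 0)) (g (Complex y 0)).
  rewrite (cabs_sub (g (Complex x 0))) => h1 h2 h3.
  by rewrite ler_norml; apply/andP; split; lra.
Qed.

(** The exponents add up as follows: pi + 1 on the imaginary axis, 1 more for the primitive, and 2
    for the parameter of the kernel. *)
Lemma RPW_sampling (g : R[i] -> R[i]) : RPW g -> (L2norm g <= 1)%E ->
  forall (s : R) (n : nat) (t : nat -> R), s = 1 \/ s = -1 ->
  (forall i, `|t i - s * i%:R| <= 1 / 2) ->
  \sum_(i < n) `|complex.Re (g (Complex (t i) 0)) - complex.Re (g (Complex (s * i%:R) 0))|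
    <= 12 * (pi + 4) ^+ 2 * (\sum_(i < n) (t i - s * i%:R) ^+ 2 + 3).
Proof.
move=> hg g1 s n t hs ht; have p0 := pi_gt0 R.
have [C C0 hC] := RPW_imag hg.
have [_ [A [B gAB]] _ _ _] := hg.
have A0 : 0 < `|A| + 1 by rewrite ltr_wpDl.
have B0 : 0 < `|B| + 1 by rewrite ltr_wpDl.
have gAB' z : cabs (g z) <= (`|A| + 1) * expR ((`|B| + 1) * cabs z).
  apply: (le_trans (gAB z)); apply: (@le_trans _ _ ((`|A| + 1) * expR (B * cabs z))).
    by rewrite ler_wpM2r ?expR_ge0// (le_trans (ler_norm _))// lerDl.
  rewrite ler_wpM2l ?(ltW A0)// ler_expR ler_wpM2r// (le_trans (ler_norm _))// lerDl//.
have pi1 : 0 < (pi : R) + 1 by lra.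
have L2 X : 0 <= X -> I (- X) X (fun x => complex.Re (g (Complex x 0)) ^+ 2) <= 1.
  by move=> _; exact: RPW_L2.
have [K K0 hK] := entire_growth A0 B0 C0 pi1 (RPW_cder hg) gAB' hC (RPW_real hg) L2.
have pi2 : 0 < (pi : R) + 1 + 1 by lra.
have := @sampling R g K (pi + 1 + 1) K0 pi2 (RPW_cder hg) hK (RPW_real hg) L2 s n t hs ht.
by have -> : pi + 1 + 1 + 2 = pi + 4 :> R by ring.
Qed.

End RPW_sampling.

(** * Hill's equation on an interval *)

Section absolutely_continuous.
Variable R : realType.
Implicit Types (a b c x y : R) (u v p q f h : R -> R).

(** u is an indefinite integral of p. The derivative is carried along as a datum, so that no
    differentiation almost everywhere occurs. *)
Definition acon a b u p := itg a b p /\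
  forall y z, a <= y -> y <= z -> z <= b -> u z - u y = I y z p.

(* Increments that are quadratically small along partitions vanish; this gives
   the product rule for absolutely continuous functions below. *)
Lemma partition_zero a b (c : R) (Phi W : R -> R) : 0 <= c -> a <= b ->
  (forall y z, a <= y -> y <= z -> z <= b ->
    `|Phi z - Phi y| <= c * (z - y) * (W z - W y)) -> Phi b = Phi a.
Proof.
move=> c0 ab H.
have key (n : nat) : `|Phi b - Phi a| <= c * (b - a) * (W b - W a) / n.+1%:R.
  pose t (i : nat) := a + (b - a) * i%:R / n.+1%:R.
  have t0 : t 0%N = a by rewrite /t mulr0 mul0r addr0.
  have tn : t n.+1 = b by rewrite /t -mulrA divff ?pnatr_eq0// mulr1 addrC subrK.
  have tS i : t i.+1 - t i = (b - a) / n.+1%:R.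
    by rewrite /t -[i.+1%:R]natr1; ring.
  have d0 : 0 <= (b - a) / n.+1%:R by rewrite divr_ge0// subr_ge0.
  have mono i j : (i <= j)%N -> t i <= t j.
    move=> ij; rewrite /t lerD2l ler_wpM2r ?invr_ge0// ler_wpM2l ?subr_ge0//.
    by rewrite ler_nat.
  have ind m : (m <= n.+1)%N -> `|Phi (t m) - Phi (t 0%N)| <= c * ((b - a) / n.+1%:R) * (W (t m) - W (t 0%N)).
    elim: m => [_|m ih mn]; first by rewrite !subrr normr0 mulr0.
    have := ih (ltnW mn).
    have h1 : a <= t m by rewrite -t0 mono.
    have h2 : t m <= t m.+1 by apply: mono.
    have h3 : t m.+1 <= b by rewrite -tn mono.
    have := H _ _ h1 h2 h3; rewrite tS.
    have := ler_normD (Phi (t m.+1) - Phi (t m)) (Phi (t m) - Phi (t 0%N)).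
    have -> : Phi (t m.+1) - Phi (t m) + (Phi (t m) - Phi (t 0%N)) =
      Phi (t m.+1) - Phi (t 0%N) by ring.
    by move: d0 {tS}; set d := (b - a) / _ => d0; nra.
  have := ind n.+1 (leqnn _); rewrite tn t0 => /le_trans; apply.
  by rewrite le_eqVlt; apply/orP; left; apply/eqP; ring.
apply/eqP; rewrite -subr_eq0 -normr_le0; apply/ler_addgt0Pr => e e0; rewrite add0r.
set Q := c * (b - a) * (W b - W a) in key.
have Q0 : 0 <= Q by have := le_trans (normr_ge0 _) (key 0%N); rewrite divr1.
have := archi_boundP (divr_ge0 Q0 (ltW e0)); set n := Num.bound _ => hn.
rewrite (le_trans (key n))// ler_pdivrMr// mulrC -ler_pdivrMr//.
by rewrite (le_trans (ltW hn))// ler_nat.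
Qed.

Lemma within_cont_meas a b u : {within `[a, b], continuous u} -> measurable_fun `[a, b] u.
Proof. by move=> cu; exact: subspace_continuous_measurable_fun. Qed.

Lemma I0x_meas a b p : a <= b -> itg a b p -> measurable_fun `[a, b] (fun x => I a x p).
Proof. by move=> ab hp; apply: within_cont_meas; exact: parameterized_integral_continuous. Qed.

Lemma I0x_bound a b p x : itg a b p -> a <= x <= b -> `|I a x p| <= I a b (fun t => `|p t|).
Proof.
move=> hp /andP[ax xb].
rewrite (le_trans (Iabs (itgS (lexx a) xb hp)))// (chasles ax xb (itg_abs hp)) lerDl.
exact: I_ge0.
Qed.

Lemma acon_eq a b u p x : acon a b u p -> a <= x <= b -> u x = u a + I a x p.
Proof. by move=> [_ h] /andP[ax xb]; rewrite -(h a x)// addrC subrK. Qed.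

Lemma acon_bound a b u p x : acon a b u p -> a <= x <= b ->
  `|u x| <= `|u a| + I a b (fun t => `|p t|).
Proof.
move=> hu hx; rewrite (acon_eq hu hx) (le_trans (ler_normD _ _))// lerD2l.
exact: I0x_bound hu.1 hx.
Qed.

Lemma eq_meas a b u v : (forall x, a <= x <= b -> u x = v x) ->
  measurable_fun `[a, b] u -> measurable_fun `[a, b] v.
Proof.
by move=> uv; apply: eq_measurable_fun => x; rewrite inE/= in_itv/=; exact: uv.
Qed.

Lemma acon_meas a b u p : a <= b -> acon a b u p -> measurable_fun `[a, b] u.
Proof.
move=> ab hu; apply: (@eq_meas a b (fun x => u a + I a x p)).
  by move=> x hx; rewrite -(acon_eq hu hx).
by apply: measurable_funD => //; exact: (I0x_meas ab hu.1).
Qed.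

(** With q bounded by C the function v is Lipschitz. Over [s, t] the difference of the two sides
    changes by the integrals of p (v(t) - v) and q (u(s) - u), each at most C (t - s) times the
    integral of |p|, and [partition_zero] applies. *)
Lemma acon_mul a b u v p q : a <= b -> acon a b u p -> acon a b v q ->
  (exists C, forall x, a <= x <= b -> `|q x| <= C) ->
  acon a b (fun x => u x * v x) (fun x => p x * v x + q x * u x).
Proof.
move=> ab hu hv [C hC].
have mu := acon_meas ab hu; have mv := acon_meas ab hv.
have hpv : itg a b (fun x => p x * v x).
  exact: itg_mul hu.1 mv (fun x => acon_bound (x := x) hv).
have hqu : itg a b (fun x => q x * u x).
  exact: itg_mul hv.1 mu (fun x => acon_bound (x := x) hu).
have hs : itg a b (fun x => p x * v x + q x * u x) by exact: itgD.
split => // y z ay yz zb.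
pose Phi x := u x * v x - I a x (fun x => p x * v x + q x * u x).
suff H : Phi z = Phi y.
  have -> : I y z (fun x => p x * v x + q x * u x) =
     I a z (fun x => p x * v x + q x * u x) - I a y (fun x => p x * v x + q x * u x).
    rewrite (chasles ay yz); first by ring.
    by apply: itgS hs.
  by move: H; rewrite /Phi; lra.
have C0 : 0 <= C by rewrite (le_trans (normr_ge0 (q a)))// hC// lexx ab.
apply: (@partition_zero y z (2 * C) Phi (fun x => I a x (fun t => `|p t|))) => //.
  by rewrite mulr_ge0.
move=> s t ys st tz.
have as_ : a <= s by exact: le_trans ys. have tb : t <= b by exact: le_trans zb.
have sub f : itg a b f -> itg s t f by apply: itgS.
have Iat f : itg a b f -> I a t f - I a s f = I s t f.
  move=> hf; have -> : I a t f = I a s f + I s t f.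
    by apply: (chasles as_ st); exact: itgS hf.
  ring.
rewrite Iat; last by exact: itg_abs hu.1.
have E : Phi t - Phi s = I s t (fun x => p x * (v t - v x)) + I s t (fun x => q x * (u s - u x)).
  have -> : Phi t - Phi s = (u t - u s) * v t + u s * (v t - v s) -
     (I a t (fun x => p x * v x + q x * u x) - I a s (fun x => p x * v x + q x * u x)).
    by rewrite /Phi; ring.
  rewrite (Iat _ hs) hu.2// hv.2// ID; [|exact: sub|exact: sub].
  have e1 : I s t (fun x => p x * (v t - v x)) = I s t p * v t - I s t (fun x => p x * v x).
    rewrite (_ : (fun x => p x * (v t - v x)) = (fun x => v t * p x - p x * v x)); last first.
      by apply/funext => x; ring.
    rewrite IB ?IZ; [by ring|exact: sub hu.1|by apply: itgZ; exact: sub hu.1|exact: sub].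
  have e2 : I s t (fun x => q x * (u s - u x)) = u s * I s t q - I s t (fun x => q x * u x).
    rewrite (_ : (fun x => q x * (u s - u x)) = (fun x => u s * q x - q x * u x)); last first.
      by apply/funext => x; ring.
    by rewrite IB ?IZ; [|exact: sub hv.1|by apply: itgZ; exact: sub hv.1|exact: sub].
  by rewrite e1 e2; ring.
have W0 : 0 <= I s t (fun x => `|p x|) by exact: I_ge0.
have mv' : measurable_fun `[s, t] (fun x => v t - v x).
  apply: measurable_funB => //; apply: measurable_funS mv => //.
  by apply: subset_itv; rewrite bnd_simp.
have mu' : measurable_fun `[s, t] (fun x => u s - u x).
  apply: measurable_funB => //; apply: measurable_funS mu => //.
  by apply: subset_itv; rewrite bnd_simp.
have b1 x : s <= x <= t -> `|v t - v x| <= C * (t - s).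
  move=> /andP[sx xt]; rewrite hv.2//; last exact: le_trans as_ sx.
  have iq : itg x t q by apply: itgS tb hv.1; exact: le_trans as_ sx.
  have bq r : x <= r <= t -> `|q r| <= C.
    move=> /andP[xr rt]; apply: hC; rewrite (le_trans as_ (le_trans sx xr)).
    exact: le_trans rt tb.
  rewrite (le_trans (I_bound xt iq bq))//.
  by rewrite ler_wpM2l// lerD2l lerN2.
have b2 x : s <= x <= t -> `|u s - u x| <= I s t (fun x => `|p x|).
  move=> /andP[sx xt]; rewrite distrC hu.2//; last exact: le_trans xt tb.
  by apply: I0x_bound; [exact: sub hu.1|rewrite sx].
have i1 : itg s t (fun x => p x * (v t - v x)) by apply: itg_mul b1 => //; exact: sub hu.1.
have i2 : itg s t (fun x => q x * (u s - u x)) by apply: itg_mul b2 => //; exact: sub hv.1.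
have h1 : `|I s t (fun x => p x * (v t - v x))| <= C * (t - s) * I s t (fun x => `|p x|).
  rewrite (le_trans (Iabs i1))// -IZ; last by apply: itg_abs; exact: sub hu.1.
  apply: leI; [exact: itg_abs|by apply: itgZ; apply: itg_abs; exact: sub hu.1|].
  by move=> x hx; rewrite normrM mulrC ler_wpM2r// b1.
have h2 : `|I s t (fun x => q x * (u s - u x))| <= C * I s t (fun x => `|p x|) * (t - s).
  apply: I_bound => // x hx; rewrite normrM ler_pM ?b2// hC//.
  by move/andP: hx => [sx xt]; rewrite (le_trans as_ sx) (le_trans xt tb).
rewrite E (le_trans (ler_normD _ _))//; lra.
Qed.

Lemma acon_smooth a b v q : (forall x, is_derive x 1 v (q x)) ->
  (forall x, {for x, continuous q}) -> acon a b v q.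
Proof.
move=> dv cq; split; first by apply: itg_cont => x _; exact: cq.
by move=> y z _ yz _; rewrite (FTC2 yz (fun x _ => dv x) (fun x _ => cq x)).
Qed.

End absolutely_continuous.

(** * Integral equations solved by Neumann series *)

Section volterra.
Variables (R : realType) (L : R).
Hypothesis L0 : 0 < L.
Implicit Types (p f h phi : R -> R) (K : (R -> R) -> R -> R).

Definition bnd f B := forall x, 0 <= x <= L -> `|f x| <= B.

(* What the Neumann series needs of a bounded operator from L^1 to L^oo. *)
Record vop K (ka : R) : Prop := Vop {
  vop_ge0 : 0 <= ka;
  vop_ext : forall h1 h2, (forall x, 0 <= x <= L -> h1 x = h2 x) ->
    forall x, 0 <= x <= L -> K h1 x = K h2 x;
  vop_lin : forall c h1 h2, itg 0 L h1 -> itg 0 L h2 -> forall x, 0 <= x <= L ->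
    K (fun t => c * h1 t + h2 t) x = c * K h1 x + K h2 x;
  vop_bnd : forall h, itg 0 L h -> bnd (K h) (ka * I 0 L (fun t => `|h t|));
  vop_meas : forall h, itg 0 L h -> measurable_fun `[0, L] (K h) }.

Section instances.
Variables (al be : R -> R) (A B : R).
Hypotheses (mal : measurable_fun `[0, L] al) (mbe : measurable_fun `[0, L] be).
Hypotheses (alA : bnd al A) (beB : bnd be B).

Let A0 : 0 <= A.
Proof. by have := alA (x := 0); rewrite lexx ltW// => /(_ isT); exact: le_trans. Qed.
Let B0 : 0 <= B.
Proof. by have := beB (x := 0); rewrite lexx ltW// => /(_ isT); exact: le_trans. Qed.

Let itb h : itg 0 L h -> itg 0 L (fun t => h t * be t).
Proof. by move=> hh; apply: itg_mul hh mbe beB. Qed.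

Let Ibound h : itg 0 L h -> I 0 L (fun t => `|h t * be t|) <= B * I 0 L (fun t => `|h t|).
Proof.
move=> hh; rewrite -IZ; last exact: itg_abs.
apply: leI; [by apply: itg_abs; exact: itb|by apply: itgZ; exact: itg_abs|].
by move=> x hx; rewrite normrM mulrC ler_wpM2r// beB.
Qed.

Lemma vop_volterra : vop (fun h x => al x * I 0 x (fun t => h t * be t)) (A * B).
Proof.
split; first exact: mulr_ge0.
- move=> h1 h2 h12 x /andP[x0 xL]; congr (_ * _); apply: eqI => t /andP[t0 tx].
  by rewrite h12// t0 (le_trans tx).
- move=> c h1 h2 i1 i2 x /andP[x0 xL].
  have j1 : itg 0 x (fun t => h1 t * be t) by apply: itgS (itb i1).
  have j2 : itg 0 x (fun t => h2 t * be t) by apply: itgS (itb i2).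
  rewrite (_ : (fun t => (c * h1 t + h2 t) * be t) = (fun t => c * (h1 t * be t) + h2 t * be t)).
    by rewrite ID// ?IZ//; [ring|exact: itgZ].
  by apply/funext => t; ring.
- move=> h hh x hx; rewrite normrM -mulrA; apply: ler_pM => //; first exact: alA.
  exact: le_trans (I0x_bound (itb hh) hx) (Ibound hh).
- move=> h hh; apply: measurable_funM => //; apply: I0x_meas; [exact: ltW|exact: itb].
Qed.

Lemma vop_fredholm : vop (fun h x => al x * I 0 L (fun t => h t * be t)) (A * B).
Proof.
split; first exact: mulr_ge0.
- by move=> h1 h2 h12 x _; congr (_ * _); apply: eqI => t ht; rewrite h12.
- move=> c h1 h2 i1 i2 x _.
  rewrite (_ : (fun t => (c * h1 t + h2 t) * be t) = (fun t => c * (h1 t * be t) + h2 t * be t)).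
    rewrite ID// ?IZ//; [ring|exact: itb|by apply: itgZ; exact: itb|exact: itb].
  by apply/funext => t; ring.
- move=> h hh x hx; rewrite normrM -mulrA; apply: ler_pM => //; first exact: alA.
  exact: le_trans (Iabs (itb hh)) (Ibound hh).
- by move=> h hh; apply: measurable_funM.
Qed.
End instances.

Lemma vop_add K1 K2 a1 a2 : vop K1 a1 -> vop K2 a2 ->
  vop (fun h x => K1 h x + K2 h x) (a1 + a2).
Proof.
move=> [p1 e1 l1 b1 m1] [p2 e2 l2 b2 m2]; split; first exact: addr_ge0.
- by move=> h1 h2 h12 x hx; rewrite (e1 _ _ h12 _ hx) (e2 _ _ h12 _ hx).
- by move=> c h1 h2 i1 i2 x hx; rewrite l1// l2//; ring.
- by move=> h hh x hx; rewrite (le_trans (ler_normD _ _))// mulrDl lerD// ?b1// b2.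
- by move=> h hh; apply: measurable_funD; [exact: m1|exact: m2].
Qed.

(** The a priori bound makes S, the supremum of |f|, finite; the improvement applied to S itself
    gives S <= e + S / 2. *)
Lemma contraction_bound f (e B : R) : bnd f B ->
  (forall B', 0 <= B' -> bnd f B' -> bnd f (e + B' / 2)) -> bnd f (2 * e).
Proof.
move=> fB H.
pose S := sup [set `|f x| | x in [set x | 0 <= x <= L]].
have ne : [set `|f x| | x in [set x | 0 <= x <= L]] !=set0.
  by exists `|f 0|; exists 0 => //=; rewrite lexx ltW.
have ub : has_ubound [set `|f x| | x in [set x | 0 <= x <= L]].
  by exists B => _ [x hx <-]; exact: fB.
have fS : bnd f S by move=> x hx; apply: ub_le_sup => //; exists x.
have S0 : 0 <= S by rewrite (le_trans (normr_ge0 (f 0)))// fS// lexx ltW.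
have SS : S <= e + S / 2 by apply: ge_sup => // _ [x hx <-]; exact: H.
by move=> x hx; rewrite (le_trans (fS x hx))//; lra.
Qed.

Definition good f := measurable_fun `[0, L] f /\ exists B, bnd f B.

Lemma good_itg p f : itg 0 L p -> good f -> itg 0 L (fun t => p t * f t).
Proof. by move=> hp [mf [B fB]]; exact: itg_mul fB. Qed.

Lemma I_mul_bound p f B : itg 0 L p -> good f -> bnd f B ->
  I 0 L (fun t => `|p t * f t|) <= I 0 L (fun t => `|p t|) * B.
Proof.
move=> hp gf fB; rewrite mulrC -IZ; last exact: itg_abs.
apply: leI; [by apply: itg_abs; exact: good_itg|by apply: itgZ; exact: itg_abs|].
by move=> x hx; rewrite normrM mulrC ler_wpM2r// fB.
Qed.

Section neumann.
Variables (K : (R -> R) -> R -> R) (ka : R) (p phi : R -> R) (B : R).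
Hypotheses (HK : vop K ka) (hp : itg 0 L p).
Hypothesis small : ka * I 0 L (fun t => `|p t|) <= 1 / 2.
Hypotheses (mphi : measurable_fun `[0, L] phi) (phiB : bnd phi B).

Let it := fix it (n : nat) : R -> R :=
  if n is m.+1 then (fun x => phi x + K (fun t => p t * it m t) x) else phi.

Let B0 : 0 <= B.
Proof. by have := phiB (x := 0); rewrite lexx ltW// => /(_ isT); exact: le_trans. Qed.

Lemma Kp_bound f C : good f -> bnd f C -> 0 <= C -> bnd (K (fun t => p t * f t)) (C / 2).
Proof.
move=> gf fC C0 x hx; rewrite (le_trans (vop_bnd HK (good_itg hp gf) hx))//.
rewrite (le_trans (ler_wpM2l (vop_ge0 HK) (I_mul_bound hp gf fC)))//.
by rewrite mulrA mulrC; have := ler_wpM2l C0 small; lra.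
Qed.

Let it_good n : good (it n) /\ bnd (it n) (2 * B).
Proof.
elim: n => [|n [gn bn]].
  split; first by split => //; exists B.
  by move=> x hx; rewrite (le_trans (phiB hx))//; have := B0; lra.
have b1 : bnd (it n.+1) (2 * B).
  move=> x hx /=; rewrite (le_trans (ler_normD _ _))//.
  have := phiB hx; have := Kp_bound gn bn (mulr_ge0 (ler0n _ 2) B0) hx; lra.
split => //; split; last by exists (2 * B).
by apply: measurable_funD => //; apply: (vop_meas HK); exact: good_itg.
Qed.

Lemma goodB f g : good f -> good g -> good (fun x => f x - g x).
Proof.
move=> [mf [Bf hf]] [mg [Bg hg]]; split; first exact: measurable_funB.
by exists (Bf + Bg) => x hx; rewrite (le_trans (ler_normB _ _))// lerD ?hf ?hg.
Qed.

Lemma K_sub f g x : good f -> good g -> 0 <= x <= L ->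
  K (fun t => p t * f t) x - K (fun t => p t * g t) x = K (fun t => p t * (f t - g t)) x.
Proof.
move=> gf gg hx.
have := vop_lin HK (-1) (good_itg hp gg) (good_itg hp gf) hx.
rewrite (_ : (fun t => -1 * (p t * g t) + p t * f t) = (fun t => p t * (f t - g t))).
  by move=> ->; rewrite mulN1r addrC.
by apply/funext => t; ring.
Qed.

Let it_step n : bnd (fun x => it n.+1 x - it n x) (B / 2 ^+ n.+1).
Proof.
elim: n => [|n ih] x hx.
  rewrite /= addrC addKr expr1; apply: (Kp_bound (f := phi)) => //.
  by split => //; exists B.
have -> : it n.+2 x - it n.+1 x = K (fun t => p t * (it n.+1 t - it n t)) x.
  rewrite -(K_sub (it_good n.+1).1 (it_good n).1 hx) /=; ring.
rewrite exprS invfM mulrCA mulrC.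
apply: (Kp_bound (f := fun t => it n.+1 t - it n t)) => //.
  exact: goodB (it_good n.+1).1 (it_good n).1.
by rewrite divr_ge0// exprn_ge0.
Qed.

(** By [Kp_bound] the map f |-> K (p f) halves sup norms, so successive iterates differ by at most B
    / 2^n. The limit stays within B of phi, and it is measurable as a pointwise limit on [0, L]. *)
Lemma neumann : exists f, [/\ measurable_fun `[0, L] f, bnd f (2 * B) &
  forall x, 0 <= x <= L -> f x = phi x + K (fun t => p t * f t) x].
Proof.
pose f x := limn (fun n => it n x).
have cau n m x : 0 <= x <= L -> `|it (n + m)%N x - it n x| <= B / 2 ^+ n.
  move=> hx; suff : `|it (n + m)%N x - it n x| <= B / 2 ^+ n - B / 2 ^+ (n + m).
    move/le_trans; apply; rewrite lerBlDr lerDl divr_ge0 ?exprn_ge0//.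
  elim: m => [|m ih]; first by rewrite addn0 !subrr normr0.
  have := it_step (n + m)%N hx; rewrite addnS => h.
  have := ler_normD (it (n + m).+1 x - it (n + m)%N x) (it (n + m)%N x - it n x).
  rewrite addrA subrK.
  move: ih; have -> : B / 2 ^+ (n + m) = 2 * (B / 2 ^+ (n + m).+1).
    by rewrite exprS invfM; field; rewrite expf_neq0.
  lra.
have pow (e : R) : 0 < e -> exists N, B / 2 ^+ N <= e.
  move=> e0; exists (Num.bound (B / e)); rewrite ler_pdivrMr ?exprn_gt0//.
  rewrite mulrC -ler_pdivrMr// (le_trans (ltW (archi_boundP _)))//.
    by rewrite divr_ge0// ltW.
  by rewrite -natrX ler_nat ltnW// ltn_expl.
have anti n m : (n <= m)%N -> B / 2 ^+ m <= B / 2 ^+ n.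
  move=> nm; rewrite ler_wpM2l// lef_pV2 ?posrE ?exprn_gt0//.
  by rewrite ler_weXn2l// ler1n.
have cvg x : 0 <= x <= L -> (fun n => it n x) @ \oo --> f x.
  move=> hx; suff : cvgn (fun n => it n x) by [].
  apply/cauchy_cvgP; apply: cauchy_exP => e e0.
  have [N hN] := pow (e / 2) (divr_gt0 e0 (ltr0n _ 2)).
  exists (it N x); exists N => // m /= Nm; rewrite /ball/= distrC.
  rewrite -(subnKC Nm) (le_lt_trans (cau N (m - N)%N x hx))// (le_lt_trans hN)//.
  by rewrite ltr_pdivrMr// ltr_pMr// ltr1n.
have lim_cau n x : 0 <= x <= L -> `|f x - it n x| <= B / 2 ^+ n.
  move=> hx; apply/ler_addgt0Pr => e e0.
  have /cvgrPdist_le /(_ e e0)[N _ hN] := cvg x hx.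
  have := hN (n + N)%N (leq_addl _ _); have := cau n N x hx.
  have := ler_normD (f x - it (n + N)%N x) (it (n + N)%N x - it n x).
  rewrite addrA subrK; lra.
have mf : measurable_fun `[0, L] f.
  apply: (@measurable_fun_cvg _ _ _ _ it).
    by move=> n; have [[]] := it_good n.
  by move=> x /=; rewrite in_itv/=; exact: cvg.
have fb : bnd f (2 * B).
  move=> x hx; have := lim_cau 0%N x hx; rewrite expr0 divr1 /=.
  have := phiB hx; have := ler_normD (f x - phi x) (phi x); rewrite subrK; lra.
have gf : good f by split => //; exists (2 * B).
exists f; split => // x hx; apply/eqP; rewrite -subr_eq0 -normr_le0.
apply/ler_addgt0Pr => e e0; rewrite add0r.
have [n hn] := pow (e / 2) (divr_gt0 e0 (ltr0n _ 2)).
have -> : f x - (phi x + K (fun t => p t * f t) x) =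
  (f x - it n.+1 x) + (it n.+1 x - phi x - K (fun t => p t * f t) x) by ring.
have h1 := lim_cau n.+1 x hx.
have h2 : `|it n.+1 x - phi x - K (fun t => p t * f t) x| <= B / 2 ^+ n / 2.
  rewrite /= [phi x + _]addrC addrK K_sub//; last exact: (it_good n).1.
  apply: Kp_bound => //; first by apply: goodB => //; exact: (it_good n).1.
    by move=> t ht; rewrite distrC; exact: lim_cau.
  by rewrite divr_ge0// exprn_ge0.
have h3 := anti n n.+1 (leqnSn n).
have := ler_normD (f x - it n.+1 x) (it n.+1 x - phi x - K (fun t => p t * f t) x); lra.
Qed.

End neumann.

(** f - f' is the sum of phi - phi', K (p (f - f')), K ((p - p') f') and (K - K') (p' f'). The
    second term is at most half the size of f - f', so [contraction_bound] doubles the sum of the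
    others. *)
Lemma perturbation (K K' : (R -> R) -> R -> R) (ka : R) p p' phi phi' f f' (B e1 e2 : R) :
  vop K ka -> vop K' ka -> itg 0 L p -> itg 0 L p' ->
  ka * I 0 L (fun t => `|p t|) <= 1 / 2 ->
  good f -> good f' -> bnd f' B -> 0 <= B ->
  (forall x, 0 <= x <= L -> f x = phi x + K (fun t => p t * f t) x) ->
  (forall x, 0 <= x <= L -> f' x = phi' x + K' (fun t => p' t * f' t) x) ->
  (forall x, 0 <= x <= L -> `|phi x - phi' x| <= e1) ->
  (forall h x, itg 0 L h -> 0 <= x <= L -> `|K h x - K' h x| <= e2 * I 0 L (fun t => `|h t|)) ->
  0 <= e2 ->
  bnd (fun x => f x - f' x) (2 * (e1 + ka * (I 0 L (fun t => `|p t - p' t|) * B)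
     + e2 * (I 0 L (fun t => `|p' t|) * B))).
Proof.
move=> HK HK' hp hp' small gf gf' fB' B0 fE fE' he1 he2 e20.
have [_ [Bf hBf]] := gf.
apply: (@contraction_bound _ _ (Bf + B)).
  by move=> x hx; rewrite (le_trans (ler_normB _ _))// lerD ?hBf ?fB'.
move=> C C0 hC x hx.
have gd := goodB gf gf'.
have ipf' := good_itg hp gf'; have ip'f' := good_itg hp' gf'.
have E : f x - f' x = (phi x - phi' x) + K (fun t => p t * (f t - f' t)) x +
    K (fun t => (p t - p' t) * f' t) x + (K (fun t => p' t * f' t) x - K' (fun t => p' t * f' t) x).
  rewrite {1}fE// {1}fE'// -(K_sub HK hp gf gf' hx).
  have -> : K (fun t => (p t - p' t) * f' t) x = K (fun t => p t * f' t) x - K (fun t => p' t * f' t) x.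
    have := vop_lin HK (-1) ip'f' ipf' hx.
    rewrite (_ : (fun t => -1 * (p' t * f' t) + p t * f' t) = (fun t => (p t - p' t) * f' t)).
      by move=> ->; rewrite mulN1r addrC.
    by apply/funext => t; ring.
  ring.
have h1 := he1 x hx.
have h2 := @Kp_bound K ka p HK hp small _ C gd hC C0 x hx.
have hpp := itgB hp hp'.
have h3 : `|K (fun t => (p t - p' t) * f' t) x| <= ka * (I 0 L (fun t => `|p t - p' t|) * B).
  rewrite (le_trans (vop_bnd HK (good_itg hpp gf') hx))//.
  by rewrite ler_wpM2l ?(vop_ge0 HK)// I_mul_bound.
have h4 : `|K (fun t => p' t * f' t) x - K' (fun t => p' t * f' t) x| <= e2 * (I 0 L (fun t => `|p' t|) * B).
  by rewrite (le_trans (he2 _ _ ip'f' hx))// ler_wpM2l// I_mul_bound.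
rewrite E; move: h1 h2 h3 h4.
set q1 := phi x - phi' x; set q2 := K _ x; set q3 := K _ x; set q4 := K _ x - K' _ x.
move=> h1 h2 h3 h4; have := ler_normD (q1 + q2 + q3) q4.
have := ler_normD (q1 + q2) q3; have := ler_normD q1 q2; lra.
Qed.

End volterra.

(** * Hill's equation as an integral equation *)

Section hill_on_interval.
Variables (R : realType) (L : R).
Hypothesis L0 : 0 < L.
Implicit Types (p V f h u v w phi : R -> R) (a b c k x : R).

Lemma acon_ext a b u u' p p' : a <= b -> (forall x, a <= x <= b -> u x = u' x) ->
  (forall x, a <= x <= b -> p x = p' x) -> acon a b u p -> acon a b u' p'.
Proof.
move=> ab uu pp [ip hu]; split; first exact: eq_itg pp ip.
move=> y z ay yz zb; rewrite -!uu ?hu//; last 2 first.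
- by rewrite ay (le_trans yz).
- by rewrite zb (le_trans ay).
apply: eqI => x /andP[yx xz]; apply: pp.
by rewrite (le_trans ay yx) (le_trans xz zb).
Qed.

Lemma acon_lin a b c u v p q : acon a b u p -> acon a b v q ->
  acon a b (fun x => c * u x + v x) (fun x => c * p x + q x).
Proof.
move=> [ip hu] [iq hv]; split; first by apply: itgD => //; exact: itgZ.
move=> y z ay yz zb.
have ip' : itg y z p by exact: itgS ip.
have iq' : itg y z q by exact: itgS iq.
rewrite ID//; last exact: itgZ.
by rewrite IZ// -hu// -hv//; ring.
Qed.

Lemma acon_int a b p c : itg a b p -> acon a b (fun x => c + I a x p) p.
Proof.
move=> ip; split => // y z ay yz zb.
rewrite (chasles ay yz); last exact: itgS ip.
ring.
Qed.

Lemma acon_bnd u p : acon 0 L u p -> exists C, forall x, 0 <= x <= L -> `|u x| <= C.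
Proof. by move=> h; eexists=> x hx; exact: (acon_bound h hx). Qed.

Lemma acon_good u p : acon 0 L u p -> good L u.
Proof. by move=> h; split; [exact: (acon_meas (ltW L0) h)|exact: acon_bnd h]. Qed.

(** The first-order system f' = h, h' = V f in integrated form; h plays the role of f'. *)
Definition sol V f h := acon 0 L f h /\ acon 0 L h (fun x => V x * f x).

Lemma wronskian V1 V2 f1 h1 f2 h2 : sol V1 f1 h1 -> sol V2 f2 h2 ->
  acon 0 L (fun x => f1 x * h2 x - h1 x * f2 x) (fun x => (V2 x - V1 x) * (f1 x * f2 x)).
Proof.
move=> [f1h1 s1] [f2h2 s2].
have a1 := acon_mul (ltW L0) s2 f1h1 (acon_bnd s1).
have a2 := acon_mul (ltW L0) s1 f2h2 (acon_bnd s2).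
by apply: (acon_ext (ltW L0) _ _ (acon_lin (-1) a2 a1)) => x _; ring.
Qed.

Lemma energy V f h : sol V f h ->
  acon 0 L (fun x => f x * h x) (fun x => h x ^+ 2 + V x * f x ^+ 2).
Proof.
move=> [fh s]; have a1 := acon_mul (ltW L0) s fh (acon_bnd s).
by apply: (acon_ext (ltW L0) _ _ a1) => x _; ring.
Qed.

Definition mid u := (u 0 + u L) / 2.
Definition J w x := I 0 x w - I 0 L w / 2.

Lemma acon_mid u p x : acon 0 L u p -> 0 <= x <= L -> u x = mid u + J p x.
Proof.
move=> hu hx; have e1 := acon_eq hu hx.
have e2 : u L = u 0 + I 0 L p by apply: (acon_eq hu); rewrite lexx ltW.
rewrite /mid /J e1 e2; lra.
Qed.

(** The case of [perturbation] in which all data coincide, so that the bound is 0. *)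
Lemma fix_uniq (K : (R -> R) -> R -> R) (ka : R) p phi f f' :
  vop L K ka -> itg 0 L p -> ka * I 0 L (fun t => `|p t|) <= 1 / 2 ->
  good L f -> good L f' ->
  (forall x, 0 <= x <= L -> f x = phi x + K (fun t => p t * f t) x) ->
  (forall x, 0 <= x <= L -> f' x = phi x + K (fun t => p t * f' t) x) ->
  forall x, 0 <= x <= L -> f x = f' x.
Proof.
move=> HK hp small gf gf' fE fE' x hx; have [_ [B hB]] := gf'.
have B0 : 0 <= B by rewrite (le_trans (normr_ge0 (f' x)))// hB.
have := @perturbation _ _ L0 K K ka p p phi phi f f' B 0 0 HK HK hp hp small gf gf' hB B0 fE fE'.
move=> /(_ _ _ (lexx 0) x hx).
have -> : I 0 L (fun t => `|p t - p t|) = 0.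
  by rewrite (eqI (g := fun=> 0)) ?Icst ?mul0r ?ltW// => t _; rewrite subrr normr0.
rewrite !(mul0r, mulr0, addr0) => H; apply/eqP; rewrite -subr_eq0 -normr_le0 H//.
- by move=> y _; rewrite subrr normr0.
- by move=> h y _ _; rewrite subrr normr0 mul0r.
Qed.

Section positive_energy.
Variables (k : R).
Hypothesis k0 : 0 < k.
Let cs x := cos (k * x).
Let sn x := sin (k * x).

(* Variation of constants for f'' + k^2 f = h. The amplitudes of cos and sin are
   normalized by the mean of their values at the two endpoints (not by their
   value at 0), which makes the matrix [Sm] of the boundary problem symmetric. *)
Definition Kop h x :=
  k^-1 * sn x * I 0 x (fun t => h t * cs t) + (- (k^-1 / 2) * sn x) * I 0 L (fun t => h t * cs t)
  + ((- k^-1) * cs x * I 0 x (fun t => h t * sn t) + (k^-1 / 2) * cs x * I 0 L (fun t => h t * sn t)).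

Let ccs x : {for x, continuous cs}. Proof. exact: is_derive_cont (dcosZ k x). Qed.
Let csn x : {for x, continuous sn}. Proof. exact: is_derive_cont (dsinZ k x). Qed.
Let mcs : measurable_fun `[0, L] cs. Proof. by apply: cont_meas => x _; exact: ccs. Qed.
Let msn : measurable_fun `[0, L] sn. Proof. by apply: cont_meas => x _; exact: csn. Qed.
Let bcs : bnd L cs 1.
Proof. by move=> x _; rewrite ler_norml cos_geN1 cos_le1. Qed.
Let bsn : bnd L sn 1.
Proof. by move=> x _; rewrite ler_norml sin_geN1 sin_le1. Qed.

Let bZ c f : bnd L f 1 -> bnd L (fun x => c * f x) `|c|.
Proof. by move=> h x hx; rewrite normrM -[leRHS]mulr1 ler_wpM2l// h. Qed.

Let mZ c f : measurable_fun `[0, L] f -> measurable_fun `[0, L] (fun x => c * f x).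
Proof. by move=> h; apply: measurable_funM. Qed.

Lemma vop_Kop : vop L Kop (3 / k).
Proof.
have := vop_add
  (vop_add (vop_volterra L0 (mZ k^-1 msn) mcs (bZ k^-1 bsn) bcs)
           (vop_fredholm L0 (mZ (- (k^-1 / 2)) msn) mcs (bZ (- (k^-1 / 2)) bsn) bcs))
  (vop_add (vop_volterra L0 (mZ (- k^-1) mcs) msn (bZ (- k^-1) bcs) bsn)
           (vop_fredholm L0 (mZ (k^-1 / 2) mcs) msn (bZ (k^-1 / 2) bcs) bsn)).
rewrite !normrN !ger0_norm ?divr_ge0 ?invr_ge0 ?(ltW k0)//.
by rewrite (_ : k^-1 * 1 + _ + _ = 3 / k)//; lra.
Qed.

Let acs : acon 0 L cs (fun x => - k * sin (k * x)).
Proof.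
apply: acon_smooth => x; first exact: dcosZ.
exact: is_derive_cont (dZ (- k) (dsinZ k x)).
Qed.

Let asn : acon 0 L sn (fun x => k * cos (k * x)).
Proof.
apply: acon_smooth => x; first exact: dsinZ.
exact: is_derive_cont (dZ k (dcosZ k x)).
Qed.

Let bdcs : exists C, forall x, 0 <= x <= L -> `|- k * sin (k * x)| <= C.
Proof. by exists `|-k| => x hx; have := bZ (- k) bsn hx. Qed.
Let bdsn : exists C, forall x, 0 <= x <= L -> `|k * cos (k * x)| <= C.
Proof. by exists `|k| => x hx; have := bZ k bcs hx. Qed.

Let k0n : k != 0. Proof. by rewrite gt_eqF. Qed.

Let cs_sn x : cs x ^+ 2 + sn x ^+ 2 = 1.
Proof. exact: cos2Dsin2. Qed.

Section given_potential.
Variable p : R -> R.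
Hypothesis hp : itg 0 L p.
Let V x := p x - k ^+ 2.

(** Variation of constants: these are the A and B with f = A cos + B sin and h = k (B cos - A sin).
    The terms in k^2 cancel in their derivatives, which leaves only p f. *)
Lemma amplitudes f h : sol V f h ->
  acon 0 L (fun x => f x * cs x - k^-1 * (h x * sn x)) (fun x => - k^-1 * (p x * f x * sn x)) /\
  acon 0 L (fun x => f x * sn x + k^-1 * (h x * cs x)) (fun x => k^-1 * (p x * f x * cs x)).
Proof.
move=> [fh s]; split.
  have a1 := acon_mul (ltW L0) fh acs bdcs.
  have a2 := acon_mul (ltW L0) s asn bdsn.
  apply: (acon_ext (ltW L0) _ _ (acon_lin (- k^-1) a2 a1)) => x _; first by ring.
  by rewrite /V /cs /sn; field.
have a1 := acon_mul (ltW L0) fh asn bdsn.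
have a2 := acon_mul (ltW L0) s acs bdcs.
apply: (acon_ext (ltW L0) _ _ (acon_lin (k^-1) a2 a1)) => x _; first by ring.
by rewrite /V /cs /sn; field.
Qed.

Lemma sol_of_amplitudes A B f :
  (forall x, 0 <= x <= L -> f x = A x * cs x + B x * sn x) ->
  acon 0 L A (fun x => - k^-1 * (p x * f x * sn x)) ->
  acon 0 L B (fun x => k^-1 * (p x * f x * cs x)) ->
  sol V f (fun x => k * (B x * cs x - A x * sn x)).
Proof.
move=> fE aA aB.
have a1 := acon_mul (ltW L0) aA acs bdcs.
have a2 := acon_mul (ltW L0) aB asn bdsn.
have a3 := acon_mul (ltW L0) aA asn bdsn.
have a4 := acon_mul (ltW L0) aB acs bdcs.
split.
  apply: (acon_ext (ltW L0) _ _ (acon_lin 1 a1 a2)) => x hx.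
    by rewrite fE// mul1r.
  by rewrite /cs /sn; ring.
have zero : acon 0 L (fun=> 0) (fun=> 0 : R).
  by apply: acon_smooth => x; exact: is_derive_cont (dcst 0 x).
have a5 := acon_lin k (acon_lin (-1) a3 a4) zero.
apply: (acon_ext (ltW L0) _ _ a5) => x hx; first by ring.
have e := cs_sn x.
have -> : V x * f x = (p x * f x) * (cs x ^+ 2 + sn x ^+ 2) - k ^+ 2 * (A x * cs x + B x * sn x).
  by rewrite e -fE// /V; ring.
by rewrite /cs /sn; field.
Qed.

Let KopE f x : 0 <= x <= L -> good L f ->
  Kop (fun t => p t * f t) x =
  J (fun t => - k^-1 * (p t * f t * sn t)) x * cs x +
  J (fun t => k^-1 * (p t * f t * cs t)) x * sn x.
Proof.
move=> /andP[x0 xL] gf; rewrite /Kop /J.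
have ipf := good_itg hp gf.
have i1 : itg 0 L (fun t => p t * f t * sn t) by exact: itg_mul ipf msn bsn.
have i2 : itg 0 L (fun t => p t * f t * cs t) by exact: itg_mul ipf mcs bcs.
have i1' : itg 0 x (fun t => p t * f t * sn t) by exact: itgS i1.
have i2' : itg 0 x (fun t => p t * f t * cs t) by exact: itgS i2.
by rewrite !IZ//; field.
Qed.

Lemma fix_of_sol f h : sol V f h ->
  let A x := f x * cs x - k^-1 * (h x * sn x) in
  let B x := f x * sn x + k^-1 * (h x * cs x) in
  forall x, 0 <= x <= L ->
  f x = mid A * cs x + mid B * sn x + Kop (fun t => p t * f t) x.
Proof.
move=> hs A B x hx; have [aA aB] := amplitudes hs.
rewrite KopE//; last exact: acon_good hs.1.
have := acon_mid aA hx; have := acon_mid aB hx.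
rewrite -/(A) -/(B) => eB eA.
have -> : f x = A x * cs x + B x * sn x.
  by rewrite /A /B -[LHS]mulr1 -(cs_sn x); ring.
have eA' : A x = mid A + J (fun x0 : R => - k^-1 * (p x0 * f x0 * sn x0)) x by exact: eA.
have eB' : B x = mid B + J (fun x0 : R => k^-1 * (p x0 * f x0 * cs x0)) x by exact: eB.
by rewrite eA' eB'; ring.
Qed.

Lemma sol_of_fix (m1 m2 : R) f : good L f ->
  (forall x, 0 <= x <= L -> f x = m1 * cs x + m2 * sn x + Kop (fun t => p t * f t) x) ->
  let A x := m1 + J (fun t => - k^-1 * (p t * f t * sn t)) x in
  let B x := m2 + J (fun t => k^-1 * (p t * f t * cs t)) x in
  [/\ sol V f (fun x => k * (B x * cs x - A x * sn x)), 
    forall x, 0 <= x <= L -> f x = A x * cs x + B x * sn x,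
    mid A = m1 & mid B = m2].
Proof.
move=> gf fE A B.
have ipf := good_itg hp gf.
have i1 : itg 0 L (fun t => p t * f t * sn t) by exact: itg_mul ipf msn bsn.
have i2 : itg 0 L (fun t => p t * f t * cs t) by exact: itg_mul ipf mcs bcs.
have fAB x : 0 <= x <= L -> f x = A x * cs x + B x * sn x.
  by move=> hx; rewrite fE// KopE//; rewrite /A /B; ring.
have midJ c w : mid (fun x => c + J w x) = c by rewrite /mid /J I0; lra.
split => //; [|exact: midJ|exact: midJ].
apply: sol_of_amplitudes => //.
  apply: (acon_ext (ltW L0) _ _ (acon_int (m1 - I 0 L (fun t => - k^-1 * (p t * f t * sn t)) / 2) (itgZ (- k^-1) i1))) => // x _.
  by rewrite /A /J; ring.
apply: (acon_ext (ltW L0) _ _ (acon_int (m2 - I 0 L (fun t => k^-1 * (p t * f t * cs t)) / 2) (itgZ k^-1 i2))) => // x _.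
by rewrite /B /J; ring.
Qed.

End given_potential.
End positive_energy.
End hill_on_interval.

(** * Boundary conditions at half the angle *)

Section boundary_algebra.
Variable R : realType.
Implicit Types (C T : R).

(** Rotation of m + d by twice an angle gives m - d iff rotation of m + d by the angle equals
    rotation of m - d by its opposite. There the cosine part of m and the sine part of d cancel. *)
Lemma rotation_per C T (m1 m2 d1 d2 : R) : C ^+ 2 + T ^+ 2 = 1 ->
  ((m1 + d1) * (C ^+ 2 - T ^+ 2) + (m2 + d2) * (2 * T * C) = m1 - d1 /\
   (m2 + d2) * (C ^+ 2 - T ^+ 2) - (m1 + d1) * (2 * T * C) = m2 - d2) <->
  (C * d2 - T * m1 = 0 /\ C * d1 + T * m2 = 0).
Proof.
move=> e.
pose X := (m1 + d1) * (C ^+ 2 - T ^+ 2) + (m2 + d2) * (2 * T * C) - (m1 - d1) * (C ^+ 2 + T ^+ 2).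
pose Y := (m2 + d2) * (C ^+ 2 - T ^+ 2) - (m1 + d1) * (2 * T * C) - (m2 - d2) * (C ^+ 2 + T ^+ 2).
split=> [[hX hY]|[hQ hP]].
  have X0 : X = 0 by rewrite /X e mulr1 hX subrr.
  have Y0 : Y = 0 by rewrite /Y e mulr1 hY subrr.
  split.
    have : T * X + C * Y = 2 * (C * d2 - T * m1) * (C ^+ 2 + T ^+ 2) by rewrite /X /Y; ring.
    by rewrite X0 Y0 e; lra.
  have : C * X - T * Y = 2 * (C * d1 + T * m2) * (C ^+ 2 + T ^+ 2) by rewrite /X /Y; ring.
  by rewrite X0 Y0 e; lra.
have X0 : X = 0.
  have -> : X = 2 * C * (C * d1 + T * m2) + 2 * T * (C * d2 - T * m1) by rewrite /X; ring.
  by rewrite hP hQ !mulr0 addr0.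
have Y0 : Y = 0.
  have -> : Y = 2 * C * (C * d2 - T * m1) - 2 * T * (C * d1 + T * m2) by rewrite /Y; ring.
  by rewrite hP hQ !mulr0 subr0.
by move: X0 Y0; rewrite /X /Y e !mulr1 => /subr0_eq -> /subr0_eq ->.
Qed.

Lemma rotation_anti C T (m1 m2 d1 d2 : R) : C ^+ 2 + T ^+ 2 = 1 ->
  ((m1 + d1) * (C ^+ 2 - T ^+ 2) + (m2 + d2) * (2 * T * C) = - (m1 - d1) /\
   (m2 + d2) * (C ^+ 2 - T ^+ 2) - (m1 + d1) * (2 * T * C) = - (m2 - d2)) <->
  (C * m1 + T * d2 = 0 /\ C * m2 - T * d1 = 0).
Proof.
move=> e.
pose X := (m1 + d1) * (C ^+ 2 - T ^+ 2) + (m2 + d2) * (2 * T * C) + (m1 - d1) * (C ^+ 2 + T ^+ 2).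
pose Y := (m2 + d2) * (C ^+ 2 - T ^+ 2) - (m1 + d1) * (2 * T * C) + (m2 - d2) * (C ^+ 2 + T ^+ 2).
split=> [[hX hY]|[hP hQ]].
  have X0 : X = 0 by rewrite /X e mulr1 hX addNr.
  have Y0 : Y = 0 by rewrite /Y e mulr1 hY addNr.
  split.
    have : C * X - T * Y = 2 * (C * m1 + T * d2) * (C ^+ 2 + T ^+ 2) by rewrite /X /Y; ring.
    by rewrite X0 Y0 e; lra.
  have : T * X + C * Y = 2 * (C * m2 - T * d1) * (C ^+ 2 + T ^+ 2) by rewrite /X /Y; ring.
  by rewrite X0 Y0 e; lra.
have X0 : X = 0.
  have -> : X = 2 * C * (C * m1 + T * d2) + 2 * T * (C * m2 - T * d1) by rewrite /X; ring.
  by rewrite hP hQ !mulr0 addr0.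
have Y0 : Y = 0.
  have -> : Y = 2 * C * (C * m2 - T * d1) - 2 * T * (C * m1 + T * d2) by rewrite /Y; ring.
  by rewrite hP hQ !mulr0 subr0.
move: X0 Y0; rewrite /X /Y e !mulr1 => /eqP + /eqP; rewrite !addr_eq0.
by move=> /eqP -> /eqP ->.
Qed.
End boundary_algebra.

(** * Reduction to a symmetric matrix *)

Section reduction.
Variables (R : realType) (L : R).
Hypothesis L0 : 0 < L.
Implicit Types (p V f h u v w phi psi : R -> R) (a b c k x : R).

Lemma vop0 K ka x : vop L K ka -> 0 <= x <= L -> K (fun=> 0) x = 0.
Proof.
move=> HK hx; have := vop_bnd HK (itg_cst 0 L 0) hx.
have -> : I 0 L (fun t : R => `|0 : R|) = 0.
  by rewrite (eqI (g := fun=> 0)) ?(Icst _ (ltW L0)) ?mul0r// => t _; rewrite normr0.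
by rewrite mulr0 normr_le0 => /eqP.
Qed.

(** A choice of the Neumann solution with source phi; [fsolP] shows that it has the required
    properties when p is small and phi is measurable and bounded by 1. *)
Definition fsol k p phi : R -> R := xget (fun=> 0) [set f | [/\ good L f, bnd L f 2 &
  forall x, 0 <= x <= L -> f x = phi x + Kop L k (fun t => p t * f t) x]].

(* [Sm] is half the jump over [0, L] of the amplitudes, as a function of their
   means m; f is (anti)periodic iff m is in the kernel of cos (k L / 2) Sm -
   sin (k L / 2), resp. cos (k L / 2) + sin (k L / 2) Sm. *)
Definition Sm k p phi psi := (2 * k)^-1 * I 0 L (fun t => p t * fsol k p psi t * phi t).

Notation cs k := (fun x => cos (k * x)).
Notation sn k := (fun x => sin (k * x)).
Notation c1 k p := (fsol k p (cs k)).
Notation c2 k p := (fsol k p (sn k)).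

Section fixed.
Variables (k : R) (p : R -> R).
Hypotheses (k0 : 0 < k) (hp : itg 0 L p).
Hypothesis small : 3 / k * I 0 L (fun t => `|p t|) <= 1 / 2.
Let V x := p x - k ^+ 2.
Let HK := vop_Kop L0 k0.

Lemma trig_meas : measurable_fun `[0, L] (cs k) /\ measurable_fun `[0, L] (sn k).
Proof.
split; apply: cont_meas => x _; first exact: is_derive_cont (dcosZ k x).
exact: is_derive_cont (dsinZ k x).
Qed.

Lemma trig_bnd : bnd L (cs k) 1 /\ bnd L (sn k) 1.
Proof.
by split=> x _ /=; rewrite ler_norml ?cos_geN1 ?cos_le1 ?sin_geN1 ?sin_le1.
Qed.

Lemma fsolP phi : measurable_fun `[0, L] phi -> bnd L phi 1 ->
  [/\ good L (fsol k p phi), bnd L (fsol k p phi) 2 &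
  forall x, 0 <= x <= L -> fsol k p phi x = phi x + Kop L k (fun t => p t * fsol k p phi t) x].
Proof.
move=> mphi bphi; have [f [mf bf fE]] := neumann L0 HK hp small mphi bphi.
rewrite mulr1 in bf.
suff : [set f | [/\ good L f, bnd L f 2 &
  forall x, 0 <= x <= L -> f x = phi x + Kop L k (fun t => p t * f t) x]] (fsol k p phi) by [].
by apply: xgetPex; exists f; split => //; split => //; exists 2.
Qed.

Let P1 := fsolP trig_meas.1 trig_bnd.1.
Let P2 := fsolP trig_meas.2 trig_bnd.2.

Definition comb m1 m2 x := m1 * c1 k p x + m2 * c2 k p x.

Lemma comb_good m1 m2 : good L (comb m1 m2).
Proof.
have [[mg1 [B1 b1]] _ _] := P1; have [[mg2 [B2 b2]] _ _] := P2.
split; first by apply: measurable_funD; apply: measurable_funM.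
exists (`|m1| * B1 + `|m2| * B2) => x hx; rewrite (le_trans (ler_normD _ _))//.
by rewrite lerD// normrM ler_wpM2l ?b1 ?b2.
Qed.

Lemma comb_fix m1 m2 x : 0 <= x <= L -> comb m1 m2 x =
  m1 * cos (k * x) + m2 * sin (k * x) + Kop L k (fun t => p t * comb m1 m2 t) x.
Proof.
move=> hx; have [g1 _ e1] := P1; have [g2 _ e2] := P2.
have i1 := good_itg hp g1; have i2 := good_itg hp g2.
have i0 : itg 0 L (fun=> 0 : R) by exact: itg_cst.
have z : Kop L k (fun=> 0) x = 0.
  exact: vop0 HK hx.
have l2 := vop_lin HK m2 i2 i0 hx.
have i2' : itg 0 L (fun t => m2 * (p t * c2 k p t) + 0) by apply: itgD => //; exact: itgZ.
have l1 := vop_lin HK m1 i1 i2' hx.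
have -> : (fun t => p t * comb m1 m2 t) =
  (fun t => m1 * (p t * c1 k p t) + (m2 * (p t * c2 k p t) + 0)).
  by apply/funext => t; rewrite /comb; ring.
by rewrite l1 l2 z /comb {1}e1// {1}e2//; ring.
Qed.

(** If the combination vanishes then so does its integral term, hence m1 cos + m2 sin. The point 0
    gives m1 = 0, and a point where k x lies in ]0, pi[ gives m2 = 0. *)
Lemma comb_inj m1 m2 : (forall x, 0 <= x <= L -> comb m1 m2 x = 0) -> m1 = 0 /\ m2 = 0.
Proof.
move=> h.
have i0 : itg 0 L (fun=> 0 : R) by exact: itg_cst.
have e x : 0 <= x <= L -> m1 * cos (k * x) + m2 * sin (k * x) = 0.
  move=> hx; have := comb_fix m1 m2 hx; rewrite h//.
  rewrite (vop_ext HK (h2 := fun=> 0)) ?hx//; last by move=> t ht; rewrite h// mulr0.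
  by rewrite (vop0 HK hx) addr0.
have m10 : m1 = 0.
  by have := e 0; rewrite mulr0 cos0 sin0 mulr1 mulr0 addr0; apply; rewrite lexx ltW.
split=> //; pose x := Num.min L (pi / (2 * k)).
have x0 : 0 < x by rewrite lt_min L0 divr_gt0 ?pi_gt0 ?mulr_gt0.
have := e x; rewrite m10 mul0r add0r => /(_ _)/eqP; rewrite mulf_eq0.
have -> : (sin (k * x) == 0) = false.
  apply: gt_eqF; apply: sin_gt0_pi; rewrite mulr_gt0//=.
  rewrite (@le_lt_trans _ _ (pi / 2))//; last by have := pi_gt0 R; lra.
  by rewrite -ler_pdivlMl// mulrC -mulrA -invfM ge_min lexx orbT.
rewrite orbF; move=> H; apply/eqP; apply: H.
by rewrite (ltW x0) ge_min lexx.
Qed.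

Let i1 phi psi : measurable_fun `[0, L] phi -> bnd L phi 1 ->
  measurable_fun `[0, L] psi -> bnd L psi 1 -> itg 0 L (fun t => p t * fsol k p psi t * phi t).
Proof.
move=> mphi bphi mpsi bpsi; have [g _ _] := fsolP mpsi bpsi.
exact: itg_mul (good_itg hp g) mphi bphi.
Qed.

Let ipair phi m1 m2 : measurable_fun `[0, L] phi -> bnd L phi 1 ->
  (2 * k)^-1 * I 0 L (fun t => p t * comb m1 m2 t * phi t) =
  m1 * Sm k p phi (cs k) + m2 * Sm k p phi (sn k).
Proof.
move=> mphi bphi.
have [[mc ms] [bc bs]] := (trig_meas, trig_bnd).
have j1 := i1 mphi bphi mc bc; have j2 := i1 mphi bphi ms bs.
rewrite /Sm (_ : (fun t => p t * comb m1 m2 t * phi t) =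
  (fun t => m1 * (p t * c1 k p t * phi t) + m2 * (p t * c2 k p t * phi t))); last first.
  by apply/funext => t; rewrite /comb; ring.
by rewrite ID ?IZ//; [ring|exact: itgZ|exact: itgZ].
Qed.

Let S11 := Sm k p (cs k) (cs k).
Let S12 := Sm k p (cs k) (sn k).
Let S21 := Sm k p (sn k) (cs k).
Let S22 := Sm k p (sn k) (sn k).

Let ends A B m1 m2 f : (forall x, 0 <= x <= L -> f x = comb m1 m2 x) ->
  acon 0 L A (fun x => - k^-1 * (p x * f x * sin (k * x))) ->
  acon 0 L B (fun x => k^-1 * (p x * f x * cos (k * x))) ->
  mid L A = m1 -> mid L B = m2 ->
  [/\ A 0 = m1 - (- (m1 * S21 + m2 * S22)), A L = m1 + (- (m1 * S21 + m2 * S22)),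
      B 0 = m2 - (m1 * S11 + m2 * S12) & B L = m2 + (m1 * S11 + m2 * S12)].
Proof.
move=> fc hA hB mA mB.
have [[mc ms] [bc bs]] := (trig_meas, trig_bnd).
have hL : 0 <= L <= L by rewrite lexx ltW.
have gc := comb_good m1 m2.
have jc : itg 0 L (fun t => p t * comb m1 m2 t * cos (k * t)) by exact: itg_mul (good_itg hp gc) mc bc.
have js : itg 0 L (fun t => p t * comb m1 m2 t * sin (k * t)) by exact: itg_mul (good_itg hp gc) ms bs.
have eA := acon_eq hA hL; have eB := acon_eq hB hL.
have : I 0 L (fun x => - k^-1 * (p x * f x * sin (k * x))) = - 2 * (m1 * S21 + m2 * S22).
  rewrite -(ipair m1 m2 ms bs) (eqI (g := fun x => - k^-1 * (p x * comb m1 m2 x * sin (k * x)))).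
    by rewrite IZ//; have := gt_eqF k0 => /negbT kn; field.
  by move=> t ht; rewrite fc.
have : I 0 L (fun x => k^-1 * (p x * f x * cos (k * x))) = 2 * (m1 * S11 + m2 * S12).
  rewrite -(ipair m1 m2 mc bc) (eqI (g := fun x => k^-1 * (p x * comb m1 m2 x * cos (k * x)))).
    by rewrite IZ//; have := gt_eqF k0 => /negbT kn; field.
  by move=> t ht; rewrite fc.
move=> e1 e2; rewrite e2 in eA; rewrite e1 in eB; move: mA mB; rewrite /mid; split; lra.
Qed.

Lemma comb_sol m1 m2 : exists h A B, [/\ sol L V (comb m1 m2) h,
  forall x, 0 <= x <= L -> comb m1 m2 x = A x * cos (k * x) + B x * sin (k * x),
  h = (fun x => k * (B x * cos (k * x) - A x * sin (k * x))) &
  [/\ A 0 = m1 - (- (m1 * S21 + m2 * S22)), A L = m1 + (- (m1 * S21 + m2 * S22)),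
      B 0 = m2 - (m1 * S11 + m2 * S12) & B L = m2 + (m1 * S11 + m2 * S12)]].
Proof.
have gc := comb_good m1 m2.
have [[mc ms] [bc bs]] := (trig_meas, trig_bnd).
have [hs fAB mA mB] := sol_of_fix L0 k0 hp gc (@comb_fix m1 m2).
have js : itg 0 L (fun t => p t * comb m1 m2 t * sin (k * t)) by exact: itg_mul (good_itg hp gc) ms bs.
have jc : itg 0 L (fun t => p t * comb m1 m2 t * cos (k * t)) by exact: itg_mul (good_itg hp gc) mc bc.
pose A x := m1 + J L (fun t => - k^-1 * (p t * comb m1 m2 t * sin (k * t))) x.
pose B x := m2 + J L (fun t => k^-1 * (p t * comb m1 m2 t * cos (k * t))) x.
have hA : acon 0 L A (fun x => - k^-1 * (p x * comb m1 m2 x * sin (k * x))).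
  have := acon_int (m1 - I 0 L (fun t => - k^-1 * (p t * comb m1 m2 t * sin (k * t))) / 2) (itgZ (- k^-1) js).
  by apply: acon_ext => //; [exact: ltW|move=> x _; rewrite /A /J; ring].
have hB : acon 0 L B (fun x => k^-1 * (p x * comb m1 m2 x * cos (k * x))).
  have := acon_int (m2 - I 0 L (fun t => k^-1 * (p t * comb m1 m2 t * cos (k * t))) / 2) (itgZ k^-1 jc).
  by apply: acon_ext => //; [exact: ltW|move=> x _; rewrite /B /J; ring].
exists (fun x => k * (B x * cos (k * x) - A x * sin (k * x))), A, B; split=> //.
exact: (ends (fun x _ => erefl) hA hB mA mB).
Qed.

(* The Wronskian of the two basic solutions is constant. *)
Lemma Sm_sym : S12 = S21.
Proof.
have [h1 [A1 [B1 [s1 f1 e1 [a1 a1' b1 b1']]]]] := comb_sol 1 0.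
have [h2 [A2 [B2 [s2 f2 e2 [a2 a2' b2 b2']]]]] := comb_sol 0 1.
have w := wronskian L0 s1 s2.
have hL : 0 <= L <= L by rewrite lexx ltW.
have h0 : 0 <= (0 : R) <= L by rewrite lexx ltW.
have := acon_eq w hL.
set z := I 0 L _; have -> : z = 0.
  rewrite /z (eqI (g := fun=> 0)) ?(Icst _ (ltW L0)) ?mul0r// => x _; ring.
have wE x : 0 <= x <= L -> comb 1 0 x * h2 x - h1 x * comb 0 1 x = k * (A1 x * B2 x - B1 x * A2 x).
  move=> hx; rewrite f1// f2// e1 e2 -[RHS]mulr1 -(cos2Dsin2 (k * x)); ring.
rewrite addr0 !wE// => /(mulfI (negbT (gt_eqF k0))).
by rewrite a1 a1' b1 b1' a2 a2' b2 b2'; lra.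
Qed.

Let C := cos (k * L / 2).
Let T := sin (k * L / 2).

Let CT : C ^+ 2 + T ^+ 2 = 1. Proof. exact: cos2Dsin2. Qed.

Let trigL : cos (k * L) = C ^+ 2 - T ^+ 2 /\ sin (k * L) = 2 * T * C.
Proof.
have -> : k * L = k * L / 2 + k * L / 2 by lra.
by rewrite cosD sinD -/C -/T; split; ring.
Qed.

Definition per_cond (m1 m2 : R) := (C * S11 - T) * m1 + C * S12 * m2 = 0 /\
  C * S12 * m1 + (C * S22 - T) * m2 = 0.
Definition anti_cond (m1 m2 : R) := (C + T * S11) * m1 + T * S12 * m2 = 0 /\
  T * S12 * m1 + (C + T * S22) * m2 = 0.

(** The amplitudes have means m1, m2 and half jumps - (S21 m1 + S22 m2), S11 m1 + S12 m2. The
    rotation lemmas at the angle k L / 2 then turn the conditions at 0 and L into the linear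
    systems. *)
Let bc_iff (s : R) f h A B m1 m2 : s = 1 \/ s = -1 ->
  (forall x, 0 <= x <= L -> f x = A x * cos (k * x) + B x * sin (k * x)) ->
  (forall x, 0 <= x <= L -> h x = k * (B x * cos (k * x) - A x * sin (k * x))) ->
  [/\ A 0 = m1 - (- (m1 * S21 + m2 * S22)), A L = m1 + (- (m1 * S21 + m2 * S22)),
      B 0 = m2 - (m1 * S11 + m2 * S12) & B L = m2 + (m1 * S11 + m2 * S12)] ->
  (f L = s * f 0 /\ h L = s * h 0) <-> (if s == 1 then per_cond m1 m2 else anti_cond m1 m2).
Proof.
move=> hs fE hE [A0 AL B0 BL].
have hL : 0 <= L <= L by rewrite lexx ltW.
have h0 : 0 <= (0 : R) <= L by rewrite lexx ltW.
rewrite !fE// !hE// mulr0 cos0 sin0 trigL.1 trigL.2 !mulr1 !mulr0 addr0 subr0.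
have kn := negbT (gt_eqF k0).
have kk : (k * (B L * (C ^+ 2 - T ^+ 2) - A L * (2 * T * C)) = s * (k * B 0)) <->
   (B L * (C ^+ 2 - T ^+ 2) - A L * (2 * T * C) = s * B 0).
  split=> [|->]; last by ring.
  by move=> h1; apply: (mulfI kn); rewrite h1; ring.
case: hs => se; rewrite se in kk *.
  rewrite eqxx /per_cond Sm_sym.
  have [r1 r2] := rotation_per m1 m2 (- (m1 * S21 + m2 * S22)) (m1 * S11 + m2 * S12) CT.
  rewrite -AL -BL -A0 -B0 in r1 r2.
  split=> [[e1 /kk e2]|[e1 e2]].
    by case: r1; [split; lra|rewrite Sm_sym => ? ?; split; lra].
  have [e3 e4] : A L * (C ^+ 2 - T ^+ 2) + B L * (2 * T * C) = A 0 /\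
       B L * (C ^+ 2 - T ^+ 2) - A L * (2 * T * C) = B 0.
    by apply: r2; rewrite Sm_sym; split; lra.
  by split; [lra|apply/kk; lra].
have -> : (-1 == 1 :> R) = false by apply: lt_eqF; lra.
rewrite /anti_cond Sm_sym.
have [r1 r2] := rotation_anti m1 m2 (- (m1 * S21 + m2 * S22)) (m1 * S11 + m2 * S12) CT.
rewrite -AL -BL -A0 -B0 in r1 r2.
split=> [[e1 /kk e2]|[e1 e2]].
  by case: r1; [split; lra|rewrite Sm_sym => ? ?; split; lra].
have [e3 e4] : A L * (C ^+ 2 - T ^+ 2) + B L * (2 * T * C) = - A 0 /\
     B L * (C ^+ 2 - T ^+ 2) - A L * (2 * T * C) = - B 0.
  by apply: r2; rewrite Sm_sym; split; lra.
by split; [lra|apply/kk; lra].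
Qed.

(** Uniqueness of the fixed point identifies a solution with the combination whose coefficients are
    its own mean amplitudes. *)
Lemma bvp_pos (s : R) f h : s = 1 \/ s = -1 -> sol L V f h ->
  f L = s * f 0 -> h L = s * h 0 -> exists m1 m2,
  (forall x, 0 <= x <= L -> f x = comb m1 m2 x) /\
  (if s == 1 then per_cond m1 m2 else anti_cond m1 m2).
Proof.
move=> hs hsol bf bh.
have fE := fix_of_sol L0 k0 hp hsol.
have [aA aB] := amplitudes L0 k0 hsol.
set A := (fun x => f x * cos (k * x) - k^-1 * (h x * sin (k * x))) in aA fE.
set B := (fun x => f x * sin (k * x) + k^-1 * (h x * cos (k * x))) in aB fE.
have fc : forall x, 0 <= x <= L -> f x = comb (mid L A) (mid L B) x.
  apply: (fix_uniq L0 HK hp small (acon_good L0 hsol.1) (comb_good _ _) fE).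
  by move=> x hx; rewrite comb_fix.
exists (mid L A), (mid L B); split => //.
have E := ends fc aA aB erefl erefl.
have fA x : 0 <= x <= L -> f x = A x * cos (k * x) + B x * sin (k * x).
  by move=> hx; rewrite /A /B -[LHS]mulr1 -(cos2Dsin2 (k * x)); ring.
have hB x : 0 <= x <= L -> h x = k * (B x * cos (k * x) - A x * sin (k * x)).
  move=> hx; rewrite /A /B -[LHS]mulr1 -(cos2Dsin2 (k * x)).
  by have := negbT (gt_eqF k0) => kn; field.
have [H _] := bc_iff hs fA hB E.
by apply: H.
Qed.

Lemma bvp_pos_conv (s m1 m2 : R) : s = 1 \/ s = -1 ->
  (if s == 1 then per_cond m1 m2 else anti_cond m1 m2) ->
  exists h, [/\ sol L V (comb m1 m2) h, comb m1 m2 L = s * comb m1 m2 0 & h L = s * h 0].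
Proof.
move=> hs hc; have [h [A [B [hsol fE hE E]]]] := comb_sol m1 m2.
exists h; have [_ H] := @bc_iff s _ h A B _ _ hs fE (fun x _ => congr1 (@^~ x) hE) E.
by have [] := H hc.
Qed.

End fixed.
End reduction.

(** * Lipschitz dependence on k and on the potential *)

Section lipschitz_dependence.
Variables (R : realType) (L : R).
Hypotheses (L0 : 0 < L) (L8 : L <= 8).
Implicit Types (p f h al be phi psi : R -> R) (k x y : R).

(** What the estimates use of [cos] and [sin], so that each is proved once for both. In the
    constants below 8 bounds L and 32 bounds 1 / k. *)
Definition wave al := [/\ forall x y : R, `|al x - al y| <= `|x - y|, forall x, `|al x| <= 1 &
  forall k x, {for x, continuous (fun y => al (k * y))}].

Lemma wave_cos : wave (@cos R).
Proof.
split; [exact: cos_lip|by move=> x; rewrite ler_norml cos_geN1 cos_le1|].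
by move=> k x; exact: is_derive_cont (dcosZ k x).
Qed.

Lemma wave_sin : wave (@sin R).
Proof.
split; [exact: sin_lip|by move=> x; rewrite ler_norml sin_geN1 sin_le1|].
by move=> k x; exact: is_derive_cont (dsinZ k x).
Qed.

Lemma wave_meas al k : wave al -> measurable_fun `[0, L] (fun x => al (k * x)).
Proof. by move=> [_ _ c]; apply: cont_meas => x _; exact: c. Qed.

Lemma wave_bnd al k : wave al -> bnd L (fun x => al (k * x)) 1.
Proof. by move=> [_ b _] x _; exact: b. Qed.

Lemma wave_lip al k k' x : wave al -> 0 <= x <= L ->
  `|al (k * x) - al (k' * x)| <= 8 * `|k - k'|.
Proof.
move=> [l _ _] /andP[x0 xL]; rewrite (le_trans (l _ _))// -mulrBl normrM mulrC.
by rewrite (ger0_norm x0) ler_wpM2r// (le_trans xL).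
Qed.

Lemma wave_itg al k h y : wave al -> 0 <= y <= L -> itg 0 L h ->
  itg 0 y (fun t => h t * al (k * t)).
Proof.
move=> w /andP[y0 yL] hh; apply: (itgS (lexx _) yL).
exact: itg_mul hh (wave_meas k w) (wave_bnd k w).
Qed.

Lemma I_le y h : 0 <= y <= L -> itg 0 L h -> I 0 y (fun t => `|h t|) <= I 0 L (fun t => `|h t|).
Proof.
move=> /andP[y0 yL] hh; rewrite (chasles y0 yL (itg_abs hh)) lerDl.
by apply: I_ge0.
Qed.

Lemma wave_I_bound be k h y : wave be -> 0 <= y <= L -> itg 0 L h ->
  `|I 0 y (fun t => h t * be (k * t))| <= I 0 L (fun t => `|h t|).
Proof.
move=> w hy hh; have hw := wave_itg k w hy hh.
rewrite (le_trans (Iabs hw))// (le_trans _ (I_le hy hh))//.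
have /andP[_ yL] := hy.
apply: leI; [exact: itg_abs|by apply: itg_abs; exact: itgS hh|].
move=> t _; rewrite normrM -[leRHS]mulr1 ler_wpM2l//; by case: w.
Qed.

Lemma wave_I_lip be k k' h y : wave be -> 0 <= y <= L -> itg 0 L h ->
  `|I 0 y (fun t => h t * be (k * t)) - I 0 y (fun t => h t * be (k' * t))| <=
  8 * `|k - k'| * I 0 L (fun t => `|h t|).
Proof.
move=> w hy hh; have hw := wave_itg k w hy hh; have hw' := wave_itg k' w hy hh.
have /andP[y0 yL] := hy.
have ih : itg 0 y h by exact: itgS hh.
rewrite -IB// (le_trans (Iabs (itgB hw hw')))//.
apply: le_trans (ler_wpM2l _ (I_le hy hh)); last by rewrite mulr_ge0.
rewrite -IZ; last exact: itg_abs.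
apply: leI; [by apply: itg_abs; exact: itgB|by apply: itgZ; exact: itg_abs|].
move=> t /andP[t0 ty]; rewrite -mulrBr normrM mulrC ler_wpM2r//.
by apply: wave_lip => //; rewrite t0 (le_trans ty).
Qed.

Lemma inv_lip k k' : 1 / 32 <= k -> 1 / 32 <= k' -> `|k^-1 - k'^-1| <= 32 * 32 * `|k - k'|.
Proof.
move=> hk hk'.
have k0 : 0 < k by lra. have k0' : 0 < k' by lra.
have -> : k^-1 - k'^-1 = (k^-1 * k'^-1) * (k' - k).
  by have /negbT kn := gt_eqF k0; have /negbT kn' := gt_eqF k0'; field; rewrite kn kn'.
rewrite normrM distrC ler_wpM2r// ger0_norm; last by rewrite mulr_ge0// invr_ge0 ltW.
by rewrite ler_pM ?invr_ge0 ?(ltW k0) ?(ltW k0')// -[leRHS]invrK lef_pV2 ?posrE//; lra.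
Qed.

Lemma inv_le32 k : 1 / 32 <= k -> 0 <= k^-1 <= 32.
Proof.
move=> hk; have k0 : 0 < k by lra.
rewrite invr_ge0 ltW//= -[leRHS]invrK lef_pV2 ?posrE//; lra.
Qed.

Lemma norm_prod_sub (a a' u u' A' U da du : R) : `|a'| <= A' -> `|u| <= U ->
  `|a - a'| <= da -> `|u - u'| <= du -> `|a * u - a' * u'| <= da * U + A' * du.
Proof.
move=> hA hU hda hdu.
have -> : a * u - a' * u' = (a - a') * u + a' * (u - u') by ring.
by rewrite (le_trans (ler_normD _ _))// !normrM lerD// ler_pM.
Qed.

Let tk al be k h x y := k^-1 * al (k * x) * I 0 y (fun t => h t * be (k * t)).

Lemma tk_lip al be k k' h x y : wave al -> wave be -> 1 / 32 <= k -> 1 / 32 <= k' ->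
  0 <= x <= L -> 0 <= y <= L -> itg 0 L h ->
  `|tk al be k h x y - tk al be k' h x y| <= 32 * 48 * `|k - k'| * I 0 L (fun t => `|h t|).
Proof.
move=> wa wb hk hk' hx hy hh; rewrite /tk.
have /andP[ik0 ik] := inv_le32 hk; have /andP[ik0' ik'] := inv_le32 hk'.
have a1 : `|k^-1 * al (k * x) - k'^-1 * al (k' * x)| <= (32 * 32 * `|k - k'|) * 1 + 32 * (8 * `|k - k'|).
  apply: norm_prod_sub; [by rewrite ger0_norm|by case: wa|exact: inv_lip|exact: wave_lip].
have a2 : `|k'^-1 * al (k' * x)| <= 32.
  rewrite normrM ger0_norm// -[leRHS]mulr1 ler_pM//; by case: wa.
have := norm_prod_sub a2 (wave_I_bound k wb hy hh) a1 (wave_I_lip k k' wb hy hh).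
by move/le_trans; apply; rewrite le_eqVlt; apply/orP; left; apply/eqP; ring.
Qed.

Lemma Kop_lip k k' h x : 1 / 32 <= k -> 1 / 32 <= k' -> itg 0 L h -> 0 <= x <= L ->
  `|Kop L k h x - Kop L k' h x| <= 64 * 72 * `|k - k'| * I 0 L (fun t => `|h t|).
Proof.
move=> hk hk' hh hx.
have hL : 0 <= L <= L by rewrite lexx ltW.
have E a : Kop L a h x = tk sin cos a h x x - tk sin cos a h x L / 2 - (tk cos sin a h x x - tk cos sin a h x L / 2).
  by rewrite /Kop /tk; lra.
rewrite !E.
have h1 := tk_lip wave_sin wave_cos hk hk' hx hx hh.
have h2 := tk_lip wave_sin wave_cos hk hk' hx hL hh.
have h3 := tk_lip wave_cos wave_sin hk hk' hx hx hh.
have h4 := tk_lip wave_cos wave_sin hk hk' hx hL hh.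
move: h1 h2 h3 h4; set M := 32 * 48 * _ * _.
have -> : 64 * 72 * `|k - k'| * I 0 L (fun t => `|h t|) = 3 * M by rewrite /M; ring.
do 8! [move: (tk _ _ _ _ _ _) => ?].
rewrite !ler_norml => /andP[? ?] /andP[? ?] /andP[? ?] /andP[? ?]; apply/andP; split; lra.
Qed.

(** [perturbation] compares two operators under one common constant; 3 / k <= 96 supplies it for all
    k >= 1/32. *)
Lemma vop_Kop96 k : 1 / 32 <= k -> vop L (Kop L k) 96.
Proof.
move=> hk; have k0 : 0 < k by lra.
have /andP[_ ik] := inv_le32 hk.
have [p e l b m] := vop_Kop L0 k0; split => // h hh x hx.
rewrite (le_trans (b _ hh _ hx))// ler_wpM2r//; [exact: I_ge0|lra].
Qed.

Variable rho : R.
Hypothesis rho_small : rho <= 1 / 192.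

(** With rho <= 1/192 the contraction condition 96 rho <= 1/2 holds uniformly in k >= 1/32. *)
Definition potential p := itg 0 L p /\ I 0 L (fun t => `|p t|) <= rho.

Let small k p : 1 / 32 <= k -> potential p -> 3 / k * I 0 L (fun t => `|p t|) <= 1 / 2.
Proof.
move=> hk [hp pr]; have hr := rho_small; have k0 : 0 < k by lra.
have /andP[ik0 ik] := inv_le32 hk.
have : 3 / k * I 0 L (fun t => `|p t|) <= 96 * (1 / 192).
  by apply: ler_pM; [rewrite divr_ge0// ltW|exact: I_ge0|lra|lra].
lra.
Qed.

Let small96 p : potential p -> 96 * I 0 L (fun t => `|p t|) <= 1 / 2.
Proof. by move=> [_ pr]; have := rho_small; lra. Qed.

Lemma rho_ge0 p : potential p -> 0 <= rho.
Proof. by move=> [_]; apply: le_trans; exact: I_ge0. Qed.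

Lemma fsol_lip psi k k' p p' : wave psi -> 1 / 32 <= k -> 1 / 32 <= k' ->
  potential p -> potential p' ->
  bnd L (fun x => fsol L k p (fun t => psi (k * t)) x - fsol L k' p' (fun t => psi (k' * t)) x)
    (2 * (8 * `|k - k'| + 96 * (I 0 L (fun t => `|p t - p' t|) * 2) +
     64 * 72 * `|k - k'| * (rho * 2))).
Proof.
move=> w hk hk' pp pp' x hx.
have k0 : 0 < k by lra. have k0' : 0 < k' by lra.
have [g b e] := fsolP L0 k0 pp.1 (small hk pp) (wave_meas k w) (wave_bnd k w).
have [g' b' e'] := fsolP L0 k0' pp'.1 (small hk' pp') (wave_meas k' w) (wave_bnd k' w).
have := @perturbation _ _ L0 _ _ 96 _ _ _ _ _ _ 2 (8 * `|k - k'|) (64 * 72 * `|k - k'|)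
  (vop_Kop96 hk) (vop_Kop96 hk') pp.1 pp'.1 (small96 pp) g g' b' _ e e'.
move=> /(_ (ler0n _ 2) (fun y hy => wave_lip k k' w hy) (fun h y hh hy => Kop_lip hk hk' hh hy)).
have d0 : 0 <= 64 * 72 * `|k - k'| by rewrite !mulr_ge0.
move=> /(_ d0 x hx) /le_trans; apply.
rewrite ler_wpM2l// lerD2l ler_wpM2l// ler_wpM2r//; exact: pp'.2.
Qed.

Lemma Sm_bound phi psi k p : wave phi -> wave psi -> 1 / 32 <= k -> potential p ->
  `|Sm L k p (fun t => phi (k * t)) (fun t => psi (k * t))| <= rho / k.
Proof.
move=> wp ws hk pp; have k0 : 0 < k by lra.
have [g b e] := fsolP L0 k0 pp.1 (small hk pp) (wave_meas k ws) (wave_bnd k ws).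
have ipf := good_itg pp.1 g.
have hL : 0 <= L <= L by rewrite lexx ltW.
rewrite /Sm normrM ger0_norm; last by rewrite invr_ge0 mulr_ge0// ltW.
have h1 := wave_I_bound k wp hL ipf.
have h2 := I_mul_bound pp.1 g b.
have h3 : `|I 0 L (fun t => p t * fsol L k p (fun t0 => psi (k * t0)) t * phi (k * t))| <= 2 * rho.
  by rewrite (le_trans h1)// (le_trans h2)// mulrC ler_wpM2l// pp.2.
have -> : rho / k = (2 * k)^-1 * (2 * rho) by have /negbT kn := gt_eqF k0; field.
by rewrite ler_wpM2l// invr_ge0 mulr_ge0// ltW.
Qed.

(** Every term in which k varies still contains a potential, hence the factor rho in front of |k -
    k'|: for a small potential the matrix varies slowly with k. *)
Lemma Sm_lip phi psi k k' p p' : wave phi -> wave psi -> 1 / 32 <= k -> 1 / 32 <= k' ->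
  potential p -> potential p' ->
  `|Sm L k p (fun t => phi (k * t)) (fun t => psi (k * t)) -
    Sm L k' p' (fun t => phi (k' * t)) (fun t => psi (k' * t))| <=
  64 * 50 * rho * `|k - k'| + 64 * I 0 L (fun t => `|p t - p' t|).
Proof.
move=> wp ws hk hk' pp pp'.
have k0 : 0 < k by lra. have k0' : 0 < k' by lra.
have r0 := rho_ge0 pp; have hr := rho_small.
have [g b e] := fsolP L0 k0 pp.1 (small hk pp) (wave_meas k ws) (wave_bnd k ws).
have [g' b' e'] := fsolP L0 k0' pp'.1 (small hk' pp') (wave_meas k' ws) (wave_bnd k' ws).
have hF := fsol_lip ws hk hk' pp pp'.
rewrite /Sm; set f := fsol L k p _ in g b e hF *; set f' := fsol L k' p' _ in g' b' e' hF *.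
have hL : 0 <= L <= L by rewrite lexx ltW.
have hpp := itgB pp.1 pp'.1.
set dl := I 0 L (fun t => `|p t - p' t|) in hF *.
have dl0 : 0 <= dl by exact: I_ge0.
set D := `|k - k'| in hF *.
have D0 : 0 <= D by exact: normr_ge0.
clearbody f f'.
have gd := goodB g g'.
have ipf := good_itg pp.1 g; have ipf' := good_itg pp'.1 g'.
have i3 := good_itg pp'.1 gd; have i4 := good_itg hpp g.
have q1 : `|I 0 L (fun t => p t * f t * phi (k * t))| <= 2 * rho.
  rewrite (le_trans (wave_I_bound k wp hL ipf))//.
  by rewrite (le_trans (I_mul_bound pp.1 g b))// mulrC ler_wpM2l// pp.2.
have q2 : `|I 0 L (fun t => p t * f t * phi (k * t)) - I 0 L (fun t => p' t * f' t * phi (k' * t))|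
   <= 2 * dl + rho * (2 * (8 * D + 96 * (dl * 2) + 64 * 72 * D * (rho * 2))) + 8 * D * (2 * rho).
  have -> : I 0 L (fun t => p t * f t * phi (k * t)) - I 0 L (fun t => p' t * f' t * phi (k' * t)) =
     I 0 L (fun t => (p t - p' t) * f t * phi (k * t)) +
     I 0 L (fun t => p' t * (f t - f' t) * phi (k * t)) +
     (I 0 L (fun t => p' t * f' t * phi (k * t)) - I 0 L (fun t => p' t * f' t * phi (k' * t))).
    have w4 := wave_itg k wp hL i4; have w3 := wave_itg k wp hL i3.
    have w5 := wave_itg k wp hL ipf'.
    have -> : I 0 L (fun t => p t * f t * phi (k * t)) =
       I 0 L (fun t => (p t - p' t) * f t * phi (k * t)) +
       I 0 L (fun t => p' t * (f t - f' t) * phi (k * t)) +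
       I 0 L (fun t => p' t * f' t * phi (k * t)).
      apply: etrans (etrans (ID (itgD w4 w3) w5) (congr1 (fun z => z + _) (ID w4 w3))).
      by apply: eqI => t _; ring.
    by move: (I _ _ _) (I _ _ _) (I _ _ _) (I _ _ _) => a1 a2 a3 a4; ring.
  have t1 := wave_I_bound k wp hL i4.
  have t2 := wave_I_bound k wp hL i3.
  have t3 := wave_I_lip k k' wp hL ipf'.
  have s1 := I_mul_bound hpp g b.
  have s2 := I_mul_bound pp'.1 gd hF.
  have s3 := I_mul_bound pp'.1 g' b'.
  rewrite (le_trans (ler_normD _ _))// lerD//.
    rewrite (le_trans (ler_normD _ _))// lerD//.
      by rewrite (le_trans t1)// (le_trans s1)// mulrC.
    rewrite (le_trans t2)// (le_trans s2)// ler_wpM2r//; last exact: pp'.2.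
    by rewrite mulr_ge0// !addr_ge0// !mulr_ge0.
  rewrite (le_trans t3)// ler_wpM2l ?mulr_ge0// (le_trans s3)// mulrC ler_wpM2l//.
  exact: pp'.2.
have h2k : `|(2 * k')^-1| <= 16.
  have /andP[ik0' ik'] := inv_le32 hk'.
  by rewrite invfM normrM !ger0_norm//; lra.
have h2d : `|(2 * k)^-1 - (2 * k')^-1| <= 16 * 32 * D.
  rewrite !invfM -mulrBr normrM ger0_norm//; have := inv_lip hk hk'; rewrite -/D; lra.
have := norm_prod_sub h2k q1 h2d q2; move/le_trans; apply.
have rr : rho * rho <= rho / 192.
  by rewrite ler_wpM2l//; lra.
have r1 : rho * dl <= dl / 192 by rewrite mulrC ler_wpM2l//; lra.
have r2 : rho * rho * D <= rho / 192 * D by rewrite ler_wpM2r.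
have r3 : 0 <= rho * D by rewrite mulr_ge0.
lra.
Qed.

End lipschitz_dependence.

(** * Floquet exponents *)

Section trigonometry.
Variable R : realType.
Implicit Types x y z : R.

Lemma sinD_npi z n : sin (z + n%:R * pi) = (-1) ^+ n * sin z.
Proof.
elim: n => [|n ih]; first by rewrite mul0r addr0 expr0 mul1r.
have -> : z + n.+1%:R * pi = (z + n%:R * pi) + pi by rewrite -[n.+1%:R]natr1; ring.
by rewrite sinDpi ih exprS; ring.
Qed.

Lemma cosD_npi z n : cos (z + n%:R * pi) = (-1) ^+ n * cos z.
Proof.
elim: n => [|n ih]; first by rewrite mul0r addr0 expr0 mul1r.
have -> : z + n.+1%:R * pi = (z + n%:R * pi) + pi by rewrite -[n.+1%:R]natr1; ring.
by rewrite cosDpi ih exprS; ring.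
Qed.

Lemma trig_half n : ((sin (pi * (n%:R / 2 : R)) == 0) = ~~ odd n) *
  ((cos (pi * (n%:R / 2 : R)) == 0) = odd n).
Proof.
have s0 : ((-1) ^+ n./2 != 0 :> R) by rewrite signr_eq0.
have e : pi * (n%:R / 2 : R) = (odd n)%:R * (pi / 2) + n./2%:R * pi.
  have en : n%:R = (odd n)%:R + n./2%:R * 2 :> R.
    by rewrite -{1}(odd_double_half n) natrD -muln2 natrM.
  by rewrite en; lra.
rewrite e sinD_npi cosD_npi !mulf_eq0 (negbTE s0) /=.
case: (odd n); rewrite ?mul1r ?mul0r ?sin0 ?cos0 ?sin_pihalf ?cos_pihalf ?eqxx ?oner_eq0//.
Qed.

(** Either condition gives sin (2 pi x) = 0. Removing the integer part of 2 x leaves a zero of [sin]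
    in [0, pi[, which can only be 0. *)
Lemma trig_zero x : 0 < x -> sin (pi * x) = 0 \/ cos (pi * x) = 0 ->
  exists2 n : nat, (0 < n)%N & x = n%:R / 2.
Proof.
move=> x0 h.
have s0 : sin (2 * x * pi) = 0.
  have -> : 2 * x * pi = pi * x + pi * x by ring.
  by rewrite sinD; case: h => ->; rewrite !(mul0r, mulr0) addr0.
have y0 : 0 <= 2 * x by rewrite mulr_ge0// ltW.
have /andP[n1 n2] := truncn_itv y0; set n := Num.truncn (2 * x) in n1 n2.
have s1 : sin ((2 * x - n%:R) * pi) = 0.
  have e : 2 * x * pi = (2 * x - n%:R) * pi + n%:R * pi by ring.
  by move: s0; rewrite e sinD_npi => /eqP; rewrite mulf_eq0 signr_eq0 /= => /eqP.
have xn : 2 * x = n%:R.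
  apply/eqP; rewrite eq_le n1 andbT leNgt; apply/negP => lt.
  have : 0 < sin ((2 * x - n%:R) * pi).
    apply: sin_gt0_pi; rewrite mulr_gt0 ?subr_gt0 ?pi_gt0//=.
    by rewrite -[ltRHS]mul1r ltr_pM2r ?pi_gt0// ltrBlDr addrC natr1.
  by rewrite s1 ltxx.
exists n; last by rewrite -xn; lra.
by rewrite -(ltr_nat R) -xn mulr_gt0.
Qed.

Lemma atan_lip x y : `|atan x - atan y| <= `|x - y|.
Proof.
wlog xy : x y / y <= x.
  move=> H; have [/H//|/ltW/H] := leP y x; by rewrite distrC (distrC y).
have b z : y <= z <= x -> `|(1 + z ^+ 2)^-1| <= 1.
  have z2 := sqr_ge0 z.
  by move=> _; rewrite ger0_norm ?invr_ge0 ?invf_le1//; lra.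
have := mvt_bound xy (fun z _ => is_derive1_atan z) b.
by rewrite mul1r (ger0_norm (_ : 0 <= x - y))// subr_ge0.
Qed.

(** This is what makes the eigenvalues of a symmetric matrix of size 2 Lipschitz in its entries even
    where they cross. *)
Lemma hypot_lip (a b c d : R) :
  `|Num.sqrt (a ^+ 2 + b ^+ 2) - Num.sqrt (c ^+ 2 + d ^+ 2)| <= `|a - c| + `|b - d|.
Proof.
have half (a' b' c' d' : R) : Num.sqrt (a' ^+ 2 + b' ^+ 2) <=
    Num.sqrt (c' ^+ 2 + d' ^+ 2) + (`|a' - c'| + `|b' - d'|).
  set r := Num.sqrt (c' ^+ 2 + d' ^+ 2).
  have r2 : r ^+ 2 = c' ^+ 2 + d' ^+ 2 by rewrite sqr_sqrtr// addr_ge0 ?sqr_ge0.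
  have r0 : 0 <= r by exact: sqrtr_ge0.
  have cr : `|c'| <= r by rewrite -sqrtr_sqr ler_wsqrtr// lerDl sqr_ge0.
  have dr : `|d'| <= r by rewrite -sqrtr_sqr ler_wsqrtr// lerDr sqr_ge0.
  have x0 : 0 <= `|a' - c'| by []. have y0 : 0 <= `|b' - d'| by [].
  have ha : `|a'| <= `|c'| + `|a' - c'|.
    by have := ler_normD c' (a' - c'); rewrite addrC subrK.
  have hb : `|b'| <= `|d'| + `|b' - d'|.
    by have := ler_normD d' (b' - d'); rewrite addrC subrK.
  rewrite -[leRHS]ger0_norm ?addr_ge0// -sqrtr_sqr ler_wsqrtr//.
  have a2 : a' ^+ 2 <= (`|c'| + `|a' - c'|) ^+ 2 by rewrite -real_normK ?num_real// lerXn2r ?nnegrE ?addr_ge0.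
  have b2 : b' ^+ 2 <= (`|d'| + `|b' - d'|) ^+ 2 by rewrite -real_normK ?num_real// lerXn2r ?nnegrE ?addr_ge0.
  have c2 : c' ^+ 2 = `|c'| ^+ 2 by rewrite real_normK ?num_real.
  have d2 : d' ^+ 2 = `|d'| ^+ 2 by rewrite real_normK ?num_real.
  rewrite c2 d2 in r2; move: a2 b2 r2 cr dr x0 y0 r0.
  set X := `|a' - c'|; set Y := `|b' - d'|; set cc := `|c'|; set dd := `|d'|.
  move=> a2 b2 r2 cr dr x0 y0 r0.
  have p1 : cc * X <= r * X by rewrite ler_wpM2r.
  have p2 : dd * Y <= r * Y by rewrite ler_wpM2r.
  have p3 : 0 <= X * Y by rewrite mulr_ge0.
  by rewrite (le_trans (lerD a2 b2))//; nra.
have h1 := half a b c d; have h2 := half c d a b.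
by rewrite (distrC c) (distrC d) in h2; rewrite ler_norml; apply/andP; split; lra.
Qed.

End trigonometry.

Section floquet_exponents.
Variables (R : realType) (L rho : R).
Hypotheses (L0 : 0 < L) (L8 : L <= 8) (rho_small : rho <= 1 / 9600).
Implicit Types (p : R -> R) (k : R) (b : bool).

Let rs : rho <= 1 / 192. Proof. by have := rho_small; lra. Qed.

Definition S11 k p := Sm L k p (fun x => cos (k * x)) (fun x => cos (k * x)).
Definition S12 k p := Sm L k p (fun x => cos (k * x)) (fun x => sin (k * x)).
Definition S22 k p := Sm L k p (fun x => sin (k * x)) (fun x => sin (k * x)).

(** Half the gap between the two eigenvalues of the symmetric matrix; in [ev] the flag [true]
    selects the larger one. *)
Definition rad k p := Num.sqrt (((S11 k p - S22 k p) / 2) ^+ 2 + S12 k p ^+ 2).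
Definition ev b k p := (S11 k p + S22 k p) / 2 + (if b then rad k p else - rad k p).

Lemma ev_sum k p : ev true k p + ev false k p = S11 k p + S22 k p.
Proof. by rewrite /ev; lra. Qed.

Lemma ev_prod k p : ev true k p * ev false k p = S11 k p * S22 k p - S12 k p ^+ 2.
Proof.
have r2 : rad k p ^+ 2 = ((S11 k p - S22 k p) / 2) ^+ 2 + S12 k p ^+ 2.
  by rewrite sqr_sqrtr// addr_ge0 ?sqr_ge0.
have -> : ev true k p * ev false k p = ((S11 k p + S22 k p) / 2) ^+ 2 - rad k p ^+ 2.
  by rewrite /ev; ring.
by rewrite r2; field.
Qed.

(* With L = 2 pi the kernels above are nontrivial iff 2 (k - eta k) is an
   integer, even for periodic and odd for antiperiodic solutions. *)
Definition eta b k p : R := atan (ev b k p) / pi.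

Lemma eta_le k p : eta false k p <= eta true k p.
Proof.
rewrite /eta ler_pM2r ?invr_gt0 ?pi_gt0//.
have e : ev false k p <= ev true k p.
  by rewrite /ev lerD2l (le_trans (_ : _ <= 0)) ?oppr_le0 ?sqrtr_ge0.
by move: e; rewrite le_eqVlt => /predU1P[->//|/lt_atan/ltW].
Qed.

Section estimates.
Variables (k k' : R) (p p' : R -> R).
Hypotheses (hk : 1 / 32 <= k) (hk' : 1 / 32 <= k').
Hypotheses (pp : potential L rho p) (pp' : potential L rho p').

Lemma ev_bound b : `|ev b k p| <= 3 * (rho / k).
Proof.
have h1 := Sm_bound L0 rs (@wave_cos R) (@wave_cos R) hk pp.
have h2 := Sm_bound L0 rs (@wave_cos R) (@wave_sin R) hk pp.
have h3 := Sm_bound L0 rs (@wave_sin R) (@wave_sin R) hk pp.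
have := hypot_lip ((S11 k p - S22 k p) / 2) (S12 k p) 0 0.
rewrite expr0n addr0 sqrtr0 !subr0 -/(rad k p) => h4.
have h5 : `|(S11 k p - S22 k p) / 2| <= rho / k.
  move: h1 h3; rewrite -/(S11 k p) -/(S22 k p) !ler_norml => /andP[? ?] /andP[? ?].
  by apply/andP; split; lra.
move: h1 h2 h3 h4 h5; rewrite -/(S11 k p) -/(S22 k p) -/(S12 k p) /ev.
set r := rho / k => h1 h2 h3 h4 h5.
have : `|rad k p| <= 2 * r by lra.
move: h1 h3; rewrite !ler_norml => /andP[? ?] /andP[? ?] /andP[? ?].
by case: b; apply/andP; split; lra.
Qed.

Lemma eta_bound b : `|eta b k p| <= 2 * rho / k.
Proof.
have := atan_lip (ev b k p) 0; rewrite atan0 !subr0 => h1.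
have h2 := ev_bound b.
have r0 := rho_ge0 pp.
have k0 : 0 < k by have := hk; lra.
have rk0 : 0 <= rho / k by rewrite divr_ge0// ltW.
rewrite /eta normrM normfV (gtr0_norm (pi_gt0 _)) ler_pdivrMr ?pi_gt0//.
have := pi_ge2 R => p2.
have : rho / k * 2 <= rho / k * pi by rewrite ler_wpM2l.
have -> : 2 * rho / k * pi = 2 * (rho / k * pi) by ring.
lra.
Qed.

(** If the entries vary by at most m, the eigenvalues vary by at most 3 m and, as pi >= 2, eta by at
    most 3 m / 2. The requirement (3/2) * 64 * 50 * rho <= 1/2 is exactly rho <= 1/9600. *)
Lemma eta_lip b : `|eta b k p - eta b k' p'| <=
  1 / 2 * `|k - k'| + 96 * I 0 L (fun t => `|p t - p' t|).
Proof.
have h1 := Sm_lip L0 L8 rs (@wave_cos R) (@wave_cos R) hk hk' pp pp'.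
have h2 := Sm_lip L0 L8 rs (@wave_cos R) (@wave_sin R) hk hk' pp pp'.
have h3 := Sm_lip L0 L8 rs (@wave_sin R) (@wave_sin R) hk hk' pp pp'.
have := hypot_lip ((S11 k p - S22 k p) / 2) (S12 k p) ((S11 k' p' - S22 k' p') / 2) (S12 k' p').
rewrite -/(rad k p) -/(rad k' p') => h4.
have r0 := rho_ge0 pp.
move: h1 h2 h3; rewrite -/(S11 k p) -/(S22 k p) -/(S12 k p) -/(S11 k' p') -/(S22 k' p') -/(S12 k' p').
set m := 64 * 50 * rho * _ + _; move=> h1 h2 h3.
have h5 : `|(S11 k p - S22 k p) / 2 - (S11 k' p' - S22 k' p') / 2| <= m.
  move: h1 h3; rewrite !ler_norml => /andP[? ?] /andP[? ?].
  by apply/andP; split; lra.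
have h6 : `|rad k p - rad k' p'| <= 2 * m by lra.
have h7 : `|ev b k p - ev b k' p'| <= 3 * m.
  move: h1 h3 h6; rewrite /ev !ler_norml => /andP[? ?] /andP[? ?] /andP[? ?].
  by case: b; apply/andP; split; lra.
have h8 := le_trans (atan_lip _ _) h7.
have m0 : 0 <= m by exact: le_trans h1.
have p2 := pi_ge2 R.
have : `|eta b k p - eta b k' p'| <= 3 / 2 * m.
  rewrite /eta -mulrBl normrM normfV (gtr0_norm (pi_gt0 _)) ler_pdivrMr ?pi_gt0//.
  by have : m * 2 <= m * pi by [rewrite ler_wpM2l|]; lra.
move/le_trans; apply; rewrite /m.
have d0 : 0 <= `|k - k'| by [].
have : rho * `|k - k'| <= 1 / 9600 * `|k - k'| by rewrite ler_wpM2r.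
lra.
Qed.

End estimates.

Lemma eta_small b k p : 1 / 32 <= k -> potential L rho p -> `|eta b k p| < 1 / 32.
Proof.
move=> hk pp; rewrite (le_lt_trans (eta_bound hk pp b))//.
have r0 := rho_ge0 pp; have := inv_le32 hk => /andP[i0 i1].
have : rho * k^-1 <= 1 / 9600 * 32 by apply: ler_pM.
by rewrite -mulrA; lra.
Qed.

Lemma Ipp0 p : I 0 L (fun t => `|p t - p t|) = 0.
Proof.
by rewrite (eqI (g := fun=> 0)) ?(Icst _ (ltW L0)) ?mul0r// => t _; rewrite subrr normr0.
Qed.

Lemma eta_mono b k k' p : 1 / 32 <= k -> k <= k' -> potential L rho p ->
  (k' - k) / 2 <= (k' - eta b k' p) - (k - eta b k p).
Proof.
move=> hk kk pp; have hk' : 1 / 32 <= k' by lra.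
have := eta_lip hk' hk pp pp b; rewrite Ipp0 mulr0 addr0.
rewrite (ger0_norm (_ : 0 <= k' - k)) ?subr_ge0// ler_norml => /andP[? ?]; lra.
Qed.

Lemma eta_cont b k p : 1 / 32 < k -> potential L rho p ->
  {for k, continuous (fun k => k - eta b k p)}.
Proof.
move=> hk pp; apply/cont_epsP => e e0; exists (Num.min (e / 2) (k - 1 / 32)).
  by rewrite lt_min divr_gt0//= subr_gt0.
move=> y; rewrite le_min => /andP[y1 y2].
have hy : 1 / 32 <= y by move: y2; rewrite ler_norml => /andP[? ?]; lra.
have := eta_lip hy (ltW hk) pp pp b; rewrite Ipp0 mulr0 addr0 => h.
have := ler_normB (y - k) (eta b y p - eta b k p).
have -> : y - k - (eta b y p - eta b k p) = y - eta b y p - (k - eta b k p) by ring.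
lra.
Qed.

(** The half-width 1/8 exceeds |eta| < 1/32, so that the window contains a root, and it keeps the
    windows of successive j disjoint. *)
Definition is_root b p (j : nat) : set R :=
  [set k | [/\ j%:R / 2 - 1 / 8 <= k, k <= j%:R / 2 + 1 / 8 & k - eta b k p = j%:R / 2]].

Definition kroot b p j := xget 0 (is_root b p j).

Section roots.
Variables (p : R -> R).
Hypotheses (pp : potential L rho p).

Lemma nat_half (j : nat) : (0 < j)%N -> 1 / 2 <= j%:R / 2 :> R.
Proof. by move=> j0; rewrite ler_wpM2r// ler1n. Qed.

Lemma krootP b j : (0 < j)%N -> is_root b p j (kroot b p j).
Proof.
move=> j0; apply: xgetPex; have h := nat_half j0.
set lo : R := j%:R / 2 - 1 / 8; set hi : R := j%:R / 2 + 1 / 8.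
have lohi : lo <= hi by rewrite /lo /hi; lra.
have hlo : 1 / 32 <= lo by rewrite /lo; lra.
have hhi : 1 / 32 <= hi by rewrite /hi; lra.
have e1 := eta_small b hlo pp; have e2 := eta_small b hhi pp.
move: e1 e2; rewrite !ltr_norml => /andP[? ?] /andP[? ?].
have m1 : lo - eta b lo p <= j%:R / 2 by rewrite {1}/lo; lra.
have m2 : j%:R / 2 <= hi - eta b hi p by rewrite {1}/hi; lra.
have [||k kk kE] := @IVT R (fun k => k - eta b k p) lo hi (j%:R / 2) lohi.
- apply: continuous_in_subspaceT => x; rewrite inE/= in_itv/= => /andP[x1 x2].
  by apply: eta_cont => //; rewrite (lt_le_trans _ x1)// /lo; lra.
- by rewrite ge_min le_max m1 m2 orbT.
by move: kk; rewrite in_itv/= => /andP[k1 k2]; exists k.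
Qed.

Lemma kroot_ge b j : (0 < j)%N -> 3 / 8 <= kroot b p j.
Proof. by move=> j0; have [] := krootP b j0; have := nat_half j0; lra. Qed.

(** Strict monotonicity of k - eta makes the root unique among all k >= 1/32, not only within its
    window. *)
Lemma kroot_uniq b j k : (0 < j)%N -> 1 / 32 <= k -> k - eta b k p = j%:R / 2 -> k = kroot b p j.
Proof.
move=> j0 hk kE; have [_ _ rE] := krootP b j0; have rg := kroot_ge b j0.
have hr : 1 / 32 <= kroot b p j by lra.
apply/eqP; rewrite eq_le; have [le|lt] := leP k (kroot b p j).
  by have := eta_mono b hk le pp; rewrite kE rE; lra.
by have := eta_mono b hr (ltW lt) pp; rewrite kE rE; lra.
Qed.

Lemma kroot_le j : (0 < j)%N -> kroot false p j <= kroot true p j.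
Proof.
move=> j0; have [_ _ fE] := krootP false j0; have [_ _ tE] := krootP true j0.
have gt := kroot_ge true j0; have hr : 1 / 32 <= kroot true p j by lra.
rewrite leNgt; apply/negP => lt.
have := eta_mono false hr (ltW lt) pp; have := eta_le (kroot true p j) p; lra.
Qed.

(** The root exceeds j / 3, so the bound 2 rho / k for eta is at most 6 rho / j. *)
Lemma kroot_close b j : (0 < j)%N -> `|kroot b p j - j%:R / 2| <= 6 * rho / j%:R.
Proof.
move=> j0; have [h1 _ rE] := krootP b j0; have rg := kroot_ge b j0.
have hr : 1 / 32 <= kroot b p j by lra.
have -> : kroot b p j - j%:R / 2 = eta b (kroot b p j) p by rewrite -rE; ring.
rewrite (le_trans (eta_bound hr pp b))// -mulrA -[leRHS]mulrA.
have r0 := rho_ge0 pp.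
have -> : 6 * (rho / j%:R) = 2 * (rho * (j%:R / 3)^-1) by rewrite invf_div; ring.
have j0' : 0 < j%:R :> R by rewrite ltr0n.
rewrite ler_wpM2l// ler_wpM2l// lef_pV2 ?posrE; [|lra|by rewrite divr_gt0].
by have := nat_half j0; lra.
Qed.

End roots.

(** Both roots solve k - eta = j / 2, so their distance D equals the difference of the two values of
    eta, at most D / 2 plus 96 times the distance of the potentials. Absorbing D / 2 doubles the
    96. *)
Lemma kroot_lip b j p p' : (0 < j)%N -> potential L rho p -> potential L rho p' ->
  `|kroot b p j - kroot b p' j| <= 192 * I 0 L (fun t => `|p t - p' t|).
Proof.
move=> j0 pp pp'; have [_ _ rE] := krootP pp b j0; have [_ _ rE'] := krootP pp' b j0.
move: rE rE' (kroot_ge pp b j0) (kroot_ge pp' b j0).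
move: (kroot b p j) (kroot b p' j) => x y rE rE' rg rg'.
have hr : 1 / 32 <= x by lra.
have hr' : 1 / 32 <= y by lra.
have := eta_lip hr hr' pp pp' b.
have -> : eta b x p - eta b y p' = x - y.
  by move: rE rE'; move: (eta b x p) (eta b y p') => u v *; lra.
by move: (I _ _ _) => D; lra.
Qed.

End floquet_exponents.

(** * Quasi-periodic extension *)

Section local_shift.
Variable R : realType.
Implicit Types (a b c : R) (u w f : R -> R).

(** Cutting f off outside the interval gives a function measurable on the whole line, to which the
    translation lemmas apply. *)
Lemma shift_loc a b c f : itg (a + c) (b + c) f ->
  itg a b (fun x => f (x + c)) /\ I a b (fun x => f (x + c)) = I (a + c) (b + c) f.
Proof.
move=> hf.
pose g := f \_ `[a + c, b + c].
have gE x : a + c <= x <= b + c -> g x = f x.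
  by move=> hx; rewrite /g patchE ifT// inE/= in_itv.
have mg : measurable_fun [set: R] g.
  apply/(measurable_restrictT _ _).1 => //.
  by move/integrableP : hf => [/measurable_EFinP].
have ig : itg (a + c) (b + c) g by apply: eq_itg hf => x hx; rewrite gE.
have e x : a <= x <= b -> g (x + c) = f (x + c).
  by move=> /andP[? ?]; rewrite gE// !lerD2r; apply/andP.
split; first exact: eq_itg e (itg_shift mg ig).
by rewrite -(eqI e) I_shift//; apply: eqI => x hx; rewrite gE.
Qed.

Lemma itg_cat a b c f : a <= b -> b <= c -> itg a b f -> itg b c f -> itg a c f.
Proof.
move=> ab bc h1 h2; rewrite /itg.
have h2' : lebesgue_measure.-integrable `]b, c] (EFin \o f).
  by apply: integrableS h2 => //; apply: subset_itvr; rewrite bnd_simp.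
have mk (D : set R) : measurable D -> (@lebesgue_measure R).-integrable D (EFin \o f) <->
    (@lebesgue_measure R).-integrable setT ((EFin \o f) \_ D).
  by move=> mD; exact: integrable_mkcond.
have {}h1 := (mk _ (measurable_itv _)).1 h1.
have {}h2' := (mk _ (measurable_itv _)).1 h2'.
apply: (mk _ (measurable_itv _)).2.
have := integrableD measurableT h1 h2'.
apply: eq_integrable => // x _ /=; rewrite !patchE !mem_setE !in_itv/=.
have [xa|ax] := leP a x; have [xb|bx] := leP x b => //=.
- by rewrite (le_trans xb bc) adde0.
- by case: (x <= c); rewrite add0e.
- by rewrite adde0.
- by have := lt_trans bx ax; rewrite ltNge ab.
Qed.

Lemma acon_cat a b c u w : a <= b -> b <= c -> acon a b u w -> acon b c u w -> acon a c u w.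
Proof.
move=> ab bc [i1 h1] [i2 h2]; have hi := itg_cat ab bc i1 i2; split => // y z ay yz zc.
have [zb|/ltW bz] := leP z b; first exact: h1.
have [yb|/ltW by_] := leP y b; last exact: h2.
rewrite (chasles yb bz); last exact: itgS hi.
by rewrite -h1// -h2//; ring.
Qed.

Lemma acon_cont a b u w x : acon a b u w -> a < x < b -> {for x, continuous u}.
Proof.
move=> hu /andP[ax xb].
have ab : a <= b by rewrite ltW// (lt_trans ax).
have c1 : {within `[a, b], continuous (fun x => I a x w)}.
  exact: parameterized_integral_continuous ab hu.1.
have c2 : {within `]a, b[, continuous (fun x => I a x w)}.
  by apply: continuous_subspaceW c1; exact: subset_itv_oo_cc.
rewrite continuous_open_subspace in c2; last exact: interval_open.
have xi : x \in (`]a, b[%classic : set R) by rewrite inE/= in_itv/= ax.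
have := c2 x xi => /cont_epsP c3; apply/cont_epsP => e e0.
have [d d0 hd] := c3 e e0.
exists (Num.min d (Num.min (x - a) (b - x))).
  by rewrite !lt_min d0 !subr_gt0 ax.
move=> y; rewrite !le_min => /and3P[y1 y2 y3].
have hy : a <= y <= b by move: y2 y3; rewrite !ler_norml => /andP[? ?] /andP[? ?]; apply/andP; split; lra.
rewrite (acon_eq hu hy) (acon_eq hu (x := x)) ?(ltW ax) ?(ltW xb)//.
have -> : u a + I a y w - (u a + I a x w) = I a y w - I a x w by ring.
exact: hd.
Qed.

End local_shift.

(** * Gluing translated cells *)

Section gluing.
Variables (R : realType) (L : R).
Hypothesis L0 : 0 < L.
Implicit Types (s x y : R) (u w f : R -> R) (n : int).

(* the extension of f from [0, L] to R with multiplier s over the period L *)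
Definition ext s f x := s ^ (Num.floor (x / L)) * f (x - L * (Num.floor (x / L))%:~R).

Let Ln0 : L != 0. Proof. by rewrite gt_eqF. Qed.

Lemma floor_cell n x : n%:~R * L <= x -> x < (n + 1)%:~R * L -> Num.floor (x / L) = n.
Proof. by move=> h1 h2; apply: floor_def; rewrite ler_pdivlMr// ltr_pdivrMr// h1. Qed.

Lemma floor_addL x n : Num.floor ((x + n%:~R * L) / L) = Num.floor (x / L) + n.
Proof.
rewrite mulrDl -mulrA divff// mulr1 floorDrz ?rpred_int//.
by rewrite intrKfloor.
Qed.

Lemma ext_quasi s f x : s != 0 -> ext s f (x + L) = s * ext s f x.
Proof.
move=> s0; have := floor_addL x 1; rewrite mul1r /ext => ->.
rewrite exprzDr ?unitfE// expr1z intrD mulrA [s * _]mulrC; congr (_ * f _); ring.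
Qed.

(** In [ext] the right end of a cell belongs to the next cell; f L = s f 0 makes the two formulas
    agree there. *)
Lemma ext_cell s f n x : s != 0 -> f L = s * f 0 ->
  n%:~R * L <= x -> x <= (n + 1)%:~R * L -> ext s f x = s ^ n * f (x - n%:~R * L).
Proof.
move=> s0 fL h1; rewrite le_eqVlt => /predU1P[->|h2]; last first.
  by rewrite /ext (floor_cell h1 h2) [L * _]mulrC.
have h3 : (n + 1)%:~R * L < (n + 1 + 1)%:~R * L by rewrite ltr_pM2r// ltr_int ltzD1.
rewrite /ext (floor_cell (lexx _) h3) [L * _]mulrC subrr.
rewrite exprzDr ?unitfE// expr1z -mulrA -fL; congr (_ * f _).
rewrite intrD; ring.
Qed.

Lemma ext_in s f x : s != 0 -> f L = s * f 0 -> 0 <= x <= L -> ext s f x = f x.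
Proof.
move=> s0 fL /andP[x0 xL].
have := @ext_cell s f 0 x s0 fL; rewrite add0r !mul0r mul1r subr0 expr0z mul1r.
by apply.
Qed.

Lemma quasi_int s f : s != 0 -> (forall x, f (x + L) = s * f x) ->
  forall n y, f (y + n%:~R * L) = s ^ n * f y.
Proof.
move=> s0 hf n.
elim/int_rect: n => [y|n ih y|n ih y].
- by rewrite mul0r addr0 expr0z mul1r.
- have -> : y + n.+1%:~R * L = (y + n%:~R * L) + L by rewrite -[n.+1]addn1 PoszD intrD; ring.
  by rewrite hf ih exprSz mulrA.
- have := hf (y + (- n.+1%:Z)%:~R * L).
  have -> : y + (- n.+1%:Z)%:~R * L + L = y + (- n%:Z)%:~R * L.
    by rewrite -[n.+1]addn1 PoszD opprD intrD; ring.
  rewrite ih => h; apply: (mulfI s0); rewrite -h mulrA; congr (_ * _).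
  rewrite -{2}[s]expr1z -exprzDr ?unitfE//; congr (_ ^ _).
  by rewrite -addn1 PoszD; ring.
Qed.

Lemma ext_self s f : s != 0 -> (forall x, f (x + L) = s * f x) -> ext s f = f.
Proof.
move=> s0 hf; apply/funext => x; rewrite /ext -(quasi_int s0 hf); congr f; ring.
Qed.

Lemma ext_acon_cell s u w n : s != 0 -> u L = s * u 0 -> w L = s * w 0 -> acon 0 L u w ->
  acon (n%:~R * L) ((n + 1)%:~R * L) (ext s u) (ext s w).
Proof.
move=> s0 uL wL [iw hu]; set c := n%:~R * L.
have cE : (n + 1)%:~R * L = L + c by rewrite intrD /c; ring.
have e0 : c + - c = 0 by ring.
have eL : L + c + - c = L by ring.
have Ew x : c <= x <= L + c -> ext s w x = s ^ n * w (x + - c).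
  by rewrite -cE => /andP[h1 h2]; rewrite (ext_cell s0 wL h1 h2).
have Eu x : c <= x <= L + c -> ext s u x = s ^ n * u (x + - c).
  by rewrite -cE => /andP[h1 h2]; rewrite (ext_cell s0 uL h1 h2).
rewrite cE; split.
  apply: (@eq_itg _ _ _ (fun x => s ^ n * w (x + - c))); first by move=> x hx; rewrite Ew.
  by apply: itgZ; apply: (shift_loc _).1; rewrite e0 eL.
move=> y z cy yz zc.
have hz : c <= z <= L + c by rewrite zc (le_trans cy).
have hy : c <= y <= L + c by rewrite cy (le_trans yz).
have y0 : 0 <= y + - c by rewrite subr_ge0.
have zL : z + - c <= L by rewrite lerBlDr.
have yz' : y + - c <= z + - c by rewrite lerD2r.
have iw' : itg (y + - c) (z + - c) w by exact: itgS iw.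
have [j1 j2] := shift_loc iw'.
rewrite Eu// Eu// -mulrBr hu// -j2 -IZ//.
apply: eqI => x /andP[yx xz]; rewrite Ew// (le_trans cy yx)/=.
exact: le_trans xz zc.
Qed.

Lemma ext_acon s u w (N : nat) : s != 0 -> u L = s * u 0 -> w L = s * w 0 -> acon 0 L u w ->
  acon (- (N.+1%:R * L)) (N.+1%:R * L) (ext s u) (ext s w).
Proof.
move=> s0 uL wL hu; have C n := ext_acon_cell n s0 uL wL hu.
elim: N => [|N ih].
  have := C 0; have := C (-1); rewrite addNr add0r mul0r.
  rewrite (_ : (-1)%:~R * L = - (1%:R * L)); last by rewrite mulNr.
  by apply: acon_cat; rewrite ?oppr_le0 mul1r ltW.
have NL : N.+1%:R * L <= N.+2%:R * L by rewrite ler_wpM2r ?ler_nat// ltW.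
have N0 : 0 <= N.+1%:R * L by rewrite mulr_ge0// ltW.
have c1 := C N.+1; have c2 := C (- N.+2%:Z).
apply: (@acon_cat _ _ (N.+1%:R * L)) => //; first by lra.
  apply: (@acon_cat _ _ (- (N.+1%:R * L))); [by rewrite lerN2|by lra| |exact: ih].
  move: c2; rewrite (_ : (- N.+2%:Z)%:~R * L = - (N.+2%:R * L)); last by rewrite intrN mulNr.
  rewrite (_ : (- N.+2%:Z + 1)%:~R * L = - (N.+1%:R * L))//.
  by rewrite -[N.+2]addn1 PoszD opprD addrNK intrN mulNr.
have e : (Posz N.+1 + 1)%:~R = N.+2%:R :> R by rewrite intrD -[N.+2]addn1 natrD.
by rewrite e in c1.
Qed.

Lemma within_cells (x : R) : exists N : nat, - (N.+1%:R * L) < x < N.+1%:R * L.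
Proof.
exists (Num.bound (`|x| / L)); have := archi_boundP (divr_ge0 (normr_ge0 x) (ltW L0)).
rewrite ltr_pdivrMr// => h.
rewrite -ltr_norml (lt_le_trans h)// ler_wpM2r ?ler_nat// ltW//.
Qed.

Lemma ext_acon_all s u w a b : s != 0 -> u L = s * u 0 -> w L = s * w 0 -> acon 0 L u w ->
  acon a b (ext s u) (ext s w).
Proof.
move=> s0 uL wL hu.
have [n /andP[n1 n2]] := within_cells a; have [m /andP[m1 m2]] := within_cells b.
have [ih hh] := ext_acon (n + m) s0 uL wL hu.
have k1 : (- ((n + m).+1%:R * L) <= a).
  by rewrite (le_trans _ (ltW n1))// lerN2 ler_wpM2r ?ler_nat ?(ltW L0)// ltnS leq_addr.
have k2 : (b <= (n + m).+1%:R * L).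
  by rewrite (le_trans (ltW m2))// ler_wpM2r ?ler_nat ?(ltW L0)// ltnS leq_addl.
split; first exact: itgS ih.
move=> y z ay yz zb; apply: hh => //; first exact: le_trans k1 ay.
exact: le_trans zb k2.
Qed.

End gluing.

(** * Solutions on the line and on one period *)

Section hill.
Variables (R : realType) (q : R -> R).
Notation L := (2 * pi : R).
Notation P := (periodize q).
Hypothesis iP : itg 0 L P.
Let L0 : 0 < L. Proof. by rewrite mulr_gt0// pi_gt0. Qed.

Lemma periodizeE : P = ext L 1 q.
Proof. by apply/funext => x; rewrite /ext exp1rz mul1r. Qed.

Lemma periodize_per x : P (x + L) = P x.
Proof. by rewrite periodizeE ext_quasi ?oner_eq0// mul1r. Qed.

(** Because h L = s h 0 the glued h is absolutely continuous across the ends of the cells, hence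
    continuous, and so it is the classical derivative of the glued f. *)
Lemma hill_of_sol (s mu : R) f h : s != 0 ->
  sol L (fun x => P x - mu) f h -> f L = s * f 0 -> h L = s * h 0 ->
  hill_solution q mu (ext L s f).
Proof.
move=> s0 [fh hs] fL hL.
set w := fun x => (P x - mu) * f x in hs.
have wL : w L = s * w 0.
  by rewrite /w fL -{1}[L]add0r periodize_per; ring.
have hE (x : R) : is_derive x 1 (ext L s f) (ext L s h x).
  have [N hN] := within_cells L0 x.
  have [aN hf] := ext_acon L0 N s0 fL hL fh.
  have ah := ext_acon L0 N s0 hL wL hs.
  apply: (derive_of_increments hN aN) => //; exact: acon_cont ah hN.
split=> [x|a b ab]; first exact: (@ex_derive _ _ _ _ _ _ _ (hE x)).
rewrite !derive1E !(@derive_val _ _ _ _ _ _ _ (hE _)).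
have [_ H] := ext_acon_all L0 a b s0 hL wL hs.
rewrite (H a b)//; apply: eqI => x _.
have PE y n : P (y - L * n%:~R) = P y.
  have hP z : P (z + L) = 1 * P z by rewrite periodize_per mul1r.
  have := quasi_int (oner_neq0 _) hP (- n) y; rewrite exp1rz mul1r intrN => <-.
  congr P; ring.
by rewrite /ext /w PE; ring.
Qed.

Lemma sol_of_hill (s mu : R) f : s != 0 -> hill_solution q mu f ->
  (forall x, f (x + L) = s * f x) ->
  [/\ sol L (fun x => P x - mu) f (derive1 f), f L = s * f 0 & derive1 f L = s * derive1 f 0].
Proof.
move=> s0 [df hf] fs.
have dF (x : R) : is_derive x 1 f (derive1 f x).
  by rewrite derive1E; apply: DeriveDef.
have fc x : {for x, continuous f} by exact: is_derive_cont.
have iPa a b : itg a b P.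
  (* After subtraction of the mean c, the primitive takes equal values at 0 and L. The gluing lemma
     then gives integrability of P over every interval. *)
  pose c := I 0 L P / L.
  have Ln0 : L != 0 by rewrite gt_eqF.
  have iPc : itg 0 L (fun x => P x - c) by apply: itgB => //; exact: itg_cst.
  have aP := acon_int 0 iPc.
  have [] := ext_acon_all L0 a b (oner_neq0 R) _ _ aP.
  - rewrite I0 IB//; last exact: itg_cst.
    rewrite Icst ?(ltW L0)// /c.
    by rewrite [L - 0]subr0 divfK// subrr; ring.
  - by rewrite -{1}[L]add0r periodize_per mul1r.
  - rewrite ext_self ?oner_neq0//; last by move=> x; rewrite periodize_per mul1r.
    move=> h _; have := itgD h (itg_cst a b c); apply: eq_itg => x _; ring.
have iW a b : itg a b (fun x => (P x - mu) * f x).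
  have [C hC] : exists C, forall x, a <= x <= b -> `|f x| <= C.
    have [ba|ab] := ltP b a.
      by exists 0 => x /andP[ax xb]; have := lt_le_trans ba (le_trans ax xb); rewrite ltxx.
    have cf : {within `[a, b], continuous (fun x => `|f x|)}.
      apply: continuous_in_subspaceT => x _; apply: (@continuous_comp _ _ _ f) => //.
      exact: norm_continuous.
    have [c' _ hc] := EVT_max ab cf.
    by exists `|f c'| => x hx; apply: hc; rewrite in_itv/=.
  apply: itg_mul hC; [by apply: itgB => //; exact: itg_cst|].
  by apply: cont_meas => x _; exact: fc.
have af' a b : acon a b (derive1 f) (fun x => (P x - mu) * f x).
  by split=> // y z _ yz _; rewrite hf.
have f'c x : {for x, continuous (derive1 f)}.
  by apply: (acon_cont (af' (x - 1) (x + 1))); apply/andP; split; lra.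
split; [split; [exact: acon_smooth|exact: af']| |].
  by have := fs 0; rewrite add0r.
have d1 : is_derive (0 : R) 1 (fun x => f (x + L)) (derive1 f L * 1).
  apply: (dcomp (g := fun x => x + L)); first by rewrite add0r.
  by apply: (is_derive_eq (dD (did 0) (dcst L 0))); rewrite addr0.
have d2 : is_derive (0 : R) 1 (fun x => f (x + L)) (s * derive1 f 0).
  rewrite (_ : (fun x => f (x + L)) = (fun x => s * f x)); last exact/funext.
  exact: dZ.
have := @derive_val _ _ _ _ _ _ _ d1; rewrite (@derive_val _ _ _ _ _ _ _ d2).
by rewrite mulr1 => ->.
Qed.

End hill.

(** * Low energies *)

Section clipping.
Variable R : realType.
Implicit Types (c x y : R).

(** It extends a function known on [- c, c] to the line, where continuity can be tested with
    two-sided neighbourhoods. *)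
Definition clip c x := Num.max (- c) (Num.min c x).

Lemma clip_id c x : - c <= x <= c -> clip c x = x.
Proof. by move=> /andP[x1 x2]; rewrite /clip min_r// max_r. Qed.

Lemma clip_itv c x : - c <= c -> - c <= clip c x <= c.
Proof. by move=> cc; rewrite /clip le_max lexx /= ge_max cc ge_min lexx. Qed.

Lemma clip_lip c x y : - c <= c -> `|clip c x - clip c y| <= `|x - y|.
Proof.
move=> cc; have h1 := ler_norm (x - y); have := ler_norm (y - x); rewrite distrC => h2.
have cl z : (z <= - c /\ clip c z = - c) \/
    ((c <= z /\ clip c z = c) \/ (- c <= z <= c /\ clip c z = z)).
  have [z1|/ltW z1] := leP z (- c).
    by left; split => //; rewrite /clip min_r ?max_l//; exact: le_trans cc.
  have [z2|/ltW z2] := leP c z; right.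
    by left; split => //; rewrite /clip min_l// max_r.
  by right; split; [rewrite z1|rewrite clip_id// z1].
have H (u v K : R) : u - v <= K -> v - u <= K -> clip c u <= clip c v + K.
  by move=> uv vu; case: (cl u) => [[? ->]|[[? ->]|[/andP[? ?] ->]]];
    case: (cl v) => [[? ->]|[[? ->]|[/andP[? ?] ->]]]; lra.
have := H _ _ _ h1 h2; have := H _ _ _ h2 h1.
by rewrite ler_norml => ? ?; apply/andP; split; lra.
Qed.

End clipping.

Section energy_numerics.
Variable R : realType.

(** T, F and Q are the integrals of |f'|, f^2 and f'^2. The hypotheses force Q <= T^2 / 24, and
    AM-GM with weight T / 16 then yields T <= (T / 2 + 2 T / 3) / 2. *)
Lemma small_energy_num (c T F Q mu rho L : R) : 0 < c -> c <= 1 / 64 -> 0 < T -> 0 <= F ->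
  F <= (T / 2) ^+ 2 * L -> L <= 8 -> rho <= c / 9 -> mu <= c ->
  Q <= mu * F + rho * (T / 2) ^+ 2 -> T <= (T / 16 * L + Q / (T / 16)) / 2 -> False.
Proof.
move=> c0 c1 Tp F0 F1 L8 hr hmu hQ hT.
have T0 := ltW Tp; have a0 : 0 < T / 16 by rewrite divr_gt0.
have m1 : mu * F <= c * F by rewrite ler_wpM2r.
have m2 : (T / 2) ^+ 2 * L <= (T / 2) ^+ 2 * 8 by rewrite ler_wpM2l ?sqr_ge0.
have m3 : rho * (T / 2) ^+ 2 <= c / 9 * (T / 2) ^+ 2 by rewrite ler_wpM2r ?sqr_ge0.
have e4 : (T / 2) ^+ 2 = T * T / 4 by field.
rewrite e4 in m2 m3 F1 hQ.
have TT : 0 <= T * T by rewrite mulr_ge0.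
have F2 : c * F <= c * (2 * (T * T)) by rewrite ler_wpM2l ?(ltW c0)//; lra.
have c2 : c * (T * T) <= 1 / 64 * (T * T) by rewrite ler_wpM2r.
have Q1 : Q <= T * T / 24 by clear - hQ m1 m3 F2 c2 TT; lra.
have Q2 : Q / (T / 16) <= 2 / 3 * T by rewrite ler_pdivrMr//; clear - Q1; lra.
have : T / 16 * L <= T / 16 * 8 by rewrite ler_wpM2l// ltW.
by clear - hT Q2 Tp; lra.
Qed.

(** A and T are the integrals of |f| and |f'|, F and D those of the squares. AM-GM with weights M /
    2 and M / 16 gives A / L <= 5 M / 18 and T <= 19 M / 72, which together fall short of M. *)
Lemma negative_energy_num (c M A T F D mu rho L : R) : 0 < c -> c <= 1 / 64 -> 0 < M ->
  4 <= L -> L <= 8 -> rho <= c / 9 -> mu <= - c -> 0 <= F -> 0 <= D ->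
  D <= mu * F + rho * M ^+ 2 -> T <= (M / 16 * L + D / (M / 16)) / 2 ->
  A <= (M / 2 * L + F / (M / 2)) / 2 -> M = A / L + T -> False.
Proof.
move=> c0 c1 Mp L4 L8 hr hmu F0 D0 hD hT hA eM.
have L0 : 0 < L by clear - L4; lra.
have a0 : 0 < M / 2 by rewrite divr_gt0.
have b0 : 0 < M / 16 by rewrite divr_gt0.
have m1 : mu * F <= - c * F by rewrite ler_wpM2r.
have m3 : rho * M ^+ 2 <= c / 9 * M ^+ 2 by rewrite ler_wpM2r ?sqr_ge0.
rewrite expr2 in hD m3.
have MM : 0 < M * M by rewrite mulr_gt0.
have c2 : c * (M * M) <= 1 / 64 * (M * M) by rewrite ler_wpM2r// ltW.
have cF : 0 <= c * F by rewrite mulr_ge0// ltW.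
have D1 : D <= M * M / 576 by clear - hD m1 m3 c2 cF; lra.
have F1 : F <= M * M / 9 by rewrite -(ler_pM2l c0); clear - hD m1 m3 D0; lra.
have D2 : D / (M / 16) <= M / 36 by rewrite ler_pdivrMr//; clear - D1; lra.
have F2 : F / (M / 2) <= 2 / 9 * M by rewrite ler_pdivrMr//; clear - F1; lra.
have h1 : M / 16 * L <= M / 16 * 8 by rewrite ler_wpM2l// ltW.
have A1 : A / L <= M / 4 + M / 9 / 4.
  rewrite ler_pdivrMr//.
  have : M * 4 <= M * L by rewrite ler_wpM2l// ltW.
  by clear - hA F2; lra.
by clear - eM A1 hT D2 h1 Mp; lra.
Qed.

End energy_numerics.

(** * Solutions below the threshold 1/1024 *)

Section low_energy.
Variables (R : realType) (L rho : R).
Hypotheses (L0 : 0 < L) (L4 : 4 <= L) (L8 : L <= 8) (rho_small : rho <= 1 / 9600).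
Implicit Types (p f h u k : R -> R) (mu x y : R).

Let c_gt0 : 0 < 1 / 1024 :> R. Proof. lra. Qed.
Let c_le : 1 / 1024 <= 1 / 64 :> R. Proof. lra. Qed.
Let rho_c : rho <= 1 / 1024 / 9. Proof. by have := rho_small; lra. Qed.

Section given_potential.
Variable p : R -> R.
Hypothesis pp : potential L rho p.
Let hp : itg 0 L p. Proof. exact: pp.1. Qed.
Let rho0 : 0 <= rho. Proof. exact: rho_ge0 pp. Qed.

Let V mu x := p x - mu.

Lemma itgV mu : itg 0 L (V mu).
Proof. by apply: itgB => //; exact: itg_cst. Qed.

Lemma good_sqr f : good L f -> itg 0 L (fun x => f x ^+ 2).
Proof.
move=> [mf [B hB]].
have := itg_mul (itg_mul (itg_cst 0 L 1) mf hB) mf hB.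
by apply: eq_itg => x _; ring.
Qed.

Lemma good_abs f : good L f -> itg 0 L (fun x => `|f x|).
Proof.
move=> [mf [B hB]]; have := itg_mul (itg_cst 0 L 1) mf hB.
by move/itg_abs; apply: eq_itg => x _; rewrite mul1r.
Qed.

(* AM-GM in place of the Cauchy-Schwarz inequality *)
Lemma I_abs_le f a : good L f -> 0 < a ->
  I 0 L (fun x => `|f x|) <= (a * L + I 0 L (fun x => f x ^+ 2) / a) / 2.
Proof.
move=> gf a0.
have i2 := good_sqr gf.
have -> : (a * L + I 0 L (fun x => f x ^+ 2) / a) / 2 =
   I 0 L (fun x => (a^-1 / 2) * f x ^+ 2 + a / 2).
  rewrite ID; [|exact: itgZ|exact: itg_cst].
  by rewrite IZ// Icst ?(ltW L0)//; ring.
apply: leI; [exact: good_abs|by apply: itgD; [exact: itgZ|exact: itg_cst]|].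
move=> x _; rewrite -(real_normK (num_real (f x))); set y := `|f x|.
have an : a != 0 by rewrite gt_eqF.
have : 0 <= a^-1 * (y - a) ^+ 2 by rewrite mulr_ge0 ?sqr_ge0// invr_ge0 ltW.
have -> : a^-1 * (y - a) ^+ 2 = a^-1 * y ^+ 2 - 2 * y + a by field.
lra.
Qed.

Lemma energy_identity mu f h : sol L (V mu) f h -> f L * h L = f 0 * h 0 ->
  I 0 L (fun x => h x ^+ 2) = I 0 L (fun x => (mu - p x) * f x ^+ 2).
Proof.
move=> hs bc; have e := energy L0 hs.
have hL : 0 <= L <= L by rewrite lexx ltW.
have := acon_eq e hL; rewrite bc => E.
have gf := acon_good L0 hs.1; have gh := acon_good L0 hs.2.
have i1 : itg 0 L (fun x => V mu x * f x ^+ 2).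
  have [mf [B hB]] := gf.
  have := itg_mul (itg_mul (itgV mu) mf hB) mf hB.
  by apply: eq_itg => x _; ring.
have z : I 0 L (fun x => h x ^+ 2 + V mu x * f x ^+ 2) = 0 by lra.
rewrite ID// in z; last exact: good_sqr.
have -> : I 0 L (fun x => (mu - p x) * f x ^+ 2) = - I 0 L (fun x => V mu x * f x ^+ 2).
  by rewrite -IN//; apply: eqI => x _; rewrite /V; ring.
lra.
Qed.

Lemma I_quad_bound f mu M : good L f -> bnd L f M -> 0 <= M ->
  I 0 L (fun x => (mu - p x) * f x ^+ 2) <= mu * I 0 L (fun x => f x ^+ 2) + rho * M ^+ 2.
Proof.
move=> gf fM M0.
have i2 := good_sqr gf; have [mf [B hB]] := gf.
have ip : itg 0 L (fun x => p x * f x ^+ 2).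
  by have := itg_mul (itg_mul hp mf hB) mf hB; apply: eq_itg => x _; ring.
have ia := itg_abs hp.
have -> : I 0 L (fun x => (mu - p x) * f x ^+ 2) =
  mu * I 0 L (fun x => f x ^+ 2) - I 0 L (fun x => p x * f x ^+ 2).
  rewrite -IZ// -IB//; last exact: itgZ.
  by apply: eqI => x _; ring.
rewrite lerD2l lerNl (le_trans _ (_ : - (I 0 L (fun t => `|p t|) * M ^+ 2) <= _))//.
  by rewrite lerN2 ler_wpM2r ?sqr_ge0//; exact: pp.2.
rewrite mulrC -IZ// -IN; last exact: itgZ.
apply: leI => //; first by apply: itgN; exact: itgZ.
move=> x hx; have f2 : f x ^+ 2 <= M ^+ 2.
  by rewrite -(real_normK (num_real (f x))) lerXn2r ?nnegrE ?fM.
have a1 : `|p x| * f x ^+ 2 <= `|p x| * M ^+ 2 by rewrite ler_wpM2l.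
have a2 : - `|p x| * f x ^+ 2 <= p x * f x ^+ 2.
  by rewrite ler_wpM2r ?sqr_ge0// lerNl; have := ler_norm (- p x); rewrite normrN.
lra.
Qed.

(* Multiply the equation by f; since the end values of f cancel, |f| is at most
   half the integral of |f'|. *)
Lemma small_energy mu f h : mu <= 1 / 1024 -> sol L (V mu) f h ->
  f 0 + f L = 0 -> f L * h L = f 0 * h 0 -> forall x, 0 <= x <= L -> f x = 0.
Proof.
move=> hmu hs f0 bc.
have gf := acon_good L0 hs.1; have gh := acon_good L0 hs.2.
set T := I 0 L (fun x => `|h x|).
have T0 : 0 <= T by exact: I_ge0.
have fT : bnd L f (T / 2).
  move=> x hx; have := acon_mid L0 hs.1 hx; rewrite /mid f0 mul0r add0r /J => ->.
  have /andP[x0 xL] := hx.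
  have i1 := hs.1.1.
  have h1 : itg 0 x h by exact: itgS i1. have h2 : itg x L h by exact: itgS i1.
  have b1 := Iabs h1; have b2 := Iabs h2.
  have := chasles x0 xL (itg_abs i1); rewrite -/T => e.
  rewrite (chasles x0 xL i1); move: b1 b2; rewrite !ler_norml => /andP[? ?] /andP[? ?].
  by apply/andP; split; lra.
suff Te : T = 0 by move=> x hx; apply/eqP; rewrite -normr_le0 (le_trans (fT x hx))// Te mul0r.
apply/eqP; rewrite eq_le T0 andbT leNgt; apply/negP => Tp.
have a0 : 0 < T / 16 by rewrite divr_gt0.
have := I_abs_le gh a0; rewrite -/T (energy_identity hs bc).
have M0 : 0 <= T / 2 by rewrite divr_ge0.
have := I_quad_bound mu gf fT M0.
have F0 : 0 <= I 0 L (fun x => f x ^+ 2) by apply: I_ge0 => x _; exact: sqr_ge0.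
have F1 : I 0 L (fun x => f x ^+ 2) <= (T / 2) ^+ 2 * L.
  rewrite -[X in _ * X]subr0 -Icst ?(ltW L0)//; apply: leI; [exact: good_sqr|exact: itg_cst|].
  by move=> x hx; rewrite -(real_normK (num_real (f x))) lerXn2r ?nnegrE ?fT.
move=> hQ hT.
exact: (small_energy_num c_gt0 c_le Tp F0 F1 L8 rho_c hmu hQ hT).
Qed.

(** The end values need not cancel, so f is bounded by the mean of |f| plus its oscillation, M = A /
    L + T. As mu is negative, the energy identity controls the integrals of both f^2 and h^2 by rho
    M^2, which is too little unless M = 0. *)
Lemma negative_energy mu f h : mu <= - (1 / 1024) -> sol L (V mu) f h ->
  f L * h L = f 0 * h 0 -> forall x, 0 <= x <= L -> f x = 0.
Proof.
move=> hmu hs bc.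
have gf := acon_good L0 hs.1; have gh := acon_good L0 hs.2.
set T := I 0 L (fun x => `|h x|); set A := I 0 L (fun x => `|f x|).
have T0 : 0 <= T by exact: I_ge0. have A0 : 0 <= A by exact: I_ge0.
have [M eM] : exists M, M = A / L + T by exists (A / L + T).
have M0 : 0 <= M by rewrite eM addr_ge0// divr_ge0// ltW.
have fM : bnd L f M.
  move=> x hx; rewrite eM -lerBlDr ler_pdivlMr//.
  have osc y : 0 <= y <= L -> `|f x - f y| <= T.
    move=> hy; wlog yx : x y hx hy / y <= x.
      by move=> H; have [/H|/ltW/H] := leP y x; [|rewrite distrC]; exact.
    have /andP[y0 _] := hy; have /andP[_ xL] := hx.
    have ih : itg y x h by exact: itgS hs.1.1.
    rewrite hs.1.2// (le_trans (Iabs ih))//.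
    have ia := itg_abs hs.1.1.
    have ia' : itg 0 x (fun t => `|h t|) by apply: itgS ia.
    rewrite /T (chasles (le_trans y0 yx) xL ia) (chasles y0 yx ia').
    have := @I_ge0 _ 0 y (fun t => `|h t|) (fun _ _ => normr_ge0 _).
    have := @I_ge0 _ x L (fun t => `|h t|) (fun _ _ => normr_ge0 _).
    lra.
  rewrite -[X in _ * X]subr0 -Icst ?(ltW L0)//.
  apply: leI; [exact: itg_cst|exact: good_abs|].
  move=> y hy; have := osc y hy; have := ler_normD (f x - f y) (f y); rewrite subrK; lra.
suff Me : M = 0 by move=> x hx; apply/eqP; rewrite -normr_le0 (le_trans (fM x hx))// Me.
apply/eqP; rewrite eq_le M0 andbT leNgt; apply/negP => Mp.
have := I_quad_bound mu gf fM M0; rewrite -(energy_identity hs bc).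
have F0 : 0 <= I 0 L (fun x => f x ^+ 2) by apply: I_ge0 => x _; exact: sqr_ge0.
have D0 : 0 <= I 0 L (fun x => h x ^+ 2) by apply: I_ge0 => x _; exact: sqr_ge0.
have a0 : 0 < M / 2 by rewrite divr_gt0. have b0 : 0 < M / 16 by rewrite divr_gt0.
have := I_abs_le gf a0; have := I_abs_le gh b0; rewrite -/T -/A.
move=> hT hA hD.
exact: (negative_energy_num c_gt0 c_le Mp L4 L8 rho_c hmu F0 D0 hD hT hA eM).
Qed.

(* the Green operator of f'' = h with Dirichlet conditions at 0 and L *)
Definition K0 h x := x * I 0 x (fun t => h t * 1) + (-1) * I 0 x (fun t => h t * t) +
  (- (x / L)) * I 0 L (fun t => h t * (L - t)).

Lemma vop_K0 : vop L K0 24.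
Proof.
have m1 : measurable_fun `[0, L] (fun=> 1 : R) by exact: measurable_cst.
have m1' : measurable_fun `[0, L] (fun=> (-1) : R) by exact: measurable_cst.
have mid_ : measurable_fun `[0, L] (fun x : R => x).
  by apply: cont_meas => x _; exact: is_derive_cont (did x).
have mL : measurable_fun `[0, L] (fun x => L - x) by apply: measurable_funB.
have mxL : measurable_fun `[0, L] (fun x => - (x / L)).
  apply: cont_meas => x _; have := is_derive_cont (dlin (- L^-1) x).
  by rewrite (_ : (fun y => - L^-1 * y) = (fun y => - (y / L)))//; apply/funext => y; ring.
have b1 : bnd L (fun=> 1) 1 by move=> x _; rewrite normr1.
have b1' : bnd L (fun=> -1) 1 by move=> x _; rewrite normrN normr1.
have bid : bnd L (fun x => x) L by move=> x /andP[x0 xL]; rewrite ger0_norm.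
have bL : bnd L (fun x => L - x) L by move=> x /andP[x0 xL]; rewrite ger0_norm; lra.
have bxL : bnd L (fun x => - (x / L)) 1.
  move=> x /andP[x0 xL]; rewrite normrN ger0_norm ?divr_ge0 ?(ltW L0)//.
  by rewrite ler_pdivrMr// mul1r.
have [h1 h2 h3 h4 h5] := vop_add (vop_add (vop_volterra L0 mid_ m1 bid b1) (vop_volterra L0 m1' mid_ b1' bid))
  (vop_fredholm L0 mxL mL bxL bL).
split => // h ih x hx; rewrite (le_trans (h4 h ih x hx))// ler_wpM2r//; first exact: I_ge0.
by have := L8; lra.
Qed.

Section dirichlet.
Variable mu : R.
Hypothesis hmu : `|mu| <= 1 / 1024.

Lemma IV_bound : I 0 L (fun x => `|V mu x|) <= 1 / 128 + rho.
Proof.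
have ia := itg_abs hp.
apply: (@le_trans _ _ (I 0 L (fun x => `|mu| + `|p x|))).
  apply: leI; [by apply: itg_abs; exact: itgV|by apply: itgD => //; exact: itg_cst|].
  by move=> x _; rewrite (le_trans (ler_normB _ _))// addrC.
rewrite ID//; last exact: itg_cst.
rewrite Icst ?(ltW L0)// subr0 lerD ?pp.2//.
have : `|mu| * L <= 1 / 1024 * 8 by apply: ler_pM => //; exact: ltW.
lra.
Qed.

(** The fixed point of f = 1 + K0 (V f). The operator has bound 3 L <= 24, the integral of |V| is at
    most 1/96 and |f| <= 2, so f differs from 1 by at most 24 * 2 / 96. *)
Lemma dirichlet_exists : exists fh : (R -> R) * (R -> R),
  [/\ sol L (V mu) fh.1 fh.2, forall x, 0 <= x <= L -> 1 / 2 <= fh.1 x <= 3 / 2,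
      fh.1 0 = 1 & fh.1 L = 1].
Proof.
have hI : I 0 L (fun x => `|V mu x|) <= 1 / 96.
  by have := IV_bound; have := rho_small; lra.
have small : 24 * I 0 L (fun x => `|V mu x|) <= 1 / 2 by lra.
have m1 : measurable_fun `[0, L] (fun=> 1 : R) by exact: measurable_cst.
have b1 : bnd L (fun=> 1) 1 by move=> x _; rewrite normr1.
have [f [mf bf fE]] := neumann L0 vop_K0 (itgV mu) small m1 b1.
rewrite mulr1 in bf.
have gf : good L f by split => //; exists 2.
have iw := good_itg (itgV mu) gf.
set w := (fun t => V mu t * f t) in iw fE.
pose c := I 0 L (fun t => w t * (L - t)) / L.
have mid_ : measurable_fun `[0, L] (fun x : R => x).
  by apply: cont_meas => x _; exact: is_derive_cont (did x).
have bid : bnd L (fun x => x) L by move=> x /andP[x0 xL]; rewrite ger0_norm.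
have iwt : itg 0 L (fun t => w t * t) by exact: itg_mul iw mid_ bid.
have Ln0 : L != 0 by rewrite gt_eqF.
have hL : 0 <= L <= L by rewrite lexx ltW.
have h0 : 0 <= (0 : R) <= L by rewrite lexx ltW.
have fE' x : 0 <= x <= L -> f x = 1 + (x * I 0 x w - I 0 x (fun t => w t * t) - c * x).
  move=> hx; rewrite fE// /K0 /c (eqI (g := w)); last by move=> t _; rewrite mulr1.
  by field.
have aw : acon 0 L (fun x => 0 + I 0 x w) w by exact: acon_int.
have awt : acon 0 L (fun x => 0 + I 0 x (fun t => w t * t)) (fun t => w t * t) by exact: acon_int.
have ax : acon 0 L (fun x : R => x) (fun=> 1).
  by apply: acon_smooth => x; exact: is_derive_cont (dcst 1 x).
have a1 : acon 0 L (fun=> 1 : R) (fun=> 0).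
  by apply: acon_smooth => x; exact: is_derive_cont (dcst 0 x).
have axw : acon 0 L (fun x => (0 + I 0 x w) * x) (fun x => w x * x + 1 * (0 + I 0 x w)).
  by apply: (acon_mul (ltW L0) aw ax); exists 1 => x _; rewrite normr1.
pose h x := I 0 x w - c.
exists (f, h); split => /=.
- split.
    have := acon_lin (- c) ax (acon_lin (-1) awt (acon_lin 1 axw a1)).
    apply: acon_ext => [||x _]; [exact: ltW| |by rewrite /h; ring].
    by move=> x hx; rewrite fE'//; ring.
  have := acon_int (- c) iw.
  by apply: acon_ext => // [|x _]; [exact: ltW|rewrite /h; ring].
- move=> x hx; have := fE x hx.
  have kb := vop_bnd vop_K0 iw hx.
  have := I_mul_bound (itgV mu) gf bf; rewrite -/w => h2.
  have : `|K0 w x| <= 1 / 2 by lra.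
  by rewrite ler_norml => /andP[k1 k2] ->; apply/andP; split; lra.
- by rewrite fE'// I0 I0; ring.
- rewrite fE'// /c (_ : (fun t => w t * (L - t)) = (fun t => L * w t - w t * t)); last first.
    by apply/funext => t; ring.
  by rewrite IB ?IZ//; [field|exact: itgZ].
Qed.

End dirichlet.

(* the solution with value 1 at both ends; it is periodic iff the jump [G mu] of
   its derivative vanishes *)
Definition dsol mu : (R -> R) * (R -> R) := xget (fun=> 0, fun=> 0)
  [set fh | [/\ sol L (V mu) fh.1 fh.2, forall x, 0 <= x <= L -> 1 / 2 <= fh.1 x <= 3 / 2,
      fh.1 0 = 1 & fh.1 L = 1]].

Definition G mu := (dsol mu).2 L - (dsol mu).2 0.

Lemma dsolP mu : `|mu| <= 1 / 1024 ->
  [/\ sol L (V mu) (dsol mu).1 (dsol mu).2,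
      forall x, 0 <= x <= L -> 1 / 2 <= (dsol mu).1 x <= 3 / 2,
      (dsol mu).1 0 = 1 & (dsol mu).1 L = 1].
Proof.
move=> hmu; have [fh Hfh] := dirichlet_exists hmu.
suff : [set fh | [/\ sol L (V mu) fh.1 fh.2, forall x, 0 <= x <= L -> 1 / 2 <= fh.1 x <= 3 / 2,
      fh.1 0 = 1 & fh.1 L = 1]] (dsol mu) by [].
by apply: xgetPex; exists fh.
Qed.

(** f minus f(0) times the Dirichlet solution vanishes at both ends, so [small_energy] makes it 0;
    equality of the end values of h then reads f(0) G = 0. *)
Lemma periodic_dirichlet mu f h : `|mu| <= 1 / 1024 -> sol L (V mu) f h ->
  f L = f 0 -> h L = h 0 ->
  (forall x, 0 <= x <= L -> f x = f 0 * (dsol mu).1 x) /\ f 0 * G mu = 0.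
Proof.
move=> hmu hs fL hL; have [ds _ d0 dL] := dsolP hmu.
set g := (dsol mu).1 in ds d0 dL *; set k := (dsol mu).2 in ds *.
have us : sol L (V mu) (fun x => - f 0 * g x + f x) (fun x => - f 0 * k x + h x).
  split; first exact: acon_lin ds.1 hs.1.
  by apply: (acon_ext (ltW L0) _ _ (acon_lin (- f 0) ds.2 hs.2)) => // x _; ring.
have u0 : forall x, 0 <= x <= L -> - f 0 * g x + f x = 0.
  have mu1 : mu <= 1 / 1024 by rewrite (le_trans (ler_norm _)).
  by apply: (small_energy mu1 us); rewrite d0 dL fL; ring.
split=> [x hx|]; first by have := u0 x hx; lra.
have hLL : 0 <= L <= L by rewrite lexx ltW.
have := acon_eq us.2 hLL; rewrite (eqI (g := fun=> 0)); last by move=> x hx; rewrite u0// mulr0.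
by rewrite Icst ?(ltW L0)// mul0r hL /G -/k; lra.
Qed.

(** The end values being 1, the increment of the Wronskian is G m2 - G m1, and c is the integral of
    the product of the two solutions. Values between 1/2 and 3/2 and 4 <= L <= 8 put c between 1 and
    18; G is thus decreasing and Lipschitz. *)
Lemma G_diff m1 m2 : `|m1| <= 1 / 1024 -> `|m2| <= 1 / 1024 ->
  exists2 c, 1 <= c <= 18 & G m2 - G m1 = (m1 - m2) * c.
Proof.
have l4 := L4; have l8 := L8.
move=> hm1 hm2; have [s1 b1 z1 e1] := dsolP hm1; have [s2 b2 z2 e2] := dsolP hm2.
have w := wronskian L0 s1 s2.
have hLL : 0 <= L <= L by rewrite lexx ltW.
have [g1 g2] := (acon_good L0 s1.1, acon_good L0 s2.1).
have ig : itg 0 L (fun x => (dsol m1).1 x * (dsol m2).1 x).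
  have [mf [B hB]] := g2; apply: itg_mul mf hB.
  have [mf1 [B1 hB1]] := g1; have := itg_mul (itg_cst 0 L 1) mf1 hB1.
  by apply: eq_itg => x _; rewrite mul1r.
exists (I 0 L (fun x => (dsol m1).1 x * (dsol m2).1 x)).
  have bb x : 0 <= x <= L -> 1 / 4 <= (dsol m1).1 x * (dsol m2).1 x <= 9 / 4.
    move=> hx; have /andP[l1 u1] := b1 x hx; have /andP[l2 u2] := b2 x hx.
    move: l1 u1 l2 u2; move: (_ x) (_ x) => y z l1 u1 l2 u2.
    by apply/andP; split; nra.
  apply/andP; split.
    apply: (@le_trans _ _ (I 0 L (fun=> 1 / 4))); first by rewrite Icst ?(ltW L0)//; lra.
    by apply: leI => [|//|x hx]; [exact: itg_cst|have /andP[] := bb x hx].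
  apply: (@le_trans _ _ (I 0 L (fun=> 9 / 4))); last by rewrite Icst ?(ltW L0)//; lra.
  by apply: leI => [//||x hx]; [exact: itg_cst|have /andP[] := bb x hx].
rewrite -IZ//.
have -> : I 0 L (fun x => (m1 - m2) * ((dsol m1).1 x * (dsol m2).1 x)) =
  I 0 L (fun x => (V m2 x - V m1 x) * ((dsol m1).1 x * (dsol m2).1 x)).
  by apply: eqI => x _; rewrite /V; ring.
have := acon_eq w hLL; rewrite z1 z2 e1 e2 /G; lra.
Qed.

(** Integrating the equation, G mu is the integral of (p - mu) f. At the two ends the term in mu has
    size at least 2 / 1024, while the term in p is at most 3 rho / 2. *)
Lemma G_ends : G (1 / 1024) < 0 /\ 0 < G (- (1 / 1024)).
Proof.
have l4 := L4; have l8 := L8.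
have E mu : `|mu| <= 1 / 1024 -> exists2 c, 2 <= c & `|G mu + mu * c| <= 3 / 2 * rho.
  move=> hmu; have [s b z e] := dsolP hmu.
  have hLL : 0 <= L <= L by rewrite lexx ltW.
  have g := acon_good L0 s.1; have ipf := good_itg hp g.
  have [mf [B hB]] := g.
  have i1 : itg 0 L (dsol mu).1.
    by have := itg_mul (itg_cst 0 L 1) mf hB; apply: eq_itg => x _; rewrite mul1r.
  exists (I 0 L (dsol mu).1).
    apply: (@le_trans _ _ (I 0 L (fun=> 1 / 2))); first by rewrite Icst ?(ltW L0)//; lra.
    by apply: leI => [|//|x hx]; [exact: itg_cst|have /andP[] := b x hx].
  have := acon_eq s.2 hLL.
  have -> : I 0 L (fun x => V mu x * (dsol mu).1 x) =
    I 0 L (fun x => p x * (dsol mu).1 x) - mu * I 0 L (dsol mu).1.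
    rewrite -IZ// -IB//; last exact: itgZ.
    by apply: eqI => x _; rewrite /V; ring.
  move=> e1; have -> : G mu + mu * I 0 L (dsol mu).1 = I 0 L (fun x => p x * (dsol mu).1 x).
    rewrite /G; lra.
  have bb : bnd L (dsol mu).1 (3 / 2).
    by move=> x hx; have /andP[? ?] := b x hx; rewrite ger0_norm; lra.
  rewrite (le_trans (Iabs ipf))// (le_trans (I_mul_bound hp g bb))// mulrC ler_wpM2l//.
  exact: pp.2.
have hr := rho_small.
have a0 : 0 <= 1 / 1024 :> R by lra.
have n1 : `|1 / 1024 : R| <= 1 / 1024 by rewrite (ger0_norm a0) lexx.
have n2 : `|- (1 / 1024) : R| <= 1 / 1024 by rewrite normrN.
split.
  by have [c c2] := E _ n1; rewrite ler_norml => /andP[g1 g2]; lra.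
by have [c c2] := E _ n2; rewrite ler_norml => /andP[g1 g2]; lra.
Qed.

Lemma G_root : exists l, `|l| < 1 / 1024 /\ G l = 0 /\
  forall mu, `|mu| <= 1 / 1024 -> G mu = 0 -> mu = l.
Proof.
have [n1 n2] := G_ends.
have lh : - (1 / 1024) <= 1 / 1024 :> R by lra.
have nm (x : R) : - (1 / 1024) <= x <= 1 / 1024 -> `|x| <= 1 / 1024 by rewrite ler_norml.
set c0 : R := 1 / 1024 in lh nm n1 n2 *.
have cont : {within `[- c0, c0], continuous (fun x => G (clip c0 x))}.
  apply: continuous_in_subspaceT => x _; apply/cont_epsP => e e0.
  exists (e / 18); first by rewrite divr_gt0.
  move=> y hy; have [c /andP[c1 c2] ->] := G_diff (nm _ (clip_itv x lh)) (nm _ (clip_itv y lh)).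
  have cge0 : 0 <= c by exact: le_trans ler01 c1.
  rewrite normrM distrC (ger0_norm cge0).
  rewrite (@le_trans _ _ (e / 18 * 18))//; last by rewrite divfK// pnatr_eq0.
  apply: ler_pM => //.
  exact: le_trans (clip_lip _ _ lh) hy.
have [|l] := @IVT R (fun x => G (clip c0 x)) _ _ 0 lh cont.
  by rewrite !clip_id ?lexx ?lh// ge_min le_max (ltW n1) (ltW n2) !orbT.
rewrite in_itv/= => hl; rewrite clip_id// => Gl; exists l; split; last split => //.
  rewrite ltr_norml !lt_neqAle; have /andP[-> ->] := hl; rewrite !andbT; apply/andP; split.
    by apply/eqP => e; move: n2; rewrite e Gl ltxx.
  by apply/eqP => e; move: n1; rewrite -e Gl ltxx.
move=> mu hmu Gm; have [c /andP[c1 _]] := G_diff hmu (nm l hl).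
rewrite Gl Gm subr0 => /esym/eqP; rewrite mulf_eq0 subr_eq0 => /orP[/eqP//|/eqP z].
by move: c1; rewrite z ler10.
Qed.

End given_potential.
End low_energy.

(** * The periodic spectrum *)

Section dimension.
Variable R : realType.
Implicit Types (E : set (R -> R)) (e f : R -> R).

Lemma has_dim0 E : (forall f, E f -> f = fun=> 0) -> has_dim E 0.
Proof.
move=> h; exists (fun _ _ => 0); split=> [[]//|f /h ->].
exists (fun=> 0); split; first by apply/funext => x; rewrite big_ord0.
by move=> c _; apply/funext => -[].
Qed.

Lemma has_dim1 E e : E e -> (exists x, e x != 0) ->
  (forall f, E f -> exists a, f = fun x => a * e x) -> has_dim E 1.
Proof.
move=> Ee [x0 ex0] h; exists (fun=> e); split=> // f /h[a ->].
exists (fun=> a); split; first by apply/funext => x; rewrite big_ord1.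
move=> c /(congr1 (fun g => g x0)); rewrite big_ord1 => /(mulIf ex0) ac.
by apply/funext => i; rewrite ord1.
Qed.

Lemma has_dim2 E e1 e2 : E e1 -> E e2 ->
  (forall a b, (fun x => a * e1 x + b * e2 x) = (fun=> 0) -> a = 0 /\ b = 0) ->
  (forall f, E f -> exists a b, f = fun x => a * e1 x + b * e2 x) -> has_dim E 2.
Proof.
move=> E1 E2 inj h; exists (fun i : 'I_2 => if i == ord0 then e1 else e2).
split=> [i|f /h[a [b ->]]]; first by case: ifP.
exists (fun i : 'I_2 => if i == ord0 then a else b); split.
  by apply/funext => x; rewrite !big_ord_recl big_ord0 /= addr0.
move=> c; pose c0 := c ord0; pose c1 := c (lift ord0 ord0).
move=> /(congr1 (fun g x => g x)) H.
have [] := inj (a - c0) (b - c1).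
  apply/funext => x; have := congr1 (fun g => g x) H.
  rewrite !big_ord_recl big_ord0 /= addr0 -/c0 -/c1.
  by move=> Hx; lra.
move=> /subr0_eq ac /subr0_eq bc; apply/funext => i.
case: (unliftP ord0 i) => [j ->|->]; last by rewrite eqxx.
by rewrite ord1 bc.
Qed.

(* l1 and l2 are the eigenvalues of the symmetric matrix [[n11, n12], [n12, n22]] *)
Lemma has_dim_kernel E e1 e2 (n11 n12 n22 l1 l2 : R) :
  (forall a b, n11 * a + n12 * b = 0 -> n12 * a + n22 * b = 0 ->
     E (fun x => a * e1 x + b * e2 x)) ->
  (forall f, E f -> exists a b, [/\ n11 * a + n12 * b = 0, n12 * a + n22 * b = 0 &
     f = fun x => a * e1 x + b * e2 x]) ->
  (forall a b, n11 * a + n12 * b = 0 -> n12 * a + n22 * b = 0 ->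
     (fun x => a * e1 x + b * e2 x) = (fun=> 0) -> a = 0 /\ b = 0) ->
  l1 + l2 = n11 + n22 -> l1 * l2 = n11 * n22 - n12 ^+ 2 ->
  has_dim E ((l1 == 0) + (l2 == 0)).
Proof.
move=> conv par inj tr det.
have gen v1 v2 : n11 * v1 + n12 * v2 = 0 -> n12 * v1 + n22 * v2 = 0 -> ~ (v1 = 0 /\ v2 = 0) ->
    (forall a b, n11 * a + n12 * b = 0 -> n12 * a + n22 * b = 0 ->
       exists t, a = t * v1 /\ b = t * v2) -> has_dim E 1.
  move=> h1 h2 v0 sp; apply: (has_dim1 (conv v1 v2 h1 h2)).
    apply: contrapT => h; apply: v0; apply: inj => //; apply/funext => x.
    by apply: contrapT => /eqP hx; apply: h; exists x.
  move=> f /par[a [b [g1 g2 ->]]]; have [t [-> ->]] := sp _ _ g1 g2.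
  by exists t; apply/funext => x; ring.
(* Determinant 0 with nonzero trace: the kernel is the line spanned by (- n12, n11), or by (1, 0)
   when n11 = 0. *)
have one : n11 * n22 = n12 * n12 -> n11 + n22 != 0 -> has_dim E 1.
  move=> det0 tr0; have [n0|n0] := eqVneq n11 0.
    have n12_0 : n12 = 0.
      by apply/eqP; move: det0; rewrite n0 mul0r => /esym/eqP; rewrite mulf_eq0 orbb.
    have n22_0 : n22 != 0 by rewrite n0 add0r in tr0.
    apply: (gen 1 0); [by rewrite n0 n12_0; ring|by rewrite n12_0; ring| |].
      by case=> /eqP; rewrite oner_eq0.
    move=> a b _; rewrite n12_0 mul0r add0r => /eqP; rewrite mulf_eq0 (negbTE n22_0) /= => /eqP ->.
    by exists a; split; ring.
  apply: (gen (- n12) n11); [by ring|by rewrite [n22 * _]mulrC det0; ring| |].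
    by case=> _ /eqP; rewrite (negbTE n0).
  move=> a b h _; exists (b / n11); split; last by rewrite divfK.
  apply: (mulfI n0); have -> : n11 * a = - (n12 * b) by lra.
  by rewrite mulrA [n11 * _]mulrC divfK//; ring.
have [l10|l10] := eqVneq l1 0; have [l20|l20] := eqVneq l2 0 => /=.
- have e22 : n22 = - n11 by move: tr; rewrite l10 l20; lra.
  have : n11 ^+ 2 + n12 ^+ 2 = 0 by move: det; rewrite l10 mul0r e22; lra.
  move/eqP; rewrite paddr_eq0 ?sqr_ge0// !sqrf_eq0 => /andP[/eqP n0 /eqP n0'].
  rewrite e22 n0 n0' oppr0 in conv par inj.
  apply: (has_dim2 (e1 := e1) (e2 := e2)).
  + rewrite (_ : e1 = (fun x => 1 * e1 x + 0 * e2 x)); last by apply/funext => x; ring.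
    by apply: conv; ring.
  + rewrite (_ : e2 = (fun x => 0 * e1 x + 1 * e2 x)); last by apply/funext => x; ring.
    by apply: conv; ring.
  + by move=> a b; apply: inj; ring.
  + by move=> f /par[a [b [_ _ ->]]]; exists a, b.
- apply: one; first by move: det; rewrite l10 mul0r; lra.
  by rewrite -tr l10 add0r.
- apply: one; first by move: det; rewrite l20 mulr0; lra.
  by rewrite -tr l20 addr0.
- apply: has_dim0 => f /par[a [b [h1 h2 ->]]].
  have d0 : n11 * n22 - n12 ^+ 2 != 0 by rewrite -det mulf_neq0.
  have a0 : a = 0.
    apply: (mulfI d0); rewrite mulr0.
    have -> : (n11 * n22 - n12 ^+ 2) * a = n22 * (n11 * a + n12 * b) - n12 * (n12 * a + n22 * b) by ring.
    by rewrite h1 h2; ring.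
  have b0 : b = 0.
    apply: (mulfI d0); rewrite mulr0.
    have -> : (n11 * n22 - n12 ^+ 2) * b = n11 * (n12 * a + n22 * b) - n12 * (n11 * a + n12 * b) by ring.
    by rewrite h1 h2; ring.
  by apply/funext => x; rewrite a0 b0; ring.
Qed.

(** The coordinates of the l basis functions in the basis of k elements form an l by k matrix. If k
    < l it has a nonzero left kernel vector, and adding that vector to coordinates in the second
    basis contradicts their uniqueness. *)
Lemma has_dim_le E k l : has_dim E k -> has_dim E l -> (l <= k)%N.
Proof.
move=> [e [Ee he]] [e' [Ee' he']]; rewrite leqNgt; apply/negP => kl.
have C_ (i : 'I_l) : {c : 'I_k -> R | e' i = (fun x => \sum_j c j * e j x)}.
  by apply: cid; have [c [hc _]] := he _ (Ee' i); exists c.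
pose M : 'M[R]_(l, k) := \matrix_(i, j) sval (C_ i) j.
have : kermx M != 0.
  rewrite kermx_eq0 /row_free neq_ltn; apply/orP; left.
  exact: leq_ltn_trans (rank_leq_col M) kl.
move=> /rowV0Pn[v /sub_kermxP vM v0].
have l0 : (0 < l)%N by exact: leq_ltn_trans kl.
pose f := e' (Ordinal l0).
have [c [hc uc]] := he' f (Ee' _).
have H : \sum_j v 0 j *: (e' j : R -> R) = (fun=> 0).
  apply/funext => x; rewrite fct_sumE /=.
  transitivity (\sum_i (v *m M) 0 i * e i x); last first.
    by rewrite vM big1// => i _; rewrite mxE mul0r.
  under [RHS]eq_bigr => i _ do rewrite mxE mulr_suml.
  rewrite exchange_big /=; apply: eq_bigr => j _.
  transitivity (v 0 j * e' j x) => //.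
  rewrite {1}(svalP (C_ j)) mulr_sumr; apply: eq_bigr => i _.
  by rewrite !mxE mulrA.
have Hx x : \sum_j v 0 j * e' j x = 0.
  by have := congr1 (fun g => g x) H; rewrite fct_sumE.
have := uc (fun j => c j + v 0 j); rewrite {1}hc => E1.
have : c = (fun j => c j + v 0 j).
  apply: E1; apply/funext => x.
  under [RHS]eq_bigr => j _ do rewrite mulrDl.
  by rewrite big_split /= Hx addr0.
move=> cv; case/eqP: v0; apply/rowP => j; rewrite mxE.
by have := congr1 (fun g => g j) cv; lra.
Qed.

Lemma has_dim_uniq E k l : has_dim E k -> has_dim E l -> k = l.
Proof. by move=> h1 h2; apply/eqP; rewrite eqn_leq !(@has_dim_le E). Qed.

End dimension.

Section finite_cardinals.
Import finmap.

Lemma card_eq_subset (A B : set nat) (n m : nat) : (A #= `I_m)%card -> (B #= `I_m)%card ->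
  A `<=` B -> B n -> A n.
Proof.
move=> Am Bm AB Bn; apply: contrapT => An.
have fA : finite_set A by apply/finite_setP; exists m.
have fB : finite_set B by apply/finite_setP; exists m.
have := card_fset_set Am; have := card_fset_set Bm => cB cA.
have sub : (n |` fset_set A `<=` fset_set B)%fset.
  apply/fsubsetP => x; rewrite !inE => /orP[/eqP ->|].
    by rewrite in_fset_set//; apply/mem_set.
  by rewrite !in_fset_set// => /set_mem/AB/mem_set.
have := fsubset_leq_card sub; rewrite cardfsU1 cA cB in_fset_set//.
by rewrite (_ : (n \in A) = false) ?add1n ?ltnn//; apply/negbTE; rewrite notin_setE.
Qed.

Lemma card_set2 (n m : nat) : n != m -> ([set n] `|` [set m] #= `I_2)%card.
Proof.
move=> nm; have -> : [set n] `|` [set m] = [set` [fset n; m]%fset].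
  apply/seteqP; split => x /=; first by case=> ->; rewrite !inE eqxx ?orbT.
  by rewrite !inE => /orP[/eqP|/eqP]; [left|right].
by apply/card_eq_fsetP; rewrite cardfs2 nm.
Qed.

End finite_cardinals.

(** * Uniqueness of the spectrum *)

Section uniqueness.
Variable R : realType.
Implicit Types (q : R -> R) (lam : nat -> R).

Lemma spectrum_mono q lam : is_periodic_spectrum q lam -> {homo lam : i j / (i <= j)%N >-> i <= j}.
Proof.
move=> [h _]; apply: homo_leq => [x|x y z|n]; [exact: lexx|exact: le_trans|].
have [h1 h2] := h n./2.
rewrite -[n]odd_double_half; case: (odd n) => /=; first by rewrite add1n.
by rewrite add0n ltW.
Qed.

(** Strong induction on the index. If the sequences agree before n and l1 n < l2 n, then l2 takes
    the value l1 n only before n, where l1 takes it as well; but l1 also takes it at n, against the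
    equality of the multiplicities. *)
Lemma spectrum_uniq q lam1 lam2 : is_periodic_spectrum q lam1 ->
  is_periodic_spectrum q lam2 -> lam1 = lam2.
Proof.
move=> s1 s2; apply/funext => n; elim/ltn_ind: n => n ih.
suff H l1 l2 : is_periodic_spectrum q l1 -> is_periodic_spectrum q l2 ->
    (forall i, (i < n)%N -> l1 i = l2 i) -> l2 n <= l1 n.
  apply/eqP; rewrite eq_le; apply/andP; split; apply: H => // i /ih ->//.
move=> s1' s2' e; rewrite leNgt; apply/negP => lt.
have [k [l [d1 d2 c1]]] := s1'.2 (l1 n); have [k' [l' [d1' d2' c2]]] := s2'.2 (l1 n).
rewrite -(has_dim_uniq d1 d1') -(has_dim_uniq d2 d2') in c2.
have sub : [set i | l2 i = l1 n] `<=` [set i | l1 i = l1 n].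
  move=> i /= hi; rewrite e//; rewrite ltnNge; apply/negP => ni.
  by have := spectrum_mono s2' ni; rewrite hi leNgt lt.
have := card_eq_subset c2 c1 sub (n := n) erefl.
by move=> /= h; move: lt; rewrite h ltxx.
Qed.

Lemma periodic_spectrumE q lam : is_periodic_spectrum q lam -> periodic_spectrum q = lam.
Proof.
move=> h; apply: (spectrum_uniq (q := q)) => //.
suff : [set lam | is_periodic_spectrum q lam] (periodic_spectrum q) by [].
by apply: xgetPex; exists lam.
Qed.

End uniqueness.

(** * The spectrum of a small potential *)

Section spectrum_of_small_potential.
Variables (R : realType) (q : R -> R) (rho : R).
Notation L := (2 * pi : R).
Notation P := (periodize q).
Hypotheses (rho_small : rho <= 1 / 9600) (pp : potential L rho P).
Implicit Types (k mu s : R) (f h : R -> R) (b : bool).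

Let L0 : 0 < L. Proof. by rewrite mulr_gt0// pi_gt0. Qed.
Lemma twopi_ge4 : 4 <= L. Proof. by have := pi_ge2 R; lra. Qed.
Lemma twopi_le8 : L <= 8.
Proof. by have := pihalf_02_cos_pihalf R => -[] /andP[_ ?] _; lra. Qed.
Let L4 := twopi_ge4.
Let L8 := twopi_le8.

Lemma cell_in (x : R) : 0 <= x - L * (Num.floor (x / L))%:~R <= L.
Proof.
have := floor_itv (x / L) => /andP[h1 h2].
rewrite ler_pdivlMr// in h1; rewrite ltr_pdivrMr// intrD mulrDl in h2.
by rewrite [L * _]mulrC; apply/andP; split; lra.
Qed.

Lemma ext_eq s f g : (forall x, 0 <= x <= L -> f x = g x) -> ext L s f = ext L s g.
Proof. by move=> fg; apply/funext => x; rewrite /ext fg// cell_in. Qed.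

(** The multipliers s = 1 and s = -1 treat the periodic and the antiperiodic problem at once. *)
Definition quasi_solutions s mu : set (R -> R) :=
  [set f | hill_solution q mu f /\ forall x, f (x + L) = s * f x].

Lemma periodic_quasi mu : periodic_solutions q mu = quasi_solutions 1 mu.
Proof.
by apply/seteqP; split=> f [h1 h2]; split => // x; rewrite h2 mul1r.
Qed.

Lemma antiperiodic_quasi mu : antiperiodic_solutions q mu = quasi_solutions (-1) mu.
Proof.
by apply/seteqP; split=> f [h1 h2]; split => // x; rewrite h2 mulN1r.
Qed.

Let s_neq0 s : s = 1 \/ s = -1 -> s != 0.
Proof. by case=> ->; rewrite ?oppr_eq0 oner_neq0. Qed.

Lemma quasi_of_sol s mu f h : s = 1 \/ s = -1 ->
  sol L (fun x => P x - mu) f h -> f L = s * f 0 -> h L = s * h 0 ->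
  quasi_solutions s mu (ext L s f).
Proof.
move=> hs hsol fL hL; have H := hill_of_sol (s_neq0 hs) hsol fL hL.
split; first exact: H.
by move=> x; rewrite (ext_quasi L0 _ _ (s_neq0 hs)).
Qed.

Lemma quasi_zero s mu : s = 1 \/ s = -1 ->
  (forall f h, sol L (fun x => P x - mu) f h -> f L = s * f 0 -> h L = s * h 0 ->
    forall x, 0 <= x <= L -> f x = 0) -> has_dim (quasi_solutions s mu) 0.
Proof.
move=> hs H; apply: has_dim0 => f [hf fs].
have [h1 h2 h3] := sol_of_hill pp.1 (s_neq0 hs) hf fs.
rewrite -(ext_self (s_neq0 hs) fs) (@ext_eq s f (fun=> 0)); last exact: (H _ _ h1).
by apply/funext => x; rewrite /ext mulr0.
Qed.

Lemma antiperiodic_dim0 mu : mu <= 1 / 1024 -> has_dim (antiperiodic_solutions q mu) 0.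
Proof.
move=> hmu; rewrite antiperiodic_quasi; apply: quasi_zero; first by right.
move=> f h hs fL hL; apply: (small_energy L0 L8 rho_small pp hmu hs).
  by rewrite fL; ring.
by rewrite fL hL; ring.
Qed.

Lemma periodic_dim0 mu : mu <= - (1 / 1024) -> has_dim (periodic_solutions q mu) 0.
Proof.
move=> hmu; rewrite periodic_quasi; apply: quasi_zero; first by left.
move=> f h hs fL hL; apply: (negative_energy L0 L4 L8 rho_small pp hmu hs).
by rewrite fL hL; ring.
Qed.

Lemma periodic_dim_low mu : `|mu| <= 1 / 1024 ->
  has_dim (periodic_solutions q mu) (G L P mu == 0).
Proof.
move=> hmu; rewrite periodic_quasi.
have [ds db d0 dL] := dsolP L0 L8 rho_small pp hmu.
have [G0|G0] := eqVneq (G L P mu) 0 => /=; last first.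
  apply: quasi_zero; first by left.
  move=> f h hs; rewrite !mul1r => fL hL x hx.
  have [fE] := periodic_dirichlet L0 L8 rho_small pp hmu hs fL hL.
  by move/eqP; rewrite mulf_eq0 (negbTE G0) orbF => /eqP f0; rewrite fE// f0 mul0r.
have hE : quasi_solutions 1 mu (ext L 1 (dsol L P mu).1).
  apply: (quasi_of_sol _ ds); [by left|by rewrite d0 dL mul1r|].
  by rewrite mul1r; apply/subr0_eq.
apply: (has_dim1 hE).
  have hL : (dsol L P mu).1 L = 1 * (dsol L P mu).1 0 by rewrite d0 dL mul1r.
  have h0 : 0 <= (0 : R) <= L by rewrite lexx ltW.
  by exists 0; rewrite (ext_in L0 (oner_neq0 R) hL h0) d0 oner_neq0.
move=> f [hf fs].
have [hs fL hL] := sol_of_hill pp.1 (oner_neq0 R) hf fs.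
rewrite !mul1r in fL hL.
have [fE _] := periodic_dirichlet L0 L8 rho_small pp hmu hs fL hL.
exists (f 0); rewrite -{1}(ext_self (oner_neq0 R) fs) (@ext_eq 1 f _ fE).
by apply/funext => x; rewrite /ext; ring.
Qed.

Section positive.
Variable k : R.
Hypothesis hk : 1 / 32 <= k.
Let k0 : 0 < k. Proof. by have := hk; lra. Qed.
Let small : 3 / k * I 0 L (fun t => `|P t|) <= 1 / 2.
Proof.
have /andP[ik0 ik] := inv_le32 hk; have := pp.2; have := rho_small => r1 r2.
have i0 : 0 <= I 0 L (fun t => `|P t|) by exact: I_ge0.
have : 3 / k * I 0 L (fun t => `|P t|) <= 96 * (1 / 9600).
  by apply: ler_pM => //; [rewrite mulr_ge0|lra|lra].
lra.
Qed.

Lemma quasi_dim s (n11 n12 n22 l1 l2 : R) : s = 1 \/ s = -1 ->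
  (forall m1 m2, (if s == 1 then per_cond L k P m1 m2 else anti_cond L k P m1 m2) <->
    (n11 * m1 + n12 * m2 = 0 /\ n12 * m1 + n22 * m2 = 0)) ->
  l1 + l2 = n11 + n22 -> l1 * l2 = n11 * n22 - n12 ^+ 2 ->
  has_dim (quasi_solutions s (k ^+ 2)) ((l1 == 0) + (l2 == 0)).
Proof.
move=> hs iff; set e1 := ext L s (fsol L k P (fun x => cos (k * x))).
set e2 := ext L s (fsol L k P (fun x => sin (k * x))).
have cE a c : (fun x => a * e1 x + c * e2 x) = ext L s (comb L k P a c).
  by apply/funext => x; rewrite /e1 /e2 /ext /comb; ring.
apply: (has_dim_kernel (e1 := e1) (e2 := e2)).
- move=> a c h1 h2; rewrite cE.
  have /(bvp_pos_conv L0 k0 pp.1 small hs)[h [hsol fL hL]] := (iff a c).2 (conj h1 h2).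
  exact: quasi_of_sol hsol fL hL.
- move=> f [hf fs]; have [hsol fL hL] := sol_of_hill pp.1 (s_neq0 hs) hf fs.
  have [m1 [m2 [fE /iff[h1 h2]]]] := bvp_pos L0 k0 pp.1 small hs hsol fL hL.
  by exists m1, m2; split=> //; rewrite cE -(ext_eq s fE) ext_self// s_neq0.
- move=> a c h1 h2; rewrite cE => z.
  have /(bvp_pos_conv L0 k0 pp.1 small hs)[h [hsol fL hL]] := (iff a c).2 (conj h1 h2).
  apply: (comb_inj L0 k0 pp.1 small) => x hx.
  by rewrite -(ext_in L0 (s_neq0 hs) fL hx) z.
Qed.

Let x b := k - eta L b k P.

(** [ev] is the tangent of pi eta and c = cos (pi eta) is positive; the addition formulas for pi k -
    pi eta give both identities, as k L / 2 = pi k. *)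
Lemma trig_eta b : exists2 c, 0 < c &
  sin (pi * x b) = - c * (cos (k * L / 2) * ev L b k P - sin (k * L / 2)) /\
  cos (pi * x b) = c * (cos (k * L / 2) + sin (k * L / 2) * ev L b k P).
Proof.
set a := atan (ev L b k P).
have c0 : 0 < cos a by apply: cos_gt0_pihalf; rewrite atan_gtNpi2 atan_ltpi2.
have sE : sin a = ev L b k P * cos a.
  by rewrite -{1}(atanK (ev L b k P)) -/a /tan divfK// gt_eqF.
exists (cos a) => //.
have -> : k * L / 2 = pi * k by field.
have -> : pi * x b = pi * k - a.
  by rewrite /x /eta mulrBr mulrCA divff ?mulr1// gt_eqF// pi_gt0.
by rewrite sinB cosB sE; split; ring.
Qed.

(** The two systems have matrices C S - T and C + T S, whose eigenvalues are C ev - T and C + T ev.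
    By [trig_eta] these vanish together with the sine and the cosine. *)
Lemma dims_pos :
  has_dim (periodic_solutions q (k ^+ 2)) ((sin (pi * x true) == 0) + (sin (pi * x false) == 0)) /\
  has_dim (antiperiodic_solutions q (k ^+ 2)) ((cos (pi * x true) == 0) + (cos (pi * x false) == 0)).
Proof.
set C := cos (k * L / 2); set T := sin (k * L / 2).
have zs b : (sin (pi * x b) == 0) = (C * ev L b k P - T == 0).
  by have [c c0 [-> _]] := trig_eta b; rewrite mulf_eq0 oppr_eq0 (gt_eqF c0).
have zc b : (cos (pi * x b) == 0) = (C + T * ev L b k P == 0).
  by have [c c0 [_ ->]] := trig_eta b; rewrite mulf_eq0 (gt_eqF c0).
have es := ev_sum L k P; have ep := ev_prod L k P.
rewrite !zs !zc periodic_quasi antiperiodic_quasi; split.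
  apply: (@quasi_dim 1 (C * S11 L k P - T) (C * S12 L k P) (C * S22 L k P - T)).
  + by left.
  + by move=> m1 m2; rewrite eqxx.
  + have -> : C * ev L true k P - T + (C * ev L false k P - T) =
      C * (ev L true k P + ev L false k P) - 2 * T by ring.
    by rewrite es; ring.
  + have -> : (C * ev L true k P - T) * (C * ev L false k P - T) =
      C ^+ 2 * (ev L true k P * ev L false k P) - C * T * (ev L true k P + ev L false k P) + T ^+ 2 by ring.
    by rewrite es ep; ring.
apply: (@quasi_dim (-1) (C + T * S11 L k P) (T * S12 L k P) (C + T * S22 L k P)).
+ by right.
+ by move=> m1 m2; rewrite (_ : (-1 == 1 :> R) = false)//; apply: lt_eqF; lra.
+ have -> : C + T * ev L true k P + (C + T * ev L false k P) =
    T * (ev L true k P + ev L false k P) + 2 * C by ring.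
  by rewrite es; ring.
+ have -> : (C + T * ev L true k P) * (C + T * ev L false k P) =
    T ^+ 2 * (ev L true k P * ev L false k P) + C * T * (ev L true k P + ev L false k P) + C ^+ 2 by ring.
  by rewrite es ep; ring.
Qed.

(** The sum of the two truth values is what the branch b contributes to the periodic and
    antiperiodic multiplicities together. At a root k - eta = j / 2 the parity of j decides which of
    the two is 1. *)
Lemma root_cases b :
  (exists j, [/\ (0 < j)%N, kroot L b P j = k,
     (forall i, (0 < i)%N -> kroot L b P i = k -> i = j) &
     ((sin (pi * x b) == 0)%R + (cos (pi * x b) == 0)%R = 1)%N]) \/
  ((forall j, (0 < j)%N -> kroot L b P j != k) /\
     ((sin (pi * x b) == 0)%R + (cos (pi * x b) == 0)%R = 0)%N).
Proof.
have x0 : 0 < x b.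
  have := eta_small L0 rho_small b hk pp; have := hk => h.
  by rewrite /x ltr_norml => /andP[_ ?]; lra.
have root j : (0 < j)%N -> kroot L b P j = k <-> x b = j%:R / 2.
  move=> j0; split=> [e|e].
    by have [_ _] := krootP L0 L8 rho_small pp b j0; rewrite e.
  by rewrite -(kroot_uniq L0 L8 rho_small pp j0 hk e).
have [[j [j0 hj]]|no] := pselect (exists j, (0 < j)%N /\ kroot L b P j = k).
  left; exists j; split => //.
    move=> i i0 hi; have := (root _ i0).1 hi; rewrite ((root _ j0).1 hj).
    by move=> e; apply/eqP; rewrite -(eqr_nat R); apply/eqP; lra.
  by rewrite ((root _ j0).1 hj) !trig_half; case: odd.
right; split; first by move=> j j0; apply/eqP => h; apply: no; exists j.
have nz : ~ (sin (pi * x b) = 0 \/ cos (pi * x b) = 0).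
  move=> /(trig_zero x0)[j j0 e]; apply: no; exists j; split => //.
  exact: (root _ j0).2.
have [s0|_] := eqVneq (sin (pi * x b)) 0; first by case: nz; left.
by have [s0|_] := eqVneq (cos (pi * x b)) 0; first by case: nz; right.
Qed.

End positive.

Definition lam0 : R := sval (cid (G_root L0 L4 L8 rho_small pp)).

Lemma lam0P : `|lam0| < 1 / 1024 /\ G L P lam0 = 0 /\
  forall mu, `|mu| <= 1 / 1024 -> G L P mu = 0 -> mu = lam0.
Proof. exact: (svalP (cid (G_root L0 L4 L8 rho_small pp))). Qed.

(** Both n = 2 j - 1 and n = 2 j have [uphalf n] equal to j; the odd index takes the root of the
    smaller eigenvalue and the even one that of the larger. *)
Definition lamq (n : nat) : R :=
  if n is 0 then lam0 else kroot L (~~ odd n) P (uphalf n) ^+ 2.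

Let kge b j : (0 < j)%N -> 3 / 8 <= kroot L b P j.
Proof. by move=> j0; exact: (kroot_ge L0 L8 rho_small pp b j0). Qed.

Lemma lamq_odd j : lamq j.*2.+1 = kroot L false P j.+1 ^+ 2.
Proof. by rewrite /lamq /= odd_double /= ?half_double ?uphalf_double. Qed.

Lemma lamq_even j : lamq j.*2.+2 = kroot L true P j.+1 ^+ 2.
Proof. by rewrite /lamq /= odd_double /= ?half_double ?uphalf_double. Qed.

Lemma lamq_pos n : (0 < n)%N -> 1 / 1024 < lamq n.
Proof.
case: n => // n _; have h := kge (~~ odd n.+1) (isT : (0 < uphalf n.+1)%N).
rewrite /lamq; move: (kroot _ _ _ _) h => y h; nra.
Qed.

Lemma lamq_lt j : lamq j.*2 < lamq j.*2.+1 /\ lamq j.*2.+1 <= lamq j.*2.+2.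
Proof.
split; last first.
  rewrite lamq_odd lamq_even lerXn2r ?nnegrE//.
  - by have := @kge false j.+1 isT; lra.
  - by have := @kge true j.+1 isT; lra.
  - exact: (kroot_le L0 L8 rho_small pp (isT : (0 < j.+1)%N)).
case: j => [|j].
  have [h _] := lam0P; have := @lamq_pos 1%N isT.
  by move: h; rewrite ltr_norml /= => /andP[_ h1] h2; exact: lt_trans h1 h2.
(* The windows around (j + 1) / 2 and (j + 2) / 2 have half-width 1/8 and do not meet. *)
rewrite doubleS lamq_even -doubleS lamq_odd.
have [_ h1 _] := krootP L0 L8 rho_small pp true (isT : (0 < j.+1)%N).
have [h2 _ _] := krootP L0 L8 rho_small pp false (isT : (0 < j.+2)%N).
have g1 := @kge true j.+1 isT.
move: h2; rewrite -[j.+2%:R]natr1 => h2.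
rewrite ltr_pXn2r ?nnegrE//; lra.
Qed.

(** Positive indices of one parity belong to one branch, on which k is the root for at most one j.
    The fiber is a point or empty, exactly as the branch contributes 1 or 0 to the multiplicity. *)
Lemma root_fiber k b : 1 / 32 <= k -> exists o : option nat,
  [set n | ~~ odd n = b /\ lamq n = k ^+ 2] = (if o is Some n then [set n] else set0) /\
  ((sin (pi * (k - eta L b k P)) == 0)%R + (cos (pi * (k - eta L b k P)) == 0)%R = isSome o)%N.
Proof.
move=> hk; have k0 : 0 <= k by lra.
have lamE n : lamq n = k ^+ 2 <-> (0 < n)%N /\ kroot L (~~ odd n) P (uphalf n) = k.
  case: n => [|n] /=.
    split=> [e|[]//]; have [] := lam0P; rewrite e ltr_norml => /andP[_ h] _.
    exfalso; nra.
  have h := kge (~~ ~~ odd n) (isT : (0 < n./2.+1)%N).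
  split=> [e|[_ ->]//]; split => //; apply/eqP.
  by rewrite -(eqrXn2 (n := 2)) ?e//; lra.
case: (root_cases hk b) => [[j [j0 hj uj ->]]|[no ->]]; last first.
  exists None; split => //; apply/seteqP; split => // n [nb /lamE[n0 e]].
  by rewrite nb in e; have := no (uphalf n); rewrite e eqxx; case: n n0 {nb e} => // n _ /(_ isT).
exists (Some (if b then j.*2 else j.*2.-1)); split => //; apply/seteqP; split => n /=.
  move=> [nb /lamE[n0 e]]; rewrite nb in e.
  have u0 : (0 < uphalf n)%N by case: n n0 {nb e}.
  have {}e := uj _ u0 e; rewrite -nb -e.
  rewrite -[in LHS](odd_double_half n) uphalf_half; case: (odd n) => /=.
    by rewrite doubleD.
  by rewrite add0n.
move=> ->; case: j j0 hj uj => // i _ hj _; rewrite doubleS.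
case: b hj => hj.
  by split; [rewrite /= odd_double|rewrite lamq_even hj].
rewrite -[i.*2.+2.-1]/(i.*2.+1).
by split; [rewrite /= odd_double|rewrite lamq_odd hj].
Qed.

Lemma lamq_card_pos k : 1 / 32 <= k -> exists d1 d2,
  [/\ has_dim (periodic_solutions q (k ^+ 2)) d1, has_dim (antiperiodic_solutions q (k ^+ 2)) d2 &
   ([set n | lamq n = k ^+ 2] #= `I_(d1 + d2))%card].
Proof.
move=> hk; have [D1 D2] := dims_pos hk.
eexists; eexists; split; [exact: D1|exact: D2|].
have [ot [At ct]] := root_fiber true hk; have [of_ [Af cf]] := root_fiber false hk.
rewrite addnACA ct cf.
have -> : [set n | lamq n = k ^+ 2] = [set n | ~~ odd n = true /\ lamq n = k ^+ 2] `|`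
    [set n | ~~ odd n = false /\ lamq n = k ^+ 2].
  apply/seteqP; split => [n /= h|n [[_ ]|[_]]//].
  by case: (boolP (odd n)) => o; [right|left]; rewrite ?o ?(negbTE o).
case: ot of_ At Af {ct cf} => [n|] [m|] At Af; rewrite At Af ?setU0 ?set0U /=.
- have /= [on _] : [set n | ~~ odd n = true /\ lamq n = k ^+ 2] n by rewrite At.
  have /= [om _] : [set n | ~~ odd n = false /\ lamq n = k ^+ 2] m by rewrite Af.
  have nm : n != m by apply/eqP => e; rewrite e om in on.
  exact: card_set2.
- exact: card_set1.
- exact: card_set1.
- by rewrite addn0 II0; exact: card_eqxx.
Qed.

(** Every mu >= 1/1024 is k^2 with k >= 1/32. Below that value there are no antiperiodic solutions;
    the periodic ones are counted by the zeros of G down to - 1/1024 and do not exist from there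
    on. *)
Lemma lamq_spectrum : is_periodic_spectrum q lamq.
Proof.
split; first exact: lamq_lt.
move=> mu; have [hmu|hmu] := leP (1 / 1024) mu.
  have k0 := sqrtr_ge0 mu.
  have k2 : Num.sqrt mu ^+ 2 = mu by rewrite sqr_sqrtr//; lra.
  rewrite -k2; apply: lamq_card_pos.
  by rewrite leNgt; apply/negP => lt; move: k2 k0 lt; move: (Num.sqrt mu) => k; nra.
exists (if mu <= - (1 / 1024) then 0%N else nat_of_bool (G L P mu == 0)), 0%N.
rewrite addn0; have [nm|nm] := leP mu (- (1 / 1024)).
  split; [exact: periodic_dim0|by apply: antiperiodic_dim0; lra|].
  rewrite II0 (_ : [set n | _] = set0); first exact: card_eqxx.
  apply/seteqP; split => // n /= e.
  case: n e => [|n] e; last by have := @lamq_pos n.+1 isT; rewrite e; lra.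
  by have [] := lam0P; rewrite -[lam0]/(lamq 0) e ltr_norml => /andP[? _]; lra.
have am : `|mu| <= 1 / 1024 by rewrite ler_norml (ltW nm) ltW.
split; [exact: periodic_dim_low|by apply: antiperiodic_dim0; lra|].
have [l1 [l2 l3]] := lam0P.
have E n : lamq n = mu -> n = 0%N.
  by case: n => // n e; exfalso; have := @lamq_pos n.+1 isT; rewrite e; lra.
have [G0|G0] := eqVneq (G L P mu) 0 => /=.
  rewrite (_ : [set n | _] = [set 0%N]); first exact: card_set1.
  apply/seteqP; split => n /=; first exact: E.
  by move=> ->; rewrite /= (l3 _ am G0).
rewrite II0 (_ : [set n | _] = set0); first exact: card_eqxx.
apply/seteqP; split => // n /= e; have n0 := E n e.
by rewrite n0 /= in e; rewrite -e l2 eqxx in G0.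
Qed.

End spectrum_of_small_potential.

(** * Measurability and concentration *)

Section lipschitz_on.
Variable R : realType.

(* through the McShane extension f |-> inf_(g in A) (h g + C d(f, g)) *)
Lemma lipschitz_on_measurable (A : set (L2T R)) (h : L2T R -> R) (C : R) : 0 <= C ->
  (forall f g, A f -> A g -> h f - h g <= C * L2dist f g) -> measurable_fun A h.
Proof.
move=> C0 hC; have [->|/set0P[a Aa]] := eqVneq A set0; first exact: measurable_fun_set0.
pose V f := [set h g + C * L2dist f g | g in A].
pose H f := inf (V f).
have lb f g : A g -> h a - C * L2dist f a <= h g + C * L2dist f g.
  move=> Ag; have := hC a g Aa Ag; have := L2dist_triangle f a g.
  move=> /(ler_wpM2l C0); rewrite mulrDr (L2dist_sym a f); lra.
have hlb f : has_lbound (V f) by exists (h a - C * L2dist f a) => _ [g Ag <-]; exact: lb.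
have ne f : V f !=set0 by exists (h a + C * L2dist f a); exists a.
have HL f f' : H f - H f' <= C * L2dist f f'.
  suff : H f - C * L2dist f f' <= H f' by lra.
  apply: lb_le_inf => // _ [g Ag <-].
  have : H f <= h g + C * L2dist f g by apply: ge_inf => //; exists g.
  by have := ler_wpM2l C0 (L2dist_triangle f' f g); rewrite mulrDr; lra.
have HE f : A f -> H f = h f.
  move=> Af; apply/eqP; rewrite eq_le; apply/andP; split.
    apply: (@le_trans _ _ (h f + C * L2dist f f)); first by apply: ge_inf => //; exists f.
    by rewrite L2distxx mulr0 addr0.
  by apply: lb_le_inf => // _ [g Ag <-]; have := hC f g Af Ag; lra.
apply: (eq_measurable_fun H); first by move=> f /set_mem; exact: HE.
by apply: measurable_funTS; exact: lipschitz_L2_measurable C0 HL.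
Qed.

End lipschitz_on.

(** * From a ball in L^2 to small potentials *)

Section periodization.
Variable R : realType.
Notation L := (2 * pi : R).
Notation mu := (@lebesgue_measure R).

Let L0 : 0 < L. Proof. by rewrite mulr_gt0// pi_gt0. Qed.

Lemma lebesgue_le_circle (f : R -> \bar R) : measurable_fun setT f -> (forall x, 0 <= f x)%E ->
  (\int[mu]_(x in `[0%R, L[) f x <= L%:E * \int[circle]_x f x)%E.
Proof.
move=> mf f0; have mD : measurable (`[0, L[%classic : set R) by exact: measurable_itv.
have mfD : measurable_fun (`[0, L[%classic : set R) f by exact: measurable_funTS.
have e : (\int[circle]_(x in `[0%R, L[) f x =
    (L^-1)%:E * \int[mu]_(x in `[0%R, L[) f x)%E.
  rewrite -(ge0_integral_mscale mu mD (NngNum (invr_2pi_ge0 R)) mfD)//.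
  apply: eq_measure_integral => A mA AD.
  by rewrite /circle /= /mscale /= /mrestr (setIidl AD).
have le : (\int[circle]_(x in `[0%R, L[) f x <= \int[circle]_x f x)%E.
  by apply: ge0_subset_integral => //; exact: mf.
rewrite e in le.
have -> : (\int[mu]_(x in `[0%R, L[) f x = L%:E * ((L^-1)%:E * \int[mu]_(x in `[0%R, L[) f x))%E.
  by rewrite muleA -EFinM divff ?mul1e// gt_eqF.
by rewrite lee_wpmul2l// lee_fin ltW.
Qed.

Lemma periodize_in (u : R -> R) x : 0 <= x < L -> periodize u x = u x.
Proof.
move=> /andP[x0 xL]; rewrite /periodize (@floor_def _ _ 0) ?mulr0 ?subr0//.
apply/andP; split; first exact: divr_ge0 x0 (ltW L0).
by rewrite ltr_pdivrMr// mul1r.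
Qed.

(** [periodize u] agrees with u on [0, 2 pi[; closing the interval adds only the null point 2 pi,
    where it takes the value u 0. *)
Lemma periodize_L1 (u : R -> R) (c : R) : measurable_fun setT u ->
  (\int[circle]_x `|u x|%:E <= c%:E)%E ->
  itg 0 L (periodize u) /\ I 0 L (fun x => `|periodize u x|) <= L * c.
Proof.
move=> mu_ hc.
have pin x : x \in (`[0, L[%classic : set R) -> periodize u x = u x.
  by rewrite inE/= in_itv/=; exact: periodize_in.
have mabs : measurable_fun [set: R] (fun x => `|u x|%:E).
  by apply/measurable_EFinP; exact: measurableT_comp.
have mP' : measurable_fun `[0, L[ (periodize u).
  apply: (eq_measurable_fun u); first by move=> x hx; rewrite pin.
  exact: measurable_funTS.
have mP : measurable_fun `[0, L] (periodize u) by apply/measurable_fun_itv_bndo_bndcP.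
have E : (\int[mu]_(x in `[0%R, L]) `|periodize u x|%:E = \int[mu]_(x in `[0%R, L[) `|u x|%:E)%E.
  rewrite -integral_itv_bndo_bndc; last first.
    by apply/measurable_EFinP; exact: measurableT_comp.
  by apply: eq_integral => x hx; rewrite pin.
have le : (\int[mu]_(x in `[0%R, L]) `|periodize u x|%:E <= (L * c)%:E)%E.
  have nn x : (0 <= `|u x|%:E)%E by rewrite lee_fin.
  rewrite E (le_trans (lebesgue_le_circle mabs nn))//.
  rewrite [(L * c)%:E]EFinM; apply: lee_wpmul2l => //.
  by rewrite lee_fin ltW.
split.
  apply/integrableP; split; first exact/measurable_EFinP.
  exact: le_lt_trans le (ltry _).
have fin : (\int[mu]_(x in `[0%R, L]) `|periodize u x|%:E)%E \is a fin_num.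
  rewrite ge0_fin_numE; first exact: le_lt_trans le (ltry _).
  by apply: integral_ge0 => x _; rewrite lee_fin.
by rewrite -lee_fin /I /Rintegral fineK.
Qed.

(** AM-GM with weight a: |q| <= q^2 / (2 a) + a / 2, and N <= a^2. *)
Lemma ball_L1 (N a : R) (q : L2T R) : 0 < a -> N <= a ^+ 2 -> L2ball N q ->
  (\int[circle]_x `|q x|%:E <= a%:E)%E.
Proof.
move=> a0 Na hq; have mq := measurable_L2fun q.
have an : a != 0 by rewrite gt_eqF.
have m2 : measurable_fun [set: measurableTypeR R] (fun x => (q x ^+ 2)%:E).
  by apply/measurable_EFinP; exact: measurable_funX.
have mab : measurable_fun [set: measurableTypeR R] (fun x => `|q x|%:E).
  by apply/measurable_EFinP; exact: measurableT_comp.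
apply: (@le_trans _ _ (\int[circle]_x (((2 * a)^-1)%:E * (q x ^+ 2)%:E + (a / 2)%:E))%E).
  apply: ge0_le_integral => //.
  - by apply: emeasurable_funD => //; exact: measurable_funeM.
  - move=> x _; rewrite -EFinM -EFinD lee_fin -(real_normK (num_real (q x))).
    set y := `|q x|; have : 0 <= (2 * a)^-1 * (y - a) ^+ 2.
      by rewrite mulr_ge0 ?sqr_ge0// invr_ge0 mulr_ge0// ltW.
    have -> : (2 * a)^-1 * (y - a) ^+ 2 = (2 * a)^-1 * y ^+ 2 - y + a / 2 by field.
    lra.
have i0 : 0 <= (2 * a)^-1 by rewrite invr_ge0 mulr_ge0// ltW.
rewrite ge0_integralD//; first last.
- by move=> x _; rewrite lee_fin divr_ge0// ltW.
- exact: measurable_funeM.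
- by move=> x _; rewrite -EFinM lee_fin mulr_ge0// sqr_ge0.
rewrite ge0_integralZl//; last by move=> x _; rewrite lee_fin sqr_ge0.
rewrite integral_cst// circle_setT mule1.
apply: (@le_trans _ _ (((2 * a)^-1)%:E * N%:E + (a / 2)%:E)%E).
  by apply: leeD2r; apply: lee_wpmul2l => //; rewrite lee_fin.
rewrite -EFinM -EFinD lee_fin.
have : (2 * a)^-1 * N <= (2 * a)^-1 * a ^+ 2 by rewrite ler_wpM2l.
have -> : (2 * a)^-1 * a ^+ 2 = a / 2 by field.
lra.
Qed.

Definition rho0 : R := 1 / 9600.
(** A normalized L^2 norm below rho0 / 8 gives an L^1 norm over a period of at most 2 pi rho0 / 8 <=
    rho0. *)
Definition ball_radius : R := (rho0 / 8) ^+ 2.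

Lemma rho0_gt0 : 0 < rho0. Proof. by rewrite /rho0; lra. Qed.

Lemma ball_potential (N : R) (q : L2T R) : N < ball_radius -> L2ball N q ->
  potential L rho0 (periodize q).
Proof.
move=> hN hq; have r0 := rho0_gt0.
have [|h1 h2] := @periodize_L1 q (rho0 / 8) (measurable_L2fun q).
  by apply: ball_L1 hq; [rewrite divr_gt0|exact: ltW].
split => //; rewrite (le_trans h2)//.
have := twopi_le8 R; move: r0; set r := rho0; set l := 2 * pi => r0 l8.
have : l * (r / 8) <= 8 * (r / 8) by rewrite ler_wpM2r// divr_ge0// ltW.
lra.
Qed.

Lemma potential_dist (q q' : L2T R) :
  I 0 L (fun x => `|periodize q x - periodize q' x|) <= 8 * L2dist q q'.
Proof.
have [_ h] := @periodize_L1 (fun x => q x - q' x) (L2dist q q') (measurable_L2funB q q') (Lnorm1_L2dist q q').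
rewrite (le_trans h)// ler_wpM2r ?twopi_le8//.
by rewrite /L2dist fine_ge0// Lnorm_ge0.
Qed.

Section ball.
Variable N : R.
Hypothesis hN : N < ball_radius.

Let rho_le : rho0 <= 1 / 9600. Proof. by []. Qed.

(** The root is Lipschitz on the ball: 192 comes from [kroot_lip], and 8 >= 2 pi from comparing
    Lebesgue measure with the normalized one. *)
Lemma kroot_measurable b j : (0 < j)%N ->
  measurable_fun (L2ball N) (fun q : L2T R => kroot L b (periodize q) j).
Proof.
move=> j0; apply: (@lipschitz_on_measurable _ _ _ (192 * 8)); first by rewrite mulr_ge0.
move=> f g hf hg.
have := kroot_lip L0 (twopi_le8 R) rho_le b j0 (ball_potential hN hf) (ball_potential hN hg).
have := potential_dist f g; set D := I _ _ _ => hD.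
move: (kroot _ _ _ _) (kroot _ _ _ _) => x y h.
by have := ler_norm (y - x); lra.
Qed.

(** This is tau_n for n >= 0 on the ball, where the eigenvalues of index 2 n - 1 and 2 n are
    squares, so the root is real. *)
Definition tr (q : L2T R) (n : nat) : R := if n is 0 then 0 else
  Num.sqrt (2 * (kroot L true (periodize q) n ^+ 2 + kroot L false (periodize q) n ^+ 2)).

Lemma tau_pos_tr q n : L2ball N q -> tau q n%:Z = Complex (tr q n) 0.
Proof.
move=> hq; have pp := ball_potential hN hq.
case: n => [|n] //.
rewrite /tau /tau_pos (periodic_spectrumE (lamq_spectrum rho_le pp)).
rewrite doubleS -[n.*2.+2.-1]/(n.*2.+1) lamq_even lamq_odd.
set v := 2 * _; have v0 : 0 <= v by rewrite mulr_ge0// addr_ge0// sqr_ge0.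
have -> : real_complex R v = (real_complex R (Num.sqrt v)) ^+ 2.
  by rewrite -rmorphXn /= sqr_sqrtr.
by rewrite sqrCK// lecE /= eqxx sqrtr_ge0.
Qed.

Lemma tau_neg_tr q n : L2ball N q -> tau q (Negz n) = Complex (- tr q n.+1) 0.
Proof.
move=> hq; have := tau_pos_tr n.+1 hq; rewrite /tau => ->.
by apply/eqP; rewrite eq_complex /= oppr0 !eqxx.
Qed.

(** Both roots lie within 1 / (8 n) of n / 2, so twice their quadratic mean lies within 1 / (4 n) of
    n. *)
Lemma tr_close q n : L2ball N q -> (0 < n)%N -> `|tr q n - n%:R| <= 1 / 2 / n%:R.
Proof.
move=> hq n0; have pp := ball_potential hN hq.
have h1 := kroot_close L0 (twopi_le8 R) rho_le pp true n0.
have h2 := kroot_close L0 (twopi_le8 R) rho_le pp false n0.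
case: n n0 h1 h2 => // n n0; rewrite /tr; set m : R := n.+1%:R.
move: (kroot _ _ _ _) (kroot _ _ _ _) => x y.
have m1 : 1 <= m by rewrite /m ler1n.
have i0 : 0 < m^-1 by rewrite invr_gt0; lra.
have i1 : m^-1 <= 1 by rewrite invf_le1; lra.
move: i0 i1; set i := m^-1 => i0 i1 hx hy.
have ri : 6 * rho0 * i <= 1 / 8 * i by rewrite ler_wpM2r ?(ltW i0)// /rho0; lra.
have {}hx := le_trans hx ri; have {}hy := le_trans hy ri.
move: hx hy; rewrite !ler_norml => /andP[x1 x2] /andP[y1 y2].
set v := 2 * _; have v0 : 0 <= v by rewrite mulr_ge0// addr_ge0// sqr_ge0.
have r2 : Num.sqrt v ^+ 2 = v by rewrite sqr_sqrtr.
have := sqrtr_ge0 v; move: r2; rewrite {2}/v; move: (Num.sqrt v) => r r2 r0.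
have lo : (m - i / 4) ^+ 2 <= r ^+ 2 by rewrite r2; nra.
have hi : r ^+ 2 <= (m + i / 4) ^+ 2 by rewrite r2; nra.
have p1 : 0 <= m - i / 4 by lra.
have p2 : 0 <= m + i / 4 by lra.
rewrite ler_pXn2r ?nnegrE// in lo; rewrite ler_pXn2r ?nnegrE// in hi.
by apply/andP; split; lra.
Qed.

Lemma tr_half q n : L2ball N q -> `|tr q n - n%:R| <= 1 / 2.
Proof.
case: n => [|n] hq; first by rewrite /= subr0 normr0; lra.
rewrite (le_trans (tr_close hq (isT : (0 < n.+1)%N)))// ler_pdivrMr ?ltr0n//.
by rewrite ler_peMr ?ler1n//; lra.
Qed.

(** Telescoping by 1 / (4 m^2) <= 1 / m - 1 / (m + 1); the term of index 0 is 0. *)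
Lemma tr_sum q n : L2ball N q -> \sum_(i < n) (tr q i - i%:R) ^+ 2 <= 1.
Proof.
move=> hq; case: n => [|n]; first by rewrite big_ord0.
suff : \sum_(i < n.+1) (tr q i - i%:R) ^+ 2 <= 1 - n.+1%:R^-1.
  by move/le_trans; apply; rewrite gerBl invr_ge0.
elim: n => [|n ih]; first by rewrite big_ord1 /= subr0 expr0n invr1 subrr.
have -> : \sum_(i < n.+2) (tr q i - i%:R) ^+ 2 =
  \sum_(i < n.+1) (tr q i - i%:R) ^+ 2 + (tr q n.+1 - n.+1%:R) ^+ 2 by rewrite big_ord_recr.
have h := tr_close hq (isT : (0 < n.+1)%N).
have -> : 1 - n.+2%:R^-1 = (1 - n.+1%:R^-1) + (n.+1%:R^-1 - n.+2%:R^-1) :> R by ring.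
apply: lerD ih _; rewrite -(real_normK (num_real _)).
rewrite (@le_trans _ _ ((1 / 2 / n.+1%:R) ^+ 2))//.
  by rewrite lerXn2r// nnegrE// divr_ge0.
rewrite -[n.+2%:R]natr1.
have m1 : 1 <= n.+1%:R :> R by rewrite ler1n.
move: (n.+1%:R : R) m1 => m m1.
have m0 : m != 0 by rewrite gt_eqF//; lra.
have m2 : m + 1 != 0 by rewrite gt_eqF//; lra.
have -> : m^-1 - (m + 1)^-1 = (m * (m + 1))^-1 by field; apply/andP.
have -> : (1 / 2 / m) ^+ 2 = (4 * m * m)^-1 by field.
by rewrite lef_pV2 ?posrE ?mulr_gt0//; nra.
Qed.

Lemma tr_measurable n : measurable_fun (L2ball N) (fun q => tr q n).
Proof.
case: n => [|n]; first exact: measurable_cst.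
apply: measurableT_comp; first exact: measurable_realfun.continuous_measurable_fun (@sqrt_continuous R).
apply: measurable_funM => //; apply: measurable_funD; apply: measurable_funX;
  exact: kroot_measurable.
Qed.

End ball.
End periodization.

(** * Concentration of a bounded variable *)

Section concentration.
Variable R : realType.

Lemma sub_bounds (M x y : R) : `|x| <= M -> `|y| <= M -> - (2 * M) <= x - y <= 2 * M.
Proof.
by rewrite !ler_norml => /andP[? ?] /andP[? ?]; apply/andP; split; lra.
Qed.

(** With x = eps / (2 M) in ]0, 1] the hypothesis reads p <= 1 / (1 + x), and 1 / (1 + x) <= 1 - x^2
    / 2 <= exp(- x^2 / 2). The middle inequality uses x <= 1. *)
Lemma exp_tail (M eps p : R) : 0 < M -> 0 < eps -> eps <= 2 * M ->
  (eps + 2 * M) * p - 2 * M <= 0 -> p <= expR (- (eps ^+ 2 / (8 * M ^+ 2))).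
Proof.
move=> M0 e0 eM key; rewrite (le_trans _ (expR_ge1Dx _))//.
pose x := eps / (2 * M).
have Mn : M != 0 by rewrite gt_eqF.
have ex : eps = 2 * M * x by rewrite /x; field.
have x0 : 0 < x by rewrite divr_gt0// mulr_gt0.
have x1 : x <= 1 by rewrite /x ler_pdivrMr ?mul1r ?mulr_gt0.
have -> : eps ^+ 2 / (8 * M ^+ 2) = x ^+ 2 / 2 by rewrite ex; field.
have k2 : (x + 1) * p <= 1.
  by rewrite -(ler_pM2l (_ : 0 < 2 * M)) ?mulr_gt0//; move: key; rewrite {1}ex; lra.
have k3 : 1 <= (x + 1) * (1 - x ^+ 2 / 2).
  have : x ^+ 2 <= x by rewrite expr2 ler_piMr// ltW.
  have : x ^+ 3 <= x by rewrite exprS ler_piMr ?exprn_ile1// ltW.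
  lra.
have x10 : 0 < x + 1 by lra.
by rewrite -(ler_pM2l x10) (le_trans k2).
Qed.

(* A bounded centered variable F - E F <= 2 M satisfies the one-sided Markov bound
   P(F - E F > eps) <= 2 M / (2 M + eps), which already is Gaussian for
   eps <= 2 M; beyond that the event is empty. *)
Lemma concentration d (T : measurableType d) (nu : probability T R) (A : set T)
    (F : T -> R) (M eps : R) : measurable A -> nu A = 1%E -> measurable_fun A F ->
  (forall x, A x -> `|F x| <= M) -> 0 < M -> 0 < eps ->
  (nu [set x | A x /\ (F x - \int[nu]_(y in A) F y > eps)%R] <=
    (expR (- (eps ^+ 2 / (8 * M ^+ 2))))%:E)%E.
Proof.
move=> mA nA mF FM M0 e0; set E := \int[nu]_(y in A) F y.
have fA : (nu A < +oo)%E by rewrite nA ltry.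
have iF : nu.-integrable A (EFin \o F).
  apply: measurable_bounded_integrable => //; exists M; split; first exact: num_real.
  by move=> K MK x Ax /=; rewrite (le_trans (FM x Ax))// ltW.
have icst r : nu.-integrable A (EFin \o (cst r)).
  apply: measurable_bounded_integrable => //; exists `|r|; split; first exact: num_real.
  by move=> K MK x Ax /=; rewrite ltW.
have Rcst r : \int[nu]_(y in A) (cst r y) = r.
  by rewrite Rintegral_cst//= nA /= mulr1.
have EM : `|E| <= M.
  rewrite (le_trans (le_normr_Rintegral _ iF))// -[leRHS]Rcst.
  by apply: le_Rintegral => //; exact: integrable_norm.
set B := [set x | _].
have mFE : measurable_fun A (fun x => F x - E) by apply: measurable_funB.
have BE : B = A `&` (fun x => F x - E) @^-1` `]eps, +oo[.
  by apply/seteqP; split => x [Ax h]; split=> //; move: h; rewrite /= in_itv/= andbT.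
have mB : measurable B by rewrite BE; apply: mFE.
have [eM|Me] := leP eps (2 * M); last first.
  suff -> : B = set0 by rewrite measure0 lee_fin expR_ge0.
  apply/seteqP; split => // x [Ax h].
  have /andP[_ le2] := sub_bounds (FM x Ax) EM.
  by have := lt_le_trans Me (le_trans (ltW h) le2); rewrite ltxx.
have fB : nu B \is a fin_num by exact: fin_num_measure.
have ind : nu.-integrable A (EFin \o (\1_B : T -> R)).
  have mI : measurable_fun A (\1_B : T -> R) by exact: measurable_indic.
  apply: (measurable_bounded_integrable mA fA mI).
  exists 1; split; first exact: num_real.
  move=> K K1 x Ax /=; rewrite indicE; case: (x \in B); first by rewrite normr1 ltW.
  by rewrite normr0 ltW// (lt_trans ltr01 K1).
(* Pointwise (eps + 2 M) 1_B - 2 M <= F - E, and the right side has integral 0. *)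
have key : (eps + 2 * M) * fine (nu B) - 2 * M <= 0.
  have -> : (eps + 2 * M) * fine (nu B) - 2 * M =
      \int[nu]_(x in A) ((eps + 2 * M) * (\1_B x : R) - cst (2 * M) x).
    rewrite RintegralB//; last exact: (integrableZl mA (eps + 2 * M) ind).
    rewrite Rcst RintegralZl//; congr (_ * _ - _).
    by rewrite /Rintegral integral_indic// BE setIAC setIid.
  have -> : 0 = \int[nu]_(x in A) (F x - cst E x) by rewrite RintegralB// Rcst subrr.
  apply: le_Rintegral => //.
  - exact: (integrableB mA (integrableZl mA (eps + 2 * M) ind) (icst _)).
  - exact: (integrableB mA iF (icst _)).
  move=> x Ax /=; rewrite indicE.
  have /andP[le2 _] := sub_bounds (FM x Ax) EM.
  case: (boolP (x \in B)) => [/set_mem[_ h]|_] /=; last by rewrite mulr0 sub0r.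
  by rewrite mulr1 addrK ltW.
by rewrite -(fineK fB) lee_fin; exact: (exp_tail M0 e0 eM key).
Qed.

End concentration.

(** * The Gibbs mass of the ball *)

Section gibbs_ball.
Variable R : realType.

Lemma point_ball (N : R) : 0 < N -> L2ball N (point : L2T R).
Proof.
move=> N0; rewrite /L2ball /=.
have z0 : (class0 R : R -> R) = cst 0 %[ae circle].
  apply/asboolP; have /eqP := reprK (class0 R).
  by rewrite eqmodE.
rewrite (ae_eq_integral (cst 0%E)) ?integral0 ?lee_fin ?ltW//.
  by apply/measurable_EFinP; apply: measurable_funX; exact: measurable_L2fun.
move: z0; apply: (@filterS _ _ (ae_filter_ringOfSetsType circle)) => x /(_ Logic.I)/= e _.
by rewrite /L2fun /point /= e expr0n.
Qed.

(** The density carries the indicator of the ball, so the total mass lies in it. In the default case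
    of [mnormalize] the Dirac mass sits at the zero class, which belongs to the ball as well. *)
Lemma gibbs_ball (gamma : probability (L2T R) R) (N beta : R) : 0 < N ->
  kdv_gibbs gamma N beta (L2ball N) = 1%E.
Proof.
move=> N0; rewrite /kdv_gibbs /= /mnormalize /=.
case: ifPn => [_|]; first by rewrite diracE mem_set//; exact: point_ball.
rewrite negb_or => /andP[m0 moo].
have -> : gibbs_unnormalized gamma N beta (L2ball N) = gibbs_unnormalized gamma N beta setT.
  rewrite /gibbs_unnormalized [LHS]integral_mkcond; apply: eq_integral => q _.
  rewrite patchE; case: ifPn => // /negbTE qB.
  by rewrite /gibbs_density indicE qB mul0r.
set e := gibbs_unnormalized gamma N beta setT in m0 moo *.
have e0 : (0 <= e)%E by apply: integral_ge0 => q _; exact: gibbs_density_ge0.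
have fe : e \is a fin_num by rewrite ge0_fin_numE// lt_neqAle moo leey.
by rewrite -{1}(fineK fe) -EFinM divff// fine_eq0.
Qed.

End gibbs_ball.

(** * Real series read as complex series *)

Section series.
Variable R : realType.

Lemma abs_series (a : nat -> R) (M : R) : (forall n, \sum_(i < n) `|a i| <= M) ->
  cvgn (series a) /\ `|limn (series a)| <= M.
Proof.
move=> h.
have c : cvgn (series a).
  apply: normed_cvg; apply: nondecreasing_is_cvgn.
    by apply: nondecreasing_series => * /=; exact: normr_ge0.
  by exists M => _ [n _ <-]; have := h n; rewrite -(big_mkord xpredT (fun i => `|a i|)).
have b n : `|series a n| <= M.
  by rewrite (le_trans _ (h n))// /series /= big_mkord; exact: ler_norm_sum.
split=> //; rewrite ler_norml; apply/andP; split.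
  by apply: limr_ge => //; apply: nearW => n; have := b n; rewrite ler_norml => /andP[].
by apply: limr_le => //; apply: nearW => n; have := b n; rewrite ler_norml => /andP[].
Qed.

Lemma cvg_complex (s : nat -> R) (l : R) : s @ \oo --> l ->
  (fun n => Complex (s n) 0 : R[i]^o) @ \oo --> (Complex l 0 : R[i]^o).
Proof.
move=> sl; apply/cvgrPdist_le => e; rewrite ltcE /= => /andP[/eqP e2 e1].
have /cvgrPdist_le /(_ _ e1) := sl.
apply: filterS => n h.
have -> : (Complex l 0 : R[i]^o) - Complex (s n) 0 = Complex (l - s n) 0.
  by apply/eqP; rewrite eq_complex /= subrr !eqxx.
rewrite normc_def /= expr0n addr0 sqrtr_sqr lecE /=.
by rewrite e2 eqxx.
Qed.

Lemma complex_series (a : nat -> R) : cvgn (series a) ->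
  cvgn (series (fun n => Complex (a n) 0 : R[i]^o)) /\
  limn (series (fun n => Complex (a n) 0 : R[i]^o)) = Complex (limn (series a)) 0.
Proof.
move=> c.
have -> : series (fun n => Complex (a n) 0 : R[i]^o) = (fun n => Complex (series a n) 0 : R[i]^o).
  apply/funext => n; rewrite /series /=.
  elim: n => [|n ih]; first by rewrite !big_geq.
  rewrite !big_nat_recr //= ih; apply/eqP; rewrite eq_complex /= addr0 !eqxx //.
have h := cvg_complex c.
by split; [apply/cvg_ex; eexists; exact: h|apply/cvg_lim].
Qed.

End series.

(** * The linear statistic on the ball *)

Section statistic.
Variable R : realType.
Implicit Types (g : R[i] -> R[i]) (q : L2T R).

Definition real_part g (x : R) : R := complex.Re (g (Complex x 0)).

Lemma RPW_real_part g x : RPW g -> g (Complex x 0) = Complex (real_part g x) 0.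
Proof.
move=> hg; have := RPW_real hg x; rewrite /real_part.
by case: (g _) => a b /= ->.
Qed.

Lemma real_part_measurable g : RPW g -> measurable_fun setT (real_part g).
Proof.
move=> hg; apply: measurable_realfun.continuous_measurable_fun => x; apply/cont_epsP => e e0.
have [l hl] := RPW_cder hg (Complex x 0).
have [d d0 hd] := cder_cont hl e0; exists d => // y hy.
have e1 : cabs (Complex y 0 - Complex x 0) = `|y - x|.
  rewrite (_ : Complex y 0 - Complex x 0 = Complex (y - x) 0) ?cabs_real//.
  by apply/eqP; rewrite eq_complex /= subrr !eqxx.
have := hd (Complex y 0); rewrite e1 => /(_ hy).
move/(le_trans (Re_cabs _)); rewrite /real_part.
by case: (g (Complex y 0)) (g (Complex x 0)) => a b [c d'].
Qed.

Section ball.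
Variables (N : R) (g : R[i] -> R[i]).
Hypotheses (hN : N < ball_radius R) (hg : RPW g) (g1 : (L2norm g <= 1)%E).

Let u := real_part g.
Definition pos_term q n := u (tr q n) - u n%:R.
(** The term of index - (n + 1), in accordance with [Negz]. *)
Definition neg_term q n := u (- tr q n.+1) - u (- n.+1%:R).

Lemma statistic_pos q n : L2ball N q ->
  statistic_term g (tau q) n%:Z = Complex (pos_term q n) 0.
Proof.
move=> hq; rewrite /statistic_term (tau_pos_tr hN)// RPW_real_part//.
have -> : (n%:Z)%:~R = Complex (n%:R : R) 0 by rewrite -[RHS]/(real_complex R n%:R) rmorph_nat.
rewrite RPW_real_part//.
by apply/eqP; rewrite eq_complex /= subrr !eqxx.
Qed.

Lemma statistic_neg q n : L2ball N q ->
  statistic_term g (tau q) (Negz n) = Complex (neg_term q n) 0.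
Proof.
move=> hq; rewrite /statistic_term (tau_neg_tr hN)// RPW_real_part//.
have -> : (Negz n)%:~R = Complex (- n.+1%:R : R) 0.
  rewrite NegzE intrN (_ : (n.+1%:Z)%:~R = real_complex R n.+1%:R); last by rewrite rmorph_nat.
  by apply/eqP; rewrite eq_complex /= oppr0 !eqxx.
rewrite RPW_real_part//.
by apply/eqP; rewrite eq_complex /= subrr !eqxx.
Qed.

(** 12 (pi + 4)^2 (1 + 3): the sampling constant, with sum of squares at most 1 by [tr_sum]. *)
Definition stat_bound : R := 48 * (pi + 4) ^+ 2.

Let sampling_le q n (s : R) : s = 1 \/ s = -1 -> L2ball N q ->
  \sum_(i < n) `|u (s * tr q i) - u (s * i%:R)| <= stat_bound.
Proof.
move=> hs hq.
have s1 : s ^+ 2 = 1 by case: hs => ->; rewrite ?sqrrN expr1n.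
have n1 : `|s| = 1 by case: hs => ->; rewrite ?normrN normr1.
have hi i : `|s * tr q i - s * i%:R| <= 1 / 2.
  by rewrite -mulrBr normrM n1 [X in X <= _]mul1r; exact: (tr_half hN i hq).
rewrite (le_trans (RPW_sampling hg g1 n hs hi))//.
have -> : \sum_(i < n) (s * tr q i - s * i%:R) ^+ 2 = \sum_(i < n) (tr q i - i%:R) ^+ 2.
  by apply: eq_bigr => i _; rewrite -mulrBr exprMn s1 mul1r.
have h := tr_sum hN n hq; rewrite /stat_bound.
have c0 : 0 <= 12 * (pi + 4 : R) ^+ 2 by rewrite mulr_ge0// sqr_ge0.
have := ler_wpM2l c0 (lerD h (lexx 3)); lra.
Qed.

Lemma pos_sum q n : L2ball N q -> \sum_(i < n) `|pos_term q i| <= stat_bound.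
Proof.
move=> hq; rewrite (le_trans _ (sampling_le n (or_introl erefl) hq))//.
by apply: ler_sum => i _; rewrite !mul1r.
Qed.

Lemma neg_sum q n : L2ball N q -> \sum_(i < n) `|neg_term q i| <= stat_bound.
Proof.
(* One more sample is taken because the negative indices start at -1; the term of index 0 is then
   dropped. *)
move=> hq; rewrite (le_trans _ (sampling_le n.+1 (or_intror erefl) hq))//.
rewrite big_ord_recl; apply: ler_wpDl => //.
by apply: ler_sum => i _; rewrite !mulN1r.
Qed.

Lemma statistic_lim q : L2ball N q ->
  [/\ cvgn (series (pos_term q)), cvgn (series (neg_term q)),
     summableZ (statistic_term g (tau q)),
     linear_statistic g (tau q) = limn (series (pos_term q)) + limn (series (neg_term q)) &
     `|linear_statistic g (tau q)| <= 2 * stat_bound].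
Proof.
move=> hq; have [c1 b1] := abs_series (fun n => pos_sum n hq).
have [c2 b2] := abs_series (fun n => neg_sum n hq).
have [d1 l1] := complex_series c1; have [d2 l2] := complex_series c2.
have e1 : (fun n => statistic_term g (tau q) n%:Z) = (fun n => Complex (pos_term q n) 0 : R[i]^o).
  by apply/funext => n; rewrite statistic_pos.
have e2 : (fun n => statistic_term g (tau q) (Negz n)) = (fun n => Complex (neg_term q n) 0 : R[i]^o).
  by apply/funext => n; rewrite statistic_neg.
have E : linear_statistic g (tau q) = limn (series (pos_term q)) + limn (series (neg_term q)).
  by rewrite /linear_statistic /sumZ e1 e2 l1 l2.
have sm : summableZ (statistic_term g (tau q)).
  split.
    rewrite e1.
    exact: d1.
  rewrite e2.
  exact: d2.
have b3 := le_trans (ler_normD _ _) (lerD b1 b2).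
have e3 : stat_bound + stat_bound = 2 * stat_bound.
  move: stat_bound => b.
  by rewrite mulr_natl mulr2n.
rewrite e3 -E in b3.
exact: And5 c1 c2 sm E b3.
Qed.

(** On the ball the statistic is the pointwise limit of its partial sums, which are continuous
    functions of finitely many measurable tau_n. *)
Lemma statistic_measurable :
  measurable_fun (L2ball N) (fun q => linear_statistic g (tau q)).
Proof.
have mu_ := real_part_measurable hg.
have mball := measurable_L2ball N.
pose S n q := series (pos_term q) n + series (neg_term q) n.
apply: (@measurable_realfun.measurable_fun_cvg _ _ _ _ S) => // [n|q hq].
  apply: measurable_funD; rewrite /series /=; apply: measurable_sum => i.
    apply: measurable_funB => //; apply: measurableT_comp => //; exact: (tr_measurable hN).
  apply: measurable_funB => //; apply: measurableT_comp => //.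
  by apply: measurableT_comp => //; exact: (tr_measurable hN).
have [c1 c2 _ -> _] := statistic_lim hq.
exact: cvgD.
Qed.

End ball.
End statistic.

Theorem proposition5p4 (R : realType) (gamma : probability (L2T R) R)
    (hgamma : is_series_law gamma) :
  exists2 N1 : R, 0 < N1 &
    forall beta N : R, 0 < beta -> beta < 1 -> 0 < N -> N < N1 ->
    exists kappa1 kappa2 : R, 0 < kappa1 /\ 0 < kappa2 /\
    forall g : R[i] -> R[i], RPW g -> (L2norm g <= 1)%E ->
    let nu : probability (L2T R) R := kdv_gibbs gamma N beta in
    let F : L2T R -> R := fun q => linear_statistic g (tau q) in
    (* the statistic is well defined on the ball, and nu-integrable *)
    (forall q : L2T R, L2ball N q -> summableZ (statistic_term g (tau q))) /\
    nu.-integrable (L2ball N) (EFin \o F) /\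
    forall eps : R, 0 < eps ->
      (nu [set q | L2ball N q /\
                   (F q - \int[nu]_(p in L2ball N) F p > eps)%R] <=
       (expR (- (kappa1 * eps ^+ 2 *
                 Num.min 1 (kappa2 * eps ^+ 4))))%:E)%E.
Proof.
exists (ball_radius R); first by rewrite exprn_gt0// divr_gt0// rho0_gt0.
move=> beta N _ _ N0 hN.
(* One [stat_bound] for each half of the integers. *)
pose M : R := 2 * stat_bound R.
have M0 : 0 < M.
  have p4 : 0 < pi + 4 :> R by rewrite addr_gt0// pi_gt0.
  by rewrite /M /stat_bound; do ?apply: mulr_gt0.
have k0 : 0 < (8 * M ^+ 2)^-1 by rewrite invr_gt0 mulr_gt0// exprn_gt0.
exists (8 * M ^+ 2)^-1, 1; split; first exact: k0.
split=> // g hg g1 nu F.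
have mA := measurable_L2ball N.
have nA : nu (L2ball N) = 1%E by exact: gibbs_ball.
have mF : measurable_fun (L2ball N) F by exact: statistic_measurable hN hg g1.
have FM q : L2ball N q -> `|F q| <= M by move=> hq; have [] := statistic_lim hN hg g1 hq.
split; first by move=> q hq; have [] := statistic_lim hN hg g1 hq.
split.
  have fA : (nu (L2ball N) < +oo)%E by rewrite nA ltry.
  apply: (measurable_bounded_integrable mA fA mF).
  exists M; split; first exact: num_real.
  by move=> K MK q hq /=; rewrite (le_trans (FM q hq))// ltW.
move=> eps e0; rewrite (le_trans (concentration mA nA mF FM M0 e0))// lee_fin ler_expR lerN2.
rewrite [X in _ <= X]mulrC ler_piMr//; last by rewrite ge_min lexx.
by rewrite mulr_ge0 ?sqr_ge0// ltW.
Qed.
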